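(* Let $\mathfrak{g}$ be a finite-dimensional real Lie algebra. Apart from bi-differential operators arising from loop graphs, the Kontsevich and CBH quantizations of $\mathfrak{g}^*$ are identical: for all $f,g\in C^\infty(\mathfrak{g}^* )$, $$\sum_{n\ge0}\epsilon^n\sum_{\substack{\Gamma\in G_n\\ \Gamma\text{ not a loop graph}}}w_K(\Gamma)\,B_{\Gamma,\bar\alpha}(f,g)=f\star_{CBH}g .$$
   Context: Fix a basis $X^1,\ldots,X^d$ of $\mathfrak{g}$ with $[X^i,X^j]=c_k^{ij}X^k$; the $X^i$ are linear coordinates on $\mathfrak{g}^*\cong\mathbb{R}^d$, $\partial_i=\partial/\partial X^i$, and $\bar\alpha^{ij}=\tfrac12c_k^{ij}X^k$. Admissible graphs: $G_n$ is the set of oriented labeled graphs with vertex set $\{1,\ldots,n\}\cup\{X,Y\}$ and $2n$ edges, with exactly two ordered edges $e_k^1,e_k^2$ starting at each aerial vertex $k\in\{1,\dots,n\}$, ending at vertices other than $k$; no edges start at $X,Y$. A loop graph is one containing a directed cycle. Operators: $B_{\Gamma,\bar\alpha}(f,g)=\sum_{I:E_\Gamma\to\{1,\ldots,d\}}\Big[\prod_{k=1}^n\Big(\prod_{e=( *,k)}\partial_{I(e)}\Big)\bar\alpha^{I(e_k^1)I(e_k^2)}\Big]\Big(\prod_{e=( *,X)}\partial_{I(e)}\Big)f\,\Big(\prod_{e=( *,Y)}\partial_{I(e)}\Big)g$. Weights: with $\mathcal{H}$ the hyperbolic upper half plane, $\mathcal{H}_n$ the configuration space of $n$ distinct labeled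 points in $\mathcal{H}$, and $\phi^h(p,q)$ the counterclockwise angle at $p$ from the geodesic from $p$ to $\infty$ to the geodesic from $p$ to $q$; placing vertex $k$ at $p_k$, $X$ at $0$, $Y$ at $1$, each edge $e=(v,w)$ gives $\phi_e=\phi^h(\text{pos}(v),\text{pos}(w))$, and $w_K(\Gamma)=\frac1{n!(2\pi)^{2n}}\int_{\mathcal{H}_n}\bigwedge_{k=1}^n(d\phi_{e_k^1}\wedge d\phi_{e_k^2})$, with orientation normalized so that the graph in $G_1$ with $e_1^1=(1,X),e_1^2=(1,Y)$ has weight $1/2$. Kontsevich's quantization is $f\star_Kg=\sum_n\epsilon^n\sum_{\Gamma\in G_n}w_K(\Gamma)B_{\Gamma,\bar\alpha}(f,g)$. CBH-quantization: with $H(A,B)=\log(e^Ae^B)$ the Campbell–Baker–Hausdorff series and $H_\epsilon$ obtained by multiplying each Lie monomial with $m$ brackets by $\epsilon^m$, and commuting formal variables $s=(s_i),t=(t_j)$, let $D(s,t)=\exp\big(H_\epsilon(s_iX^i,t_jX^j)-s_iX^i-t_jX^j\big)$, computed in the commutative algebra of formal series in $s,t,\epsilon$ whose coefficients are polynomial functions on $\mathfrak{g}^*$ (elements of $\mathfrak{g}$ being linear functions). Replacing each term $F(X)s_{i_1}\cdots s_{i_a}t_{j_1}\cdots t_{j_b}$ by $(f,g)\mapsto F\,\partial_{i_1}\cdots\partial_{i_a}f\,\partial_{j_1}\cdots\partial_{j_b}g$ gives $\hat D$, and $f\star_{CBH}g=\hat D(f,g)$. *)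

(* Defs.v *)
From HB Require Import structures.
From mathcomp Require Import all_boot all_order all_algebra.
From mathcomp Require Import mpoly.
From mathcomp Require Import all_classical all_reals all_analysis.

Set Implicit Arguments.
Unset Strict Implicit.
Unset Printing Implicit Defensive.

Import Order.TTheory GRing.Theory Num.Theory.
Local Open Scope ring_scope.

Section KontsevichCBH.
Variable R : realType.
Variable d : nat.
(* structure constants: [X^i, X^j] = \sum_k c k i j X^k,  i.e. c k i j = c_k^{ij} *)
Variable c : 'I_d -> 'I_d -> 'I_d -> R.

Definition lie_antisym : Prop := forall k i j, c k i j = - c k j i.
Definition lie_jacobi : Prop := forall i j l m,
  \sum_(k < d) (c k i j * c m k l + c k j l * c m k i + c k l i * c m k j) = 0.

(* Functions on g^* = R^d (points are row vectors x, x ord0 k = X^k(x)) *)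
Definition partial (i : 'I_d) (f : 'rV[R]_d -> R) : 'rV[R]_d -> R :=
  fun x => 'D_(delta_mx 0 i) f x.

Definition iterpartial (s : seq 'I_d) (f : 'rV[R]_d -> R) : 'rV[R]_d -> R :=
  foldr partial f s.

Definition Rd := matrix_matrix__canonical__normed_module_NormedModule R 1 d.

Definition smooth (f : 'rV[R]_d -> R) : Prop :=
  forall (s : seq 'I_d) (x : Rd), differentiable (iterpartial s f : Rd -> R^o) x.

Definition alphabar (i j : 'I_d) : 'rV[R]_d -> R :=
  fun x => 2^-1 * \sum_(k < d) c k i j * x ord0 k.

(* Admissible graphs.  Vertices: 'I_(n + 2); aerial vertex k is lshift 2 k,
   X is rshift n 0, Y is rshift n 1.  Edges: (k, i) = e_k^{i+1}; a graph
   assigns to each edge its endpoint.                                   *)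
Definition vX (n : nat) : 'I_(n + 2) := rshift n (0 : 'I_2).
Definition vY (n : nat) : 'I_(n + 2) := rshift n (1 : 'I_2).
Definition vA (n : nat) (k : 'I_n) : 'I_(n + 2) := lshift 2 k.

Definition edge (n : nat) : finType := ('I_n * 'I_2)%type.

Definition graph (n : nat) := {ffun edge n -> 'I_(n + 2)}.

Definition G (n : nat) : {set graph n} :=
  [set Γ : graph n | [forall e : edge n, Γ e != vA e.1]].

Definition aedge (n : nat) (Γ : graph n) : rel 'I_n :=
  fun k l => [exists i : 'I_2, Γ (k, i) == vA l].

(* Γ contains a directed cycle (only aerial vertices have outgoing edges) *)
Definition loop_graph (n : nat) (Γ : graph n) : bool :=
  [exists k : 'I_n, [exists l : 'I_n, aedge Γ k l && connect (aedge Γ) l k]].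

Definition into (n : nat) (Γ : graph n) (I : {ffun edge n -> 'I_d})
  (v : 'I_(n + 2)) : seq 'I_d :=
  [seq I e | e <- enum (edge n) & Γ e == v].

Definition Bop (n : nat) (Γ : graph n) (f g : 'rV[R]_d -> R) (x : 'rV[R]_d) : R :=
  \sum_(I : {ffun edge n -> 'I_d})
     (\prod_(k < n)
        iterpartial (into Γ I (vA k)) (alphabar (I (k, 0)) (I (k, 1))) x)
     * iterpartial (into Γ I (vX n)) f x
     * iterpartial (into Γ I (vY n)) g x.

(* d(arg) at z = (zx,zy) applied to the tangent vector w = (wx,wy):
   Im (w / z) *)
Definition darg (z w : R * R) : R :=
  (z.1 * w.2 - z.2 * w.1) / (z.1 ^+ 2 + z.2 ^+ 2).

Definition conjp (z : R * R) : R * R := (z.1, - z.2).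
Definition subp (z w : R * R) : R * R := (z.1 - w.1, z.2 - w.2).

(* phi^h(p, q) = arg(q - p) - arg(q - conj p) (mod 2 pi), the hyperbolic
   angle at p from the geodesic to infinity to the geodesic to q; its
   differential applied to the tangent vector (dp, dq) is: *)
Definition dphi (p q dp dq : R * R) : R :=
  darg (subp q p) (subp dq dp) - darg (subp q (conjp p)) (subp dq (conjp dp)).

(* coordinates of a configuration: vertex m sits at (z (2m), z (2m+1)) *)
Definition apos (z : nat -> R) (m : nat) : R * R := (z (m * 2)%N, z (m * 2).+1).

Definition vpos (n : nat) (z : nat -> R) (v : 'I_(n + 2)) : R * R :=
  match fintype.split v with
  | inl k => apos z k
  | inr j => if j == 0 then (0, 0) else (1, 0)
  end.

Definition utan (j : 'I_2) : R * R := if j == 0 then (1, 0) else (0, 1).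

(* d phi_e / d (coordinate (m, j)) *)
Definition dphi_coord (n : nat) (Γ : graph n) (z : nat -> R)
  (e : edge n) (cj : edge n) : R :=
  let t := utan cj.2 in
  dphi (vpos z (vA e.1)) (vpos z (Γ e))
       (if vA e.1 == vA cj.1 then t else (0, 0))
       (if Γ e == vA cj.1 then t else (0, 0)).

(* Jacobian: rows = edges in the order e_1^1, e_1^2, e_2^1, ...;
   columns = coordinates in the order x_1, y_1, x_2, y_2, ...
   (enum of a product finType is lexicographic). Its determinant is the
   coefficient of  /\_k (dphi_{e_k^1} /\ dphi_{e_k^2})  with respect to
   dx_1 /\ dy_1 /\ ... /\ dx_n /\ dy_n. *)
Definition jac (n : nat) (Γ : graph n) (z : nat -> R)
  : 'M[R]_(#|{: edge n}|) :=
  \matrix_(r, s) dphi_coord Γ z (enum_val r) (enum_val s).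

Definition inHn (n : nat) (z : nat -> R) : bool :=
  [forall m : 'I_n, 0 < (apos z m).2] &&
  [forall m : 'I_n, forall l : 'I_n, (m != l) ==> (apos z m != apos z l)].

Definition integrand (n : nat) (Γ : graph n) (z : nat -> R) : R :=
  if inHn n z then \det (jac Γ z) else 0.

Fixpoint iterint (m : nat) (F : (nat -> R) -> R) : R :=
  match m with
  | 0 => F (fun _ => 0)
  | m'.+1 => Rintegral (@lebesgue_measure R) setT
               (fun t => iterint m' (fun z => F (fun j => if j == m' then t else z j)))
  end.

(* weight with the standard (product) orientation of \mathcal H_n *)
Definition wstd (n : nat) (Γ : graph n) : R :=
  (n`!%:R * (2 * pi) ^+ (2 * n))^-1 * iterint (n * 2) (integrand Γ).

Definition basic_graph : graph 1 :=
  [ffun e => if e.2 == 0 then vX 1 else vY 1].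

(* orientation normalization: reversing the orientation of \mathcal H
   multiplies the weight of graphs in G_n by (-1)^n *)
Definition orient_sign : R := if wstd basic_graph == 2^-1 then 1 else -1.

Definition wK (n : nat) (Γ : graph n) : R := orient_sign ^+ n * wstd Γ.

(* CBH side.  Polynomials in the 3d commuting variables
   s_1..s_d, t_1..t_d, X^1..X^d.                                        *)
Definition nv := ((d + d) + d)%N.
Definition P := mpoly.mpoly nv R.
Definition sidx (i : 'I_d) : 'I_nv := lshift d (lshift d i).
Definition tidx (i : 'I_d) : 'I_nv := lshift d (rshift d i).
Definition xidx (k : 'I_d) : 'I_nv := rshift (d + d) k.
Definition var (v : 'I_nv) : P := mpoly.mpolyX R (mpoly.mnm1 v).

(* elements of g (x) R[s,t,X]: coefficient vectors w.r.t. the basis X^k *)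
Definition lie := {ffun 'I_d -> P}.
Definition lscale (a : P) (u : lie) : lie := [ffun k => a * u k].
Definition bracket (u v : lie) : lie :=
  [ffun k => \sum_(i < d) \sum_(j < d) mpoly.mpolyC nv (c k i j) * (u i * v j)].

Fixpoint nest (w : seq lie) : lie :=
  match w with
  | [::] => 0
  | [:: x] => x
  | x :: w' => bracket x (nest w')
  end.

Definition sA : lie := [ffun k => var (sidx k)].
Definition tB : lie := [ffun k => var (tidx k)].

(* Degree-N part H_N(A, B) of the Campbell-Baker-Hausdorff series
   H(A,B) = log(e^A e^B), written as a Lie series (Dynkin's formula):
   sum over m >= 1 and (r_i, s_i) with r_i + s_i > 0, sum (r_i+s_i) = N of
   (-1)^(m-1)/m * [A^{r_1} B^{s_1} ... A^{r_m} B^{s_m}]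
                 / (N * prod r_i! s_i!).
   Each of its Lie monomials contains exactly N - 1 brackets.           *)
Definition cbh_deg (N : nat) : lie :=
  \sum_(1 <= m < N.+1)
   \sum_(r : {ffun 'I_m -> 'I_N.+1})
   \sum_(s : {ffun 'I_m -> 'I_N.+1})
     if [forall i, (0 < r i + s i)%N] && (\sum_(i < m) (r i + s i) == N)%N then
       lscale (mpoly.mpolyC nv
         (((-1) ^+ m.-1 / m%:R)
            / (N%:R * \prod_(i < m) ((r i)`!%:R * (s i)`!%:R))))
       (nest (flatten [seq nseq (r i) sA ++ nseq (s i) tB | i <- enum 'I_m]))
     else 0.

Definition pairX (u : lie) : P := \sum_(k < d) u k * var (xidx k).

(* coefficient of eps^N in H_eps(sX, tX) - sX - tX *)
Definition Ecoef (N : nat) : P :=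
  pairX (cbh_deg N.+1) - (if N == 0%N then pairX sA + pairX tB else 0).

(* coefficient of eps^n in D = exp(\sum_N eps^N Ecoef N), for a series
   without constant term *)
Definition Dcoef (n : nat) : P :=
  \sum_(m < n.+1) (m`!%:R)^-1 *:
    \sum_(k : {ffun 'I_m -> 'I_n.+1})
      if [forall i, (0 < k i)%N] && (\sum_(i < m) k i == n)%N then
        \prod_(i < m) Ecoef (k i)
      else 0.

(* \hat p (f, g): F(X) s_{i_1}..s_{i_a} t_{j_1}..t_{j_b}
      |-> F d_{i_1}..d_{i_a} f  d_{j_1}..d_{j_b} g                     *)
Definition hat (p : P) (f g : 'rV[R]_d -> R) (x : 'rV[R]_d) : R :=
  \sum_(mo <- mpoly.msupp p)
     mpoly.mcoeff mo p
     * (\prod_(k < d) x ord0 k ^+ (mo (xidx k)))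
     * iterpartial (flatten [seq nseq (mo (sidx i)) i | i <- enum 'I_d]) f x
     * iterpartial (flatten [seq nseq (mo (tidx i)) i | i <- enum 'I_d]) g x.

Definition star_cbh_coef (n : nat) (f g : 'rV[R]_d -> R) : 'rV[R]_d -> R :=
  hat (Dcoef n) f g.

Definition star_K_nonloop_coef (n : nat) (f g : 'rV[R]_d -> R) : 'rV[R]_d -> R :=
  fun x => \sum_(Γ in G n | ~~ loop_graph Γ) wK Γ * Bop Γ f g x.

End KontsevichCBH.

(* Main.v *)
(* A loop-free graph with some aerial vertex of in-degree at least 2 acts by zero, since [alphabar] is
   linear; the other loop-free graphs are forests of binary trees with leaves X and Y, with an ordering
   of their roots amounting to a list of labelled plane trees. The Jacobian of such a graph is block
   triangular, so its weight is the product over the trees T of numbers th T, and it remains to show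
   that sum_T (th T / 2^brackets) T, over plane trees T, is the Campbell-Baker-Hausdorff series.
   For this, the angle forms define the tree densities [dens], and the connection they generate on the
   upper half plane is flat; its holonomy along the horizontal line at height h is computed
   in two ways. As h tends to infinity it becomes the exponential of the sum of all tree masses, and
   as h tends to 0 it becomes e^A e^B, the forms concentrating at the two boundary points 0 and 1.
   Dynkin's projection and the antisymmetry of th under exchanging subtrees turn words into brackets. *)
Require Import Defs.
From HB Require Import structures.
From mathcomp Require Import all_boot all_order all_algebra.
From mathcomp Require Import mpoly.
From mathcomp Require Import all_classical all_reals all_analysis.
From mathcomp Require Import measurable_realfun ring lra zify.
Import Order.TTheory GRing.Theory Num.Theory numFieldNormedType.Exports.
Set Implicit Arguments.
Unset Strict Implicit.
Unset Printing Implicit Defensive.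
Local Open Scope classical_set_scope.
Local Open Scope ring_scope.

(** The weights are never computed tree by tree: only their generating series enters, and it is
    pinned down by its exponential. As a form in p, the angle form dphi(p, q) is closed away from q
    and winds once around q. Averaging q over the density of a tree T gives a one-form A_T whose
    exterior derivative is 2 pi times that density, and the density of a tree with subtrees l and r
    is A_l /\ A_r by construction. Scaling a tree with n leaves by (-1/(2 pi))^(n-1) turns this into
    d omega = - omega /\ omega for the sum omega over all trees, which is flatness.

    The obstacle is regularity: densities are merely integrable and the A_T are controlled almost
    everywhere only. So flatness is proved in integrated form on rectangles, from two bounds uniform
    in the sources: 2 pi for the kernels on horizontal and vertical lines, and [CJ] for the Jacobian
    of one vertex over the half plane. The second bound, applied vertex by vertex, also gives the
    absolute convergence that allows the coordinates in a weight to be reordered along the trees. *)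

Section Measurability.
Context d (X : measurableType d) (R : realType).
Implicit Types f g : X -> R.
Implicit Types a b : X -> bool.

Lemma mfD f g : measurable_fun setT f -> measurable_fun setT g ->
  measurable_fun setT (fun x => f x + g x).
Proof. by move=> mf mg; exact: measurable_funD. Qed.

Lemma mfN f : measurable_fun setT f -> measurable_fun setT (fun x => - f x).
Proof. by move=> mf; exact: measurable_funN. Qed.

Lemma mfM f g : measurable_fun setT f -> measurable_fun setT g ->
  measurable_fun setT (fun x => f x * g x).
Proof. by move=> mf mg; exact: measurable_funM. Qed.

Lemma mfX f n : measurable_fun setT f -> measurable_fun setT (fun x => f x ^+ n).
Proof. by move=> mf; exact: measurable_funX. Qed.

Lemma mfnorm f : measurable_fun setT f -> measurable_fun setT (fun x => `|f x|).
Proof. by move=> mf; exact: (measurableT_comp (@normr_measurable R setT)). Qed.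

Lemma mfsum (I : Type) (s : seq I) (F : I -> X -> R) :
  (forall i, measurable_fun setT (F i)) ->
  measurable_fun setT (fun x => \sum_(i <- s) F i x).
Proof. by move=> mF; exact: measurable_sum. Qed.

Lemma mfprod (I : Type) (s : seq I) (F : I -> X -> R) :
  (forall i, measurable_fun setT (F i)) ->
  measurable_fun setT (fun x => \prod_(i <- s) F i x).
Proof.
move=> mF; elim: s => [|i s IH].
  by under eq_fun do rewrite big_nil; exact: measurable_cst.
by under eq_fun do rewrite big_cons; exact: mfM.
Qed.

Lemma mfif a f g : measurable_fun setT a -> measurable_fun setT f ->
  measurable_fun setT g -> measurable_fun setT (fun x => if a x then f x else g x).
Proof. by move=> ma mf mg; exact: measurable_fun_ifT. Qed.

Lemma mfb a : measurable_fun setT a -> measurable_fun setT (fun x => (a x)%:R : R).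
Proof.
move=> ma; rewrite (_ : (fun x => _) = (fun x => if a x then 1 else 0 : R)).
  by apply: mfif => //; exact: measurable_cst.
by apply/funext => x; case: (a x).
Qed.

Lemma mband a b : measurable_fun setT a -> measurable_fun setT b ->
  measurable_fun setT (fun x => a x && b x).
Proof. by move=> ma mb; exact: measurable_and. Qed.

Lemma mbneg a : measurable_fun setT a -> measurable_fun setT (fun x => ~~ a x).
Proof. by move=> ma; exact: measurable_neg. Qed.

Lemma mblt f g : measurable_fun setT f -> measurable_fun setT g ->
  measurable_fun setT (fun x => f x < g x).
Proof. by move=> mf mg; exact: measurable_fun_ltr. Qed.

Lemma mble f g : measurable_fun setT f -> measurable_fun setT g ->
  measurable_fun setT (fun x => f x <= g x).
Proof. by move=> mf mg; exact: measurable_fun_ler. Qed.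

Lemma mbeq f g : measurable_fun setT f -> measurable_fun setT g ->
  measurable_fun setT (fun x => f x == g x).
Proof. by move=> mf mg; exact: measurable_fun_eqr. Qed.

End Measurability.

Lemma measurable_invr (R : realType) : measurable_fun setT (@GRing.inv R).
Proof.
rewrite (_ : setT = [set~ 0] `|` [set 0]); last first.
  by apply/seteqP; split => // x _; have [->|/eqP] := eqVneq x 0; [right|left].
apply/measurable_funU => //; first exact: measurableC.
split; last exact: measurable_fun_set1.
apply: open_continuous_measurable_fun; first exact/closed_openC/accessible_closed_set1/hausdorff_accessible/Rhausdorff.
by move=> x /set_mem/= x0; apply: inv_continuous; apply/eqP.
Qed.

Lemma mfV d (X : measurableType d) (R : realType) (f : X -> R) :
  measurable_fun setT f -> measurable_fun setT (fun x => (f x)^-1).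
Proof. by move=> mf; exact: (measurableT_comp (@measurable_invr R)). Qed.

Lemma mfst d1 d2 d3 (X : measurableType d1) (Y : measurableType d2)
  (Z : measurableType d3) (f : X -> Y * Z) :
  measurable_fun setT f -> measurable_fun setT (fun x => (f x).1).
Proof. by move=> mf; exact: (measurableT_comp measurable_fst). Qed.

Lemma msnd d1 d2 d3 (X : measurableType d1) (Y : measurableType d2)
  (Z : measurableType d3) (f : X -> Y * Z) :
  measurable_fun setT f -> measurable_fun setT (fun x => (f x).2).
Proof. by move=> mf; exact: (measurableT_comp measurable_snd). Qed.

Lemma mpair d1 d2 d3 (X : measurableType d1) (Y : measurableType d2)
  (Z : measurableType d3) (f : X -> Y) (g : X -> Z) :
  measurable_fun setT f -> measurable_fun setT g ->
  measurable_fun setT (fun x => (f x, g x)).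
Proof. exact: measurable_fun_pair. Qed.

Ltac msr := intros; cbv beta; repeat first
  [ assumption | exact: measurable_id | exact: measurable_cst
  | apply: mfD | apply: mfN | apply: mfM | apply: mfX | apply: mfV
  | apply: mfnorm | apply: mfb | apply: mband | apply: mblt | apply: mble
  | apply: mbeq | apply: mbneg | apply: mfif | apply: mfst | apply: msnd
  | apply: mpair ].

(** * Real-valued integration: integrability, linearity, bounds, dominated convergence *)

Section Integrals.
Context d (X : measurableType d) (R : realType) (m : {measure set X -> \bar R}).
Implicit Types f g : X -> R.

Definition itg f := m.-integrable setT (EFin \o f).

Lemma itg_meas f : itg f -> measurable_fun setT f.
Proof. by move/(measurable_int m)/measurable_EFinP. Qed.

Lemma itgD f g : itg f -> itg g -> itg (fun x => f x + g x).
Proof. by move=> If Ig; exact: (integrableD _ If Ig). Qed.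

Lemma itgZ k f : itg f -> itg (fun x => k * f x).
Proof. by move=> If; exact: (integrableZl _ k If). Qed.

Lemma itgN f : itg f -> itg (fun x => - f x).
Proof. by move=> If; exact: (integrableN If). Qed.

Lemma itgB f g : itg f -> itg g -> itg (fun x => f x - g x).
Proof. by move=> If Ig; apply: itgD => //; exact: itgN. Qed.

Lemma itg0 : itg (fun=> 0).
Proof. exact: integrable0. Qed.

Lemma itg_norm f : itg f -> itg (fun x => `|f x|).
Proof. exact: integrable_norm. Qed.

Lemma itg_sum I (s : seq I) (F : I -> X -> R) : (forall i, itg (F i)) ->
  itg (fun x => \sum_(i <- s) F i x).
Proof.
move=> IF; elim: s => [|i s IH].
  by under eq_fun do rewrite big_nil; exact: itg0.
by under eq_fun do rewrite big_cons; exact: itgD.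
Qed.

Lemma itg_dom f g : measurable_fun setT f -> (forall x, `|f x| <= g x) ->
  itg g -> itg f.
Proof.
move=> mf fg; apply: le_integrable => //; first exact/measurable_EFinP.
by move=> x _ /=; rewrite lee_fin (le_trans (fg x))// ler_norm.
Qed.

Lemma itg_mulb (b f : X -> R) C : measurable_fun setT b ->
  (forall x, `|b x| <= C) -> itg f -> itg (fun x => b x * f x).
Proof.
move=> mb bC If; apply: (@itg_dom _ (fun x => C * `|f x|)).
- by apply: mfM => //; exact: itg_meas.
- by move=> x; rewrite normrM ler_wpM2r.
- exact/itgZ/itg_norm.
Qed.

Lemma rintE f : itg f -> (\int[m]_x f x)%:E = (\int[m]_x (f x)%:E)%E.
Proof. by move=> If; rewrite /Rintegral fineK//; exact: integrable_fin_num. Qed.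

Lemma rintD f g : itg f -> itg g ->
  \int[m]_x (f x + g x) = \int[m]_x f x + \int[m]_x g x.
Proof. exact: RintegralD. Qed.

Lemma rintB f g : itg f -> itg g ->
  \int[m]_x (f x - g x) = \int[m]_x f x - \int[m]_x g x.
Proof. exact: RintegralB. Qed.

Lemma rintZ k f : itg f -> \int[m]_x (k * f x) = k * \int[m]_x f x.
Proof. exact: RintegralZl. Qed.

Lemma rint0 : \int[m]_x 0 = 0 :> R.
Proof. by rewrite /Rintegral integral0. Qed.

Lemma rint_sum I (s : seq I) (F : I -> X -> R) : (forall i, itg (F i)) ->
  \int[m]_x (\sum_(i <- s) F i x) = \sum_(i <- s) \int[m]_x F i x.
Proof.
move=> IF; elim: s => [|i s IH].
  by under eq_Rintegral do rewrite big_nil; rewrite big_nil rint0.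
under eq_Rintegral do rewrite big_cons.
by rewrite rintD ?big_cons ?IH//; exact: itg_sum.
Qed.

Lemma rint_norm f : itg f -> `|\int[m]_x f x| <= \int[m]_x `|f x|.
Proof. exact: le_normr_Rintegral. Qed.

Lemma rint_le f g : itg f -> itg g -> (forall x, f x <= g x) ->
  \int[m]_x f x <= \int[m]_x g x.
Proof. by move=> If Ig fg; exact: le_Rintegral. Qed.

Lemma rint_ge0 f : (forall x, 0 <= f x) -> 0 <= \int[m]_x f x.
Proof. by move=> f0; exact: Rintegral_ge0. Qed.

Lemma rint_bound f g : itg f -> itg g -> (forall x, `|f x| <= g x) ->
  `|\int[m]_x f x| <= \int[m]_x g x.
Proof.
by move=> If Ig fg; apply: (le_trans (rint_norm If)); apply: rint_le => //; exact: itg_norm.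
Qed.

Lemma rint_ae f g : measurable_fun setT f -> measurable_fun setT g ->
  {ae m, forall x, f x = g x} -> \int[m]_x f x = \int[m]_x g x.
Proof.
move=> mf mg fg; congr fine; apply: ae_eq_integral => //; try exact/measurable_EFinP.
by apply: filterS fg => x /= -> _.
Qed.

Lemma rint_le_ae f g : itg f -> itg g -> {ae m, forall x, f x <= g x} ->
  \int[m]_x f x <= \int[m]_x g x.
Proof.
move=> If Ig fg; rewrite -subr_ge0 -rintB//.
rewrite (@rint_ae _ (fun x => `|g x - f x|)); first exact: rint_ge0.
- by apply: itg_meas; exact: itgB.
- by apply: mfnorm; apply: itg_meas; exact: itgB.
- by apply: filterS fg => x fgx; rewrite ger0_norm// subr_ge0.
Qed.

Lemma rint_eq f g : f =1 g -> \int[m]_x f x = \int[m]_x g x.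
Proof. by move=> fg; apply: eq_Rintegral => x _. Qed.

Lemma itg_eq f g : f =1 g -> itg f -> itg g.
Proof. by move=> /funext ->. Qed.

(** The usual way to obtain integrability here: one bound on the extended integral yields both
    integrability and the same bound on the real integral. *)
Lemma itg_ub f (C : R) : measurable_fun setT f ->
  (\int[m]_x `|f x|%:E <= C%:E)%E -> itg f /\ \int[m]_x `|f x| <= C.
Proof.
move=> mf fC; have If : itg f.
  by apply/integrableP; split; [exact/measurable_EFinP|exact: (le_lt_trans fC (ltry _))].
by split => //; rewrite -lee_fin rintE//; exact: itg_norm.
Qed.

Lemma rint_norm0 f : itg f -> \int[m]_x `|f x| = 0 -> {ae m, forall x, f x = 0}.
Proof.
move=> If f0; have : (\int[m]_x `|(f x)%:E|)%E = 0%E.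
  by rewrite -[LHS](rintE (itg_norm If)) f0.
move=> /(ae_eq_integral_abs _ measurableT)[|N HN].
  by apply/measurable_EFinP; exact: itg_meas.
by exists N; case: HN => mN N0 sN; split => // x /= /= fx; apply: sN => /= /(_ I)[].
Qed.

Lemma dct (F : nat -> X -> R) f g :
  (forall n, measurable_fun setT (F n)) -> measurable_fun setT f -> itg g ->
  (forall n x, `|F n x| <= g x) ->
  {ae m, forall x, F n x @[n --> \oo] --> f x} ->
  \int[m]_x F n x @[n --> \oo] --> \int[m]_x f x.
Proof.
move=> mF mf Ig Fg Ff.
have [||||If _ cv] := @dominated_convergence _ _ _ m setT measurableT
  (fun n => EFin \o F n) (EFin \o f) (EFin \o g) _ _ _ Ig.
- by move=> n; exact/measurable_EFinP.
- exact/measurable_EFinP.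
- apply: filterS Ff => x Fx _.
  by apply/fine_cvgP; split; [exact: nearW|exact: Fx].
- by apply: aeW => x n _; rewrite lee_fin.
by apply: fine_cvg; rewrite (rintE If); exact: cv.
Qed.

End Integrals.

(** * Fubini and Tonelli for real-valued integrals over product measures *)

Section FubiniProd.
Context d1 d2 (X : measurableType d1) (Y : measurableType d2) (R : realType).
Variables (m1 : {sigma_finite_measure set X -> \bar R})
          (m2 : {sigma_finite_measure set Y -> \bar R}).
Implicit Types F : X * Y -> R.
Local Notation m12 := (m1 \x m2)%E.

Lemma mslice1 (F : X * Y -> R) x : measurable_fun setT F ->
  measurable_fun setT (fun y => F (x, y)).
Proof. by move=> mF; apply: (measurableT_comp mF); exact: pair1_measurable. Qed.

Lemma mslice2 (F : X * Y -> R) y : measurable_fun setT F ->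
  measurable_fun setT (fun x => F (x, y)).
Proof. by move=> mF; apply: (measurableT_comp mF); exact: pair2_measurable. Qed.

(** Tonelli applies to the positive and negative parts separately, and [fine] of their difference
    stays measurable, so measurability of F suffices. *)
Lemma mrint1 F : measurable_fun setT F ->
  measurable_fun setT (fun x => \int[m2]_y F (x, y)).
Proof.
move=> mF; apply: (measurableT_comp (@fine_measurable R setT _)) => //.
rewrite [X in measurable_fun _ X](_ : _ = (fun x =>
    \int[m2]_y ((EFin \o F)^\+ (x, y)) - \int[m2]_y ((EFin \o F)^\- (x, y)))%E).
  apply: emeasurable_funB; apply: measurable_fun_fubini_tonelli_F => //.
    by apply: measurable_funepos; exact/measurable_EFinP.
  by apply: measurable_funeneg; exact/measurable_EFinP.
apply/funext => x; rewrite [LHS]integralE.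
by congr (_ - _)%E; apply: eq_integral => y _; rewrite ?funeposE ?funenegE.
Qed.

Lemma mrint2 F : measurable_fun setT F ->
  measurable_fun setT (fun y => \int[m1]_x F (x, y)).
Proof.
move=> mF; apply: (measurableT_comp (@fine_measurable R setT _)) => //.
rewrite [X in measurable_fun _ X](_ : _ = (fun y =>
    \int[m1]_x ((EFin \o F)^\+ (x, y)) - \int[m1]_x ((EFin \o F)^\- (x, y)))%E).
  apply: emeasurable_funB; apply: measurable_fun_fubini_tonelli_G => //.
    by apply: measurable_funepos; exact/measurable_EFinP.
  by apply: measurable_funeneg; exact/measurable_EFinP.
apply/funext => x; rewrite [LHS]integralE.
by congr (_ - _)%E; apply: eq_integral => y _; rewrite ?funeposE ?funenegE.
Qed.

Lemma pfub_ae1 F : itg m12 F -> {ae m1, forall x, itg m2 (fun y => F (x, y))}.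
Proof. exact: ae_integrable1. Qed.

Lemma pfub_ae2 F : itg m12 F -> {ae m2, forall y, itg m1 (fun x => F (x, y))}.
Proof. exact: ae_integrable2. Qed.

Lemma pfub_aeE1 F : itg m12 F ->
  {ae m1, forall x, (\int[m2]_y F (x, y))%:E = (\int[m2]_y (F (x, y))%:E)%E}.
Proof. by move=> /pfub_ae1; apply: filterS => x; exact: rintE. Qed.

Lemma pfub_aeE2 F : itg m12 F ->
  {ae m2, forall y, (\int[m1]_x F (x, y))%:E = (\int[m1]_x (F (x, y))%:E)%E}.
Proof. by move=> /pfub_ae2; apply: filterS => x; exact: rintE. Qed.

Lemma pfub_itg1 F : itg m12 F -> itg m1 (fun x => \int[m2]_y F (x, y)).
Proof.
move=> IF; have mF := itg_meas IF.
have If := integrable_fubini_F IF; apply/integrableP; split.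
  by apply/measurable_EFinP; exact: mrint1.
have [mf] := integrableP _ _ _ If; apply: le_lt_trans.
apply: ae_ge0_le_integral => //.
- by apply: measurableT_comp => //; apply/measurable_EFinP; exact: mrint1.
- exact: measurableT_comp.
- by apply: filterS (pfub_aeE1 IF) => x H _ /=; rewrite /fubini_F /= -?H.
Qed.

Lemma pfub_itg2 F : itg m12 F -> itg m2 (fun y => \int[m1]_x F (x, y)).
Proof.
move=> IF; have mF := itg_meas IF.
apply/integrableP; split; first by apply/measurable_EFinP; exact: mrint2.
have := (integrable21ltyP _ _ ((measurable_EFinP _ _).2 mF)).1 IF; apply: le_lt_trans.
apply: ae_ge0_le_integral => //.
- by apply: measurableT_comp => //; apply/measurable_EFinP; exact: mrint2.
- by move=> y _; exact: integral_ge0.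
- apply: (measurable_fun_fubini_tonelli_G (fun z => (`|(F z)%:E|)%E)) => //.
  by apply: measurableT_comp => //; exact/measurable_EFinP.
- apply: filterS (pfub_ae2 IF) => y Iy _ /=; rewrite -(rintE (itg_norm Iy)) lee_fin.
  exact: rint_norm.
Qed.

Lemma pfub1 F : itg m12 F ->
  \int[m12]_z F z = \int[m1]_x \int[m2]_y F (x, y).
Proof.
move=> IF; have mF := itg_meas IF.
congr fine; rewrite -(integral12_prod_meas1 IF).
apply: ae_eq_integral => //.
- exact: (measurable_fubini_F IF).
- by apply/measurable_EFinP; exact: mrint1.
- by apply: filterS (pfub_aeE1 IF) => x H _ /=; rewrite /fubini_F /= -?H.
Qed.

Lemma pfub2 F : itg m12 F ->
  \int[m12]_z F z = \int[m2]_y \int[m1]_x F (x, y).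
Proof.
move=> IF; have mF := itg_meas IF.
congr fine; rewrite -(integral21_prod_meas1 IF).
apply: ae_eq_integral => //.
- exact: (measurable_fubini_G IF).
- by apply/measurable_EFinP; exact: mrint2.
- by apply: filterS (pfub_aeE2 IF) => x H _ /=; rewrite /fubini_F /= -?H.
Qed.

Lemma pfubR F : itg m12 F ->
  \int[m1]_x \int[m2]_y F (x, y) = \int[m2]_y \int[m1]_x F (x, y).
Proof. by move=> IF; rewrite -pfub1// pfub2. Qed.

(** The main criterion for joint integrability below: the slice bound comes from a kernel estimate
    that is uniform in the source, and [G] from a density already known to be integrable. *)
Lemma pton1 F (G : X -> R) : measurable_fun setT F -> itg m1 G ->
  (forall x, itg m2 (fun y => F (x, y))) ->
  (forall x, \int[m2]_y `|F (x, y)| <= G x) -> itg m12 F.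
Proof.
move=> mF IG IF FG; apply/integrable12ltyP; first exact/measurable_EFinP.
have [mG] := integrableP _ _ _ IG; apply: le_lt_trans.
apply: ge0_le_integral => //.
- by move=> x _; exact: integral_ge0.
- apply: (measurable_fun_fubini_tonelli_F (fun z => (`|(F z)%:E|)%E)) => //.
  by apply: measurableT_comp => //; exact/measurable_EFinP.
- exact: measurableT_comp.
- move=> x _ /=; rewrite -(rintE (itg_norm (IF x))) lee_fin.
  exact: le_trans (FG x) (ler_norm _).
Qed.

Lemma pton2 F (G : Y -> R) : measurable_fun setT F -> itg m2 G ->
  (forall y, itg m1 (fun x => F (x, y))) ->
  (forall y, \int[m1]_x `|F (x, y)| <= G y) -> itg m12 F.
Proof.
move=> mF IG IF FG; apply/integrable21ltyP; first exact/measurable_EFinP.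
have [mG] := integrableP _ _ _ IG; apply: le_lt_trans.
apply: ge0_le_integral => //.
- by move=> x _; exact: integral_ge0.
- apply: (measurable_fun_fubini_tonelli_G (fun z => (`|(F z)%:E|)%E)) => //.
  by apply: measurableT_comp => //; exact/measurable_EFinP.
- exact: measurableT_comp.
- move=> y _ /=; rewrite -(rintE (itg_norm (IF y))) lee_fin.
  exact: le_trans (FG y) (ler_norm _).
Qed.

Lemma pitg_prod (f : X -> R) (g : Y -> R) : itg m1 f -> itg m2 g ->
  itg m12 (fun z => f z.1 * g z.2).
Proof.
move=> If Ig; apply: (@pton1 _ (fun x => `|f x| * \int[m2]_y `|g y|)).
- by apply: mfM; [apply: (measurableT_comp (itg_meas If))|apply: (measurableT_comp (itg_meas Ig))].
- apply: (@itg_eq _ _ _ _ (fun x => (\int[m2]_y `|g y|) * `|f x|)).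
    by move=> x; rewrite mulrC.
  exact/itgZ/itg_norm.
- by move=> x; exact: (itgZ (f x) Ig).
- move=> x /=; rewrite -rintZ; last exact: itg_norm.
  by under eq_Rintegral do rewrite normrM.
Qed.

End FubiniProd.

(* The canonical sigma-finite structure on a product measure is shadowed in the
   library by the subprobability one; [sprod] restores it. *)
Section SigmaFiniteProduct.
Context d1 d2 (X : measurableType d1) (Y : measurableType d2) (R : realType).
Variables (m1 : {sigma_finite_measure set X -> \bar R})
          (m2 : {sigma_finite_measure set Y -> \bar R}).
Definition sprod : set (X * Y) -> \bar R := (m1 \x m2)%E.

HB.instance Definition _ := Measure.copy sprod (m1 \x m2)%E.

Let sprod_sigma_finite : sigma_finite setT sprod.
Proof.
have /sigma_finiteP[F [TF ndF Foo]] := sigma_finiteT m1.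
have /sigma_finiteP[G [TG ndG Goo]] := sigma_finiteT m2.
exists (fun n => F n `*` G n).
  rewrite -setXTT TF TG predeqE => -[x y]; split.
    move=> [/= [n _ Fnx] [k _ Gky]]; exists (maxn n k) => //; split.
    - by move: x Fnx; exact/subsetPset/ndF/leq_maxl.
    - by move: y Gky; exact/subsetPset/ndG/leq_maxr.
  by move=> [n _ []/= ? ?]; split; exists n.
move=> k; have [? ?] := Foo k; have [? ?] := Goo k.
split; first exact: measurableX.
by rewrite /sprod product_measure1E// lte_mul_pinfty// ge0_fin_numE.
Qed.

HB.instance Definition _ := Measure_isSigmaFinite.Build _ _ _ sprod sprod_sigma_finite.

End SigmaFiniteProduct.

Section Fubini.
Context d1 d2 (X : measurableType d1) (Y : measurableType d2) (R : realType).
Variables (m1 : {sigma_finite_measure set X -> \bar R})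
          (m2 : {sigma_finite_measure set Y -> \bar R}).
Implicit Types F : X * Y -> R.
Local Notation m12 := (sprod m1 m2).

Lemma fub_ae1 F : itg m12 F -> {ae m1, forall x, itg m2 (fun y => F (x, y))}.
Proof. exact: pfub_ae1. Qed.

Lemma fub_itg1 F : itg m12 F -> itg m1 (fun x => \int[m2]_y F (x, y)).
Proof. exact: pfub_itg1. Qed.

Lemma fub_itg2 F : itg m12 F -> itg m2 (fun y => \int[m1]_x F (x, y)).
Proof. exact: pfub_itg2. Qed.

Lemma fub1 F : itg m12 F ->
  \int[m12]_z F z = \int[m1]_x \int[m2]_y F (x, y).
Proof. exact: pfub1. Qed.

Lemma fub2 F : itg m12 F ->
  \int[m12]_z F z = \int[m2]_y \int[m1]_x F (x, y).
Proof. exact: pfub2. Qed.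

Lemma fubR F : itg m12 F ->
  \int[m1]_x \int[m2]_y F (x, y) = \int[m2]_y \int[m1]_x F (x, y).
Proof. exact: pfubR. Qed.

Lemma ton1 F (G : X -> R) : measurable_fun setT F -> itg m1 G ->
  (forall x, itg m2 (fun y => F (x, y))) ->
  (forall x, \int[m2]_y `|F (x, y)| <= G x) -> itg m12 F.
Proof. exact: pton1. Qed.

Lemma ton2 F (G : Y -> R) : measurable_fun setT F -> itg m2 G ->
  (forall y, itg m1 (fun x => F (x, y))) ->
  (forall y, \int[m1]_x `|F (x, y)| <= G y) -> itg m12 F.
Proof. exact: pton2. Qed.

Lemma itg_prod (f : X -> R) (g : Y -> R) : itg m1 f -> itg m2 g ->
  itg m12 (fun z => f z.1 * g z.2).
Proof. exact: pitg_prod. Qed.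

End Fubini.

(** * Cauchy kernels and an integrable singular weight on the line *)

Section LineIntegrals.
Variable R : realType.
Local Notation mu := (@lebesgue_measure R).

Lemma integral_oneDsqrV : (\int[mu]_x ((1 + x ^+ 2)^-1)%:E = (@pi R)%:E)%E.
Proof.
rewrite ge0_symfun_integralT.
- rewrite (_ : [set x : R | 0 <= x] = `[0, +oo[%classic); last first.
    by apply/seteqP; split => x /=; rewrite in_itv/= andbT.
  by rewrite integral0y_oneDsqr -EFinM; congr EFin; field.
- by move=> x; rewrite invr_ge0 addr_ge0// sqr_ge0.
- exact: continuous_oneDsqrV.
- by move=> x /=; rewrite sqrrN.
Qed.

Lemma integral_cauchy (s c : R) : 0 < s ->
  (\int[mu]_t (s / ((t - c) ^+ 2 + s ^+ 2))%:E = (@pi R)%:E)%E.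
Proof.
move=> s0; rewrite -integral_oneDsqrV.
pose F (t : R) := s^-1 * (t - c).
have dF (x : R) : is_derive x 1 F s^-1.
  rewrite /F; have -> : s^-1 = s^-1 *: (1 - 0 : R) by rewrite subr0 /GRing.scale/= mulr1.
  have -> : (fun t : R => (s^-1 *: (1 - 0 : R)) * (t - c)) = s^-1 *: (id - cst c).
    by apply/funext => t; rewrite /= subr0 /GRing.scale/= mulr1.
  exact: is_deriveZ.
have F' : derive1 F = cst s^-1.
  by apply/funext => x; rewrite derive1E; exact: derive_val.
have s'0 : 0 < s^-1 by rewrite invr_gt0.
rewrite (@increasing_ge0_integration_by_substitutionT _ F (fun x => (1 + x ^+ 2)^-1)).
- apply: eq_integral => t _; congr EFin; rewrite /= F' /= /F.
  have ss : s ^+ 2 != 0 by rewrite expf_neq0// gt_eqF.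
  have h1 : (t - c) ^+ 2 + s ^+ 2 != 0 by rewrite gt_eqF// ltr_wpDl ?sqr_ge0 ?exprn_gt0.
  rewrite [RHS](_ : _ = (1 + (s^-1 * (t - c)) ^+ 2)^-1 * s^-1)//.
  by field; rewrite ?h1 ?(addrC (s ^+ 2)) ?h1 ?gt_eqF.
- by move=> x y xy; rewrite /F ltr_pM2l// ltrD2r.
- by rewrite F' => x; exact: cvg_cst.
- by rewrite F'; apply/cvg_ex; exists s^-1; exact: cvg_cst.
- by rewrite F'; apply/cvg_ex; exists s^-1; exact: cvg_cst.
- by move=> x; exact: ex_derive.
- apply/cvgrNyPle => A; near=> x; rewrite /F mulrC ler_pdivrMr// lerBlDr.
  by near: x; apply: nbhs_ninfty_le; rewrite ?num_real.
- apply/cvgryPge => A; near=> x; rewrite /F mulrC ler_pdivlMr// lerBrDr.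
  by near: x; apply: nbhs_pinfty_ge; rewrite ?num_real.
- exact: continuous_oneDsqrV.
- by move=> x; rewrite invr_ge0 addr_ge0// sqr_ge0.
Unshelve. all: by end_near. Qed.

Lemma itg_cauchy (s c : R) : s != 0 ->
  itg mu (fun t => `|s| / ((t - c) ^+ 2 + s ^+ 2)).
Proof.
move=> s0; have s0' : 0 < `|s| by rewrite normr_gt0.
have [] // := @itg_ub _ _ _ mu (fun t => `|s| / ((t - c) ^+ 2 + s ^+ 2)) pi.
  by msr.
rewrite -(integral_cauchy c s0') le_eqVlt; apply/orP; left; apply/eqP.
apply: eq_integral => t _; rewrite ger0_norm ?real_normK ?num_real//.
by rewrite divr_ge0// addr_ge0// sqr_ge0.
Qed.

Lemma rint_cauchy (s c : R) : s != 0 ->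
  \int[mu]_t (`|s| / ((t - c) ^+ 2 + s ^+ 2)) = pi.
Proof.
move=> s0; have s0' : 0 < `|s| by rewrite normr_gt0.
rewrite -[RHS]/(fine pi%:E) -(integral_cauchy c s0'); congr fine.
by apply: eq_integral => t _; rewrite real_normK ?num_real.
Qed.

(** Integrable at 0 and at infinity, with total integral of order 1/k. A product of two such
    weights, one per coordinate, dominates the Jacobian of one vertex after multiplication by k^2,
    so the resulting bound does not depend on the scale k. *)
Definition wker (k t : R) : R := (Num.sqrt `|t| * (`|t| + k ^+ 2))^-1.

Lemma mwker k : measurable_fun setT (wker k).
Proof.
rewrite /wker; apply: mfV; apply: mfM; last by msr.
apply: (measurableT_comp (f := @Num.sqrt R)); last by msr.
by apply: continuous_measurable_fun; exact: sqrt_continuous.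
Qed.

Lemma wker_ge0 k t : 0 <= wker k t.
Proof. by rewrite invr_ge0 mulr_ge0 ?sqrtr_ge0// addr_ge0// sqr_ge0. Qed.

(** The primitive is (2/k) atan(sqrt(t - c) / k), of total variation pi/k. The half-line starts at c
    + e because the integrand is singular at c; the bound is uniform in e. *)
Lemma integral_wker_right (k c e : R) : 0 < k -> 0 < e ->
  (\int[mu]_(t in `[(c + e)%R, +oo[) (wker k (t - c))%:E <= (pi / k)%:E)%E.
Proof.
move=> k0 e0.
pose F (t : R) : R := 2 / k * atan (k^-1 * Num.sqrt (t - c)).
have dF (x : R) : c < x -> is_derive x 1 F (wker k (x - c)).
  move=> cx; have xc0 : 0 < x - c by rewrite subr_gt0.
  have d1 : is_derive x 1 (fun t => t - c) (1 - 0 : R) by exact: is_deriveB.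
  have d2 := is_derive1_sqrt xc0.
  have d3 := is_derive1_comp (g := fun t => t - c) d2 d1.
  have d4 := is_deriveZ k^-1 d3.
  have d5 := is_derive1_comp (g := k^-1 \*: (Num.sqrt \o (fun t => t - c))) (is_derive1_atan (k^-1 * Num.sqrt (x - c))) d4.
  have d6 := is_deriveZ (2 / k) d5.
  apply: (is_derive_eq d6).
  rewrite /wker /GRing.scale/= gtr0_norm// subr0 mulr1.
  set s := Num.sqrt (x - c); have s0 : 0 < s by rewrite sqrtr_gt0.
  have -> : x - c = s ^+ 2 by rewrite sqr_sqrtr// ltW.
  have h1 : s ^+ 2 + k ^+ 2 != 0 by rewrite gt_eqF// addr_gt0 ?exprn_gt0.
  have h2 : k ^+ 2 + s ^+ 2 != 0 by rewrite addrC.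
  by field; rewrite ?h1 ?h2 ?gt_eqF.
have ce : c < c + e by rewrite ltrDl.
rewrite (@ge0_continuous_FTC2y _ _ F _ (pi / k)).
- rewrite leeBlDr// leeDl// lee_fin mulr_ge0 ?divr_ge0 ?(ltW k0)//.
  by rewrite -[X in X <= _]atan0 le_atan// mulr_ge0 ?invr_ge0 ?sqrtr_ge0// ltW.
- by move=> x _; exact: wker_ge0.
- apply: continuous_in_subspaceT => x /set_mem/=; rewrite in_itv/= andbT => cx.
  have xc : 0 < x - c by rewrite subr_gt0 (lt_le_trans ce).
  rewrite /wker; apply: (@cvgV _ _ (nbhs x) _ (fun t => Num.sqrt `|t - c| * (`|t - c| + k ^+ 2))).
    rewrite mulf_neq0//; first by rewrite gt_eqF// sqrtr_gt0 normr_gt0 gt_eqF.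
    by rewrite gt_eqF// ltr_pwDr ?exprn_gt0.
  have cn : `|t - c| @[t --> x] --> `|x - c|.
    by apply: cvg_norm; apply: cvgB; [exact: cvg_id|exact: cvg_cst].
  apply: cvgM; last by apply: cvgD => //; exact: cvg_cst.
  by apply: (@cvg_comp _ _ _ _ _ _ _ _ cn); exact: sqrt_continuous.
- rewrite (_ : pi / k = 2 / k * (pi / 2)); last by field; rewrite gt_eqF.
  apply: cvgMl_tmp.
  apply: (@cvg_comp _ _ _ (fun t => k^-1 * Num.sqrt (t - c)) atan _ (+oo)); last exact: cvgy_atan.
  apply/cvgryPge => A; near=> x; rewrite mulrC ler_pdivlMr//.
  apply: (@le_trans _ _ (Num.sqrt ((A * k) ^+ 2))); first by rewrite sqrtr_sqr ler_norm.
  rewrite ler_sqrt; last by rewrite subr_ge0; near: x; apply: nbhs_pinfty_ge; rewrite ?num_real.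
  by rewrite lerBrDr; near: x; apply: nbhs_pinfty_ge; rewrite ?num_real.
- by move=> x cx; have [] := dF x (lt_trans ce cx).
- apply: cvg_at_right_filter; apply: differentiable_continuous; apply/derivable1_diffP.
  by have [] := dF (c + e) ce.
- move=> x; rewrite in_itv/= andbT => cx; rewrite derive1E.
  by have [] := dF x (lt_trans ce cx).
Unshelve. all: by end_near. Qed.

Lemma integral_wker_left (k c e : R) : 0 < k -> 0 < e ->
  (\int[mu]_(t in `]-oo, (c - e)%R]) (wker k (t - c))%:E <= (pi / k)%:E)%E.
Proof.
move=> k0 e0; rewrite -[c - e]opprK ge0_integration_by_substitutionNy.
- rewrite opprB addrC; apply: le_trans (integral_wker_right (- c) k0 e0).
  rewrite le_eqVlt; apply/orP; left; apply/eqP; apply: eq_integral => t _ /=.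
  by rewrite /wker -opprD normrN opprK.
- apply: continuous_in_subspaceT => x /set_mem/=; rewrite in_itv/= => cx.
  have xc : x - c < 0 by rewrite opprK in cx; rewrite subr_lt0 (le_lt_trans cx)// ltrBlDr ltrDl.
  rewrite /wker; apply: (@cvgV _ _ (nbhs x) _ (fun t => Num.sqrt `|t - c| * (`|t - c| + k ^+ 2))).
    rewrite mulf_neq0//; first by rewrite gt_eqF// sqrtr_gt0 normr_gt0 lt_eqF.
    by rewrite gt_eqF// ltr_pwDr ?exprn_gt0.
  have cn : `|t - c| @[t --> x] --> `|x - c|.
    by apply: cvg_norm; apply: cvgB; [exact: cvg_id|exact: cvg_cst].
  apply: cvgM; last by apply: cvgD => //; exact: cvg_cst.
  by apply: (@cvg_comp _ _ _ _ _ _ _ _ cn); exact: sqrt_continuous.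
- by move=> x _; exact: wker_ge0.
Qed.

Lemma wker_itg (k c : R) : 0 < k ->
  itg mu (fun t => wker k (t - c)) /\ \int[mu]_t wker k (t - c) <= 2 * pi / k.
Proof.
move=> k0.
have mw : measurable_fun setT (fun t : R => wker k (t - c)).
  by apply: (measurableT_comp (mwker k)); msr.
suff : (\int[mu]_t `|wker k (t - c)|%:E <= (2 * pi / k)%:E)%E.
  move=> H; have [I1 I2] := itg_ub (m := mu) mw H; split => //.
  by move: I2; under eq_Rintegral do rewrite ger0_norm ?wker_ge0//.
under eq_integral do rewrite ger0_norm ?wker_ge0//.
(* The complement of c is exhausted by pairs of closed half-lines, so that monotone convergence
   removes the margin around the singularity. *)
pose S (n : nat) : set R := `]-oo, c - n.+1%:R^-1] `|` `[c + n.+1%:R^-1, +oo[.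
have n0 n : 0 < n.+1%:R^-1 :> R by rewrite invr_gt0.
have mS n : measurable (S n) by apply: measurableU; exact: measurable_itv.
have ndS : nondecreasing_seq S.
  apply/nondecreasing_seqP => n; apply/subsetPset => t [] /=; rewrite !in_itv/= ?andbT => h; [left|right];
    rewrite /= in_itv/= ?andbT.
    by rewrite (le_trans h)// lerB// lef_pV2 ?posrE// ler_nat.
  by rewrite (le_trans _ h)// lerD2l lef_pV2 ?posrE// ler_nat.
have SU : \bigcup_n S n = [set~ c].
  apply/seteqP; split=> [t [n _ []]|t /= /eqP tc]; rewrite /= ?in_itv/= ?andbT.
  - by move=> h; apply/eqP; rewrite lt_eqF// (le_lt_trans h)// ltrBlDr ltrDl.
  - by move=> h; apply/eqP; rewrite gt_eqF// (lt_le_trans _ h)// ltrDl.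
  have tc0 : 0 < `|t - c| by rewrite normr_gt0 subr_eq0.
  have [N _ HN] := near_infty_natSinv_lt (PosNum tc0).
  have /= := HN N (leqnn _); have [h|h] := leP c t.
    rewrite ger0_norm ?subr_ge0// => /ltW h1; exists N => //; right; rewrite /= in_itv/= andbT.
    by rewrite addrC -lerBrDr.
  rewrite ltr0_norm ?subr_lt0// opprB => /ltW h1; exists N => //; left; rewrite /= in_itv/=.
  by rewrite lerBrDr addrC -lerBrDr.
have cv := @ge0_nondecreasing_set_cvg_integral _ (measurableTypeR R) R S (fun t => (wker k (t - c))%:E) mu ndS mS.
have wm (D : set (measurableTypeR R)) : measurable_fun D (fun t : measurableTypeR R => (wker k (t - c))%:E).
  by apply/measurable_EFinP; exact: (@measurable_funTS _ _ (measurableTypeR R) _ _ _ mw).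
have w0 (t : R) : (0 <= (wker k (t - c))%:E)%E by rewrite lee_fin wker_ge0.
have := @ge0_negligible_integral _ (measurableTypeR R) R mu setT [set c]
  (fun t => (wker k (t - c))%:E) (measurable_set1 _) measurableT (wm _) (fun t _ => w0 t)
  (lebesgue_measure_set1 _).
rewrite setTD -SU => ->.
apply: cvge_le (cv _ _) => //; apply: nearW => n.
rewrite ge0_integral_setU//=.
- rewrite (_ : 2 * pi / k = pi / k + pi / k); last by ring.
  by rewrite EFinD; apply: leeD; [rewrite integral_wker_left|rewrite integral_wker_right].
- rewrite disj_set2E; apply/eqP; rewrite -subset0 => t [] /=; rewrite !in_itv/= andbT => h1 h2.
  by have := n0 n; move: h1 h2; set u := n.+1%:R^-1; lra.
Qed.

End LineIntegrals.

(** * Derivatives of the angle function and the Jacobian of one vertex *)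

Section Kernel.
Variable R : realType.
Local Notation mu := (@lebesgue_measure R).
Definition pt := (measurableTypeR R * measurableTypeR R)%type.
Local Notation mu2 := (sprod mu mu).

(** The width [s] may have any sign, so sources above and below a line are covered by one formula;
    the integral over the line is pi times the sign of [s]. *)
Definition cau (s c t : R) : R := s / ((t - c) ^+ 2 + s ^+ 2).

Lemma mcau s c : measurable_fun setT (cau s c).
Proof. by rewrite /cau; msr. Qed.

Lemma cau_itg s c : itg mu (cau s c) /\ \int[mu]_t `|cau s c t| <= pi.
Proof.
have [->|s0] := eqVneq s 0.
  have E : cau 0 c = fun=> 0 by apply/funext => t; rewrite /cau mul0r.
  by rewrite E; split; [exact: itg0|under eq_Rintegral do rewrite normr0; rewrite rint0 pi_ge0].
have E (t : R) : `|cau s c t| = `|s| / ((t - c) ^+ 2 + s ^+ 2).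
  by rewrite /cau normrM normfV [X in _ / X]ger0_norm// addr_ge0// sqr_ge0.
split.
  apply: (itg_dom _ _ (itg_cauchy c s0)); first exact: mcau.
  by move=> t; rewrite E.
by under eq_Rintegral do rewrite E; rewrite rint_cauchy.
Qed.

Definition rsq (p q : pt) : R := (p.1 - q.1) ^+ 2 + (p.2 - q.2) ^+ 2.
Definition rsqN (p q : pt) : R := (p.1 - q.1) ^+ 2 + (p.2 + q.2) ^+ 2.
(** [aK] and [bK] are the partial derivatives of phi^h(p, q) in the abscissa and the height of p;
    the second fraction in each comes from the mirror image. [JK] is the Jacobian of the two angles
    seen from p towards q1 and q2. *)
Definition aK (p q : pt) : R := (q.2 - p.2) / rsq p q - (q.2 + p.2) / rsqN p q.
Definition bK (p q : pt) : R := (p.1 - q.1) / rsq p q + (p.1 - q.1) / rsqN p q.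
Definition JK (p q1 q2 : pt) : R := aK p q1 * bK p q2 - bK p q1 * aK p q2.

Lemma maK d (X : measurableType d) (f g : X -> pt) : measurable_fun setT f ->
  measurable_fun setT g -> measurable_fun setT (fun x => aK (f x) (g x)).
Proof. by move=> mf mg; rewrite /aK /rsq /rsqN; msr. Qed.

Lemma mbK d (X : measurableType d) (f g : X -> pt) : measurable_fun setT f ->
  measurable_fun setT g -> measurable_fun setT (fun x => bK (f x) (g x)).
Proof. by move=> mf mg; rewrite /bK /rsq /rsqN; msr. Qed.

Lemma mJK d (X : measurableType d) (f g h : X -> pt) : measurable_fun setT f ->
  measurable_fun setT g -> measurable_fun setT h ->
  measurable_fun setT (fun x => JK (f x) (g x) (h x)).
Proof.
by move=> mf mg mh; apply: mfD; [|apply: mfN]; apply: mfM;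
  [exact: maK|exact: mbK|exact: mbK|exact: maK].
Qed.

(** Two Cauchy kernels appear on each horizontal line, and likewise in [bKE] on each vertical line;
    this is the source of the bound 2 pi, whatever the position of q. *)
Lemma aKE (x h : R) (q : pt) : aK (x, h) q = cau (q.2 - h) q.1 x - cau (q.2 + h) q.1 x.
Proof.
rewrite /aK /cau /rsq /rsqN /=; congr (_ / (_ + _) - _ / (_ + _)).
  by rewrite -sqrrN opprB.
by rewrite addrC.
Qed.

Lemma bKE (x h : R) (q : pt) :
  bK (x, h) q = cau (x - q.1) q.2 h + cau (x - q.1) (- q.2) h.
Proof. by rewrite /bK /cau /rsq /rsqN /= opprK; congr (_ / _ + _ / _); rewrite addrC. Qed.

Lemma cau2_itg s c s' c' (k : R) : `|k| = 1 ->
  itg mu (fun t => cau s c t + k * cau s' c' t) /\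
  \int[mu]_t `|cau s c t + k * cau s' c' t| <= 2 * pi.
Proof.
move=> k1; have [I1 L1] := cau_itg s c; have [I2 L2] := cau_itg s' c'.
have I3 : itg mu (fun t => cau s c t + k * cau s' c' t) by apply: itgD => //; exact: itgZ.
split => //; have -> : 2 * pi = pi + pi :> R by ring.
apply: le_trans (lerD L1 L2); rewrite -rintD; [|exact: itg_norm|exact: itg_norm].
apply: rint_le; [exact: itg_norm|by apply: itgD; exact: itg_norm|].
by move=> t; apply: (le_trans (ler_normD _ _)); rewrite [`|k * _|]normrM k1 mul1r.
Qed.

Lemma aK_itg h q : itg mu (fun x => aK (x, h) q) /\ \int[mu]_x `|aK (x, h) q| <= 2 * pi.
Proof.
have E : (fun x : measurableTypeR R => aK (x, h) q) =
  (fun x => cau (q.2 - h) q.1 x + (-1) * cau (q.2 + h) q.1 x).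
  by apply/funext => x; rewrite aKE mulN1r.
rewrite E (_ : (\int[mu]_x `|aK (x, h) q|) =
  \int[mu]_x `|cau (q.2 - h) q.1 x + (-1) * cau (q.2 + h) q.1 x|).
  by apply: cau2_itg; rewrite normrN1.
by apply: rint_eq => x; have := congr1 (fun f => f x) E => /= ->.
Qed.

Lemma bK_itg x q : itg mu (fun h => bK (x, h) q) /\ \int[mu]_h `|bK (x, h) q| <= 2 * pi.
Proof.
have E : (fun h : measurableTypeR R => bK (x, h) q) =
  (fun h => cau (x - q.1) q.2 h + 1 * cau (x - q.1) (- q.2) h).
  by apply/funext => h; rewrite bKE mul1r.
rewrite E (_ : (\int[mu]_h `|bK (x, h) q|) =
  \int[mu]_h `|cau (x - q.1) q.2 h + 1 * cau (x - q.1) (- q.2) h|).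
  by apply: cau2_itg; rewrite normr1.
by apply: rint_eq => h; have := congr1 (fun f => f h) E => /= ->.
Qed.

Lemma rsq_ge0 p q : 0 <= rsq p q. Proof. by rewrite addr_ge0// sqr_ge0. Qed.

Lemma rsq_gt0 p q : p != q -> 0 < rsq p q.
Proof.
case: p q => [x h] [u y]; rewrite lt_def rsq_ge0 andbT; apply: contra.
rewrite /rsq/= paddr_eq0 ?sqr_ge0// !sqrf_eq0 !subr_eq0 => /andP[/eqP-> /eqP->].
by [].
Qed.

(* Writing K = M + N for the parts singular at q and at its mirror image,
   |M| = 1/|p-q| >= |N| as p and q lie on the same side. *)
Lemma K_norm (p q : pt) : 0 < p.2 -> 0 <= q.2 -> p != q ->
  aK p q ^+ 2 + bK p q ^+ 2 <= 4 / rsq p q.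
Proof.
move=> p0 q0 pq; have r0 := rsq_gt0 pq.
have rN : rsq p q <= rsqN p q.
  rewrite /rsq /rsqN lerD2l; have : 0 <= (p.2 : R) * (q.2 : R) by rewrite mulr_ge0// ltW.
  by nra.
have r0' : 0 < rsqN p q := lt_le_trans r0 rN.
have EM : ((q.2 - p.2) / rsq p q) ^+ 2 + ((p.1 - q.1) / rsq p q) ^+ 2 = (rsq p q)^-1.
  have Es : (q.2 - p.2 : R) ^+ 2 + (p.1 - q.1 : R) ^+ 2 = rsq p q by rewrite /rsq; ring.
  by rewrite !expr_div_n -mulrDl Es; field; rewrite gt_eqF.
have EN : ((q.2 + p.2) / rsqN p q) ^+ 2 + ((p.1 - q.1) / rsqN p q) ^+ 2 = (rsqN p q)^-1.
  have Es : (q.2 + p.2 : R) ^+ 2 + (p.1 - q.1 : R) ^+ 2 = rsqN p q by rewrite /rsqN; ring.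
  by rewrite !expr_div_n -mulrDl Es; field; rewrite gt_eqF.
have LN : (rsqN p q)^-1 <= (rsq p q)^-1 by rewrite lef_pV2 ?posrE.
rewrite /aK /bK; move: EM EN LN.
set A := (q.2 - p.2) / _; set B := (p.1 - q.1) / _; set C := (q.2 + p.2) / _; set D := (p.1 - q.1) / _.
move=> EM EN LN; rewrite -[4 / _]/(4 * (rsq p q)^-1).
have h1 : 0 <= (A + C) ^+ 2 by exact: sqr_ge0.
have h2 : 0 <= (B - D) ^+ 2 by exact: sqr_ge0.
nra.
Qed.

(** Up to conjugation, 1/(p - q1) - 1/(p - q2) = (q1 - q2) / ((p - q1)(p - q2)). The mirror terms
    satisfy the same identity with larger distances, and the two contributions are combined by (a +
    b)^2 <= 2 a^2 + 2 b^2. *)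
Lemma K_diff (p q1 q2 : pt) : 0 < p.2 -> 0 <= q1.2 -> 0 <= q2.2 -> p != q1 -> p != q2 ->
  (aK p q1 - aK p q2) ^+ 2 + (bK p q1 - bK p q2) ^+ 2
  <= 4 * rsq q1 q2 / (rsq p q1 * rsq p q2).
Proof.
move=> p0 q10 q20 pq1 pq2; have r1 := rsq_gt0 pq1; have r2 := rsq_gt0 pq2.
have rN (q : pt) : 0 <= q.2 -> rsq p q <= rsqN p q.
  move=> q0; rewrite /rsq /rsqN lerD2l; have : 0 <= (p.2 : R) * (q.2 : R) by rewrite mulr_ge0// ltW.
  by nra.
have r1' := lt_le_trans r1 (rN _ q10); have r2' := lt_le_trans r2 (rN _ q20).
have n1 : rsq p q1 != 0 by rewrite gt_eqF. have n2 : rsq p q2 != 0 by rewrite gt_eqF.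
have n1' : rsqN p q1 != 0 by rewrite gt_eqF. have n2' : rsqN p q2 != 0 by rewrite gt_eqF.
have EM : ((q1.2 - p.2) / rsq p q1 - (q2.2 - p.2) / rsq p q2) ^+ 2
  + ((p.1 - q1.1) / rsq p q1 - (p.1 - q2.1) / rsq p q2) ^+ 2
  = rsq q1 q2 / (rsq p q1 * rsq p q2).
  move: n1 n2; rewrite /rsq => n1 n2; field; by rewrite ?n1 ?n2.
have EN : ((q1.2 + p.2) / rsqN p q1 - (q2.2 + p.2) / rsqN p q2) ^+ 2
  + ((p.1 - q1.1) / rsqN p q1 - (p.1 - q2.1) / rsqN p q2) ^+ 2
  = rsq q1 q2 / (rsqN p q1 * rsqN p q2).
  move: n1' n2'; rewrite /rsq /rsqN => n1' n2'; field; by rewrite ?n1' ?n2'.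
have LN : rsq q1 q2 / (rsqN p q1 * rsqN p q2) <= rsq q1 q2 / (rsq p q1 * rsq p q2).
  rewrite ler_wpM2l ?rsq_ge0// lef_pV2 ?posrE ?mulr_gt0//.
  by rewrite ler_pM ?rN// ltW.
rewrite /aK /bK -(mulrA 4); move: EM EN LN.
set A := _ / _; set B := (q2.2 - p.2) / _; set C := (p.1 - q1.1) / _; set D := (p.1 - q2.1) / _.
set A' := (q1.2 + p.2) / _; set B' := (q2.2 + p.2) / _; set C' := (p.1 - q1.1) / _; set D' := (p.1 - q2.1) / _.
move=> EM EN LN.
have h1 : 0 <= (A - B + (A' - B')) ^+ 2 by exact: sqr_ge0.
have h2 : 0 <= (C - D - (C' - D')) ^+ 2 by exact: sqr_ge0.
nra.
Qed.

Lemma JK_anti p q1 q2 : JK p q1 q2 = - JK p q2 q1.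
Proof. by rewrite /JK; ring. Qed.

Lemma JK_self p q : JK p q q = 0.
Proof. by rewrite /JK; ring. Qed.

(** A determinant is unchanged when one column is subtracted from the other, and it is at most the
    product of the two lengths. The difference gains a factor |q1 - q2|, which improves the decay in
    p from order 2 to order 3 and makes the bound integrable at infinity. *)
Lemma JK_sqr (p q1 q2 : pt) : 0 < p.2 -> 0 <= q1.2 -> 0 <= q2.2 -> p != q1 -> p != q2 ->
  JK p q1 q2 ^+ 2 <= 16 * rsq q1 q2 / (rsq p q1 * rsq p q2 * rsq p q2).
Proof.
move=> p0 q10 q20 pq1 pq2; have r1 := rsq_gt0 pq1; have r2 := rsq_gt0 pq2.
have k2 := K_norm p0 q20 pq2; have kd := K_diff p0 q10 q20 pq1 pq2.
have L : JK p q1 q2 ^+ 2 <= (aK p q2 ^+ 2 + bK p q2 ^+ 2) *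
   ((aK p q1 - aK p q2) ^+ 2 + (bK p q1 - bK p q2) ^+ 2).
  (* Lagrange's identity: the defect is the square of the scalar product. *)
  rewrite /JK -subr_ge0 (_ : _ - _ =
    (aK p q2 * (aK p q1 - aK p q2) + bK p q2 * (bK p q1 - bK p q2)) ^+ 2).
    exact: sqr_ge0.
  by ring.
apply: (le_trans L); apply: (le_trans (ler_pM _ _ k2 kd)); rewrite ?addr_ge0 ?sqr_ge0//.
rewrite le_eqVlt; apply/orP; left; apply/eqP; field.
by rewrite ?gt_eqF.
Qed.

(** The square root of the distance: [kdist ^+ 2] is the distance itself and matches the term k^2 in
    [wker]. *)
Definition kdist (q1 q2 : pt) : R := Num.sqrt (Num.sqrt (rsq q1 q2)).

(** Let X and Y be the coordinate distances of p from q1, and D = |q1 - q2|. As p is no farther from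
    q1 than from q2, D <= 2 |p - q2|, whence (X + D)(Y + D) <= 10 |p - q2|^2, while 2XY <= |p -
    q1|^2. Comparison with [JK_sqr] then asks for a squared constant of 800, and 30^2 = 900. *)
Lemma JK_wker_half (p q1 q2 : pt) : 0 < p.2 -> 0 <= q1.2 -> 0 <= q2.2 ->
  p.1 != q1.1 -> p.2 != q1.2 -> p != q2 -> rsq p q1 <= rsq p q2 ->
  `|JK p q1 q2| <= 30 * (kdist q1 q2 ^+ 2 * (wker (kdist q1 q2) (p.1 - q1.1) * wker (kdist q1 q2) (p.2 - q1.2))).
Proof.
move=> p0 q10 q20 px py pq2 r12; set k := kdist q1 q2.
have pq1 : p != q1 by apply: contra px => /eqP ->.
have r1 := rsq_gt0 pq1; have r2 := rsq_gt0 pq2.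
have k2 : k ^+ 2 = Num.sqrt (rsq q1 q2) by rewrite sqr_sqrtr// sqrtr_ge0.
set D := k ^+ 2 in k2 *; have D0 : 0 <= D by rewrite sqr_ge0.
have DD : D ^+ 2 = rsq q1 q2 by rewrite k2 sqr_sqrtr// rsq_ge0.
have J2 := JK_sqr p0 q10 q20 pq1 pq2.
set X : R := `|p.1 - q1.1|; set Y : R := `|p.2 - q1.2|.
have X0 : 0 < X by rewrite normr_gt0 subr_eq0.
have Y0 : 0 < Y by rewrite normr_gt0 subr_eq0.
have E1 : rsq p q1 = X ^+ 2 + Y ^+ 2 by rewrite /rsq /X /Y !real_normK ?num_real.
have W0 : 0 <= D * (wker k (p.1 - q1.1) * wker k (p.2 - q1.2)).
  by rewrite mulr_ge0// mulr_ge0// wker_ge0.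
have W30 := mulr_ge0 (ler0n R 30) W0.
rewrite -sqrtr_sqr -(ger0_norm W30) -[leRHS]sqrtr_sqr ler_sqrt ?sqr_ge0//.
apply: (le_trans J2); rewrite -DD.
have T1 : D ^+ 2 <= 4 * rsq p q2.
  rewrite DD; have -> : rsq q1 q2 = ((p.1 - q2.1) - (p.1 - q1.1)) ^+ 2 + ((p.2 - q2.2) - (p.2 - q1.2)) ^+ 2.
    by rewrite /rsq; ring.
  move: r12; rewrite /rsq; set a := p.1 - q1.1; set b := p.2 - q1.2; set c := p.1 - q2.1; set e := p.2 - q2.2.
  have := sqr_ge0 (a + c); have := sqr_ge0 (b + e); nra.
have T2 : (X + D) * (Y + D) <= 2 * (rsq p q1 + D ^+ 2).
  rewrite E1; have := sqr_ge0 (X - Y); have := sqr_ge0 (X - D); have := sqr_ge0 (Y - D); nra.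
have T3 : 2 * X * Y <= rsq p q1 by rewrite E1; have := sqr_ge0 (X - Y); nra.
have T4 : (X + D) * (Y + D) <= 10 * rsq p q2 by nra.
have XDp : 0 < X + D by rewrite ltr_pwDl.
have YDp : 0 < Y + D by rewrite ltr_pwDl.
have P0 : 0 < (X + D) * (Y + D) by rewrite mulr_gt0// ltr_pwDl.
have Ew : (30 * (D * (wker k (p.1 - q1.1) * wker k (p.2 - q1.2)))) ^+ 2 =
   900 * D ^+ 2 / (X * Y * ((X + D) * (Y + D)) ^+ 2).
  rewrite /wker -/X -/Y -/D.
  have -> : X * Y = Num.sqrt X ^+ 2 * Num.sqrt Y ^+ 2 by rewrite !sqr_sqrtr// ltW.
  have sx : Num.sqrt X != 0 by rewrite gt_eqF// sqrtr_gt0.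
  have sy : Num.sqrt Y != 0 by rewrite gt_eqF// sqrtr_gt0.
  have XD : X + D != 0 by rewrite gt_eqF// ltr_pwDl.
  have YD : Y + D != 0 by rewrite gt_eqF// ltr_pwDl.
  by field; rewrite sx sy XD YD.
rewrite Ew -2!(mulrA _ (D ^+ 2)) (mulrCA 16) (mulrCA 900) ler_wpM2l ?sqr_ge0//.
rewrite ler_pdivrMr ?mulr_gt0// mulrAC ler_pdivlMr ?mulr_gt0 ?exprn_gt0//.
have XY0 : 0 < X * Y by rewrite mulr_gt0.
have T5 : ((X + D) * (Y + D)) ^+ 2 <= 100 * rsq p q2 ^+ 2.
  by move: T4 P0; set P := (X + D) * (Y + D); nra.
have T6 : 2 * (X * Y) <= rsq p q1 by rewrite mulrA.
apply: (@le_trans _ _ (16 * (X * Y * (100 * rsq p q2 ^+ 2)))).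
  by rewrite ler_wpM2l// ler_wpM2l// ltW.
have -> : 16 * (X * Y * (100 * rsq p q2 ^+ 2)) = (800 * (2 * (X * Y))) * rsq p q2 ^+ 2 by ring.
have -> : 900 * (rsq p q1 * rsq p q2 * rsq p q2) = (900 * rsq p q1) * rsq p q2 ^+ 2 by ring.
by rewrite ler_wpM2r ?sqr_ge0//; nra.
Qed.

Definition jdom (q1 q2 p : pt) : R := 30 * (kdist q1 q2 ^+ 2 *
  (wker (kdist q1 q2) (p.1 - q1.1) * wker (kdist q1 q2) (p.2 - q1.2))).

Lemma JK_jdom (p q1 q2 : pt) : 0 < p.2 -> 0 <= q1.2 -> 0 <= q2.2 ->
  p.1 != q1.1 -> p.2 != q1.2 -> p.1 != q2.1 -> p.2 != q2.2 ->
  `|JK p q1 q2| <= jdom q1 q2 p + jdom q2 q1 p.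
Proof.
move=> p0 h1 h2 x1 y1 x2 y2.
have nq (q : pt) : p.1 != q.1 -> p != q by apply: contra => /eqP ->.
have d0 q q' : 0 <= jdom q q' p by rewrite /jdom mulr_ge0// mulr_ge0 ?sqr_ge0// mulr_ge0 ?wker_ge0.
have [r|r] := leP (rsq p q1) (rsq p q2).
  by apply: (le_trans (JK_wker_half _ _ _ _ _ _ r)) => //; [exact: nq|rewrite lerDl].
rewrite JK_anti normrN.
by apply: (le_trans (JK_wker_half _ _ _ _ _ _ (ltW r))) => //; [exact: nq|rewrite lerDr].
Qed.

(** The factor k^2 cancels the two factors 1/k from [wker_itg], leaving 30 (2 pi)^2 whatever the
    distance between q1 and q2. *)
Lemma jdom_itg q1 q2 : q1 != q2 ->
  itg mu2 (jdom q1 q2) /\ \int[mu2]_p jdom q1 q2 p <= 120 * pi ^+ 2.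
Proof.
move=> q12; set k := kdist q1 q2.
have k0 : 0 < k by rewrite !sqrtr_gt0 rsq_gt0.
have [I1 L1] := wker_itg q1.1 k0; have [I2 L2] := wker_itg q1.2 k0.
have Ip := itg_prod I1 I2.
split; first exact/itgZ/itgZ.
rewrite (_ : (\int[mu2]_p jdom q1 q2 p) = 30 * (k ^+ 2 *
   \int[mu2]_z (wker k (z.1 - q1.1) * wker k (z.2 - q1.2)))); last first.
  by rewrite -!rintZ//; exact: itgZ.
rewrite fub1//=; under eq_Rintegral do rewrite rintZ//.
rewrite (_ : 120 * pi ^+ 2 = 30 * (k ^+ 2 * ((2 * pi / k) * (2 * pi / k)))); last first.
  by field; rewrite gt_eqF.
rewrite ler_pM2l// ler_pM2l ?exprn_gt0//.
under eq_Rintegral do rewrite mulrC.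
by rewrite rintZ// ler_pM ?rint_ge0// => x; exact: wker_ge0.
Qed.

Definition up (p : pt) : R := (0 < (p.2 : R))%R%:R.

Lemma measurable_up : measurable_fun setT up.
Proof. by rewrite /up; msr. Qed.

Lemma ae_line1 (c : R) : {ae mu2, forall p : pt, p.1 != c}.
Proof.
exists ([set c] `*` setT); split; first exact: measurableX.
  have := @product_measure1E _ _ (measurableTypeR R) (measurableTypeR R) R mu mu [set c] setT
    (measurable_set1 c) measurableT.
  move=> H; apply: etrans H _.
  by apply: etrans (congr1 (fun z => (z * _)%E) (lebesgue_measure_set1 c)) _; exact: mul0e.
by move=> p /= /negP; rewrite negbK => /eqP ->.
Qed.

Lemma ae_line2 (c : R) : {ae mu2, forall p : pt, p.2 != c}.
Proof.
exists (setT `*` [set c]); split; first exact: measurableX.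
  have := @product_measure1E _ _ (measurableTypeR R) (measurableTypeR R) R mu mu setT [set c]
    measurableT (measurable_set1 c).
  move=> H; apply: etrans H _.
  by apply: etrans (congr1 (fun z => (_ * z)%E) (lebesgue_measure_set1 c)) _; exact: mule0.
by move=> p /= /negP; rewrite negbK => /eqP ->.
Qed.

Definition CJ : R := 240 * pi ^+ 2.

(** The uniform two-dimensional estimate: points nearer to q1 and points nearer to q2 are dominated
    separately, with 120 pi^2 for each. The lines through the two sources, where the domination
    fails, are null sets. *)
Lemma JK_itg (q1 q2 : pt) : 0 <= q1.2 -> 0 <= q2.2 ->
  itg mu2 (fun p => up p * JK p q1 q2) /\
  \int[mu2]_p `|up p * JK p q1 q2| <= CJ.
Proof.
move=> h1 h2; have [<-|q12] := eqVneq q1 q2.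
  have E : (fun p => up p * JK p q1 q1) = (fun=> 0).
    by apply/funext => p; rewrite JK_self mulr0.
  rewrite E; split; first exact: itg0.
  under eq_Rintegral do rewrite JK_self mulr0 normr0.
  by rewrite rint0 mulr_ge0// sqr_ge0.
have q21 : q2 != q1 by rewrite eq_sym.
have [I1 L1] := jdom_itg q12; have [I2 L2] := jdom_itg (q1 := q2) (q2 := q1) q21.
have mJ : measurable_fun setT (fun p => up p * JK p q1 q2).
  by apply: mfM; [exact: measurable_up|apply: mJK; msr].
have I12 := itgD I1 I2.
apply: itg_ub => //.
rewrite (_ : CJ = 120 * pi ^+ 2 + 120 * pi ^+ 2); last by rewrite /CJ; ring.
apply: (@le_trans _ _ (\int[mu2]_p (jdom q1 q2 p + jdom q2 q1 p)%:E)%E).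
  apply: ae_ge0_le_integral => //.
  - by apply/measurable_EFinP; exact: mfnorm.
  - by move=> p _; rewrite lee_fin addr_ge0// /jdom mulr_ge0// mulr_ge0 ?sqr_ge0// mulr_ge0 ?wker_ge0.
  - by apply/measurable_EFinP; exact: (itg_meas I12).
  - have A := ae_line1; have B := ae_line2.
    apply: filterS (filterI (filterI (A q1.1) (B q1.2)) (filterI (A q2.1) (B q2.2))).
    move=> p [[n1 n2] [n3 n4]] _; rewrite lee_fin /up.
    case: ltP => p0; last first.
      rewrite mul0r normr0 addr_ge0// /jdom mulr_ge0// mulr_ge0 ?sqr_ge0// mulr_ge0 ?wker_ge0//.
    by rewrite mul1r JK_jdom.
by rewrite -(rintE I12) lee_fin rintD// lerD.
Qed.

End Kernel.

(** * Densities of trees and the one-forms they generate *)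

Inductive tree := leaf of bool | node of tree & tree.

Section Sources.
Variable R : realType.
Local Notation mu := (@lebesgue_measure R).
Local Notation mu2 := (sprod mu mu).
Local Notation pt := (pt R).

Definition ept (b : bool) : pt := ((b%:R : R), (0 : R)).

(** A leaf is pinned at the boundary point 0 or 1, an inner vertex ranges over the plane. One
    reference measure per tree lets both be integrated by the same formulas. *)
Definition mtree (t : tree) : {sigma_finite_measure set pt -> \bar R} :=
  match t with leaf b => dirac (ept b) | node _ _ => mu2 end.

(** The density of the root position once all other vertices are integrated out. A leaf carries the
    indicator of the closed half plane, which is 1 at its own point, so that [dens_supp] holds for
    every tree. *)
Fixpoint dens (t : tree) : pt -> R :=
  match t with
  | leaf _ => fun q => (0 <= (q.2 : R))%R%:R
  | node l r => fun p => \int[(sprod (mtree l) (mtree r))]_z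
      (up p * JK p z.1 z.2 * (dens l z.1 * dens r z.2))
  end.

Lemma dens_supp t q : dens t q != 0 -> 0 <= (q.2 : R).
Proof.
case: t => [b|l r] /=; first by case: leP => //; rewrite eqxx.
rewrite /up; case: ltP => [/ltW//|h]; rewrite (rint_eq _ (g := fun=> 0)) ?rint0 ?eqxx//.
by move=> z; rewrite !mul0r.
Qed.

Lemma dens_node_itg (l r : tree) : measurable_fun setT (dens l) -> measurable_fun setT (dens r) ->
  itg (mtree l) (dens l) -> itg (mtree r) (dens r) ->
  itg (sprod mu2 (sprod (mtree l) (mtree r)))
    (fun s => up s.1 * JK s.1 s.2.1 s.2.2 * (dens l s.2.1 * dens r s.2.2)).
Proof.
move=> ml mr Il Ir.
apply: (@ton2 _ _ _ _ _ _ _ _ (fun z => CJ R * `|dens l z.1 * dens r z.2|)).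
- apply: mfM; first by apply: mfM; [apply: (measurableT_comp (@measurable_up R)); msr|apply: mJK; msr].
  by apply: mfM; [apply: (measurableT_comp ml); msr|apply: (measurableT_comp mr); msr].
- by apply: itgZ; apply: itg_norm; exact: itg_prod.
- move=> [q1 q2] /=; have [->|h1] := eqVneq (dens l q1) 0.
    by apply: itg_eq (itg0 _) => p; rewrite mul0r mulr0.
  have [->|h2] := eqVneq (dens r q2) 0.
    by apply: itg_eq (itg0 _) => p; rewrite !mulr0.
  have [I _] := JK_itg (dens_supp h1) (dens_supp h2).
  by apply: itg_eq (itgZ (dens l q1 * dens r q2) I) => p; rewrite mulrC.
- move=> [q1 q2] /=; have CJ0 : 0 <= CJ R by rewrite mulr_ge0// sqr_ge0.
  have [->|h1] := eqVneq (dens l q1) 0.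
    rewrite (rint_eq _ (g := fun=> 0)) ?rint0; first exact: (mulr_ge0 CJ0 (normr_ge0 _)).
    by move=> p; rewrite mul0r mulr0 normr0.
  have [->|h2] := eqVneq (dens r q2) 0.
    rewrite (rint_eq _ (g := fun=> 0)) ?rint0; first exact: (mulr_ge0 CJ0 (normr_ge0 _)).
    by move=> p; rewrite !mulr0 normr0.
  have [I L] := JK_itg (dens_supp h1) (dens_supp h2).
  rewrite (rint_eq _ (g := fun p => `|dens l q1 * dens r q2| * `|up p * JK p q1 q2|)).
    rewrite rintZ; last exact: itg_norm.
    by rewrite mulrC ler_wpM2r.
  by move=> p; rewrite normrM mulrC.
Qed.

Lemma dens_good t : measurable_fun setT (dens t) /\ itg (mtree t) (dens t).
Proof.
elim: t => [b|l [ml Il] r [mr Ir]] /=.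
  have m : measurable_fun setT (fun q : pt => (0 <= (q.2 : R))%R%:R : R) by msr.
  split => //; apply: (proj1 (itg_ub (C := 1) m _)).
  rewrite integral_dirac//; last by apply/measurable_EFinP; exact: mfnorm.
  by rewrite diracT mul1e lee_fin /= lexx normr1.
have I := dens_node_itg ml mr Il Ir; split; last exact: (fub_itg1 I).
exact: (mrint1 _ (itg_meas I)).
Qed.

Lemma mdens t : measurable_fun setT (dens t). Proof. exact: (dens_good t).1. Qed.
Lemma dens_itg t : itg (mtree t) (dens t). Proof. exact: (dens_good t).2. Qed.

Definition ndens t : R := \int[mtree t]_q `|dens t q|.

Lemma ndens_ge0 t : 0 <= ndens t. Proof. exact: rint_ge0. Qed.

(** The coefficients of dx and dy in the average of the angle form over the density of the tree. *)
Definition aT t (p : pt) : R := \int[mtree t]_q (aK p q * dens t q).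
Definition bT t (p : pt) : R := \int[mtree t]_q (bK p q * dens t q).

Lemma maT t : measurable_fun setT (aT t).
Proof.
apply: (@mrint1 _ _ _ _ _ (mtree t) (fun z => aK z.1 z.2 * dens t z.2)).
by apply: mfM; [apply: maK; msr|apply: (measurableT_comp (mdens t)); msr].
Qed.

Lemma mbT t : measurable_fun setT (bT t).
Proof.
apply: (@mrint1 _ _ _ _ _ (mtree t) (fun z => bK z.1 z.2 * dens t z.2)).
by apply: mfM; [apply: mbK; msr|apply: (measurableT_comp (mdens t)); msr].
Qed.

(* The bound for the kernel on lines gives one for its average by Tonelli. *)
Lemma line_itg (k : measurableTypeR R -> pt -> R) t (C : R) : 0 <= C ->
  measurable_fun setT (fun z : measurableTypeR R * pt => k z.1 z.2) ->
  (forall q, itg mu (k ^~ q) /\ \int[mu]_x `|k x q| <= C) ->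
  itg (sprod mu (mtree t)) (fun z => k z.1 z.2 * dens t z.2) /\
  \int[mu]_x `|\int[mtree t]_q (k x q * dens t q)| <= C * ndens t.
Proof.
move=> C0 mk Hk.
have mF : measurable_fun setT (fun z : measurableTypeR R * pt => k z.1 z.2 * dens t z.2).
  by apply: mfM => //; apply: (measurableT_comp (mdens t)); msr.
have bnd q : \int[mu]_x `|k x q * dens t q| <= C * `|dens t q|.
  rewrite (rint_eq _ (g := fun x => `|dens t q| * `|k x q|)); last first.
    by move=> x; rewrite normrM mulrC.
  rewrite rintZ; last by apply: itg_norm; case: (Hk q).
  by rewrite mulrC ler_wpM2r//; case: (Hk q).
have I : itg (sprod mu (mtree t)) (fun z => k z.1 z.2 * dens t z.2).
  apply: (@ton2 _ _ _ _ _ _ _ _ (fun q => C * `|dens t q|)) => //.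
  - by apply: itgZ; apply: itg_norm; exact: dens_itg.
  - move=> q /=; have [I _] := Hk q.
    by apply: itg_eq (itgZ (dens t q) I) => x; rewrite mulrC.
split => //.
apply: (@le_trans _ _ (\int[mu]_x \int[mtree t]_q `|k x q * dens t q|)).
  apply: rint_le_ae; [exact/itg_norm/(fub_itg1 I)|exact: (fub_itg1 (itg_norm I))|].
  by apply: filterS (fub_ae1 I) => x Ix; exact: rint_norm.
rewrite (fubR (itg_norm I)) /= /ndens -rintZ; last exact/itg_norm/dens_itg.
apply: rint_le => //; first exact: (fub_itg2 (itg_norm I)).
exact/itgZ/itg_norm/dens_itg.
Qed.

Lemma twopi_ge0 : 0 <= 2 * pi :> R. Proof. by rewrite mulr_ge0// pi_ge0. Qed.

Lemma aT_line t (h : R) :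
  itg (sprod mu (mtree t)) (fun z => aK (z.1, h) z.2 * dens t z.2) /\
  \int[mu]_x `|aT t (x, h)| <= 2 * pi * ndens t.
Proof.
apply: (line_itg t twopi_ge0); first by apply: maK; msr.
by move=> q; exact: aK_itg.
Qed.

Lemma bT_line t (x : R) :
  itg (sprod mu (mtree t)) (fun z => bK (x, z.1) z.2 * dens t z.2) /\
  \int[mu]_h `|bT t (x, h)| <= 2 * pi * ndens t.
Proof.
apply: (line_itg t twopi_ge0); first by apply: mbK; msr.
by move=> q; exact: bK_itg.
Qed.

Lemma aT_itg t (h : R) : itg mu (fun x => aT t (x, h)).
Proof. exact: (fub_itg1 (aT_line t h).1). Qed.

Lemma bT_itg t (x : R) : itg mu (fun h => bT t (x, h)).
Proof. exact: (fub_itg1 (bT_line t x).1). Qed.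

(** The kernel itself is integrable along lines only, uniformly in the source. A positive integrable
    weight in the transverse coordinate makes it integrable over the plane; Fubini then provides
    almost every slice, and the weight is divided out. *)
Lemma kernel_dens_ae (k : pt -> pt -> R) (kap : pt -> R) (C : R) t :
  measurable_fun setT (fun z : pt * pt => k z.1 z.2) -> measurable_fun setT kap ->
  (forall p, 0 < kap p) ->
  (forall q, itg mu2 (fun p => kap p * k p q) /\ \int[mu2]_p `|kap p * k p q| <= C) ->
  {ae mu2, forall p, itg (mtree t) (fun q => k p q * dens t q)}.
Proof.
move=> mk mkap kap0 Hk.
have I : itg (sprod mu2 (mtree t)) (fun z => kap z.1 * (k z.1 z.2 * dens t z.2)).
  apply: (@ton2 _ _ _ _ _ _ _ _ (fun q => C * `|dens t q|)).
  - apply: mfM; first by apply: (measurableT_comp mkap); msr.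
    by apply: mfM => //; apply: (measurableT_comp (mdens t)); msr.
  - by apply: itgZ; apply: itg_norm; exact: dens_itg.
  - by move=> q /=; apply: itg_eq (itgZ (dens t q) (Hk q).1) => p; ring.
  - move=> q; rewrite (rint_eq _ (g := fun p => `|dens t q| * `|kap p * k p q|)); last first.
      by move=> p; rewrite mulrA normrM mulrC.
    rewrite rintZ; last exact/itg_norm/(Hk q).1.
    by rewrite mulrC ler_wpM2r//; exact: (Hk q).2.
apply: filterS (fub_ae1 I) => p Ip.
apply: itg_eq (itgZ (kap p)^-1 Ip) => q /=.
by rewrite mulKf// gt_eqF.
Qed.

Let kap (h : R) : R := `|1| / ((h - 0) ^+ 2 + 1 ^+ 2).

Let kap_gt0 h : 0 < kap h.
Proof. by rewrite /kap divr_gt0 ?normr1// expr1n ltr_wpDl// sqr_ge0. Qed.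

Let kap_itg : itg mu kap.
Proof. by apply: itg_cauchy; rewrite oner_eq0. Qed.

Let kap_mul (f : measurableTypeR R -> measurableTypeR R -> R) (C : R) :
  measurable_fun setT (fun z : pt => f z.1 z.2) ->
  (forall y, itg mu (f ^~ y) /\ \int[mu]_x `|f x y| <= C) ->
  itg mu2 (fun z => kap z.2 * f z.1 z.2) /\
  \int[mu2]_z `|kap z.2 * f z.1 z.2| <= C * \int[mu]_h kap h.
Proof.
move=> mf Hf.
have bnd y : \int[mu]_x `|kap y * f x y| <= C * kap y.
  rewrite (rint_eq _ (g := fun x => kap y * `|f x y|)); last first.
    by move=> x; rewrite normrM gtr0_norm.
  rewrite rintZ; last exact/itg_norm/(Hf y).1.
  by rewrite mulrC ler_wpM2r ?(ltW (kap_gt0 y))//; exact: (Hf y).2.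
have I : itg mu2 (fun z => kap z.2 * f z.1 z.2).
  apply: (@ton2 _ _ _ _ _ _ _ _ (fun y : measurableTypeR R => C * kap y)) => //.
  - by apply: mfM => //; apply: (measurableT_comp (itg_meas kap_itg)); msr.
  - exact: itgZ.
  - by move=> y; exact: (itgZ (kap y) (Hf y).1).
split => //; rewrite (fub2 (itg_norm I)) -rintZ//.
by apply: rint_le => //; [exact: (fub_itg2 (itg_norm I))|exact: itgZ].
Qed.

Let kap_mul' (f : measurableTypeR R -> measurableTypeR R -> R) (C : R) :
  measurable_fun setT (fun z : pt => f z.1 z.2) ->
  (forall x, itg mu (f x) /\ \int[mu]_y `|f x y| <= C) ->
  itg mu2 (fun z => kap z.1 * f z.1 z.2) /\
  \int[mu2]_z `|kap z.1 * f z.1 z.2| <= C * \int[mu]_h kap h.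
Proof.
move=> mf Hf.
have bnd x : \int[mu]_y `|kap x * f x y| <= C * kap x.
  rewrite (rint_eq _ (g := fun y => kap x * `|f x y|)); last first.
    by move=> y; rewrite normrM gtr0_norm.
  rewrite rintZ; last exact/itg_norm/(Hf x).1.
  by rewrite mulrC ler_wpM2r ?(ltW (kap_gt0 x))//; exact: (Hf x).2.
have I : itg mu2 (fun z => kap z.1 * f z.1 z.2).
  apply: (@ton1 _ _ _ _ _ _ _ _ (fun y : measurableTypeR R => C * kap y)) => //.
  - by apply: mfM => //; apply: (measurableT_comp (itg_meas kap_itg)); msr.
  - exact: itgZ.
  - by move=> x; exact: (itgZ (kap x) (Hf x).1).
split => //; rewrite (fub1 (itg_norm I)) -rintZ//.
by apply: rint_le => //; [exact: (fub_itg1 (itg_norm I))|exact: itgZ].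
Qed.

Lemma aK_dens_ae t : {ae mu2, forall p, itg (mtree t) (fun q => aK p q * dens t q)}.
Proof.
apply: (@kernel_dens_ae _ (fun p => kap p.2)); [by apply: maK; msr| |by []|].
  by apply: (measurableT_comp (itg_meas kap_itg)); msr.
move=> q; have [I L] := @kap_mul (fun x h => aK (x, h) q) (2 * pi)
  (maK (f := fun z : pt => (z.1, z.2)) (g := fun=> q) ltac:(msr) ltac:(msr)) (fun h => @aK_itg R h q).
by split; [exact: I|exact: L].
Qed.

Lemma bK_dens_ae t : {ae mu2, forall p, itg (mtree t) (fun q => bK p q * dens t q)}.
Proof.
apply: (@kernel_dens_ae _ (fun p => kap p.1)); [by apply: mbK; msr| |by []|].
  by apply: (measurableT_comp (itg_meas kap_itg)); msr.
move=> q; have [I L] := @kap_mul' (fun x h => bK (x, h) q) (2 * pi)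
  (mbK (f := fun z : pt => (z.1, z.2)) (g := fun=> q) ltac:(msr) ltac:(msr)) (fun h => @bK_itg R h q).
by split; [exact: I|exact: L].
Qed.

(** The Jacobian is bilinear in the two angle forms, so the double integral separates into the wedge
    product of the one-forms of l and r. Separation needs both averages to converge, hence the
    exceptional null set. *)
Lemma dens_nodeE l r : {ae mu2, forall p,
  dens (node l r) p = up p * (aT l p * bT r p - bT l p * aT r p)}.
Proof.
apply: filterS (filterI (filterI (aK_dens_ae l) (bK_dens_ae l))
                        (filterI (aK_dens_ae r) (bK_dens_ae r))).
move=> p [[al bl] [ar br]] /=.
have I1 := itg_prod al br; have I2 := itg_prod bl ar.
rewrite (rint_eq _ (g := fun z => up p * ((aK p z.1 * dens l z.1) * (bK p z.2 * dens r z.2)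
   - (bK p z.1 * dens l z.1) * (aK p z.2 * dens r z.2)))); last first.
  by move=> z; rewrite /JK; ring.
rewrite rintZ; last exact: itgB.
rewrite rintB//; congr (_ * (_ - _)).
  rewrite fub1//=; under eq_Rintegral do rewrite rintZ// mulrC.
  by rewrite rintZ// mulrC.
rewrite fub1//=; under eq_Rintegral do rewrite rintZ// mulrC.
by rewrite rintZ// mulrC.
Qed.

Definition mass t : R := \int[mtree t]_q dens t q.

End Sources.

(** * Primitives, the product rule and the fundamental theorem on the line *)

Section LineCalculus.
Variable R : realType.
Local Notation mu := (@lebesgue_measure R).
Local Notation rT := (measurableTypeR R).

Definition ind (a b t : R) : R := ((a < t)%R && (t <= b)%R)%:R.
Definition lft (x t : R) : R := (t <= x)%R%:R.

Lemma mind d (X : measurableType d) (a b f : X -> R) : measurable_fun setT a ->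
  measurable_fun setT b -> measurable_fun setT f ->
  measurable_fun setT (fun x => ind (a x) (b x) (f x)).
Proof. by move=> ma mb mf; rewrite /ind; msr. Qed.

Lemma mlft d (X : measurableType d) (a f : X -> R) : measurable_fun setT a ->
  measurable_fun setT f -> measurable_fun setT (fun x => lft (a x) (f x)).
Proof. by move=> ma mf; rewrite /lft; msr. Qed.

Lemma norm_bool_le1 (b : bool) : `|b%:R : R| <= 1.
Proof. by case: b; rewrite ?normr1 ?normr0. Qed.

Lemma itg_ind a b (f : rT -> R) : itg mu f -> itg mu (fun t => ind a b t * f t).
Proof.
move=> If; apply: (@itg_mulb _ _ _ _ _ _ 1) => //; first by apply: mind; msr.
by move=> x; exact: norm_bool_le1.
Qed.

Lemma itg_lft x (f : rT -> R) : itg mu f -> itg mu (fun t => lft x t * f t).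
Proof.
move=> If; apply: (@itg_mulb _ _ _ _ _ _ 1) => //; first by apply: mlft; msr.
by move=> t; exact: norm_bool_le1.
Qed.

Lemma lft_ind a b t : a <= b -> lft b t - lft a t = ind a b t.
Proof.
move=> ab; rewrite /lft /ind; case: (leP t a) => ta /=.
  by rewrite (le_trans ta ab) subrr.
by rewrite subr0.
Qed.

Lemma ae_neq (c : R) : {ae mu, forall t : rT, t != c}.
Proof.
exists [set c]; split => //; first exact: lebesgue_measure_set1.
by move=> t /= /negP; rewrite negbK => /eqP ->.
Qed.

(** The quadrant of pairs below x is split into two triangles along the diagonal, and each triangle
    is integrated with the larger variable outermost. *)
Lemma prim_mul (v1 v2 : rT -> R) (x : R) : itg mu v1 -> itg mu v2 ->
  (\int[mu]_t (lft x t * v1 t)) * (\int[mu]_t (lft x t * v2 t)) =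
  \int[mu]_r (lft x r * (v1 r * \int[mu]_s (lft r s * v2 s)
                        + (\int[mu]_s (lft r s * v1 s)) * v2 r)).
Proof.
move=> I1 I2; have J1 := itg_lft x I1; have J2 := itg_lft x I2.
have Ip := itg_prod J1 J2.
have mA : measurable_fun setT (fun z : rT * rT => lft z.1 z.2) by apply: mlft; msr.
have IA : itg (sprod mu mu) (fun z => lft z.1 z.2 * ((lft x z.1 * v1 z.1) * (lft x z.2 * v2 z.2))).
  by apply: (@itg_mulb _ _ _ _ _ _ 1) => // z; exact: norm_bool_le1.
have mB : measurable_fun setT (fun z : rT * rT => lft z.2 z.1).
  by apply: mlft; msr.
have IB : itg (sprod mu mu) (fun z => lft z.2 z.1 * ((lft x z.1 * v1 z.1) * (lft x z.2 * v2 z.2))).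
  by apply: (@itg_mulb _ _ _ _ _ _ 1) => // z; exact: norm_bool_le1.
have -> : (\int[mu]_t (lft x t * v1 t)) * (\int[mu]_t (lft x t * v2 t)) =
  \int[sprod mu mu]_z ((lft x z.1 * v1 z.1) * (lft x z.2 * v2 z.2)).
  rewrite fub1//=; under [RHS]eq_Rintegral do rewrite rintZ// mulrC.
  by rewrite rintZ// mulrC.
have -> : \int[sprod mu mu]_z ((lft x z.1 * v1 z.1) * (lft x z.2 * v2 z.2)) =
  \int[sprod mu mu]_z (lft z.1 z.2 * ((lft x z.1 * v1 z.1) * (lft x z.2 * v2 z.2)) +
   lft z.2 z.1 * ((lft x z.1 * v1 z.1) * (lft x z.2 * v2 z.2))).
  apply: rint_ae; [exact: itg_meas Ip|by apply: mfD; [exact: (itg_meas IA)|exact: (itg_meas IB)]|].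
  (* The diagonal is a null set because each of its slices is a point. *)
  have : {ae sprod mu mu, forall z : rT * rT, z.1 != z.2}.
    pose N (z : rT * rT) : R := (z.1 == z.2)%:R.
    have mN : measurable_fun setT N by rewrite /N; msr.
    have IN : itg (sprod mu mu) N /\ \int[sprod mu mu]_z `|N z| = 0.
      have z0 (y : rT) : (\int[mu]_x0 `|N (x0, y)|%:E)%E = 0%E.
        rewrite (ae_eq_integral (cst 0%E)) ?integral0//.
          by apply/measurable_EFinP; apply: mfnorm; exact: (mslice2 y mN).
        by apply: filterS (ae_neq y) => t ty _ /=; rewrite /N /= (negbTE ty) normr0.
      have IN : itg (sprod mu mu) N.
        apply: (@ton2 _ _ _ _ _ _ _ _ (fun=> 0)) => //; first exact: itg0.
          move=> y; apply: (proj1 (itg_ub (C := 0) (mslice2 y mN) _)).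
          by rewrite z0.
        by move=> y; rewrite /Rintegral z0.
      split => //; rewrite (fub2 (itg_norm IN)).
      by rewrite -[RHS](rint0 mu); apply: rint_eq => y; rewrite /Rintegral z0.
    apply: filterS (rint_norm0 IN.1 IN.2) => z; rewrite /N.
    by case: (_ =P _) => // _ /eqP; rewrite oner_eq0.
  apply: filterS => -[r s] /= rs; rewrite -mulrDl (_ : lft r s + lft s r = 1) ?mul1r//.
  by rewrite /lft; case: (ltgtP r s) rs => // _ _; rewrite ?addr0 ?add0r.
rewrite rintD// fub1// (fub2 IB) /= -rintD; last 2 first.
- exact: (fub_itg1 IA).
- exact: (fub_itg2 IB).
apply: rint_eq => r; rewrite mulrDr; congr (_ + _).
  rewrite mulrA -rintZ; last exact: itg_lft.
  apply: rint_eq => s; rewrite /lft.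
  case: (leP r x) => rx; last by rewrite !mul0r mulr0.
  case: (leP s r) => sr; last by rewrite !mul0r mulr0.
  by rewrite (le_trans sr rx) !mul1r.
rewrite [X in _ = _ * X]mulrC [RHS]mulrA -rintZ; last exact: itg_lft.
apply: rint_eq => s; rewrite /lft.
case: (leP r x) => rx; last by rewrite !(mul0r, mulr0).
case: (leP s r) => sr; last by rewrite !(mul0r, mulr0).
by rewrite (le_trans sr rx) !mul1r mulrC.
Qed.

(** The product rule for absolutely continuous functions, the regularity that transported
    coefficients have along lines. The bound on [G2] is restricted to the interval because [G2] will
    be an angle derivative, which is singular at its source. *)
Lemma ac_prod_itv (a b : R) (v1 v2 G1 G2 : rT -> R) : a <= b ->
  itg mu (fun t => ind a b t * v1 t) -> itg mu (fun t => ind a b t * v2 t) ->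
  measurable_fun setT G1 -> measurable_fun setT G2 ->
  (exists C, forall t, `|G1 t| <= C) -> (exists C, forall t, `|G2 t * ind a b t| <= C) ->
  (forall r, a <= r -> r <= b -> G1 r = G1 a + \int[mu]_t (ind a r t * v1 t)) ->
  (forall r, a <= r -> r <= b -> G2 r = G2 a + \int[mu]_t (ind a r t * v2 t)) ->
  G1 b * G2 b - G1 a * G2 a = \int[mu]_r (ind a b r * (v1 r * G2 r + G1 r * v2 r)).
Proof.
move=> ab I1 I2 mG1 mG2 [C1 B1] [C2 B2] H1 H2.
have E (v : rT -> R) r : a <= r -> r <= b ->
    \int[mu]_t (ind a r t * v t) = \int[mu]_t (lft r t * (ind a b t * v t)).
  move=> ar rb; apply: rint_eq => t; rewrite /ind /lft mulrA; congr (_ * _).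
  by case: (leP t r) => tr; rewrite ?andbF ?mul0r// (le_trans tr rb) mul1r.
have P := prim_mul b I1 I2.
rewrite -(E _ b ab (lexx _)) -(E _ b ab (lexx _)) in P.
have F1 : \int[mu]_t (ind a b t * v1 t) = G1 b - G1 a by rewrite (H1 b ab (lexx _)) addrAC subrr add0r.
have F2 : \int[mu]_t (ind a b t * v2 t) = G2 b - G2 a by rewrite (H2 b ab (lexx _)) addrAC subrr add0r.
rewrite F1 F2 in P.
have Ia : itg mu (fun r => G1 r * (ind a b r * v2 r)) by apply: (@itg_mulb _ _ _ _ _ _ C1).
have Ib : itg mu (fun r => (G2 r * ind a b r) * (ind a b r * v1 r)).
  by apply: (@itg_mulb _ _ _ _ _ _ C2) => //; apply: mfM => //; apply: mind; msr.
have ii r : ind a b r * ind a b r = ind a b r by rewrite /ind; case: (_ && _); rewrite ?mul1r ?mul0r.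
have -> : \int[mu]_r (ind a b r * (v1 r * G2 r + G1 r * v2 r)) =
  \int[mu]_r ((G2 r * ind a b r) * (ind a b r * v1 r) + G1 r * (ind a b r * v2 r)).
  apply: rint_eq => r; rewrite (_ : G2 r * ind a b r * (ind a b r * v1 r) = (ind a b r * ind a b r) * (G2 r * v1 r)); [rewrite ii; ring|ring].
have -> : G1 b * G2 b - G1 a * G2 a = (G1 b - G1 a) * (G2 b - G2 a) +
   (G2 a * (G1 b - G1 a) + G1 a * (G2 b - G2 a)) by ring.
rewrite P -F1 -F2 -!rintZ// -rintD; [|exact: itgZ|exact: itgZ].
have IL : itg mu (fun r => (G2 r * ind a b r) * (ind a b r * v1 r) + G1 r * (ind a b r * v2 r)
    - (G2 a * (ind a b r * v1 r) + G1 a * (ind a b r * v2 r))).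
  by apply: itgB; apply: itgD => //; exact: itgZ.
rewrite (rint_eq _ (g := fun r => (G2 r * ind a b r) * (ind a b r * v1 r) + G1 r * (ind a b r * v2 r)
    - (G2 a * (ind a b r * v1 r) + G1 a * (ind a b r * v2 r)))).
  rewrite rintB; [by rewrite subrK|exact: itgD|].
  by apply: itgD; exact: itgZ.
move=> r; rewrite /= {1}/lft; rewrite /ind; case: (boolP (_ && _)) => [/andP[ar rb]|nr]; last first.
  by rewrite !(mul0r, mulr0, addr0, subr0).
have K1 := H1 r (ltW ar) rb; have K2 := H2 r (ltW ar) rb.
rewrite rb !mul1r (E v1 r (ltW ar) rb) /ind in K1 *; rewrite (E v2 r (ltW ar) rb) /ind in K2.
rewrite K1 K2; set X := \int[mu]_t _; set Y := \int[mu]_t _.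
have -> : true%:R = 1 :> R by [].
ring.
Qed.

Lemma ftc_ind (f F : R -> R) (a b : R) : a <= b ->
  (forall t, a <= t <= b -> is_derive t 1 F (f t)) ->
  (forall t, a <= t <= b -> {for t, continuous f}) ->
  \int[mu]_t (ind a b t * f t) = F b - F a.
Proof.
move=> ab dF cf.
have E : \int[mu]_t (ind a b t * f t) = \int[mu]_(t in `]a, b]) f t.
  rewrite [RHS]Rintegral_mkcond; apply: rint_eq => t; rewrite /ind patchE.
  by rewrite mem_setE /= in_itv/=; case: (_ && _); rewrite ?mul1r ?mul0r.
rewrite E; move: ab; rewrite le_eqVlt => /predU1P[->|ab].
  by rewrite set_itvoc0 Rintegral_set0 subrr.
have cw : {within `[a, b], continuous f}.
  by apply: continuous_in_subspaceT => t /set_mem/=; rewrite in_itv/=; exact: cf.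
have If : mu.-integrable `[a, b] (EFin \o f).
  by apply: continuous_compact_integrable => //; exact: segment_compact.
rewrite Rintegral_itv_obnd_cbnd; last first.
  by apply: integrableS If => //; apply: subset_itv_oc_cc.
rewrite /Rintegral (@continuous_FTC2 _ _ F) //.
- split.
  + by move=> t; rewrite in_itv/= => /andP[h1 h2]; have [] := dF t _; rewrite ?ltW.
  + apply: cvg_at_right_filter; apply: differentiable_continuous; apply/derivable1_diffP.
    by have [] := dF a _; rewrite ?lexx ?ltW.
  + apply: cvg_at_left_filter; apply: differentiable_continuous; apply/derivable1_diffP.
    by have [] := dF b _; rewrite ?lexx ?ltW.
- by move=> t; rewrite in_itv/= => /andP[h1 h2]; rewrite derive1E; have [] := dF t _; rewrite ?ltW.
Qed.

End LineCalculus.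

(** * Closedness of the angle form and concentration of the Cauchy kernel *)

Section KernelCalculus.
Variable R : realType.
Local Notation mu := (@lebesgue_measure R).
Local Notation rT := (measurableTypeR R).
Local Notation pt := (pt R).

(** The common value of the derivative of [aK] in the height and of [bK] in the abscissa: their
    equality is the closedness of the angle form in p away from q. *)
Definition kK (p q : pt) : R :=
  ((p.2 - q.2) ^+ 2 - (p.1 - q.1) ^+ 2) / rsq p q ^+ 2
  + ((p.2 + q.2) ^+ 2 - (p.1 - q.1) ^+ 2) / rsqN p q ^+ 2.

Lemma mkK d (X : measurableType d) (f g : X -> pt) : measurable_fun setT f ->
  measurable_fun setT g -> measurable_fun setT (fun x => kK (f x) (g x)).
Proof. by move=> mf mg; rewrite /kK /rsq /rsqN; msr. Qed.

Lemma derive_affine (n0 n1 t : R) : is_derive t 1 (fun s => n0 + n1 * s) n1.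
Proof.
have d : is_derive t 1 (cst n0 + n1 \*: (@id R)) (0 + n1 *: (1 : R)).
  by apply: is_deriveD; apply: is_deriveZ.
by move: d; rewrite add0r /GRing.scale/= mulr1.
Qed.

Lemma derive_frac (n0 n1 e0 e1 k t : R) : k + (e0 + e1 * t) ^+ 2 != 0 ->
  is_derive t 1 (fun s => (n0 + n1 * s) / (k + (e0 + e1 * s) ^+ 2))
   ((n1 * (k + (e0 + e1 * t) ^+ 2) - (n0 + n1 * t) * (2 * e1 * (e0 + e1 * t)))
    / (k + (e0 + e1 * t) ^+ 2) ^+ 2).
Proof.
move=> D0; have dN := derive_affine n0 n1 t; have dE := derive_affine e0 e1 t.
pose N s := n0 + n1 * s; pose E s := e0 + e1 * s; pose D := cst k + E * E.
have dD : is_derive t 1 D (0 + (E t *: e1 + E t *: e1)).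
  by apply: is_deriveD; apply: is_deriveM.
have DE s : D s = k + E s ^+ 2 by rewrite /D /= expr2.
have Dt0 : D t != 0 by rewrite DE.
have dV := is_deriveV Dt0 dD.
have := is_deriveM dN dV.
rewrite (_ : (fun s => _ ) * _ = (fun s => (n0 + n1 * s) / (k + (e0 + e1 * s) ^+ 2))); last first.
  by apply/funext => s; rewrite /= -DE.
move=> H; apply: (is_derive_eq H); rewrite DE /GRing.scale/= /E.
by field.
Qed.

Lemma cont_frac (e0 k t : R) : k + (e0 + t) ^+ 2 != 0 ->
  {for t, continuous (fun s => ((e0 + s) ^+ 2 - k) / (k + (e0 + s) ^+ 2) ^+ 2)}.
Proof.
move=> D0.
have c1 : (e0 + s) ^+ 2 @[s --> t] --> (e0 + t) ^+ 2.
  rewrite (_ : (fun s => (e0 + s) ^+ 2) = (fun s => (e0 + s) * (e0 + s))).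
    by apply: cvgM; (apply: cvgD; [exact: cvg_cst|exact: cvg_id]).
  by apply/funext => s; rewrite expr2.
apply: cvgM; first by apply: cvgB => //; exact: cvg_cst.
apply: cvgV; first by rewrite expf_neq0.
rewrite (_ : (fun s => (k + (e0 + s) ^+ 2) ^+ 2) = (fun s => (k + (e0 + s) ^+ 2) * (k + (e0 + s) ^+ 2))).
  by rewrite expr2; apply: cvgM; (apply: cvgD; [exact: cvg_cst|]).
by apply/funext => s; rewrite expr2.
Qed.

Lemma ftc_aK (x h1 h2 : R) (q : pt) : h1 <= h2 ->
  (forall h, h1 <= h <= h2 -> rsq (x, h) q != 0 /\ rsqN (x, h) q != 0) ->
  \int[mu]_h (ind h1 h2 h * kK (x, h) q) = aK (x, h2) q - aK (x, h1) q.
Proof.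
move=> h12 H.
pose k : R := (x - q.1) ^+ 2.
apply: (@ftc_ind _ (fun h => kK (x, h) q) (fun h => aK (x, h) q)) => // t tb.
- have [r0 r0'] := H t tb.
  have r1 : k + (- q.2 + 1 * t) ^+ 2 != 0 by rewrite (_ : _ + _ = rsq (x, t) q)// /k /rsq /=; ring.
  have r2 : k + (q.2 + 1 * t) ^+ 2 != 0 by rewrite (_ : _ + _ = rsqN (x, t) q)// /k /rsqN /=; ring.
  have := is_deriveD (derive_frac q.2 (-1) r1) (derive_frac (- q.2) (-1) r2).
  rewrite (_ : (fun s => _) + _ = (fun h => aK (x, h) q)); last first.
    apply/funext => s; rewrite -[LHS]/((q.2 + -1 * s) / (k + (- q.2 + 1 * s) ^+ 2) +
      (- q.2 + -1 * s) / (k + (q.2 + 1 * s) ^+ 2)) /aK /rsq /rsqN /= /k.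
    rewrite (_ : - q.2 + 1 * s = s - q.2 :> R); last by ring.
    rewrite (_ : q.2 + 1 * s = s + q.2 :> R); last by ring.
    by ring.
  move=> D; apply: (is_derive_eq D); rewrite /kK /rsq /rsqN /= /k.
  rewrite (_ : - q.2 + 1 * t = t - q.2 :> R); last by ring.
  rewrite (_ : q.2 + 1 * t = t + q.2 :> R); last by ring.
  by congr (_ / _ + _ / _); ring.
- have [r0 r0'] := H t tb.
  have r1 : k + (- q.2 + t) ^+ 2 != 0 by rewrite (_ : _ + _ = rsq (x, t) q)// /k /rsq /=; ring.
  have r2 : k + (q.2 + t) ^+ 2 != 0 by rewrite (_ : _ + _ = rsqN (x, t) q)// /k /rsqN /=; ring.
  rewrite (_ : (fun h => kK (x, h) q) = (fun s : R => ((- q.2 + s) ^+ 2 - k) / (k + (- q.2 + s) ^+ 2) ^+ 2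
     + ((q.2 + s) ^+ 2 - k) / (k + (q.2 + s) ^+ 2) ^+ 2)).
    by apply: cvgD; exact: cont_frac.
  by apply/funext => s; rewrite /kK /rsq /rsqN /= /k (addrC s) (addrC s q.2).
Qed.

Lemma ftc_bK (h x1 x2 : R) (q : pt) : x1 <= x2 ->
  (forall x, x1 <= x <= x2 -> rsq (x, h) q != 0 /\ rsqN (x, h) q != 0) ->
  \int[mu]_x (ind x1 x2 x * kK (x, h) q) = bK (x2, h) q - bK (x1, h) q.
Proof.
move=> h12 H.
pose k : R := (h - q.2) ^+ 2; pose l : R := (h + q.2) ^+ 2.
apply: (@ftc_ind _ (fun x => kK (x, h) q) (fun x => bK (x, h) q)) => // t tb.
- have [r0 r0'] := H t tb.
  have r1 : k + (- q.1 + 1 * t) ^+ 2 != 0 by rewrite (_ : _ + _ = rsq (t, h) q)// /k /rsq /=; ring.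
  have r2 : l + (- q.1 + 1 * t) ^+ 2 != 0 by rewrite (_ : _ + _ = rsqN (t, h) q)// /l /rsqN /=; ring.
  have := is_deriveD (derive_frac (- q.1) 1 r1) (derive_frac (- q.1) 1 r2).
  rewrite (_ : (fun s => _) + _ = (fun x => bK (x, h) q)); last first.
    apply/funext => s; rewrite -[LHS]/((- q.1 + 1 * s) / (k + (- q.1 + 1 * s) ^+ 2) +
      (- q.1 + 1 * s) / (l + (- q.1 + 1 * s) ^+ 2)) /bK /rsq /rsqN /= /k /l.
    rewrite (_ : - q.1 + 1 * s = s - q.1 :> R); last by ring.
    by rewrite (addrC (_ ^+ 2)) (addrC (_ ^+ 2) ((s - q.1) ^+ 2)).
  move=> D; apply: (is_derive_eq D); rewrite /kK /rsq /rsqN /= /k /l.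
  rewrite (_ : - q.1 + 1 * t = t - q.1 :> R); last by ring.
  by congr (_ / _ + _ / _); ring.
- have [r0 r0'] := H t tb.
  have r1 : k + (- q.1 + t) ^+ 2 != 0 by rewrite (_ : _ + _ = rsq (t, h) q)// /k /rsq /=; ring.
  have r2 : l + (- q.1 + t) ^+ 2 != 0 by rewrite (_ : _ + _ = rsqN (t, h) q)// /l /rsqN /=; ring.
  rewrite (_ : (fun x => kK (x, h) q) = (fun s : R => - (((- q.1 + s) ^+ 2 - k) / (k + (- q.1 + s) ^+ 2) ^+ 2)
     - ((- q.1 + s) ^+ 2 - l) / (l + (- q.1 + s) ^+ 2) ^+ 2)).
    by apply: cvgB; [apply: cvgN|]; exact: cont_frac.
  apply/funext => s; rewrite /kK /rsq /rsqN /= /k /l (addrC _ s).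
  move: ((s - q.1) ^+ 2) ((h - q.2) ^+ 2) ((h + q.2) ^+ 2) => A B C.
  by rewrite (addrC B A) (addrC C A); ring.
Qed.

Lemma frac_bound (z r dl : R) : 0 < dl -> dl ^+ 2 <= r -> z ^+ 2 <= r -> `|z / r| <= dl^-1.
Proof.
move=> d0 dr zr; have r0 : 0 < r by apply: lt_le_trans dr; rewrite exprn_gt0.
rewrite normrM normfV (gtr0_norm r0) ler_pdivrMr// mulrC ler_pdivlMr//.
rewrite -[leRHS](gtr0_norm r0) -[dl](gtr0_norm d0) -normrM -!sqrtr_sqr ler_sqrt ?sqr_ge0//.
by rewrite exprMn [leRHS]expr2 ler_pM ?sqr_ge0.
Qed.

Lemma K_bound (p q : pt) (dl : R) : 0 < dl -> dl ^+ 2 <= rsq p q -> 0 < p.2 -> 0 <= q.2 ->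
  [/\ `|aK p q| <= 2 / dl, `|bK p q| <= 2 / dl & `|kK p q| <= 2 / dl ^+ 2].
Proof.
move=> d0 dr p0 q0.
have rN : rsq p q <= rsqN p q.
  rewrite /rsq /rsqN lerD2l; have : 0 <= (p.2 : R) * (q.2 : R) by rewrite mulr_ge0// ltW.
  by nra.
have dr' := le_trans dr rN.
have r0 : 0 < rsq p q by apply: lt_le_trans dr; rewrite exprn_gt0.
have r0' : 0 < rsqN p q by apply: lt_le_trans dr'; rewrite exprn_gt0.
have two : 2 / dl = dl^-1 + dl^-1 by ring.
have sq1 (z w : R) : z ^+ 2 <= z ^+ 2 + w ^+ 2 by rewrite lerDl sqr_ge0.
have sq2 (z w : R) : w ^+ 2 <= z ^+ 2 + w ^+ 2 by rewrite lerDr sqr_ge0.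
split.
- rewrite /aK two; apply: (le_trans (ler_normB _ _)); apply: lerD; apply: frac_bound => //.
    by rewrite -sqrrN opprB /rsq sq2.
  by rewrite addrC /rsqN sq2.
- rewrite /bK two; apply: (le_trans (ler_normD _ _)); apply: lerD; apply: frac_bound => //.
    by rewrite /rsq sq1.
  by rewrite /rsqN sq1.
have kb (z w r : R) : z ^+ 2 + w ^+ 2 = r -> dl ^+ 2 <= r ->
    `|(w ^+ 2 - z ^+ 2) / r ^+ 2| <= (dl ^+ 2)^-1.
  move=> E dlr; have rr : 0 < r by apply: lt_le_trans dlr; rewrite exprn_gt0.
  rewrite normrM normfV [X in _ / X]ger0_norm ?sqr_ge0//.
  apply: (@le_trans _ _ (r / r ^+ 2)).
    rewrite ler_wpM2r ?invr_ge0 ?sqr_ge0// ler_norml -E.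
    by have := sqr_ge0 z; have := sqr_ge0 w; lra.
  rewrite expr2 invfM mulrA divff ?gt_eqF// mul1r lef_pV2 ?posrE//.
  by rewrite exprn_gt0.
rewrite /kK (_ : 2 / _ = (dl ^+ 2)^-1 + (dl ^+ 2)^-1); last by ring.
by apply: (le_trans (ler_normD _ _)); apply: lerD; apply: kb.
Qed.

(** Away from the centre the kernel carries a factor s in front of the profile of width 1, so its
    tail is small and integrable at the same time. *)
Lemma cau_far (s c h eta : R) : 0 < s -> 0 < eta -> eta <= `|h - c| ->
  cau s c h <= s * (1 + (eta ^+ 2)^-1) * cau 1 c h.
Proof.
move=> s0 e0 eh; rewrite /cau -mulrA ler_pM2l// mul1r expr1n.
have e2 : eta ^+ 2 <= (h - c) ^+ 2.
  by rewrite -[leRHS]real_normK ?num_real// !expr2 ler_pM// ltW.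
have e20 : 0 < eta ^+ 2 by rewrite exprn_gt0.
set z := (h - c) ^+ 2 in e2 *; have z0 : 0 < z := lt_le_trans e20 e2.
rewrite ler_pdivlMr ?ltr_wpDr// mulrC ler_pdivrMr ?ltr_pwDl// ?sqr_ge0//.
have h1 : z + 1 <= (1 + (eta ^+ 2)^-1) * z.
  by rewrite mulrDl mul1r lerD2l mulrC ler_pdivlMr// mul1r.
apply: (le_trans h1); rewrite ler_wpM2l ?addr_ge0 ?invr_ge0 ?ltW//.
by rewrite ltr_pwDr ?exprn_gt0.
Qed.

(* approximate identity: the Cauchy kernel concentrates at its centre *)
Lemma poisson_lim (Phi : nat -> rT -> R) (s : nat -> R) (C c l : R) :
  (forall n, measurable_fun setT (Phi n)) -> (forall n h, `|Phi n h| <= C) ->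
  (forall n, 0 < s n) -> s n @[n --> \oo] --> 0 ->
  (forall e : R, 0 < e -> exists2 eta : R, 0 < eta &
     \forall n \near \oo, forall h, `|h - c| < eta -> `|Phi n h - l| <= e) ->
  \int[mu]_h (Phi n h * cau (s n) c h) @[n --> \oo] --> pi * l.
Proof.
move=> mP bP s0 sl Hl.
have C0 : 0 <= C by apply: le_trans (bP 0%N 0).
have Ic n := (cau_itg (s n) c).1.
have cp (k h : R) : 0 < k -> 0 <= cau k c h.
  by move=> k0; rewrite /cau divr_ge0 ?ltW// ltr_wpDl ?sqr_ge0 ?exprn_gt0.
have E n : pi * l = \int[mu]_h (l * cau (s n) c h).
  rewrite rintZ// mulrC; congr (_ * _).
  have sn0 : s n != 0 by rewrite gt_eqF.
  by rewrite -(rint_cauchy c sn0); apply: rint_eq => h; rewrite gtr0_norm.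
have IP n : itg mu (fun h => Phi n h * cau (s n) c h) by apply: (@itg_mulb _ _ _ _ _ _ C).
apply/cvgrPdist_le => /= e e0; have pi0 := @pi_gt0 R.
have [|eta eta0 Hn] := Hl (e / (2 * pi)); first by rewrite divr_gt0// mulr_gt0.
(* [M] is the total of the tail estimate per unit of [s n]; adding 1 keeps it positive when that
   estimate vanishes. *)
pose M := (C + `|l|) * (1 + (eta ^+ 2)^-1) * pi + 1.
have M0 : 0 < M.
  by rewrite /M ltr_wpDl// mulr_ge0 ?(ltW pi0)// mulr_ge0 ?addr_ge0 ?invr_ge0 ?sqr_ge0.
have sM : \forall n \near \oo, s n <= e / (2 * M).
  have eM : 0 < e / (2 * M) by rewrite divr_gt0// mulr_gt0.
  move/cvgrPdist_le : sl => /(_ _ eM); apply: filterS => n.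
  by rewrite sub0r normrN gtr0_norm.
near=> n; rewrite (E n) -rintB; [|exact: itgZ|by []].
have I1 : itg mu (fun h => e / (2 * pi) * cau (s n) c h +
    (C + `|l|) * (s n * (1 + (eta ^+ 2)^-1)) * cau 1 c h).
  by apply: itgD; apply: itgZ => //; exact: (cau_itg 1 c).1.
apply: (@le_trans _ _ (\int[mu]_h (e / (2 * pi) * cau (s n) c h +
    (C + `|l|) * (s n * (1 + (eta ^+ 2)^-1)) * cau 1 c h))).
  apply: rint_bound => //; first by apply: itgB => //; exact: itgZ.
  move=> h; rewrite -mulrBl normrM (ger0_norm (cp _ h (s0 n))).
  have Q1 : 0 <= (C + `|l|) * (s n * (1 + (eta ^+ 2)^-1)) * cau 1 c h.
    by rewrite mulr_ge0 ?cp// mulr_ge0 ?addr_ge0// mulr_ge0 ?(ltW (s0 n))// addr_ge0// invr_ge0 sqr_ge0.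
  have Q2 : 0 <= e / (2 * pi) * cau (s n) c h.
    by rewrite mulr_ge0 ?cp// divr_ge0 ?mulr_ge0// ltW.
  have [he|he] := ltP `|h - c| eta.
    rewrite ler_wpDr// ler_wpM2r ?cp// distrC.
    by have := near (Hn) n; apply => //; near: n; exact: Hn.
  rewrite ler_wpDl// -mulrA; apply: ler_pM => //; first exact: cp.
    by apply: (le_trans (ler_normB _ _)); rewrite addrC lerD2r.
  exact: cau_far.
rewrite rintD; [|exact/itgZ|exact/itgZ/(cau_itg 1 c).1].
rewrite (rintZ _ (Ic n)) (rintZ _ (cau_itg 1 c).1).
have cE (k : R) : 0 < k -> \int[mu]_h cau k c h = pi.
  move=> k0; have kn : k != 0 by rewrite gt_eqF.
  by rewrite -(rint_cauchy c kn); apply: rint_eq => h; rewrite gtr0_norm.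
rewrite (cE _ (s0 n)) (cE 1 ltr01).
have dM (M' : R) : 0 < M' -> e / (2 * M') * M' = e / 2.
  by move=> M'0; rewrite invfM mulrA mulfVK// lt0r_neq0.
rewrite dM//.
rewrite [leRHS](splitr e) lerD2l.
have sn : s n <= e / (2 * M) by near: n; exact: sM.
apply: (@le_trans _ _ (s n * M)).
  rewrite (_ : _ * pi = s n * (M - 1)); last by rewrite /M; ring.
  by rewrite ler_wpM2l ?(ltW (s0 n))// lerBlDr lerDl.
apply: (le_trans (ler_wpM2r (ltW M0) sn)).
by rewrite dM.
Unshelve. all: by end_near. Qed.

End KernelCalculus.

(** * Stokes' formula on rectangles for a single source *)

Section Stokes.
Variable R : realType.
Local Notation mu := (@lebesgue_measure R).
Local Notation mu2 := (sprod mu mu).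
Local Notation rT := (measurableTypeR R).
Local Notation pt := (pt R).

Definition indR (x1 x2 h1 h2 : R) (p : pt) : R := ind x1 x2 p.1 * ind h1 h2 p.2.

Lemma mindR x1 x2 h1 h2 : measurable_fun setT (indR x1 x2 h1 h2).
Proof. by apply: mfM; apply: mind; msr. Qed.

Lemma ind_norm (a b t : R) : `|ind a b t| <= 1. Proof. exact: norm_bool_le1. Qed.

Lemma ind_ge0 (a b t : R) : 0 <= ind a b t. Proof. exact: ler0n. Qed.

Lemma indR_norm x1 x2 h1 h2 p : `|indR x1 x2 h1 h2 p| <= 1.
Proof. by rewrite normrM mulr_ile1// ind_norm. Qed.

Lemma ind_itg (a b : R) : itg mu (ind a b).
Proof.
have := @integrable_indic_itv R a b false false; apply: itg_eq => t.
by rewrite /ind indicE mem_setE /= in_itv.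
Qed.

Lemma indR_itg x1 x2 h1 h2 : itg mu2 (indR x1 x2 h1 h2).
Proof. exact: (itg_prod (ind_itg x1 x2) (ind_itg h1 h2)). Qed.

Lemma rectx_itg (f : pt -> R) C x1 x2 h1 h2 : measurable_fun setT f ->
  (forall h : R, itg mu (fun x => f (x, h)) /\ \int[mu]_x `|f (x, h)| <= C) ->
  itg mu2 (fun p => indR x1 x2 h1 h2 p * f p).
Proof.
move=> mf Hf; apply: (@ton2 _ _ _ _ _ _ _ _ (fun h : rT => C * ind h1 h2 h)).
- by apply: mfM => //; exact: mindR.
- exact/itgZ/ind_itg.
- move=> h; apply: itg_eq (itgZ (ind h1 h2 h) (itg_ind x1 x2 (Hf h).1)) => x.
  by rewrite /indR /=; ring.
- move=> h; have I := itg_norm (Hf h).1.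
  apply: (@le_trans _ _ (\int[mu]_x (ind h1 h2 h * `|f (x, h)|))).
    apply: rint_le; [|exact: itgZ|].
    + apply: itg_norm; apply: itg_eq (itgZ (ind h1 h2 h) (itg_ind x1 x2 (Hf h).1)) => x.
      by rewrite /indR /=; ring.
    + move=> x; rewrite /indR /= !normrM (ger0_norm (ind_ge0 h1 h2 h)).
      by rewrite ler_wpM2r// -[leRHS]mul1r ler_wpM2r ?ind_ge0 ?ind_norm.
  by rewrite rintZ// mulrC ler_wpM2r ?ind_ge0//; exact: (Hf h).2.
Qed.

Lemma recty_itg (f : pt -> R) C x1 x2 h1 h2 : measurable_fun setT f ->
  (forall x : R, itg mu (fun h => f (x, h)) /\ \int[mu]_h `|f (x, h)| <= C) ->
  itg mu2 (fun p => indR x1 x2 h1 h2 p * f p).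
Proof.
move=> mf Hf; apply: (@ton1 _ _ _ _ _ _ _ _ (fun x : rT => C * ind x1 x2 x)).
- by apply: mfM => //; exact: mindR.
- exact/itgZ/ind_itg.
- move=> x; apply: itg_eq (itgZ (ind x1 x2 x) (itg_ind h1 h2 (Hf x).1)) => h.
  by rewrite /indR /=; ring.
- move=> x; have I := itg_norm (Hf x).1.
  apply: (@le_trans _ _ (\int[mu]_h (ind x1 x2 x * `|f (x, h)|))).
    apply: rint_le; [|exact: itgZ|].
    + apply: itg_norm; apply: itg_eq (itgZ (ind x1 x2 x) (itg_ind h1 h2 (Hf x).1)) => h.
      by rewrite /indR /=; ring.
    + move=> h; rewrite /indR /= !normrM (ger0_norm (ind_ge0 x1 x2 x)) -mulrA.
      by rewrite ler_wpM2l ?ind_ge0// -[leRHS]mul1r ler_wpM2r ?ind_norm.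
  by rewrite rintZ// mulrC ler_wpM2r ?ind_ge0//; exact: (Hf x).2.
Qed.

Section Transported.
Variables (g : pt -> R) (Cg : R) (I : Type) (s : seq I) (gam : I -> pt -> R)
          (tr : I -> tree) (Cm : R).
Hypothesis mg : measurable_fun setT g.
Hypothesis bg : forall p, `|g p| <= Cg.
Hypothesis mgam : forall i, measurable_fun setT (gam i).
Hypothesis bgam : forall i p, `|gam i p| <= Cm.

(** [g] is to be a coefficient of parallel transport, and [vx], [vy] are its partial derivatives:
    combinations of the one-forms of trees with bounded coefficients. These are merely integrable
    along lines, so [gx] and [gy] state the differential of g in integrated form. *)
Definition vx (p : pt) : R := \sum_(i <- s) gam i p * aT (tr i) p.
Definition vy (p : pt) : R := \sum_(i <- s) gam i p * bT (tr i) p.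

Hypothesis gx : forall h x1 x2 : R, 0 < h -> x1 <= x2 ->
  g (x2, h) - g (x1, h) = \int[mu]_t (ind x1 x2 t * vx (t, h)).
Hypothesis gy : forall x h1 h2 : R, 0 < h1 -> h1 <= h2 ->
  g (x, h2) - g (x, h1) = \int[mu]_r (ind h1 h2 r * vy (x, r)).

Let Cm0 (i : I) : 0 <= Cm. Proof. exact: le_trans (normr_ge0 _) (bgam i (0, 0)). Qed.

Lemma mvx : measurable_fun setT vx.
Proof. by apply: mfsum => i; apply: mfM => //; exact: maT. Qed.

Lemma mvy : measurable_fun setT vy.
Proof. by apply: mfsum => i; apply: mfM => //; exact: mbT. Qed.

Definition Nv : R := \sum_(i <- s) Cm * (2 * pi * ndens R (tr i)).

Lemma vx_line (h : R) : itg mu (fun x => vx (x, h)) /\ \int[mu]_x `|vx (x, h)| <= Nv.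
Proof.
have Ii i : itg mu (fun x => gam i (x, h) * aT (tr i) (x, h)).
  apply: (@itg_mulb _ _ _ _ _ _ Cm) => //; first exact: (mslice2 h (mgam i)).
  exact: aT_itg.
split; first exact: itg_sum.
apply: (@le_trans _ _ (\int[mu]_x \sum_(i <- s) Cm * `|aT (tr i) (x, h)|)).
  apply: rint_le; [exact/itg_norm/itg_sum| |].
  - by apply: itg_sum => i; apply: itgZ; apply: itg_norm; exact: aT_itg.
  - move=> x; apply: (le_trans (ler_norm_sum _ _ _)); apply: ler_sum => i _.
    by rewrite normrM ler_wpM2r.
rewrite rint_sum; last by move=> i; apply: itgZ; apply: itg_norm; exact: aT_itg.
apply: ler_sum => i _; rewrite rintZ; last exact/itg_norm/aT_itg.
by rewrite ler_wpM2l ?(Cm0 i)//; exact: (aT_line (tr i) h).2.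
Qed.

Lemma vy_line (x : R) : itg mu (fun h => vy (x, h)) /\ \int[mu]_h `|vy (x, h)| <= Nv.
Proof.
have Ii i : itg mu (fun h => gam i (x, h) * bT (tr i) (x, h)).
  apply: (@itg_mulb _ _ _ _ _ _ Cm) => //; first exact: (mslice1 x (mgam i)).
  exact: bT_itg.
split; first exact: itg_sum.
apply: (@le_trans _ _ (\int[mu]_h \sum_(i <- s) Cm * `|bT (tr i) (x, h)|)).
  apply: rint_le; [exact/itg_norm/itg_sum| |].
  - by apply: itg_sum => i; apply: itgZ; apply: itg_norm; exact: bT_itg.
  - move=> h; apply: (le_trans (ler_norm_sum _ _ _)); apply: ler_sum => i _.
    by rewrite normrM ler_wpM2r.
rewrite rint_sum; last by move=> i; apply: itgZ; apply: itg_norm; exact: bT_itg.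
apply: ler_sum => i _; rewrite rintZ; last exact/itg_norm/bT_itg.
by rewrite ler_wpM2l ?(Cm0 i)//; exact: (bT_line (tr i) x).2.
Qed.

(** The integral of g dphi(., q) around the boundary of the rectangle, run clockwise. *)
Definition bdK (q : pt) (x1 x2 h1 h2 : R) : R :=
  \int[mu]_x (ind x1 x2 x * (g (x, h2) * aK (x, h2) q))
  - \int[mu]_x (ind x1 x2 x * (g (x, h1) * aK (x, h1) q))
  - \int[mu]_h (ind h1 h2 h * (g (x2, h) * bK (x2, h) q))
  + \int[mu]_h (ind h1 h2 h * (g (x1, h) * bK (x1, h) q)).

(** The density of - dg /\ dphi(., q); the sign matches the clockwise orientation of [bdK]. *)
Definition WK (q p : pt) : R := vy p * aK p q - vx p * bK p q.

Lemma mWK : measurable_fun setT (fun z : pt * pt => WK z.1 z.2).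
Proof.
apply: mfD; [|apply: mfN]; apply: mfM.
- by apply: (measurableT_comp mvy); msr.
- by apply: maK; msr.
- by apply: (measurableT_comp mvx); msr.
- by apply: mbK; msr.
Qed.

Lemma gaK_itg q (x1 x2 h : R) : itg mu (fun x => ind x1 x2 x * (g (x, h) * aK (x, h) q)).
Proof.
apply: itg_ind; apply: (@itg_mulb _ _ _ _ _ _ Cg) => //; first exact: (mslice2 h mg).
exact: (aK_itg h q).1.
Qed.

Lemma gbK_itg q (h1 h2 x : R) : itg mu (fun h => ind h1 h2 h * (g (x, h) * bK (x, h) q)).
Proof.
apply: itg_ind; apply: (@itg_mulb _ _ _ _ _ _ Cg) => //; first exact: (mslice1 x mg).
exact: (bK_itg x q).1.
Qed.

Lemma ind_pos (a b t : R) : ind a b t != 0 -> a < t /\ t <= b.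
Proof. by rewrite /ind; case: (_ && _) / andP => // _; rewrite eqxx. Qed.

Lemma ind_idem (a b t : R) : ind a b t * ind a b t = ind a b t.
Proof. by rewrite /ind; case: (_ && _); rewrite ?mul1r ?mul0r. Qed.

Lemma indR_idem x1 x2 h1 h2 p : indR x1 x2 h1 h2 p * indR x1 x2 h1 h2 p = indR x1 x2 h1 h2 p.
Proof. by rewrite /indR mulrACA !ind_idem. Qed.

(** At distance at least [dl] from the source all kernels are bounded. The product rule is applied
    to g [aK] on vertical slices and to g [bK] on horizontal ones; the two terms containing [kK]
    cancel because the angle form is closed. *)
Lemma stokes_far (q : pt) (x1 x2 h1 h2 dl : R) : x1 <= x2 -> 0 < h1 -> h1 <= h2 ->
  0 <= q.2 -> 0 < dl ->
  (forall x h : R, x1 <= x <= x2 -> h1 <= h <= h2 -> dl ^+ 2 <= rsq (x, h) q) ->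
  itg mu2 (fun p => indR x1 x2 h1 h2 p * WK q p) /\
  bdK q x1 x2 h1 h2 = \int[mu2]_p (indR x1 x2 h1 h2 p * WK q p).
Proof.
move=> x12 h10 h12 q0 dl0 far.
have dl2 : 0 < dl ^+ 2 by rewrite exprn_gt0.
have KB (x h : R) : x1 <= x <= x2 -> h1 <= h <= h2 ->
    [/\ `|aK (x, h) q| <= 2 / dl, `|bK (x, h) q| <= 2 / dl & `|kK (x, h) q| <= 2 / dl ^+ 2].
  move=> xb hb; apply: K_bound => //; first exact: far.
  by case/andP: hb => hb _; exact: lt_le_trans h10 hb.
have nz (x h : R) : x1 <= x <= x2 -> h1 <= h <= h2 -> rsq (x, h) q != 0 /\ rsqN (x, h) q != 0.
  move=> xb hb; have r0 := lt_le_trans dl2 (far x h xb hb); split; first by rewrite gt_eqF.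
  rewrite gt_eqF// (lt_le_trans r0)// /rsq /rsqN /= lerD2l.
  have : 0 < h by case/andP: hb => hb _; exact: lt_le_trans h10 hb.
  move: q0; set y : R := q.2 => y0 h0; have := mulr_ge0 (ltW h0) y0; nra.
have inR p : indR x1 x2 h1 h2 p != 0 -> x1 <= (p.1 : R) <= x2 /\ h1 <= (p.2 : R) <= h2.
  rewrite /indR mulf_eq0 negb_or => /andP[/ind_pos[a1 a2] /ind_pos[a3 a4]].
  by rewrite a2 a4 (ltW a1) (ltW a3).
have bI (K : pt -> R) (C : R) p : 0 <= C -> (indR x1 x2 h1 h2 p != 0 -> `|K p| <= C) ->
    `|indR x1 x2 h1 h2 p * K p| <= C.
  move=> C0 H; have [->|n0] := eqVneq (indR x1 x2 h1 h2 p) 0; first by rewrite mul0r normr0.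
  by rewrite normrM -[leRHS]mul1r ler_pM ?indR_norm// H.
have d20 : 0 <= 2 / dl by rewrite divr_ge0// ltW.
have d220 : 0 <= 2 / dl ^+ 2 by rewrite divr_ge0// ltW.
have mI := mindR x1 x2 h1 h2.
have maq : measurable_fun setT (fun p : pt => aK p q) by apply: maK; msr.
have mbq : measurable_fun setT (fun p : pt => bK p q) by apply: mbK; msr.
have mkq : measurable_fun setT (fun p : pt => kK p q) by apply: mkK; msr.
have Iva : itg mu2 (fun p => (indR x1 x2 h1 h2 p * aK p q) * (indR x1 x2 h1 h2 p * vy p)).
  apply: (@itg_mulb _ _ _ _ _ _ (2 / dl)); first exact: mfM.
    by move=> p; apply: (bI (fun p => aK p q)) => // /inR[xb hb]; rewrite (surjective_pairing p); have [] := KB _ _ xb hb.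
  exact: (recty_itg x1 x2 h1 h2 mvy vy_line).
have Ivb : itg mu2 (fun p => (indR x1 x2 h1 h2 p * bK p q) * (indR x1 x2 h1 h2 p * vx p)).
  apply: (@itg_mulb _ _ _ _ _ _ (2 / dl)); first exact: mfM.
    by move=> p; apply: (bI (fun p => bK p q)) => // /inR[xb hb]; rewrite (surjective_pairing p); have [] := KB _ _ xb hb.
  exact: (rectx_itg x1 x2 h1 h2 mvx vx_line).
have Igk : itg mu2 (fun p => (indR x1 x2 h1 h2 p * kK p q) * (g p * indR x1 x2 h1 h2 p)).
  apply: (@itg_mulb _ _ _ _ _ _ (2 / dl ^+ 2)); first exact: mfM.
    by move=> p; apply: (bI (fun p => kK p q)) => // /inR[xb hb]; rewrite (surjective_pairing p); have [] := KB _ _ xb hb.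
  by apply: (@itg_mulb _ _ _ _ _ _ Cg) => //; exact: indR_itg.
(* [F1] and [F2] are the derivatives of g [aK] in the height and of g [bK] in the abscissa, cut off
   to the rectangle. *)
pose F1 p := indR x1 x2 h1 h2 p * (vy p * aK p q + g p * kK p q).
pose F2 p := indR x1 x2 h1 h2 p * (vx p * bK p q + g p * kK p q).
have IF1 : itg mu2 F1.
  apply: itg_eq (itgD Iva Igk) => p; rewrite /F1 -[in RHS]indR_idem; ring.
have IF2 : itg mu2 F2.
  apply: itg_eq (itgD Ivb Igk) => p; rewrite /F2 -[in RHS]indR_idem; ring.
have EW p : indR x1 x2 h1 h2 p * WK q p = F1 p - F2 p by rewrite /WK /F1 /F2; ring.
split; first by apply: itg_eq (itgB IF1 IF2) => p; rewrite EW.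
under [RHS]eq_Rintegral do rewrite EW.
rewrite rintB// fub1// (fub2 IF2).
have -> : \int[mu]_x \int[mu]_y F1 (x, y) =
   \int[mu]_x (ind x1 x2 x * (g (x, h2) * aK (x, h2) q) - ind x1 x2 x * (g (x, h1) * aK (x, h1) q)).
  apply: rint_eq => x; have [E0|/ind_pos[/ltW xa xb]] := eqVneq (ind x1 x2 x) 0.
    rewrite E0 !mul0r subr0 -[RHS](rint0 mu); apply: rint_eq => y.
    by rewrite /F1 /indR /= E0 !mul0r.
  have xx : x1 <= x <= x2 by rewrite xa xb.
  have ii : ind x1 x2 x = 1 \/ ind x1 x2 x = 0 by rewrite /ind; case: (_ && _); [left|right].
  rewrite -mulrBr.
  have := @ac_prod_itv R h1 h2 (fun h => vy (x, h)) (fun h => kK (x, h) q)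
    (fun h => g (x, h)) (fun h => aK (x, h) q) h12.
  move=> ->.
  - rewrite -rintZ; first by apply: rint_eq => h; rewrite /F1 /indR /=; ring.
    have Iv : itg mu (fun h => (aK (x, h) q * ind h1 h2 h) * (ind h1 h2 h * vy (x, h))).
      apply: (@itg_mulb _ _ _ _ _ _ (2 / dl)); first by apply: mfM; [exact: (mslice1 x maq)|apply: mind; msr].
        move=> h; have [->|/ind_pos[/ltW ha hb]] := eqVneq (ind h1 h2 h) 0; first by rewrite mulr0 normr0.
        rewrite normrM -[leRHS]mulr1 ler_pM ?ind_norm//.
        by have [] := KB x h xx _; rewrite ?ha ?hb.
      exact/itg_ind/(vy_line x).1.
    have Ik : itg mu (fun h => (kK (x, h) q * ind h1 h2 h) * (g (x, h) * ind h1 h2 h)).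
      apply: (@itg_mulb _ _ _ _ _ _ (2 / dl ^+ 2)); first by apply: mfM; [exact: (mslice1 x mkq)|apply: mind; msr].
        move=> h; have [->|/ind_pos[/ltW ha hb]] := eqVneq (ind h1 h2 h) 0; first by rewrite mulr0 normr0.
        rewrite normrM -[leRHS]mulr1 ler_pM ?ind_norm//.
        by have [] := KB x h xx _; rewrite ?ha ?hb.
      by apply: (@itg_mulb _ _ _ _ _ _ Cg) => //; [exact: (mslice1 x mg)|exact: ind_itg].
    apply: itg_eq (itgD Iv Ik) => h; rewrite -[in RHS]ind_idem; ring.
  - exact/itg_ind/(vy_line x).1.
  - have Ik : itg mu (fun h => (kK (x, h) q * ind h1 h2 h) * ind h1 h2 h).
      apply: (@itg_mulb _ _ _ _ _ _ (2 / dl ^+ 2)); last exact: ind_itg.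
        by apply: mfM; [exact: (mslice1 x mkq)|apply: mind; msr].
      move=> h; have [->|/ind_pos[/ltW ha hb]] := eqVneq (ind h1 h2 h) 0; first by rewrite mulr0 normr0.
      rewrite normrM -[leRHS]mulr1 ler_pM ?ind_norm//.
      by have [] := KB x h xx _; rewrite ?ha ?hb.
    by apply: itg_eq Ik => h; rewrite -mulrA ind_idem mulrC.
  - exact: (mslice1 x mg).
  - exact: (mslice1 x maq).
  - by exists Cg.
  - exists (2 / dl) => h; have [->|/ind_pos[/ltW ha hb]] := eqVneq (ind h1 h2 h) 0; first by rewrite mulr0 normr0.
    rewrite normrM -[leRHS]mulr1 ler_pM ?ind_norm//.
    by have [] := KB x h xx _; rewrite ?ha ?hb.
  - by move=> r ar rb; rewrite -(gy x h10 ar) addrC subrK.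
  - move=> r ar rb; rewrite ftc_aK//; first by rewrite addrC subrK.
    by move=> h /andP[ha hb]; apply: nz => //; rewrite ha (le_trans hb rb).
have -> : \int[mu]_y \int[mu]_x F2 (x, y) =
   \int[mu]_h (ind h1 h2 h * (g (x2, h) * bK (x2, h) q) - ind h1 h2 h * (g (x1, h) * bK (x1, h) q)).
  apply: rint_eq => h; have [E0|/ind_pos[ha' hb]] := eqVneq (ind h1 h2 h) 0.
    rewrite E0 !mul0r subr0 -[RHS](rint0 mu); apply: rint_eq => y.
    by rewrite /F2 /indR /= E0 mulr0 !mul0r.
  have ha := ltW ha'; have h0 : 0 < h := lt_trans h10 ha'.
  have hh : h1 <= h <= h2 by rewrite ha hb.
  rewrite -mulrBr.
  have := @ac_prod_itv R x1 x2 (fun x => vx (x, h)) (fun x => kK (x, h) q)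
    (fun x => g (x, h)) (fun x => bK (x, h) q) x12.
  move=> ->.
  - rewrite -rintZ; first by apply: rint_eq => x; rewrite /F2 /indR /=; ring.
    have Iv : itg mu (fun x => (bK (x, h) q * ind x1 x2 x) * (ind x1 x2 x * vx (x, h))).
      apply: (@itg_mulb _ _ _ _ _ _ (2 / dl)); first by apply: mfM; [exact: (mslice2 h mbq)|apply: mind; msr].
        move=> x; have [->|/ind_pos[/ltW xa xb]] := eqVneq (ind x1 x2 x) 0; first by rewrite mulr0 normr0.
        rewrite normrM -[leRHS]mulr1 ler_pM ?ind_norm//.
        by have [] := KB x h _ hh; rewrite ?xa ?xb.
      exact/itg_ind/(vx_line h).1.
    have Ik : itg mu (fun x => (kK (x, h) q * ind x1 x2 x) * (g (x, h) * ind x1 x2 x)).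
      apply: (@itg_mulb _ _ _ _ _ _ (2 / dl ^+ 2)); first by apply: mfM; [exact: (mslice2 h mkq)|apply: mind; msr].
        move=> x; have [->|/ind_pos[/ltW xa xb]] := eqVneq (ind x1 x2 x) 0; first by rewrite mulr0 normr0.
        rewrite normrM -[leRHS]mulr1 ler_pM ?ind_norm//.
        by have [] := KB x h _ hh; rewrite ?xa ?xb.
      by apply: (@itg_mulb _ _ _ _ _ _ Cg) => //; [exact: (mslice2 h mg)|exact: ind_itg].
    apply: itg_eq (itgD Iv Ik) => x; rewrite -[in RHS]ind_idem; ring.
  - exact/itg_ind/(vx_line h).1.
  - have Ik : itg mu (fun x => (kK (x, h) q * ind x1 x2 x) * ind x1 x2 x).
      apply: (@itg_mulb _ _ _ _ _ _ (2 / dl ^+ 2)); last exact: ind_itg.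
        by apply: mfM; [exact: (mslice2 h mkq)|apply: mind; msr].
      move=> x; have [->|/ind_pos[/ltW xa xb]] := eqVneq (ind x1 x2 x) 0; first by rewrite mulr0 normr0.
      rewrite normrM -[leRHS]mulr1 ler_pM ?ind_norm//.
      by have [] := KB x h _ hh; rewrite ?xa ?xb.
    by apply: itg_eq Ik => x; rewrite -mulrA ind_idem mulrC.
  - exact: (mslice2 h mg).
  - exact: (mslice2 h mbq).
  - by exists Cg.
  - exists (2 / dl) => x; have [->|/ind_pos[/ltW xa xb]] := eqVneq (ind x1 x2 x) 0; first by rewrite mulr0 normr0.
    rewrite normrM -[leRHS]mulr1 ler_pM ?ind_norm//.
    by have [] := KB x h _ hh; rewrite ?xa ?xb.
  - by move=> r ar rb; rewrite -(gx h0 ar) addrC subrK.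
  - move=> r ar rb; rewrite ftc_bK//; first by rewrite addrC subrK.
    by move=> x /andP[xa xb]; apply: nz => //; rewrite xa (le_trans xb rb).
rewrite rintB; [|exact: gaK_itg|exact: gaK_itg].
rewrite rintB; [|exact: gbK_itg|exact: gbK_itg].
by rewrite /bdK; ring.
Qed.

Lemma ind_split (a b c t : R) : a <= b -> b <= c -> ind a c t = ind a b t + ind b c t.
Proof.
move=> ab bc; rewrite /ind; case: (leP t b) => tb.
  by rewrite (le_trans tb bc) /= !andbT addr0.
by rewrite (le_lt_trans ab tb) /= add0r.
Qed.

Lemma bdK_split (q : pt) (x1 x x2 h1 h2 : R) : x1 <= x -> x <= x2 ->
  bdK q x1 x2 h1 h2 = bdK q x1 x h1 h2 + bdK q x x2 h1 h2.
Proof.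
move=> a b; rewrite /bdK.
have E h : \int[mu]_t (ind x1 x2 t * (g (t, h) * aK (t, h) q)) =
  \int[mu]_t (ind x1 x t * (g (t, h) * aK (t, h) q)) + \int[mu]_t (ind x x2 t * (g (t, h) * aK (t, h) q)).
  rewrite -rintD; [|exact: gaK_itg|exact: gaK_itg].
  by apply: rint_eq => t; rewrite (ind_split _ a b) mulrDl.
by rewrite (E h1) (E h2); ring.
Qed.

(** The source may lie in the rectangle, where the kernels are unbounded. Inserting the averages
    that define the one-forms rewrites [WK] almost everywhere as a combination of averages of -[JK],
    to which the bound [CJ] applies; hence an estimate independent of q. *)
Lemma WK_itg (q : pt) x1 x2 (h1 h2 : R) : 0 < h1 -> 0 <= q.2 ->
  itg mu2 (fun p => indR x1 x2 h1 h2 p * WK q p) /\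
  \int[mu2]_p `|indR x1 x2 h1 h2 p * WK q p| <= \sum_(i <- s) Cm * (CJ R * ndens R (tr i)).
Proof.
move=> h10 q0.
have up1 p : indR x1 x2 h1 h2 p * up p = indR x1 x2 h1 h2 p.
  rewrite /indR /up; have [->|/ind_pos[a _]] := eqVneq (ind h1 h2 p.2) 0; first by rewrite mulr0 mul0r.
  by rewrite (lt_trans h10 a) mulr1.
have H i : itg (sprod mu2 (mtree R (tr i))) (fun z => (indR x1 x2 h1 h2 z.1 * gam i z.1) *
    (up z.1 * JK z.1 z.2 q * dens (tr i) z.2)) /\
    \int[mu2]_p \int[mtree R (tr i)]_q' `|(indR x1 x2 h1 h2 p * gam i p) *
    (up p * JK p q' q * dens (tr i) q')| <= Cm * (CJ R * ndens R (tr i)).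
  have bc p : `|indR x1 x2 h1 h2 p * gam i p| <= Cm.
    by rewrite normrM -[leRHS]mul1r ler_pM ?indR_norm.
  have I0 : itg (sprod mu2 (mtree R (tr i))) (fun z => up z.1 * JK z.1 z.2 q * dens (tr i) z.2) /\
     \int[sprod mu2 (mtree R (tr i))]_z `|up z.1 * JK z.1 z.2 q * dens (tr i) z.2| <= CJ R * ndens R (tr i).
    have Iq q' : itg mu2 (fun p => up p * JK p q' q * dens (tr i) q').
      have [->|d0] := eqVneq (dens (tr i) q') 0; first by apply: itg_eq (itg0 _) => p; rewrite mulr0.
      by apply: itg_eq (itgZ (dens (tr i) q') (JK_itg (dens_supp d0) q0).1) => p; rewrite mulrC.
    have Lq q' : \int[mu2]_p `|up p * JK p q' q * dens (tr i) q'| <= CJ R * `|dens (tr i) q'|.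
      have [->|d0] := eqVneq (dens (tr i) q') 0.
        rewrite normr0 mulr0 (rint_eq _ (g := fun=> 0)) ?rint0// => p.
        by rewrite mulr0 normr0.
      have [I1 L1] := JK_itg (dens_supp d0) q0.
      rewrite (rint_eq _ (g := fun p => `|dens (tr i) q'| * `|up p * JK p q' q|)); last first.
        by move=> p; rewrite normrM mulrC.
      by rewrite rintZ; [rewrite mulrC ler_wpM2r|exact: itg_norm].
    have I1 : itg (sprod mu2 (mtree R (tr i))) (fun z => up z.1 * JK z.1 z.2 q * dens (tr i) z.2).
      apply: (@ton2 _ _ _ _ _ _ _ _ (fun q' => CJ R * `|dens (tr i) q'|)) => //.
      - have m1 : measurable_fun setT (fun z : pt * pt => up z.1 * JK z.1 z.2 q).
          by apply: mfM; [apply: (measurableT_comp (@measurable_up R)); msr|apply: mJK; msr].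
        have m2 : measurable_fun setT (fun z : pt * pt => dens (tr i) z.2).
          by apply: (measurableT_comp (@mdens R (tr i))); msr.
        exact: (mfM m1 m2).
      - exact/itgZ/itg_norm/dens_itg.
    split=> //; rewrite (fub2 (itg_norm I1)) /ndens -rintZ; last exact/itg_norm/dens_itg.
    apply: rint_le => //; first exact: (fub_itg2 (itg_norm I1)).
    exact/itgZ/itg_norm/dens_itg.
  have I2 : itg (sprod mu2 (mtree R (tr i))) (fun z => (indR x1 x2 h1 h2 z.1 * gam i z.1) *
    (up z.1 * JK z.1 z.2 q * dens (tr i) z.2)).
    apply: (@itg_mulb _ _ _ _ _ _ Cm); last exact: I0.1.
      by apply: mfM; [apply: (measurableT_comp (mindR x1 x2 h1 h2)); msr|apply: (measurableT_comp (mgam i)); msr].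
    by move=> z; exact: bc.
  split=> //; have := fub1 (itg_norm I2); rewrite /= => <-.
  apply: (@le_trans _ _ (Cm * \int[sprod mu2 (mtree R (tr i))]_z `|up z.1 * JK z.1 z.2 q * dens (tr i) z.2|)).
    rewrite -rintZ; last exact/itg_norm/I0.1.
    apply: rint_le; [exact: itg_norm|exact/itgZ/itg_norm/I0.1|].
    by move=> z; rewrite normrM ler_wpM2r.
  by rewrite ler_wpM2l ?(Cm0 i)//; exact: I0.2.
pose Q i p := \int[mtree R (tr i)]_q' ((indR x1 x2 h1 h2 p * gam i p) * (up p * JK p q' q * dens (tr i) q')).
have IQ i : itg mu2 (Q i) by exact: (fub_itg1 (H i).1).
have EQ i : {ae mu2, forall p, - Q i p = indR x1 x2 h1 h2 p * (gam i p * bT (tr i) p * aK p q - gam i p * aT (tr i) p * bK p q)}.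
  apply: filterS (filterI (@aK_dens_ae R (tr i)) (@bK_dens_ae R (tr i))) => p [Ia Ib].
  rewrite /Q (rint_eq _ (g := fun q' => (indR x1 x2 h1 h2 p * gam i p * bK p q) * (aK p q' * dens (tr i) q')
     - (indR x1 x2 h1 h2 p * gam i p * aK p q) * (bK p q' * dens (tr i) q'))); last first.
    by move=> q'; rewrite /JK -[in RHS](up1 p); ring.
  by rewrite rintB; [rewrite !rintZ// /aT /bT; ring|exact: itgZ|exact: itgZ].
have aeW : {ae mu2, forall p, - (\sum_(i <- s) Q i p) = indR x1 x2 h1 h2 p * WK q p}.
  rewrite /WK /vx /vy; elim: s => [|i l IHl].
    by apply: aeW => p; rewrite !big_nil !mul0r subr0 mulr0 oppr0.
  apply: filterS (filterI (EQ i) IHl) => p [E1 E2].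
  by rewrite !big_cons opprD E1 E2; ring.
have mW : measurable_fun setT (fun p => indR x1 x2 h1 h2 p * WK q p).
  by apply: mfM; [exact: mindR|exact: (mslice1 q mWK)].
have IS : itg mu2 (fun p => \sum_(i <- s) Q i p) by exact: itg_sum.
have bS : \int[mu2]_p `|\sum_(i <- s) Q i p| <= \sum_(i <- s) Cm * (CJ R * ndens R (tr i)).
  apply: (@le_trans _ _ (\int[mu2]_p \sum_(i <- s) `|Q i p|)).
    apply: rint_le; [exact: itg_norm|by apply: itg_sum => i; exact: itg_norm|].
    by move=> p; exact: ler_norm_sum.
  rewrite rint_sum; last by move=> i; exact: itg_norm.
  apply: ler_sum => i _; apply: (le_trans _ (H i).2).
  apply: rint_le_ae; [exact: itg_norm|exact: (fub_itg1 (itg_norm (H i).1))|].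
  by apply: filterS (fub_ae1 (H i).1) => p Ip; exact: rint_norm.
have EN : \int[mu2]_p `|indR x1 x2 h1 h2 p * WK q p| = \int[mu2]_p `|\sum_(i <- s) Q i p|.
  apply: rint_ae; [exact: mfnorm|exact: mfnorm (itg_meas IS)|].
  by apply: filterS aeW => p <-; rewrite normrN.
have fin : (\int[mu2]_p `|indR x1 x2 h1 h2 p * WK q p|%:E <=
    (\int[mu2]_p `|\sum_(i <- s) Q i p|)%:E)%E.
  rewrite rintE; last exact: itg_norm.
  rewrite le_eqVlt; apply/orP; left; apply/eqP; apply: ae_eq_integral => //.
  - by apply/measurable_EFinP; exact: mfnorm.
  - by apply/measurable_EFinP; exact: mfnorm (itg_meas IS).
  - by apply: filterS aeW => p <- _; rewrite normrN.
by have [I1 L1] := itg_ub mW fin; split => //; exact: le_trans L1 bS.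
Qed.

End Transported.
End Stokes.

Lemma itg_ae d (X : measurableType d) (R : realType) (m : {measure set X -> \bar R})
  (f g : X -> R) : itg m f -> measurable_fun setT g -> {ae m, forall x, f x = g x} -> itg m g.
Proof.
move=> If mg fg; apply: (proj1 (itg_ub (C := \int[m]_x `|f x|) mg _)).
rewrite (rintE (itg_norm If)) le_eqVlt; apply/orP; left; apply/eqP.
apply: ae_eq_integral => //.
- by apply/measurable_EFinP; exact: mfnorm.
- by apply/measurable_EFinP; apply: mfnorm; exact: itg_meas If.
- by apply: filterS fg => x -> _.
Qed.

(** * Stokes' formula with the source inside, and averaged over a tree *)

Section SourceStokes.
Variable R : realType.
Local Notation mu := (@lebesgue_measure R).
Local Notation mu2 := (sprod mu mu).
Local Notation rT := (measurableTypeR R).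
Local Notation pt := (pt R).

(** The indicator of the interval between a and b taken in either order, as limit points are
    approached from both sides. *)
Definition bt (a b t : R) : R := ind a b t + ind b a t.

Lemma bt_bound (a b t : R) : 0 <= bt a b t <= 1.
Proof.
rewrite /bt /ind; case: (leP t b) => tb; case: (leP t a) => ta /=; rewrite ?andbF ?addr0 ?add0r ?lexx ?ler01//.
Qed.

Lemma rint_ind (a b : R) : a <= b -> \int[mu]_t ind a b t = b - a.
Proof.
move=> ab; rewrite -(@ftc_ind _ (fun=> 1) id a b ab).
- by apply: rint_eq => t; rewrite mulr1.
- by move=> t _; exact: cvg_cst.
Qed.

Lemma bt_itg (a b : R) : itg mu (bt a b) /\ \int[mu]_t bt a b t = `|b - a|.
Proof.
split; first by apply: itgD; exact: ind_itg.
rewrite rintD; [|exact: ind_itg|exact: ind_itg].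
have z (c e : R) : e < c -> \int[mu]_t ind c e t = 0.
  move=> ec; rewrite -(rint0 mu); apply: rint_eq => t; rewrite /ind.
  by case: (ltP c t) => //= ct; rewrite leNgt (lt_trans ec ct).
have e (c : R) : \int[mu]_t ind c c t = 0 by rewrite rint_ind// subrr.
case: (ltgtP a b) => [ab|ba|->].
- by rewrite (rint_ind (ltW ab)) z// addr0 gtr0_norm// subr_gt0.
- by rewrite (rint_ind (ltW ba)) z// add0r ltr0_norm ?subr_lt0// opprB.
- by rewrite !e addr0 subrr normr0.
Qed.

Lemma bt_mul_itg (a b : R) (f : rT -> R) : itg mu f -> itg mu (fun t => bt a b t * f t).
Proof.
move=> If; apply: (@itg_mulb _ _ _ _ _ _ 1) => //.
  by apply: mfD; apply: mind; msr.
by move=> t; case/andP: (bt_bound a b t) => h1 h2; rewrite ger0_norm.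
Qed.

Lemma measurable_pt1 (q : pt) : measurable [set q].
Proof.
have -> : [set q] = [set q.1] `*` [set q.2].
  apply/seteqP; split => [p ->//|p [/= e1 e2]].
  by rewrite (surjective_pairing p) (surjective_pairing q) e1 e2.
by apply: measurableX; exact: measurable_set1.
Qed.

Lemma squeeze0 (f h : nat -> R) : (\forall n \near \oo, 0 <= f n <= h n) ->
  h n @[n --> \oo] --> 0 -> f n @[n --> \oo] --> 0.
Proof.
move=> Hf ch; apply/cvgrPdist_le => e e0; move/cvgrPdist_le : ch => /(_ _ e0) H.
apply: filterS (filterI Hf H) => n [/andP[a b]]; rewrite !sub0r !normrN => c.
by rewrite ger0_norm// (le_trans b)// (le_trans (ler_norm _) c).
Qed.

Lemma ae_mtree_neq t (q : pt) : 0 < q.2 -> {ae mtree R t, forall q', q' != q}.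
Proof.
move=> q0; case: t => [b|l r] /=.
  exists [set q]; split.
  - exact: measurable_pt1.
  - rewrite diracE (_ : ept R b \in [set q] = false)//; apply/negbTE/negP => /set_mem/= E.
    by move: q0; rewrite -E /= ltxx.
  - by move=> q' /= /negP; rewrite negbK => /eqP.
by apply: filterS (ae_line1 q.1) => p; apply: contra => /eqP ->.
Qed.

(** For a fixed source other than q the kernel stays bounded on the interval between [a] and [an n],
    whose length tends to 0. Almost every source differs from q, and the bound 2 pi on lines
    provides the domination. *)
Lemma source_small t (q : pt) (kn : nat -> rT -> pt -> R) (a : R) (an : nat -> R) :
  0 < q.2 ->
  (forall n, measurable_fun setT (fun z : rT * pt => kn n z.1 z.2)) ->
  (forall n q', itg mu (kn n ^~ q') /\ \int[mu]_x `|kn n x q'| <= 2 * pi) ->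
  an n @[n --> \oo] --> a ->
  (forall q', q' != q -> 0 <= q'.2 -> exists M : R, \forall n \near \oo,
     forall x : R, bt a (an n) x != 0 -> `|kn n x q'| <= M) ->
  \int[mu]_x (bt a (an n) x * `|\int[mtree R t]_q' (kn n x q' * dens t q')|) @[n --> \oo] --> 0.
Proof.
move=> q0 mk Hk ca Hs.
have LI n := line_itg t (twopi_ge0 R) (mk n) (Hk n).
have I1 n := (LI n).1.
pose Ph n q' := \int[mu]_x (bt a (an n) x * `|kn n x q'|).
have Ik n q' := itg_norm (Hk n q').1.
have mbt n : measurable_fun setT (bt a (an n)) by apply: mfD; apply: mind; msr.
have I2 n : itg (sprod mu (mtree R t)) (fun z => bt a (an n) z.1 * `|kn n z.1 z.2 * dens t z.2|).
  apply: (@itg_mulb _ _ _ _ _ _ 1); last exact: itg_norm (I1 n).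
    by apply: (measurableT_comp (mbt n)); msr.
  by move=> z; case/andP: (bt_bound a (an n) z.1) => h1 h2; rewrite ger0_norm.
have PhE n : \int[mu]_x \int[mtree R t]_q' (bt a (an n) x * `|kn n x q' * dens t q'|) =
    \int[mtree R t]_q' (Ph n q' * `|dens t q'|).
  rewrite (fubR (I2 n)) /=; apply: rint_eq => q'; rewrite /Ph mulrC -rintZ; last exact: bt_mul_itg.
  by apply: rint_eq => x; rewrite normrM; ring.
have Ph0 n q' : 0 <= Ph n q'.
  by apply: rint_ge0 => x; rewrite mulr_ge0//; case/andP: (bt_bound a (an n) x).
have Phb n q' : Ph n q' <= 2 * pi.
  apply: (le_trans _ (Hk n q').2); apply: rint_le => //; first exact: bt_mul_itg.
  by move=> x; rewrite -[leRHS]mul1r ler_wpM2r//; case/andP: (bt_bound a (an n) x).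
have mPh n : measurable_fun setT (fun q' => Ph n q' * `|dens t q'|).
  apply: mfM; last exact: mfnorm (@mdens R t).
  apply: (@mrint2 _ _ _ _ _ mu (fun z => bt a (an n) z.1 * `|kn n z.1 z.2|)).
  by apply: mfM; [apply: (measurableT_comp (mbt n)); msr|exact: mfnorm].
have lim : \int[mtree R t]_q' (Ph n q' * `|dens t q'|) @[n --> \oo] --> \int[mtree R t]_q' (0 : R).
  apply: (@dct _ _ _ _ _ _ (fun q' => 2 * pi * `|dens t q'|)) => //.
  - exact/itgZ/itg_norm/dens_itg.
  - by move=> n q'; rewrite normrM normr_id ler_wpM2r// ger0_norm.
  - apply: filterS (ae_mtree_neq t q0) => q' q'q.
    have [->|d0] := eqVneq (dens t q') 0.
      by under eq_fun do rewrite normr0 mulr0; exact: cvg_cst.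
    have [M HM] := Hs q' q'q (dens_supp d0).
    rewrite -[X in _ --> X](mul0r `|dens t q'|); apply: cvgMr_tmp.
    have cz : `|M| * `|an n - a| @[n --> \oo] --> (0 : R).
      rewrite -[X in _ --> X](mulr0 `|M|); apply: cvgMl_tmp.
      rewrite -(normr0 R); apply: cvg_norm; rewrite -(subrr a).
      by apply: cvgB => //; exact: cvg_cst.
    apply: squeeze0 cz; apply: filterS HM => n Hn; rewrite Ph0 /=.
    have [Ib Eb] := bt_itg a (an n); rewrite -Eb -rintZ//.
    apply: rint_le; [exact: bt_mul_itg|exact: itgZ|].
    move=> x; rewrite mulrC; case/andP: (bt_bound a (an n) x) => b0 _.
    have [->|bn] := eqVneq (bt a (an n) x) 0; first by rewrite !mulr0.
    by rewrite ler_wpM2r// (le_trans (Hn x bn))// ler_norm.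
rewrite rint0 in lim.
apply: squeeze0 lim; apply: nearW => n; apply/andP; split.
  by apply: rint_ge0 => x; rewrite mulr_ge0//; case/andP: (bt_bound a (an n) x).
rewrite -PhE; apply: rint_le_ae.
- by apply: bt_mul_itg; apply: itg_norm; exact: (fub_itg1 (I1 n)).
- exact: (fub_itg1 (I2 n)).
- apply: filterS (fub_ae1 (I1 n)) => x Ix.
  rewrite rintZ; last exact: itg_norm Ix.
  by case/andP: (bt_bound a (an n) x) => b0 _; rewrite ler_wpM2l//; exact: rint_norm.
Qed.

Lemma near_half (c : R) (an : nat -> R) (a : R) : an n @[n --> \oo] --> a -> c != a ->
  \forall n \near \oo, forall x : R, bt a (an n) x != 0 \/ x = an n -> `|a - c| / 2 <= `|x - c|.
Proof.
move=> ca ca0; have e0 : 0 < `|a - c| / 2 by rewrite divr_gt0// normr_gt0 subr_eq0 eq_sym.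
move/cvgrPdist_le : ca => /(_ _ e0); apply: filterS => n h x Hx.
have xa : `|a - x| <= `|a - c| / 2.
  case: Hx => [|-> //]; rewrite /bt /ind.
  case: (boolP (a < x <= an n)) => [/andP[h1 h2] _|_].
    apply: le_trans h; rewrite !ler0_norm ?subr_le0 ?(ltW h1)//; last exact: le_trans (ltW h1) h2.
    by rewrite !opprB lerD2r.
  case: (boolP (an n < x <= a)) => [/andP[h1 h2] _|_]; last by rewrite addr0 eqxx.
  apply: le_trans h; rewrite !ger0_norm ?subr_ge0//; last exact: le_trans (ltW h1) h2.
  by rewrite lerD2l lerN2 ltW.
have := ler_normB (a - x) (a - c); have -> : a - x - (a - c) = - (x - c) by ring.
rewrite normrN => _; have := ler_normD (a - x) (x - c).
have -> : a - x + (x - c) = a - c by ring.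
by move=> hh; rewrite -(lerD2l `|a - x|); apply: le_trans hh; rewrite [leRHS](splitr `|a - c|) lerD2r.
Qed.

Lemma cvg_sumr (J : Type) (r : seq J) (f : J -> nat -> R) (l : J -> R) :
  (forall i, f i n @[n --> \oo] --> l i) ->
  \sum_(i <- r) f i n @[n --> \oo] --> \sum_(i <- r) l i.
Proof.
move=> H; elim: r => [|i r IH].
  by under eq_fun do rewrite big_nil; rewrite big_nil; exact: cvg_cst.
by under eq_fun do rewrite big_cons; rewrite big_cons; exact: cvgD.
Qed.

Variables (g : pt -> R) (Cg : R) (I : Type) (s : seq I) (gam : I -> pt -> R)
          (tr : I -> tree) (Cm : R).
Hypothesis mg : measurable_fun setT g.
Hypothesis bg : forall p, `|g p| <= Cg.
Hypothesis mgam : forall i, measurable_fun setT (gam i).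
Hypothesis bgam : forall i p, `|gam i p| <= Cm.
Local Notation vx := (vx s gam tr).
Local Notation vy := (vy s gam tr).
Hypothesis gx : forall h x1 x2 : R, 0 < h -> x1 <= x2 ->
  g (x2, h) - g (x1, h) = \int[mu]_t (ind x1 x2 t * vx (t, h)).
Hypothesis gy : forall x h1 h2 : R, 0 < h1 -> h1 <= h2 ->
  g (x, h2) - g (x, h1) = \int[mu]_r (ind h1 h2 r * vy (x, r)).

Lemma near_far_bound (q' : pt) (u y : R) (xn hn : nat -> R) : 0 < y ->
  xn n @[n --> \oo] --> u -> hn n @[n --> \oo] --> y -> q' != (u, y) -> 0 <= q'.2 ->
  exists M : R, \forall n \near \oo, forall x h : R,
    bt u (xn n) x != 0 \/ x = xn n \/ x = u -> bt y (hn n) h != 0 \/ h = hn n \/ h = y -> 0 < h ->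
    `|aK (x, h) q'| <= M /\ `|bK (x, h) q'| <= M.
Proof.
move=> y0 cx ch qq q0.
have gen (a c : R) (an : nat -> R) : an n @[n --> \oo] --> a -> c != a ->
   exists2 dl : R, 0 < dl & \forall n \near \oo, forall x : R, bt a (an n) x != 0 \/ x = an n \/ x = a ->
     dl ^+ 2 <= (x - c) ^+ 2.
  move=> ca can; exists (`|a - c| / 2); first by rewrite divr_gt0// normr_gt0 subr_eq0 eq_sym.
  apply: filterS (near_half ca can) => n Hn x Hx.
  have H : `|a - c| / 2 <= `|x - c|.
    case: Hx => [h|[h|->]]; [by apply: Hn; left|by apply: Hn; right|].
    by rewrite ler_pdivrMr// ler_peMr// ler1n.
  by rewrite -[leRHS]real_normK ?num_real// !expr2 ler_pM// divr_ge0.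
have : q'.1 != u \/ q'.2 != y.
  have [E1|] := eqVneq q'.1 u; last by left.
  right; apply: contra qq => /eqP E2; rewrite (surjective_pairing q') E1 E2 //.
case=> [/(gen _ _ _ cx)|/(gen _ _ _ ch)] [dl dl0 Hdl]; exists (2 / dl);
  apply: filterS Hdl => n Hn x h Hx Hh h0.
- have [] := @K_bound R (x, h) q' dl dl0 _ h0 q0; last by [].
  by apply: (le_trans (Hn x Hx)); rewrite /rsq /= lerDl sqr_ge0.
- have [] := @K_bound R (x, h) q' dl dl0 _ h0 q0; last by [].
  by apply: (le_trans (Hn h Hh)); rewrite /rsq /= lerDr sqr_ge0.
Qed.

(** The derivatives of g may be unbounded near the point. The increment is instead controlled by
    their integrals along a horizontal and a vertical segment, and both vanish by [source_small]. *)
Lemma g_cont_seq (u y : R) (xn hn : nat -> R) : 0 < y -> (forall n, 0 < hn n) ->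
  xn n @[n --> \oo] --> u -> hn n @[n --> \oo] --> y ->
  g (xn n, hn n) @[n --> \oo] --> g (u, y).
Proof.
move=> y0 hn0 cx ch.
pose En n := \sum_(i <- s) Cm * \int[mu]_x (bt u (xn n) x * `|aT (tr i) (x, hn n)|)
           + \sum_(i <- s) Cm * \int[mu]_h (bt y (hn n) h * `|bT (tr i) (u, h)|).
have cE : En n @[n --> \oo] --> (0 : R).
  rewrite -[X in _ --> X]addr0; apply: cvgD.
    rewrite [X in _ --> X](_ : (0 : R) = \sum_(i <- s) Cm * 0); last by rewrite big1// => i _; rewrite mulr0.
    apply: cvg_sumr => i; apply: cvgMl_tmp.
    apply: (@source_small _ (u, y) (fun n x q' => aK (x, hn n) q')) => //.
    - by move=> n; apply: maK; msr.
    - by move=> n q'; exact: aK_itg.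
    - move=> q' qq q'0; have [M HM] := near_far_bound y0 cx ch qq q'0.
      exists M; apply: filterS HM => n Hn x bx.
      by have [] := Hn x (hn n) (or_introl bx) (or_intror (or_introl erefl)) (hn0 n).
  rewrite [X in _ --> X](_ : (0 : R) = \sum_(i <- s) Cm * 0); last by rewrite big1// => i _; rewrite mulr0.
  apply: cvg_sumr => i; apply: cvgMl_tmp.
  apply: (@source_small _ (u, y) (fun n h q' => bK (u, h) q')) => //.
  - by move=> n; apply: mbK; msr.
  - by move=> n q'; exact: bK_itg.
  - move=> q' qq q'0; have [M HM] := near_far_bound y0 cx ch qq q'0.
    exists M; apply: filterS HM => n Hn h bh.
    have h0 : 0 < h.
      move: bh; rewrite /bt /ind.
      case: (boolP (y < h <= hn n)) => [/andP[h1 _] _|_]; first exact: lt_trans h1.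
      case: (boolP (hn n < h <= y)) => [/andP[h1 _] _|_]; last by rewrite addr0 eqxx.
      exact: lt_trans h1.
    by have [] := Hn u h (or_intror (or_intror erefl)) (or_introl bh) h0.
have bnd (f : rT -> R) (k : I -> rT -> R) a b : (forall i, itg mu (k i)) ->
    (forall x, `|f x| <= \sum_(i <- s) Cm * `|k i x|) -> measurable_fun setT f ->
    `|\int[mu]_t (ind a b t * f t)| <= \sum_(i <- s) Cm * \int[mu]_x (bt a b x * `|k i x|).
  move=> Ik fk mf.
  have IS : itg mu (fun x => \sum_(i <- s) Cm * (bt a b x * `|k i x|)).
    by apply: itg_sum => i; apply: itgZ; apply: bt_mul_itg; exact: itg_norm.
  have IS' : itg mu (fun x => \sum_(i <- s) Cm * `|k i x|).
    by apply: itg_sum => i; apply: itgZ; exact: itg_norm.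
  have If : itg mu f by exact: itg_dom mf fk IS'.
  have -> : \sum_(i <- s) Cm * \int[mu]_x (bt a b x * `|k i x|) =
      \int[mu]_x \sum_(i <- s) Cm * (bt a b x * `|k i x|).
    rewrite rint_sum; last by move=> i; apply: itgZ; apply: bt_mul_itg; exact: itg_norm.
    by apply: eq_bigr => i _; rewrite rintZ//; apply: bt_mul_itg; exact: itg_norm.
  apply: rint_bound => //; first exact: itg_ind.
  move=> x; rewrite normrM (ger0_norm (ind_ge0 a b x)).
  have -> : \sum_(i <- s) Cm * (bt a b x * `|k i x|) = bt a b x * \sum_(i <- s) Cm * `|k i x|.
    by rewrite mulr_sumr; apply: eq_bigr => i _; ring.
  by rewrite ler_pM ?ind_ge0// /bt lerDl ind_ge0.
have vxb (h : R) (x : rT) : `|vx (x, h)| <= \sum_(i <- s) Cm * `|aT (tr i) (x, h)|.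
  apply: (le_trans (ler_norm_sum _ _ _)); apply: ler_sum => i _.
  by rewrite normrM ler_wpM2r.
have vyb (x : R) (h : rT) : `|vy (x, h)| <= \sum_(i <- s) Cm * `|bT (tr i) (x, h)|.
  apply: (le_trans (ler_norm_sum _ _ _)); apply: ler_sum => i _.
  by rewrite normrM ler_wpM2r.
have btC a b t : bt a b t = bt b a t by rewrite /bt addrC.
have Hx n : `|g (xn n, hn n) - g (u, hn n)| <= \sum_(i <- s) Cm * \int[mu]_x (bt u (xn n) x * `|aT (tr i) (x, hn n)|).
  have B a b := @bnd (fun x => vx (x, hn n)) (fun i x => aT (tr i) (x, hn n)) a b
    (fun i => @aT_itg R (tr i) (hn n)) (vxb (hn n)) (mslice2 (hn n) (mvx s tr mgam)).
  have [ux|xu] := leP u (xn n); first by rewrite gx.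
  rewrite distrC gx// ?(ltW xu)//; apply: (le_trans (B _ _)); rewrite le_eqVlt; apply/orP; left; apply/eqP.
  by apply: eq_bigr => i _; congr (_ * _); apply: rint_eq => x; rewrite btC.
have Hy n : `|g (u, hn n) - g (u, y)| <= \sum_(i <- s) Cm * \int[mu]_h (bt y (hn n) h * `|bT (tr i) (u, h)|).
  have B a b := @bnd (fun h => vy (u, h)) (fun i h => bT (tr i) (u, h)) a b
    (fun i => @bT_itg R (tr i) u) (vyb u) (mslice1 u (mvy s tr mgam)).
  have [ux|xu] := leP y (hn n); first by rewrite gy.
  rewrite distrC gy// ?(ltW xu)//; apply: (le_trans (B _ _)); rewrite le_eqVlt; apply/orP; left; apply/eqP.
  by apply: eq_bigr => i _; congr (_ * _); apply: rint_eq => x; rewrite btC.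
apply/cvgrPdist_le => e e0; move/cvgrPdist_le : cE => /(_ _ e0); apply: filterS => n.
rewrite sub0r normrN => h; apply: (le_trans _ h); apply: le_trans (ler_norm _).
have -> : g (u, y) - g (xn n, hn n) = - ((g (xn n, hn n) - g (u, hn n)) + (g (u, hn n) - g (u, y))) by ring.
by rewrite normrN (le_trans (ler_normD _ _))// lerD.
Qed.

Lemma g_cont (u y e : R) : 0 < y -> 0 < e -> exists2 eta : R, 0 < eta &
  forall x h : R, 0 < h -> `|x - u| < eta -> `|h - y| < eta -> `|g (x, h) - g (u, y)| <= e.
Proof.
move=> y0 e0; apply: contrapT => H.
have /choice[f Hf] : forall n : nat, exists z : R * R, [/\ 0 < z.2, `|z.1 - u| < n.+1%:R^-1,
    `|z.2 - y| < n.+1%:R^-1 & e < `|g (z.1, z.2) - g (u, y)|].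
  move=> n; apply: contrapT => K; apply: H; exists n.+1%:R^-1; first by rewrite invr_gt0.
  by move=> x h h0 hx hy; rewrite leNgt; apply/negP => eg; apply: K; exists (x, h).
have lim (k : nat -> R) c : (forall n, `|k n - c| < n.+1%:R^-1) -> k n @[n --> \oo] --> c.
  move=> kc; apply/cvgrPdist_le => d d0; near=> n.
  rewrite distrC (le_trans (ltW (kc n)))// ltW//.
  by near: n; exact: (near_infty_natSinv_lt (PosNum d0)).
have := @g_cont_seq u y (fun n => (f n).1) (fun n => (f n).2) y0.
move=> /(_ (fun n => let: And4 a _ _ _ := Hf n in a)).
move=> /(_ (lim _ _ (fun n => let: And4 _ a _ _ := Hf n in a))).
move=> /(_ (lim _ _ (fun n => let: And4 _ _ a _ := Hf n in a))).
move/cvgrPdist_le => /(_ _ e0)[N _ /(_ N (leqnn _))] /=.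
by have [_ _ _] := Hf N; rewrite distrC ltNge => /negP.
Unshelve. all: by end_near. Qed.

Local Notation bdK := (bdK g).
Local Notation WK := (WK s gam tr).

(** The two horizontal sides shrink away. On the sides at distance s from q the form restricts, up
    to sign, to two Cauchy kernels of width s, centred at the height of q and at its mirror image.
    The first selects pi g(q) on each side; the second is centred outside the rectangle and
    contributes nothing in the limit. *)
Lemma strip_lim (q : pt) (h1 h2 : R) (sn : nat -> R) : 0 < h1 -> h1 < q.2 -> q.2 < h2 ->
  (forall n, 0 < sn n) -> sn n @[n --> \oo] --> 0 ->
  bdK q (q.1 - sn n) (q.1 + sn n) h1 h2 @[n --> \oo] --> - (2 * pi * g q).
Proof.
move=> h10 h1q qh2 s0 cs; set u : R := q.1; set y : R := q.2.
have y0 : 0 < y := lt_trans h10 h1q.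
have Cg0 : 0 <= Cg := le_trans (normr_ge0 _) (bg (0, 0)).
have hor (h : R) : \int[mu]_x (ind (u - sn n) (u + sn n) x * (g (x, h) * aK (x, h) q)) @[n --> \oo] --> 0.
  rewrite -[X in _ --> X](rint0 mu).
  apply: (@dct _ _ _ _ _ _ (fun x => Cg * `|aK (x, h) q|)).
  - by move=> n; exact: itg_meas (gaK_itg mg bg q _ _ _).
  - exact: measurable_cst.
  - exact/itgZ/itg_norm/(aK_itg h q).1.
  - move=> n x; rewrite !normrM mulrA ler_wpM2r// -[leRHS]mul1r ler_pM ?ind_norm//.
  - apply: filterS (ae_neq u) => x xu; apply: cvg_near_cst.
    have xu0 : 0 < `|x - u| by rewrite normr_gt0 subr_eq0.
    move/cvgrPdist_lt : cs => /(_ _ xu0); apply: filterS => n; rewrite sub0r normrN gtr0_norm// => sx.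
    rewrite (_ : ind _ _ _ = 0) ?mul0r//; rewrite /ind.
    case: (boolP (_ && _)) => // /andP[l1 l2].
    by move: sx; rewrite ltNge ler_norml; case/negP; apply/andP; split; lra.
have near_in (c : R) : c = y \/ c = - y -> forall e : R, 0 < e -> exists2 eta : R, 0 < eta &
    \forall n \near \oo, forall (sg h : R), `|sg| = 1 -> `|h - c| < eta ->
      `|ind h1 h2 h * g (u + sg * sn n, h) - (if c == y then g q else 0)| <= e.
  move=> cy e e0; case: cy => cE; last first.
    exists h1 => //; apply: nearW => n sg h _ hc.
    have -> : c == y = false by rewrite cE eq_sym gt_eqF// ltrNl oppr0 || (rewrite cE; apply/negbTE; rewrite lt_eqF//; lra).
    rewrite (_ : ind h1 h2 h = 0) ?mul0r ?subr0 ?normr0 ?ltW//.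
    rewrite /ind; case: (boolP (_ && _)) => // /andP[l1 l2].
    by move: hc; rewrite cE opprK ltr_norml => /andP[_ l3]; lra.
  have [eta eta0 He] := @g_cont u y e y0 e0.
  pose eta' := Num.min eta (Num.min (y - h1) (h2 - y)).
  have m0 : 0 < eta' by rewrite !lt_min eta0 !subr_gt0 h1q.
  exists eta' => //.
  move/cvgrPdist_lt : cs => /(_ _ eta0); apply: filterS => n; rewrite sub0r normrN gtr0_norm// => sx sg h sg1.
  rewrite cE eqxx !lt_min => /and3P[l1 l2 l3].
  have hin : h1 < h <= h2.
    move: l2 l3; rewrite !ltr_norml => /andP[a1 a2] /andP[a3 a4].
    by apply/andP; split; [lra|apply: ltW; lra].
  rewrite /ind hin mul1r (surjective_pairing q); apply: He.
  - by case/andP: hin => a _; exact: lt_trans h10 a.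
  - by rewrite addrC addKr normrM sg1 mul1r gtr0_norm.
  - exact: l1.
have ver (sg c : R) : `|sg| = 1 -> c = y \/ c = - y ->
    \int[mu]_h ((ind h1 h2 h * g (u + sg * sn n, h)) * cau (sn n) c h) @[n --> \oo] -->
    pi * (if c == y then g q else 0).
  move=> sg1 cy; apply: (@poisson_lim R _ sn Cg) => //.
  - move=> n; apply: mfM; first by apply: mind; msr.
    exact: (mslice1 (u + sg * sn n) mg).
  - by move=> n h; rewrite normrM -[leRHS]mul1r ler_pM ?ind_norm.
  - move=> e e0; have [eta eta0 H] := near_in c cy e e0; exists eta => //.
    by apply: filterS H => n Hn h hc; exact: Hn.
have yN : - y == y = false by apply/negbTE; rewrite lt_eqF//; lra.
have vert (sg : R) (xs : nat -> R) : `|sg| = 1 -> sg * sg = 1 -> (forall n, xs n = u + sg * sn n) ->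
    \int[mu]_h (ind h1 h2 h * (g (xs n, h) * bK (xs n, h) q)) @[n --> \oo] --> sg * (pi * g q).
  move=> sg1 sgg /funext ->.
  have E n : \int[mu]_h (ind h1 h2 h * (g (u + sg * sn n, h) * bK (u + sg * sn n, h) q)) =
     sg * (\int[mu]_h ((ind h1 h2 h * g (u + sg * sn n, h)) * cau (sn n) y h) +
           \int[mu]_h ((ind h1 h2 h * g (u + sg * sn n, h)) * cau (sn n) (- y) h)).
    have Ic c : itg mu (fun h => (ind h1 h2 h * g (u + sg * sn n, h)) * cau (sn n) c h).
      apply: (@itg_mulb _ _ _ _ _ _ Cg); last exact: (cau_itg _ _).1.
        by apply: mfM; [by apply: mind; msr|exact: (mslice1 (u + sg * sn n) mg)].
      by move=> h; rewrite normrM -[leRHS]mul1r ler_pM ?ind_norm.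
    rewrite -rintD; [|exact: Ic|exact: Ic].
    rewrite -rintZ; last exact: itgD.
    apply: rint_eq => h; rewrite bKE -/u -/y.
    have cs' c : cau (u + sg * sn n - u) c h = sg * cau (sn n) c h.
      rewrite /cau (addrC u) addrK exprMn (_ : sg ^+ 2 = 1) ?mul1r -?mulrA//.
    by rewrite !cs'; ring.
  rewrite (funext E) (_ : sg * (pi * g q) = sg * (pi * g q + 0)); last by rewrite addr0.
  apply: cvgMl_tmp; apply: cvgD.
    by have := ver sg y sg1 (or_introl erefl); rewrite eqxx.
  by have := ver sg (- y) sg1 (or_intror erefl); rewrite yN mulr0.
rewrite /bdK.
have -> : - (2 * pi * g q) = 0 - 0 - 1 * (pi * g q) + (-1) * (pi * g q) by ring.
apply: cvgD; [apply: cvgB; [apply: cvgB; exact: hor|]|].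
  by apply: vert; rewrite ?normr1 ?mulr1// => n; rewrite mul1r.
by apply: vert; rewrite ?normrN1 ?mulrNN ?mulr1// => n; rewrite mulN1r.
Qed.

(** The rectangle is cut into a thin strip around the source and two pieces away from it, and the
    strip is shrunk. The residue 2 pi g(q) records that the angle winds once around q. *)
Lemma stokes_near (q : pt) (x1 x2 h1 h2 : R) : 0 < h1 -> x1 < q.1 -> q.1 < x2 ->
  h1 < q.2 -> q.2 < h2 ->
  bdK q x1 x2 h1 h2 = \int[mu2]_p (indR x1 x2 h1 h2 p * WK q p) - 2 * pi * g q.
Proof.
move=> h10 x1u ux2 h1y yh2; set u : R := q.1; set y : R := q.2.
have y0 : 0 < y := lt_trans h10 h1y; have h12 : h1 <= h2 by rewrite ltW// (lt_trans h1y).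
pose e := Num.min (u - x1) (x2 - u).
have e0 : 0 < e by rewrite lt_min !subr_gt0 x1u.
pose sn n : R := e * n.+1%:R^-1.
have sn0 n : 0 < sn n by rewrite mulr_gt0// invr_gt0.
have sne n : sn n <= e by rewrite ler_piMr ?(ltW e0)// invf_le1// ler1n.
have cs : sn n @[n --> \oo] --> 0.
  rewrite -[X in _ --> X](mulr0 e); apply: cvgMl_tmp; exact: cvg_harmonic.
have sx1 n : x1 <= u - sn n by have := sne n; rewrite le_min => /andP[a _]; lra.
have sx2 n : u + sn n <= x2 by have := sne n; rewrite le_min => /andP[_ a]; lra.
have far n a b : a <= b -> (forall x : R, a <= x <= b -> sn n <= `|x - u|) ->
    itg mu2 (fun p => indR a b h1 h2 p * WK q p) /\
    bdK q a b h1 h2 = \int[mu2]_p (indR a b h1 h2 p * WK q p).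
  move=> ab H; apply: (@stokes_far R g Cg I s gam tr Cm mg bg mgam bgam gx gy q a b h1 h2 (sn n)) => //; first exact: ltW.
  move=> x h xb _; rewrite /rsq /= -/u; apply: (@le_trans _ _ ((x - u) ^+ 2)); last by rewrite lerDl sqr_ge0.
  by rewrite -[leRHS]real_normK ?num_real// !expr2 ler_pM ?(ltW (sn0 n))//; exact: H.
have IW := (@WK_itg R I s gam tr Cm mgam bgam q x1 x2 h1 h2 h10 (ltW y0)).1.
have E n : bdK q x1 x2 h1 h2 - bdK q (u - sn n) (u + sn n) h1 h2 =
    \int[mu2]_p ((ind x1 (u - sn n) p.1 + ind (u + sn n) x2 p.1) * (indR x1 x2 h1 h2 p * WK q p)).
  have f1 (x : R) : x1 <= x <= u - sn n -> sn n <= `|x - u|.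
    by move=> /andP[_ xb]; rewrite distrC; apply: le_trans (ler_norm _); lra.
  have f2 (x : R) : u + sn n <= x <= x2 -> sn n <= `|x - u|.
    by move=> /andP[xb _]; apply: le_trans (ler_norm _); lra.
  have [I1 E1] := far n _ _ (sx1 n) f1.
  have [I2 E2] := far n _ _ (sx2 n) f2.
  have su : u - sn n <= u + sn n by have := sn0 n; lra.
  rewrite (@bdK_split R g Cg mg bg q x1 (u - sn n) x2)// ?(le_trans su)//.
  rewrite (@bdK_split R g Cg mg bg q (u - sn n) (u + sn n) x2)//.
  have ar (a b c : R) : a + (b + c) - b = a + c by ring.
  rewrite ar E1 E2 -rintD//.
  apply: rint_eq => p; rewrite /indR.
  have a1 : ind x1 (u - sn n) p.1 * ind x1 x2 p.1 = ind x1 (u - sn n) p.1.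
    rewrite /ind; case: (boolP (x1 < p.1 <= u - sn n)) => [/andP[l1 l2]|_]; last by rewrite mul0r.
    by rewrite l1 (le_trans l2)// ?mul1r// (le_trans su).
  have a2 : ind (u + sn n) x2 p.1 * ind x1 x2 p.1 = ind (u + sn n) x2 p.1.
    rewrite /ind; case: (boolP (u + sn n < p.1 <= x2)) => [/andP[l1 l2]|_]; last by rewrite mul0r.
    by rewrite l2 (le_lt_trans _ l1) ?mul1r// (le_trans (sx1 n)).
  by rewrite -[in LHS]a1 -[in LHS]a2; ring.
have L1 : bdK q x1 x2 h1 h2 - bdK q (u - sn n) (u + sn n) h1 h2 @[n --> \oo] -->
    bdK q x1 x2 h1 h2 - - (2 * pi * g q).
  by apply: cvgB; [exact: cvg_cst|exact: strip_lim].
have L2 : bdK q x1 x2 h1 h2 - bdK q (u - sn n) (u + sn n) h1 h2 @[n --> \oo] -->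
    \int[mu2]_p (indR x1 x2 h1 h2 p * WK q p).
  rewrite (funext E).
  apply: (@dct _ _ _ _ _ _ (fun p => `|indR x1 x2 h1 h2 p * WK q p|)).
  - move=> n; apply: mfM; last exact: itg_meas IW.
    by apply: mfD; apply: mind; msr.
  - exact: itg_meas IW.
  - exact: itg_norm.
  - move=> n p; rewrite normrM -[leRHS]mul1r ler_wpM2r//.
    rewrite /ind; have := sn0 n; case: (boolP (x1 < p.1 <= u - sn n)) => [/andP[l1 l2]|_] sp.
      rewrite (_ : u + sn n < p.1 = false) /= ?addr0 ?normr1//.
      by apply/negbTE; rewrite -leNgt; apply: (le_trans l2); lra.
    by rewrite add0r norm_bool_le1.
  - apply: filterS (ae_line1 u) => p pu; apply: cvg_near_cst.
    have pu0 : 0 < `|p.1 - u : R| by rewrite normr_gt0 subr_eq0.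
    move/cvgrPdist_lt : cs => /(_ _ pu0); apply: filterS => n; rewrite sub0r normrN gtr0_norm// => sx.
    have key : (ind x1 (u - sn n) p.1 + ind (u + sn n) x2 p.1) * ind x1 x2 p.1 = ind x1 x2 p.1.
      rewrite /ind; case: (boolP (x1 < p.1 <= x2)) => [/andP[l1 l2]|_]; last by rewrite !mulr0.
      rewrite mulr1 l1 l2 andbT /=; move: sx; set t : R := p.1; case: (ltP t u) => tu.
        rewrite ltr0_norm ?subr_lt0// => sx.
        have -> : t <= u - sn n by lra.
        have -> : u + sn n < t = false by apply/negbTE; rewrite -leNgt; have := sn0 n; lra.
        by rewrite addr0.
      rewrite ger0_norm ?subr_ge0// => sx.
      have -> : t <= u - sn n = false by apply/negbTE; rewrite -ltNge; have := sn0 n; lra.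
      have -> : u + sn n < t by lra.
      by rewrite add0r.
    by rewrite /indR mulrA [_ * (ind x1 x2 p.1 * _)]mulrA key.
have := cvg_lim (@Rhausdorff R) L1; rewrite (cvg_lim (@Rhausdorff R) L2) => ->.
by rewrite opprK addrK.
Qed.

Definition bdT (t : tree) (x1 x2 h1 h2 : R) : R :=
  \int[mu]_x (ind x1 x2 x * (g (x, h2) * aT t (x, h2)))
  - \int[mu]_x (ind x1 x2 x * (g (x, h1) * aT t (x, h1)))
  - \int[mu]_h (ind h1 h2 h * (g (x2, h) * bT t (x2, h)))
  + \int[mu]_h (ind h1 h2 h * (g (x1, h) * bT t (x1, h))).

Lemma source_swap t (k : rT -> pt -> R) (c : rT -> R) : measurable_fun setT c ->
  (forall x, `|c x| <= Cg) ->
  measurable_fun setT (fun z : rT * pt => k z.1 z.2) ->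
  (forall q, itg mu (k ^~ q) /\ \int[mu]_x `|k x q| <= 2 * pi) ->
  itg (mtree R t) (fun q => dens t q * \int[mu]_x (c x * k x q)) /\
  \int[mu]_x (c x * \int[mtree R t]_q (k x q * dens t q)) =
  \int[mtree R t]_q (dens t q * \int[mu]_x (c x * k x q)).
Proof.
move=> mc bc mk Hk; have [I1 _] := line_itg t (twopi_ge0 R) mk Hk.
have I2 : itg (sprod mu (mtree R t)) (fun z => c z.1 * (k z.1 z.2 * dens t z.2)).
  by apply: (@itg_mulb _ _ _ _ _ _ Cg) => //; apply: (measurableT_comp mc); msr.
have E q : \int[mu]_x (c x * (k x q * dens t q)) = dens t q * \int[mu]_x (c x * k x q).
  rewrite -rintZ; first by apply: rint_eq => x; ring.
  by apply: (@itg_mulb _ _ _ _ _ _ Cg) => //; exact: (Hk q).1.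
split; first by apply: itg_eq (fub_itg2 I2) => q; exact: E.
have := fubR I2; rewrite /= (rint_eq _ E) => <-.
apply: rint_ae; [by apply: mfM => //; exact: itg_meas (fub_itg1 I1)|exact: itg_meas (fub_itg1 I2)|].
by apply: filterS (fub_ae1 I1) => x Ix; rewrite rintZ.
Qed.

(** A leaf lies on the boundary of the half plane, below the rectangle, and an inner vertex avoids
    the four side lines almost everywhere; so almost every source is covered by the far or by the
    near case. *)
Lemma ae_generic t (x1 x2 h1 h2 : R) : 0 < h1 -> {ae mtree R t, forall q : pt,
  (q.2 < h1)%R \/ [/\ q.1 != x1, q.1 != x2, q.2 != h1 & q.2 != h2]}.
Proof.
move=> h10; case: t => [b|l r] /=.
  exists [set~ ept R b]; split.
  - by apply: measurableC; exact: measurable_pt1.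
  - by rewrite diracE (_ : ept R b \in _ = false)//; apply/negbTE/negP => /set_mem/=.
  - by move=> q /= nq qb; apply: nq; left; rewrite qb.
apply: filterS (filterI (filterI (ae_line1 x1) (ae_line1 x2)) (filterI (ae_line2 h1) (ae_line2 h2))).
by move=> q [[a b] [c d]]; right.
Qed.

(** The formulas for one source, averaged over the density of t. For constant g it says that the
    one-form of t has exterior derivative 2 pi times the density of t. *)
Lemma stokes_tree t (x1 x2 h1 h2 : R) : x1 <= x2 -> 0 < h1 -> h1 <= h2 ->
  [/\ itg mu2 (fun p => indR x1 x2 h1 h2 p * (vy p * aT t p - vx p * bT t p)),
      itg (mtree R t) (fun q => indR x1 x2 h1 h2 q * (g q * dens t q)) &
  bdT t x1 x2 h1 h2 = \int[mu2]_p (indR x1 x2 h1 h2 p * (vy p * aT t p - vx p * bT t p))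
    - 2 * pi * \int[mtree R t]_q (indR x1 x2 h1 h2 q * (g q * dens t q))].
Proof.
move=> x12 h10 h12.
have mix : measurable_fun setT (ind x1 x2 : rT -> R) by apply: mind; msr.
have mih : measurable_fun setT (ind h1 h2 : rT -> R) by apply: mind; msr.
have bx (a b h x : R) : `|ind a b x * g (x, h)| <= Cg.
  by rewrite normrM -[leRHS]mul1r ler_pM ?ind_norm.
have by_ (a b x h : R) : `|ind a b h * g (x, h)| <= Cg.
  by rewrite normrM -[leRHS]mul1r ler_pM ?ind_norm.
have SA (h : R) := @source_swap t (fun x q => aK (x, h) q) (fun x => ind x1 x2 x * g (x, h))
  (mfM mix (mslice2 h mg)) (bx _ _ h) (maK (f := fun z : rT * pt => (z.1, h)) (g := snd) ltac:(msr) ltac:(msr)) (fun q => aK_itg h q).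
have SB (x : R) := @source_swap t (fun h q => bK (x, h) q) (fun h => ind h1 h2 h * g (x, h))
  (mfM mih (mslice1 x mg)) (by_ _ _ x) (mbK (f := fun z : rT * pt => (x, z.1)) (g := snd) ltac:(msr) ltac:(msr)) (fun q => bK_itg x q).
have as1 (f k : rT -> R) (i : rT -> R) : \int[mu]_x (i x * (f x * k x)) = \int[mu]_x ((i x * f x) * k x).
  by apply: rint_eq => x; rewrite mulrA.
have EB : bdT t x1 x2 h1 h2 = \int[mtree R t]_q (dens t q * bdK q x1 x2 h1 h2).
  rewrite /bdT !as1 (SA h2).2 (SA h1).2 (SB x2).2 (SB x1).2.
  rewrite -rintB; [|exact: (SA h2).1|exact: (SA h1).1].
  rewrite -rintB; [|by apply: itgB; [exact: (SA h2).1|exact: (SA h1).1]|exact: (SB x2).1].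
  rewrite -rintD; [|by apply: itgB; [apply: itgB; [exact: (SA h2).1|exact: (SA h1).1]|exact: (SB x2).1]|exact: (SB x1).1].
  by apply: rint_eq => q; rewrite /bdK !as1; ring.
have mF : measurable_fun setT (fun z : pt * pt => dens t z.1 * (indR x1 x2 h1 h2 z.2 * WK z.1 z.2)).
  have mm1 : measurable_fun setT (fun z : pt * pt => dens t z.1) by apply: (measurableT_comp (@mdens R t)); msr.
  have mm2 : measurable_fun setT (fun z : pt * pt => indR x1 x2 h1 h2 z.2) by apply: (measurableT_comp (@mindR R x1 x2 h1 h2)); msr.
  exact: (mfM mm1 (mfM mm2 (@mWK R I s gam tr mgam))).
pose CC := \sum_(i <- s) Cm * (CJ R * ndens R (tr i)).
have HW q : dens t q != 0 -> _ := fun d0 => @WK_itg R I s gam tr Cm mgam bgam q x1 x2 h1 h2 h10 (dens_supp d0).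
have IF : itg (sprod (mtree R t) mu2) (fun z => dens t z.1 * (indR x1 x2 h1 h2 z.2 * WK z.1 z.2)).
  apply: (@ton1 _ _ _ _ _ _ _ _ (fun q => CC * `|dens t q|)) => //.
  - exact/itgZ/itg_norm/dens_itg.
  - move=> q /=; have [->|d0] := eqVneq (dens t q) 0; first by apply: itg_eq (itg0 _) => p; rewrite mul0r.
    exact: (itgZ (dens t q) (HW q d0).1).
  - move=> q /=; have [->|d0] := eqVneq (dens t q) 0.
      by rewrite normr0 mulr0 (rint_eq _ (g := fun=> 0)) ?rint0// => p; rewrite mul0r normr0.
    rewrite (rint_eq _ (g := fun p => `|dens t q| * `|indR x1 x2 h1 h2 p * WK q p|)); last first.
      by move=> p; rewrite normrM.
    rewrite rintZ; last exact/itg_norm/(HW q d0).1.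
    by rewrite mulrC ler_wpM2r//; exact: (HW q d0).2.
have IG : itg (mtree R t) (fun q => indR x1 x2 h1 h2 q * (g q * dens t q)).
  apply: (@itg_mulb _ _ _ _ _ _ 1); [exact: mindR|exact: indR_norm|].
  by apply: (@itg_mulb _ _ _ _ _ _ Cg) => //; exact: dens_itg.
have mB : measurable_fun setT (fun q => dens t q * bdK q x1 x2 h1 h2).
  have m1 := itg_meas (SA h2).1; have m2 := itg_meas (SA h1).1.
  have m3 := itg_meas (SB x2).1; have m4 := itg_meas (SB x1).1.
  have := mfD (mfD (mfD m1 (mfN m2)) (mfN m3)) m4.
  by congr measurable_fun; apply/funext => q; rewrite /bdK !as1; ring.
have mA : measurable_fun setT (fun p => indR x1 x2 h1 h2 p * (vy p * aT t p - vx p * bT t p)).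
  apply: mfM; first exact: mindR.
  apply: mfD; [|apply: mfN]; apply: mfM; [exact: mvy|exact: maT|exact: mvx|exact: mbT].
have aeA : {ae mu2, forall p, \int[mtree R t]_q (dens t q * (indR x1 x2 h1 h2 p * WK q p)) =
    indR x1 x2 h1 h2 p * (vy p * aT t p - vx p * bT t p)}.
  apply: filterS (filterI (@aK_dens_ae R t) (@bK_dens_ae R t)) => p [Ia Ib].
  rewrite (rint_eq _ (g := fun q => (indR x1 x2 h1 h2 p * vy p) * (aK p q * dens t q)
     - (indR x1 x2 h1 h2 p * vx p) * (bK p q * dens t q))); last first.
    by move=> q; rewrite /WK; ring.
  by rewrite rintB; [rewrite !rintZ// /aT /bT; ring|exact: itgZ|exact: itgZ].
split=> //; first exact: itg_ae (fub_itg2 IF) mA aeA.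
rewrite EB (@rint_ae _ _ _ _ _ (fun q => (\int[mu2]_p (dens t q * (indR x1 x2 h1 h2 p * WK q p)))
   - 2 * pi * (indR x1 x2 h1 h2 q * (g q * dens t q)))) //.
- rewrite rintB; [|exact: (fub_itg1 IF)|exact: itgZ].
  rewrite rintZ//; congr (_ - _); rewrite (fubR IF) /=.
  exact: rint_ae (itg_meas (fub_itg2 IF)) mA aeA.
- by apply: mfD; [exact: itg_meas (fub_itg1 IF)|apply: mfN; exact: itg_meas (itgZ _ IG)].
- apply: filterS (ae_generic t x1 x2 h2 h10) => q gq.
  have [->|d0] := eqVneq (dens t q) 0.
    by rewrite mul0r !mulr0 subr0 (rint_eq _ (g := fun=> 0)) ?rint0// => p; rewrite mul0r.
  have q0 := dens_supp d0; rewrite rintZ; last exact: (HW q d0).1.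
  (* A source beyond any of the four sides is treated alike, [dl] being its distance from the line
     of that side. *)
  have farE (dl : R) : 0 < dl -> (forall x h : R, x1 <= x <= x2 -> h1 <= h <= h2 -> dl ^+ 2 <= rsq (x, h) q) ->
      indR x1 x2 h1 h2 q = 0 ->
      dens t q * bdK q x1 x2 h1 h2 = dens t q * \int[mu2]_p (indR x1 x2 h1 h2 p * WK q p) -
        2 * pi * (indR x1 x2 h1 h2 q * (g q * dens t q)).
    move=> dl0 far ->; rewrite mul0r mulr0 subr0; congr (_ * _).
    exact: (@stokes_far R g Cg I s gam tr Cm mg bg mgam bgam gx gy q x1 x2 h1 h2 dl x12 h10 h12 q0 dl0 far).2.
  have sq (a b : R) : 0 < a -> a <= `|b| -> a ^+ 2 <= b ^+ 2.
    by move=> a0 ab; rewrite -[leRHS]real_normK ?num_real// !expr2 ler_pM ?(ltW a0).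
  have [ql|ql] := ltP (q.2 : R) h1.
    apply: (farE (h1 - q.2)); first by rewrite subr_gt0.
      move=> x h _ /andP[hl _]; apply: (@le_trans _ _ ((h - q.2) ^+ 2)); last by rewrite /rsq /= lerDr sqr_ge0.
      apply: sq; rewrite ?subr_gt0//; apply: le_trans (ler_norm _); by apply: lerB => //; apply: ltW.
    by rewrite /indR {2}/ind ltNge (ltW ql) mulr0.
  case: gq => [|[n1 n2 n3 n4]]; first by rewrite ltNge ql.
  have q1 : h1 < q.2 by rewrite lt_def n3 ql.
  have [qh|qh] := ltP h2 (q.2 : R).
    apply: (farE (q.2 - h2)); first by rewrite subr_gt0.
      move=> x h _ /andP[_ hl]; apply: (@le_trans _ _ ((h - q.2) ^+ 2)); last by rewrite /rsq /= lerDr sqr_ge0.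
      apply: sq; rewrite ?subr_gt0// distrC; apply: le_trans (ler_norm _); by apply: lerB => //; apply: ltW.
    by rewrite /indR {2}/ind [X in _ && X]leNgt qh andbF mulr0.
  have q2 : q.2 < h2 by rewrite lt_def eq_sym n4 qh.
  have [qx|qx] := ltP (q.1 : R) x1.
    apply: (farE (x1 - q.1)); first by rewrite subr_gt0.
      move=> x h /andP[hl _] _; apply: (@le_trans _ _ ((x - q.1) ^+ 2)); last by rewrite /rsq /= lerDl sqr_ge0.
      apply: sq; rewrite ?subr_gt0//; apply: le_trans (ler_norm _); by apply: lerB => //; apply: ltW.
    by rewrite /indR {1}/ind ltNge (ltW qx) mul0r.
  have [qy|qy] := ltP x2 (q.1 : R).
    apply: (farE (q.1 - x2)); first by rewrite subr_gt0.
      move=> x h /andP[_ hl] _; apply: (@le_trans _ _ ((x - q.1) ^+ 2)); last by rewrite /rsq /= lerDl sqr_ge0.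
      apply: sq; rewrite ?subr_gt0// distrC; apply: le_trans (ler_norm _); by apply: lerB => //; apply: ltW.
    by rewrite /indR {1}/ind [X in _ && X]leNgt qy andbF mul0r.
  have q3 : x1 < q.1 by rewrite lt_def n1 qx.
  have q4 : q.1 < x2 by rewrite lt_def eq_sym n2 qy.
  rewrite stokes_near// (_ : indR x1 x2 h1 h2 q = 1); first by ring.
  by rewrite /indR /ind q1 q3 (ltW q2) (ltW q4) mulr1.
Qed.

End SourceStokes.

(** * Bracketings of words *)

Fixpoint brkn (n : nat) (w : seq bool) : seq tree :=
  match n with
  | 0 => [::]
  | n'.+1 => match w with
    | [::] => [::]
    | [:: b] => [:: leaf b]
    | _ => flatten [seq [seq node l r | l <- brkn n' (take k w), r <- brkn n' (drop k w)]
                   | k <- index_iota 1 (size w)]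
    end
  end.

(** All plane binary trees whose leaves, read from left to right, spell [w]. The length serves as
    fuel, since the recursion on the two parts of a cut is not structural. *)
Definition brk (w : seq bool) : seq tree := brkn (size w) w.

Lemma brknSE n b c (w : seq bool) : brkn n.+1 [:: b, c & w] =
  flatten [seq [seq node l r | l <- brkn n (take k [:: b, c & w]), r <- brkn n (drop k [:: b, c & w])]
          | k <- index_iota 1 (size w).+2].
Proof. by []. Qed.

Lemma brkn_stable n m w : (size w <= n)%N -> (size w <= m)%N -> brkn n w = brkn m w.
Proof.
elim: n m w => [|n IH] [|m] w //.
- by rewrite leqn0 => /nilP ->.
- by move=> _; rewrite leqn0 => /nilP ->.
case: w => [|b [|c w]]// sn sm; rewrite !brknSE.
congr (flatten _); apply/eq_in_map => k; rewrite mem_index_iota => /andP[k0 kw].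
have st : (size (take k (b :: c :: w)) <= (size w).+1)%N.
  by rewrite size_takel ?(ltnW kw)// -ltnS.
have sd : (size (drop k (b :: c :: w)) <= (size w).+1)%N by rewrite size_drop; case: k k0 {kw st} => // k _; rewrite subSS leq_subr.
rewrite (IH m (take k (b :: c :: w))) ?(leq_trans st)//.
by rewrite (IH m (drop k (b :: c :: w))) ?(leq_trans sd).
Qed.

Lemma brk1 b : brk [:: b] = [:: leaf b]. Proof. by []. Qed.

Lemma sum_brk (V : nmodType) (phi : tree -> V) (w : seq bool) : (1 < size w)%N ->
  \sum_(T <- brk w) phi T = \sum_(1 <= k < size w) \sum_(l <- brk (take k w))
    \sum_(r <- brk (drop k w)) phi (node l r).
Proof.
case: w => [|b [|c w]]// _; rewrite /brk -[X in brkn X _]/(size w).+2.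
rewrite brknSE big_flatten big_map.
rewrite [LHS]big_seq [RHS]big_seq; apply: eq_bigr => k; rewrite mem_index_iota => /andP[k0 kw].
have st : (size (take k (b :: c :: w)) <= (size w).+1)%N.
  by rewrite size_takel ?(ltnW kw)// -ltnS.
have sd : (size (drop k (b :: c :: w)) <= (size w).+1)%N by rewrite size_drop; case: k k0 {kw st} => // k _; rewrite subSS leq_subr.
rewrite big_allpairs_dep (@brkn_stable (size w).+1 (size (take k (b :: c :: w))))//.
by apply: eq_bigr => l _; rewrite (@brkn_stable (size w).+1 (size (drop k (b :: c :: w)))).
Qed.

(** Cutting a word and then its remainder is the same as choosing two nested cut positions; through
    this exchange the associativity of concatenation enters the flatness computation. *)
Lemma sum_triangle (V : nmodType) (F : nat -> nat -> V) n :
  \sum_(0 <= j < n) \sum_(1 <= i < n - j) F j (i + j)%N = \sum_(0 <= k < n) \sum_(0 <= j < k) F j k.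
Proof.
have E j : \sum_(1 <= i < n - j) F j (i + j)%N = \sum_(j.+1 <= k < n) F j k.
  by rewrite -[in RHS](add1n j) big_addn.
rewrite (eq_bigr _ (fun j _ => E j)); move: {E} n => n.
elim: n => [|n IH]; first by rewrite !big_geq.
rewrite big_nat_recr//= [RHS]big_nat_recr//= -IH [X in _ + X]big_geq// addr0 -big_split /=.
rewrite !big_nat; apply: eq_bigr => j /andP[_ jn]; by rewrite big_nat_recr.
Qed.

(** * Path-ordered exponentials along the line, word by word *)

Section IteratedIntegrals.
Variable R : realType.
Local Notation mu := (@lebesgue_measure R).
Local Notation rT := (measurableTypeR R).
Implicit Types (al : seq bool -> rT -> R) (w : seq bool).

(** The coefficient of [w] in the solution of g' = g al with value 1 at minus infinity, where al is
    the sum of [al v] times v over words v in two noncommuting letters. Only nonempty suffixes are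
    split off because al has no constant term. *)
Fixpoint ITn (n : nat) al w (x : rT) : R :=
  match n with
  | 0 => 1
  | n'.+1 => if w is [::] then 1 else
      \sum_(0 <= k < size w) \int[mu]_t (lft x t * (ITn n' al (take k w) t * al (drop k w) t))
  end.

Definition IT al w := ITn (size w) al w.

(** The value of the solution at plus infinity, that is the holonomy of the whole line. *)
Definition HT al w : R := if w is [::] then 1 else
  \sum_(0 <= k < size w) \int[mu]_t (IT al (take k w) t * al (drop k w) t).

Lemma ITn_stable n m al w : (size w <= n)%N -> (size w <= m)%N -> ITn n al w = ITn m al w.
Proof.
elim: n m w => [|n IH] [|m] w //.
- by rewrite leqn0 => /nilP ->.
- by move=> _; rewrite leqn0 => /nilP ->.
case: w => [|b w]// sn sm; apply/funext => x; rewrite [LHS]/= [RHS]/=.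
rewrite !big_nat; apply: eq_bigr => k /andP[_ kw]; apply: rint_eq => t.
have st : (size (take k (b :: w)) <= size w)%N.
  by rewrite size_takel ?(ltnW kw)// -ltnS.
by rewrite (IH m (take k (b :: w))) ?(leq_trans st).
Qed.

Lemma IT0 al x : IT al [::] x = 1. Proof. by []. Qed.

Lemma ITE al w x : w != [::] ->
  IT al w x = \sum_(0 <= k < size w) \int[mu]_t (lft x t * (IT al (take k w) t * al (drop k w) t)).
Proof.
case: w => [|b w]// _; rewrite {1}/IT [LHS]/=.
rewrite !big_nat; apply: eq_bigr => k /andP[_ kw]; apply: rint_eq => t.
rewrite (@ITn_stable (size w) (size (take k (b :: w))))//.
by rewrite size_takel ?(ltnW kw)// -ltnS.
Qed.

Lemma word_ind (P : seq bool -> Prop) :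
  (forall w, (forall v, (size v < size w)%N -> P v) -> P w) -> forall w, P w.
Proof.
move=> H w; have [n le_n] := ubnP (size w); elim: n w le_n => // n IH w le_n.
by apply: H => v vw; apply: IH; rewrite (leq_trans vw).
Qed.

Lemma size_take_lt w k : (k < size w)%N -> (size (take k w) < size w)%N.
Proof. by move=> kw; rewrite size_take kw. Qed.

Definition line_ok (N : seq bool -> R) al := forall v, itg mu (al v) /\ \int[mu]_t `|al v t| <= N v.

(** The constant is chosen before [al] and depends on the norms [N] alone, which later gives bounds
    uniform in the height of the line. *)
Lemma IT_bound (N : seq bool -> R) w : exists2 C : R, 0 <= C & forall al, line_ok N al ->
  measurable_fun setT (IT al w) /\ forall x, `|IT al w x| <= C.
Proof.
elim/word_ind: w => w IH; have [->|w0] := eqVneq w [::].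
  by exists 1 => // al _; split => [|x]; [exact: measurable_cst|rewrite IT0 normr1].
have /choice[C HC] : forall k, exists C : R, (k < size w)%N -> 0 <= C /\ forall al, line_ok N al ->
    measurable_fun setT (IT al (take k w)) /\ forall x, `|IT al (take k w) x| <= C.
  move=> k; have [kw|_] := ltnP k (size w); last by exists 0.
  by have [C C0 H] := IH _ (size_take_lt kw); exists C => _; split.
exists (\sum_(0 <= k < size w) `|C k| * `|N (drop k w)|).
  by apply: sumr_ge0 => k _; rewrite mulr_ge0.
move=> al ok; split.
  have -> : IT al w = fun x => \sum_(0 <= k < size w)
      \int[mu]_t (lft x t * (IT al (take k w) t * al (drop k w) t)).
    by apply/funext => x; rewrite ITE.
  (* The list is filtered and the summand guarded so that every summand is measurable, although the
     induction hypothesis covers only cuts below the length of the word. *)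
  rewrite (_ : (fun x => _) = fun x => \sum_(k <- [seq k <- index_iota 0 (size w) | (k < size w)%N])
      \int[mu]_t (lft x t * (if (k < size w)%N then IT al (take k w) t * al (drop k w) t else 0))); last first.
    apply/funext => x; rewrite big_filter big_nat [RHS]big_nat_cond; apply: eq_big => [k|k /andP[_ kw]].
      by case: (k < size w)%N; rewrite ?andbF ?andbT.
    by rewrite kw.
  apply: mfsum => k; apply: (@mrint1 _ _ _ _ _ mu (fun z : rT * rT => lft z.1 z.2 *
      (if (k < size w)%N then IT al (take k w) z.2 * al (drop k w) z.2 else 0))).
  apply: mfM; first by apply: mlft; msr.
  case: (boolP (k < size w)%N) => kw; last exact: measurable_cst.
  have [_ /(_ al ok)[m _]] := HC k kw.
  apply: mfM; [exact: (measurableT_comp m)|].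
  exact: (measurableT_comp (itg_meas (ok (drop k w)).1)).
move=> x; rewrite ITE// (le_trans (ler_norm_sum _ _ _))// big_nat [leRHS]big_nat.
apply: ler_sum => k /andP[_ kw]; have [C0 /(_ al ok)[m b]] := HC k kw.
have [Ia La] := ok (drop k w).
have Ip : itg mu (fun t => IT al (take k w) t * al (drop k w) t) by apply: (@itg_mulb _ _ _ _ _ _ (C k)).
apply: (@le_trans _ _ (\int[mu]_t (C k * `|al (drop k w) t|))).
  apply: rint_bound; [exact: itg_lft|exact/itgZ/itg_norm|].
  move=> t; rewrite !normrM -[leRHS]mul1r ler_pM ?norm_bool_le1 ?mulr_ge0//.
  by rewrite ler_wpM2r.
rewrite rintZ; last exact: itg_norm.
by rewrite ler_pM ?rint_ge0// ?ler_norm// (le_trans La)// ler_norm.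
Qed.

Lemma IT_term_itg N al w k : line_ok N al -> itg mu (fun t => IT al (take k w) t * al (drop k w) t).
Proof.
move=> ok; have [C _ /(_ al ok)[m b]] := IT_bound N (take k w).
by apply: (@itg_mulb _ _ _ _ _ _ C) => //; exact: (ok _).1.
Qed.

Lemma rint_lft_lim (f : rT -> R) : itg mu f ->
  \int[mu]_t (lft n%:R t * f t) @[n --> \oo] --> \int[mu]_t f t /\
  \int[mu]_t (lft (- n%:R) t * f t) @[n --> \oo] --> (0 : R).
Proof.
move=> If; have b (x t : R) : `|lft x t * f t| <= `|f t|.
  by rewrite normrM -[leRHS]mul1r ler_wpM2r// norm_bool_le1.
have nr (t : R) : \forall n \near \oo, t <= (n%:R : R).
  by near=> n; near: n; exact: nbhs_infty_ger.
split.
  apply: (@dct _ _ _ _ _ _ (fun t => `|f t|)).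
  - by move=> n; exact: itg_meas (itg_lft _ If).
  - exact: itg_meas If.
  - exact: itg_norm.
  - by move=> n t; exact: b.
  - apply: nearW => t; apply: cvg_near_cst; apply: filterS (nr t) => n tn.
    by rewrite /lft tn mul1r.
rewrite -[X in _ --> X](rint0 mu).
apply: (@dct _ _ _ _ _ _ (fun t => `|f t|)).
- by move=> n; exact: itg_meas (itg_lft _ If).
- exact: measurable_cst.
- exact: itg_norm.
- by move=> n t; exact: b.
- apply: nearW => t; apply: cvg_near_cst; apply: filterS (nr (1 - t)) => n tn.
  by rewrite /lft (_ : t <= - n%:R = false) ?mul0r//; apply/negbTE; rewrite -ltNge; lra.
Unshelve. all: by end_near. Qed.

Lemma IT_lim N al w : line_ok N al ->
  IT al w n%:R @[n --> \oo] --> HT al w /\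
  (w != [::] -> IT al w (- n%:R) @[n --> \oo] --> (0 : R)).
Proof.
move=> ok; case: w => [|b w]; first by split => //; exact: cvg_cst.
split => [|_].
  have E n : IT al (b :: w) n%:R = _ := ITE al n%:R (isT : b :: w != [::]).
  rewrite (funext E) /HT; apply: cvg_sumr => k.
  exact: (rint_lft_lim (IT_term_itg (b :: w) k ok)).1.
have E n : IT al (b :: w) (- n%:R) = _ := ITE al (- n%:R) (isT : b :: w != [::]).
rewrite (funext E) [X in _ --> X](_ : (0 : R) = \sum_(0 <= k < size (b :: w)) 0); last by rewrite big1.
apply: cvg_sumr => k.
exact: (rint_lft_lim (IT_term_itg (b :: w) k ok)).2.
Qed.

(** A difference of products splits into a difference of prefixes, uniformly small by induction, and
    a difference of forms, small in L1. *)
Lemma IT_stab (N : seq bool -> R) (al be : nat -> seq bool -> rT -> R) w :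
  (forall n, line_ok N (al n)) -> (forall n, line_ok N (be n)) ->
  (forall v, (0 < size v)%N -> \int[mu]_t `|al n v t - be n v t| @[n --> \oo] --> (0 : R)) ->
  exists2 e : nat -> R, e n @[n --> \oo] --> (0 : R) &
    forall n x, `|IT (al n) w x - IT (be n) w x| <= e n.
Proof.
move=> oka okb ab; elim/word_ind: w => w IH; have [->|w0] := eqVneq w [::].
  by exists (fun=> 0) => [|n x]; [exact: cvg_cst|rewrite !IT0 subrr normr0].
have /choice[e He] : forall k, exists e : nat -> R, (k < size w)%N ->
    e n @[n --> \oo] --> (0 : R) /\ forall n x, `|IT (al n) (take k w) x - IT (be n) (take k w) x| <= e n.
  move=> k; have [kw|_] := ltnP k (size w); last by exists (fun=> 0).
  by have [e e0 H] := IH _ (size_take_lt kw); exists e => _; split.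
have /choice[C HC] : forall k, exists C : R, 0 <= C /\ forall al, line_ok N al ->
    measurable_fun setT (IT al (take k w)) /\ forall x, `|IT al (take k w) x| <= C.
  by move=> k; have [C C0 H] := IT_bound N (take k w); exists C.
pose D k n := \int[mu]_t `|al n (drop k w) t - be n (drop k w) t|.
pose E n := \sum_(k <- [seq k <- index_iota 0 (size w) | (k < size w)%N])
  (if (k < size w)%N then `|e k n| * `|N (drop k w)| + C k * D k n else 0).
exists E.
  rewrite /E [X in _ --> X](_ : (0 : R) = \sum_(k <- [seq k <- index_iota 0 (size w) | (k < size w)%N]) 0); last by rewrite big1.
  apply: cvg_sumr => k; case: (boolP (k < size w)%N) => kw; last exact: cvg_cst.
  have [ek _] := He k kw.
  rewrite -[X in _ --> X]addr0; apply: cvgD.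
    rewrite -[X in _ --> X](mul0r `|N (drop k w)|); apply: cvgMr_tmp.
    by rewrite -(normr0 R); exact: cvg_norm.
  rewrite -[X in _ --> X](mulr0 (C k)); apply: cvgMl_tmp; apply: ab.
  by rewrite size_drop subn_gt0.
move=> n x; rewrite !ITE// -sumrB (le_trans (ler_norm_sum _ _ _))// /E big_filter.
rewrite big_nat [leRHS]big_nat_cond [leRHS](eq_bigl (fun k => (0 <= k < size w)%N)); last first.
  by move=> k; case: (k < size w)%N; rewrite ?andbF ?andbT.
apply: ler_sum => k /andP[_ kw]; rewrite kw.
have [_ ee] := He k kw; have [C0 HCk] := HC k.
have [ma ba] := HCk _ (oka n); have [mb bb] := HCk _ (okb n).
have [Ia La] := oka n (drop k w); have [Ib Lb] := okb n (drop k w).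
have Ipa := IT_term_itg w k (oka n); have Ipb := IT_term_itg w k (okb n).
rewrite -rintB; [|exact: itg_lft|exact: itg_lft].
apply: (@le_trans _ _ (\int[mu]_t (`|e k n| * `|al n (drop k w) t| + C k * `|al n (drop k w) t - be n (drop k w) t|))).
  apply: rint_bound.
  - by apply: itgB; exact: itg_lft.
  - by apply: itgD; [exact/itgZ/itg_norm|exact/itgZ/itg_norm/itgB].
  - move=> t; rewrite -mulrBr normrM (le_trans (ler_wpM2r (normr_ge0 _) (norm_bool_le1 _ _)))// mul1r.
    have -> : IT (al n) (take k w) t * al n (drop k w) t - IT (be n) (take k w) t * be n (drop k w) t =
       (IT (al n) (take k w) t - IT (be n) (take k w) t) * al n (drop k w) t +
       IT (be n) (take k w) t * (al n (drop k w) t - be n (drop k w) t) by ring.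
    rewrite (le_trans (ler_normD _ _))// !normrM lerD// ler_wpM2r//.
    by rewrite (le_trans (ee n t))// ler_norm.
rewrite rintD; [|exact/itgZ/itg_norm|exact/itgZ/itg_norm/itgB].
rewrite (rintZ _ (itg_norm Ia)) (rintZ _ (itg_norm (itgB Ia Ib))).
by rewrite lerD// ler_wpM2l// (le_trans La)// ler_norm.
Qed.

Lemma HT_stab (N : seq bool -> R) (al be : nat -> seq bool -> rT -> R) w :
  (forall n, line_ok N (al n)) -> (forall n, line_ok N (be n)) ->
  (forall v, (0 < size v)%N -> \int[mu]_t `|al n v t - be n v t| @[n --> \oo] --> (0 : R)) ->
  HT (al n) w - HT (be n) w @[n --> \oo] --> (0 : R).
Proof.
move=> oka okb ab; have [e e0 He] := IT_stab w oka okb ab.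
apply/cvgrPdist_le => d d0; move/cvgrPdist_le : e0 => /(_ _ d0); apply: filterS => n.
rewrite !sub0r !normrN => ed.
have ca := (IT_lim w (oka n)).1; have cb := (IT_lim w (okb n)).1.
have L : `|IT (al n) w m%:R - IT (be n) w m%:R| @[m --> \oo] --> `|HT (al n) w - HT (be n) w|.
  by apply: cvg_norm; exact: cvgB.
have U : \forall m \near \oo, `|IT (al n) w m%:R - IT (be n) w m%:R| <= d.
  by apply: nearW => m; rewrite (le_trans (He n _))// (le_trans (ler_norm _)).
exact: (ler_cvg_to L (cvg_cst d) U).
Qed.

End IteratedIntegrals.

(** * Flatness, and independence of the holonomy of the height *)

Section Transport.
Variable R : realType.
Local Notation mu := (@lebesgue_measure R).
Local Notation mu2 := (sprod mu mu).
Local Notation rT := (measurableTypeR R).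
Local Notation pt := (pt R).

(** By Tonelli the L1 norm of the average is at most the average of the L1 norms over the sources,
    and the bound on lines dominates these. *)
Lemma kern_lim t (kn : nat -> rT -> pt -> R) (C : R) : 0 <= C ->
  (forall n, measurable_fun setT (fun z : rT * pt => kn n z.1 z.2)) ->
  (forall n q, itg mu (kn n ^~ q) /\ \int[mu]_x `|kn n x q| <= C) ->
  {ae mtree R t, forall q, dens t q != 0 -> \int[mu]_x `|kn n x q| @[n --> \oo] --> (0 : R)} ->
  \int[mu]_x `|\int[mtree R t]_q (kn n x q * dens t q)| @[n --> \oo] --> (0 : R).
Proof.
move=> C0 mk Hk H.
have LI n := line_itg t C0 (mk n) (Hk n); have I1 n := (LI n).1.
pose Ph n q := \int[mu]_x `|kn n x q * dens t q|.
have PhE n q : Ph n q = `|dens t q| * \int[mu]_x `|kn n x q|.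
  rewrite /Ph -rintZ; last exact/itg_norm/(Hk n q).1.
  by apply: rint_eq => x; rewrite normrM mulrC.
have lim : \int[mtree R t]_q Ph n q @[n --> \oo] --> \int[mtree R t]_q 0.
  apply: (@dct _ _ _ _ _ _ (fun q => C * `|dens t q|)).
  - by move=> n; exact: itg_meas (fub_itg2 (itg_norm (I1 n))).
  - exact: measurable_cst.
  - exact/itgZ/itg_norm/dens_itg.
  - move=> n q; rewrite PhE ger0_norm ?mulr_ge0 ?rint_ge0// mulrC ler_wpM2r//; exact: (Hk n q).2.
  - apply: filterS H => q Hq; have [d0|d0] := eqVneq (dens t q) 0.
      have E n : Ph n q = 0 by rewrite PhE d0 normr0 mul0r.
      by rewrite (funext E); exact: cvg_cst.
    rewrite (funext (PhE ^~ q)) -[X in _ --> X](mulr0 `|dens t q|); apply: cvgMl_tmp; exact: Hq.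
rewrite rint0 in lim; apply: squeeze0 lim; apply: nearW => n; apply/andP; split; first exact: rint_ge0.
rewrite -(fubR (itg_norm (I1 n))); apply: rint_le_ae.
- exact/itg_norm/(fub_itg1 (I1 n)).
- exact: (fub_itg1 (itg_norm (I1 n))).
- by apply: filterS (fub_ae1 (I1 n)) => x Ix; exact: rint_norm.
Qed.

(** Chosen for flatness: a tree with n leaves is scaled by [kap ^+ n.-1], so that splitting it at
    its root leaves one factor, and 2 pi [kap] = -1 cancels the factor in [stokes_tree]. *)
Definition kap : R := - (2 * pi)^-1.

Lemma kapE : - (2 * pi) * kap = 1 :> R.
Proof. by rewrite /kap mulrNN mulfV// mulf_neq0// gt_eqF// pi_gt0. Qed.

Definition aW (w : seq bool) (p : pt) : R := \sum_(T <- brk w) kap ^+ (size w).-1 * aT T p.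
Definition bW (w : seq bool) (p : pt) : R := \sum_(T <- brk w) kap ^+ (size w).-1 * bT T p.

Lemma maW w : measurable_fun setT (aW w).
Proof. by apply: mfsum => T; apply: mfM; [exact: measurable_cst|exact: maT]. Qed.

Definition NW (w : seq bool) : R := \sum_(T <- brk w) `|kap ^+ (size w).-1| * (2 * pi * ndens R T).

Lemma aW_ok h : line_ok NW (fun v t => aW v (t, h)).
Proof.
move=> v; have I T : itg mu (fun t => kap ^+ (size v).-1 * aT T (t, h)).
  by apply: itgZ; exact: (@aT_itg R T h).
split; first exact: itg_sum.
apply: (@le_trans _ _ (\int[mu]_t \sum_(T <- brk v) `|kap ^+ (size v).-1| * `|aT T (t, h)|)).
  apply: rint_le.
  - by apply: itg_norm; exact: itg_sum.
  - by apply: itg_sum => T; apply: itgZ; apply: itg_norm; exact: (@aT_itg R T h).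
  - move=> t; rewrite (le_trans (ler_norm_sum _ _ _))//; apply: ler_sum => T _; by rewrite normrM.
rewrite rint_sum; last by move=> T; apply: itgZ; apply: itg_norm; exact: (@aT_itg R T h).
apply: ler_sum => T _; rewrite rintZ; last by apply: itg_norm; exact: (@aT_itg R T h).
by rewrite ler_wpM2l//; exact: (aT_line T h).2.
Qed.

(** Transport along the horizontal line through p, from minus infinity up to p. *)
Definition gW (w : seq bool) (p : pt) : R := IT (fun v t => aW v (t, p.2)) w p.1.

Lemma gW_bound w : exists2 C : R, 0 <= C & forall p, `|gW w p| <= C.
Proof.
have [C C0 H] := IT_bound NW w; exists C => // p.
exact: (H _ (aW_ok p.2)).2.
Qed.

Lemma gWE w p : w != [::] -> gW w p = \sum_(0 <= k < size w)
  \int[mu]_t (lft p.1 t * (gW (take k w) (t, p.2) * aW (drop k w) (t, p.2))).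
Proof. by move=> w0; rewrite /gW ITE. Qed.

Lemma mgW w : measurable_fun setT (gW w).
Proof.
elim/word_ind: w => w IH; have [->|w0] := eqVneq w [::]; first exact: measurable_cst.
rewrite (_ : gW w = fun p => \sum_(k <- [seq k <- index_iota 0 (size w) | (k < size w)%N])
      \int[mu]_t (lft p.1 t * (if (k < size w)%N then gW (take k w) (t, p.2) * aW (drop k w) (t, p.2) else 0))); last first.
  apply/funext => p; rewrite gWE// big_filter big_nat [RHS]big_nat_cond; apply: eq_big => [k|k /andP[_ kw]].
    by case: (k < size w)%N; rewrite ?andbF ?andbT.
  by rewrite kw.
apply: mfsum => k; apply: (@mrint1 _ _ _ _ _ mu (fun z : pt * rT => lft z.1.1 z.2 *
    (if (k < size w)%N then gW (take k w) (z.2, z.1.2) * aW (drop k w) (z.2, z.1.2) else 0))).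
apply: mfM; first by apply: mlft; msr.
case: (boolP (k < size w)%N) => kw; last exact: measurable_cst.
have m : measurable_fun setT (fun z : pt * rT => (z.2, z.1.2) : pt) by msr.
by apply: mfM; [exact: (measurableT_comp (IH _ (size_take_lt kw)) m)|exact: (measurableT_comp (maW _) m)].
Qed.

(** The terms in the derivative of [gW w]: a cut of the word and a tree on the suffix. This indexing
    casts the transport equation in the shape that [stokes_tree] requires. *)
Definition sW (w : seq bool) : seq (nat * tree) :=
  [seq (k, T) | k <- index_iota 0 (size w), T <- brk (drop k w)].
Definition cfW (w : seq bool) (i : nat * tree) : R := kap ^+ (size w - i.1).-1.
Definition gamW (w : seq bool) (i : nat * tree) (p : pt) : R := cfW w i * gW (take i.1 w) p.
Definition vxW w := vx (sW w) (gamW w) snd.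
Definition vyW w := vy (sW w) (gamW w) snd.

Lemma sum_sW (V : nmodType) w (phi : nat * tree -> V) : \sum_(i <- sW w) phi i =
  \sum_(0 <= k < size w) \sum_(T <- brk (drop k w)) phi (k, T).
Proof. by rewrite /sW big_allpairs_dep. Qed.

Lemma vxE w p : vxW w p = \sum_(0 <= k < size w) gW (take k w) p * aW (drop k w) p.
Proof.
rewrite /vxW /vx sum_sW; apply: eq_bigr => k _; rewrite /aW mulr_sumr.
by apply: eq_bigr => T _; rewrite /gamW /cfW /= size_drop; ring.
Qed.

Lemma vyE w p : vyW w p = \sum_(0 <= k < size w) gW (take k w) p * bW (drop k w) p.
Proof.
rewrite /vyW /vy sum_sW; apply: eq_bigr => k _; rewrite /bW mulr_sumr.
by apply: eq_bigr => T _; rewrite /gamW /cfW /= size_drop; ring.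
Qed.

Lemma mgamW w i : measurable_fun setT (gamW w i).
Proof. by apply: mfM; [exact: measurable_cst|exact: mgW]. Qed.

Lemma kap_norm : `|kap| <= 1.
Proof.
rewrite /kap normrN normfV invf_le1 ?normr_gt0; last by rewrite mulf_neq0// gt_eqF// pi_gt0.
by rewrite ger0_norm ?mulr_ge0 ?pi_ge0// (le_trans (ler1n R 2))// ler_peMr// (le_trans _ (pi_ge2 R))// ler1n.
Qed.

Lemma gamW_bound w : exists2 C : R, 0 <= C & forall i p, `|gamW w i p| <= C.
Proof.
have /choice[C HC] : forall v, exists C : R, 0 <= C /\ forall p, `|gW v p| <= C.
  by move=> v; have [C C0 H] := gW_bound v; exists C.
exists (\sum_(k < (size w).+1) C (take k w)).
  by apply: sumr_ge0 => k _; exact: (HC _).1.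
move=> [k T] p; rewrite /gamW normrM -[leRHS]mul1r ler_pM//.
  by rewrite /cfW normrX exprn_ile1// kap_norm.
pose m := minn k (size w); have mw : (m < (size w).+1)%N by rewrite ltnS geq_minr.
have -> : take k w = take m w.
  by rewrite /m; case: (leqP k (size w)) => h //; rewrite take_size take_oversize// ltnW.
rewrite (bigD1 (Ordinal mw))//= (le_trans ((HC _).2 p))// lerDl.
by apply: sumr_ge0 => i _; exact: (HC _).1.
Qed.

Lemma gW_x w (h x1 x2 : R) : x1 <= x2 ->
  gW w (x2, h) - gW w (x1, h) = \int[mu]_t (ind x1 x2 t * vxW w (t, h)).
Proof.
move=> x12; have [->|w0] := eqVneq w [::].
  rewrite /gW !IT0 subrr -(rint0 mu); apply: rint_eq => t.
  by rewrite vxE big_geq ?mulr0.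
rewrite !gWE//= -sumrB.
have I k := IT_term_itg w k (aW_ok h).
rewrite (rint_eq _ (g := fun t : rT => \sum_(0 <= k < size w) ind x1 x2 t * (gW (take k w) (t, h) * aW (drop k w) (t, h)))); last first.
  by move=> t; rewrite vxE mulr_sumr.
rewrite rint_sum; last by move=> k; apply: itg_ind; exact: I.
apply: eq_bigr => k _; rewrite -rintB; [|exact: (itg_lft x2 (I k))|exact: (itg_lft x1 (I k))].
by apply: rint_eq => t; rewrite -mulrBl lft_ind.
Qed.

(** The density with respect to plane measure; leaves contribute 0 as they lie on the boundary,
    outside every rectangle considered. *)
Definition dT (t : tree) (p : pt) : R := if t is node _ _ then dens t p else 0.

Lemma ae_sum_eq (I : Type) (s : seq I) (f g : I -> pt -> R) :
  (forall i, {ae mu2, forall p, f i p = g i p}) ->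
  {ae mu2, forall p, \sum_(i <- s) f i p = \sum_(i <- s) g i p}.
Proof.
move=> H; elim: s => [|i s IH]; first by apply: nearW => p; rewrite !big_nil.
by apply: filterS (filterI (H i) IH) => p [h1 h2]; rewrite !big_cons h1 h2.
Qed.

(** Under summation over all bracketings, the cut at the root of a tree becomes a cut of the word,
    and [dens_nodeE] turns the density into a product of one-forms; one factor [kap] is left
    over. *)
Lemma dW_ae v : {ae mu2, forall p, \sum_(T <- brk v) kap ^+ (size v).-1 * dT T p =
  \sum_(1 <= k < size v) kap * (up p * (aW (take k v) p * bW (drop k v) p - bW (take k v) p * aW (drop k v) p))}.
Proof.
have [v1|v1] := leqP (size v) 1.
  apply: nearW => p; rewrite [RHS]big_geq//.
  by case: v v1 => [|b [|]]// _; rewrite /brk ?big_nil// big_seq1 mulr0.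
have H := @ae_sum_eq _ (brk v) (fun T p => dT T p).
pose G (T : tree) p : R := if T is node l r then up p * (aT l p * bT r p - bT l p * aT r p) else 0.
have HG : {ae mu2, forall p, \sum_(T <- brk v) dT T p = \sum_(T <- brk v) G T p}.
  by apply: ae_sum_eq => -[b|l r]; [exact: nearW|exact: dens_nodeE].
apply: filterS HG => p Hp; rewrite -mulr_sumr Hp sum_brk// mulr_sumr.
rewrite !big_nat; apply: eq_bigr => k /andP[k1 kv].
have -> : kap ^+ (size v).-1 = kap * (kap ^+ k.-1 * kap ^+ (size v - k).-1).
  by rewrite -exprD -exprS; congr (_ ^+ _); lia.
have E (f : tree -> pt -> R) : \sum_(T <- brk (take k v)) kap ^+ (size (take k v)).-1 * f T p =
    kap ^+ k.-1 * \sum_(T <- brk (take k v)) f T p by rewrite size_take kv mulr_sumr.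
have E' (f : tree -> pt -> R) : \sum_(T <- brk (drop k v)) kap ^+ (size (drop k v)).-1 * f T p =
    kap ^+ (size v - k).-1 * \sum_(T <- brk (drop k v)) f T p by rewrite size_drop mulr_sumr.
rewrite /aW /bW !E !E' /=.
rewrite (_ : \sum_(l <- _) _ = up p * ((\sum_(T <- brk (take k v)) aT T p) * (\sum_(T <- brk (drop k v)) bT T p)
   - (\sum_(T <- brk (take k v)) bT T p) * (\sum_(T <- brk (drop k v)) aT T p))); first by ring.
rewrite !mulr_suml -sumrB mulr_sumr; apply: eq_bigr => l _.
by rewrite !mulr_sumr -sumrB mulr_sumr; apply: eq_bigr => r _.
Qed.

(** For a fixed source the kernel on a distant vertical segment is at most 2 divided by the
    horizontal distance; the average over sources is then handled by [kern_lim]. *)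
Lemma bT_infty t (h1 h2 : R) (sg : R) : `|sg| = 1 -> 0 < h1 ->
  \int[mu]_r `|\int[mtree R t]_q ((ind h1 h2 r * bK (sg * n%:R, r) q) * dens t q)| @[n --> \oo] --> (0 : R).
Proof.
move=> sg1 h10; have b n q (r : rT) : `|ind h1 h2 r * bK (sg * n%:R, r) q| <= `|bK (sg * n%:R, r) q|.
  by rewrite normrM -[leRHS]mul1r ler_wpM2r// ind_norm.
have Ib n q := (bK_itg (sg * n%:R) q).1.
apply: (@kern_lim t (fun n r q => ind h1 h2 r * bK (sg * n%:R, r) q) (2 * pi) (twopi_ge0 R)).
- move=> n; apply: mfM; first by apply: mind; msr.
  by apply: mbK; msr.
- move=> n q; split; first exact: itg_ind (Ib n q).
  apply: (le_trans _ (bK_itg (sg * n%:R) q).2); apply: rint_le => //.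
  + by apply: itg_norm; exact: itg_ind (Ib n q).
  + exact: itg_norm.
apply: nearW => q d0; have q0 := dens_supp d0.
have [hh|hh] := leP h1 h2; last first.
  rewrite (_ : (fun n => _) = fun=> 0); first exact: cvg_cst.
  apply/funext => n; rewrite -[RHS](rint0 mu); apply: rint_eq => r; rewrite /ind.
  case: (boolP (_ && _)) => [/andP[a c]|_]; last by rewrite mul0r normr0.
  by move: (lt_le_trans a c); rewrite ltNge (ltW hh).
have L : (h2 - h1) * 2 / (n.+1%:R : R) @[n --> \oo] --> (0 : R).
  rewrite -[X in _ --> X](mulr0 ((h2 - h1) * 2)); apply: cvgMl_tmp; exact: cvg_harmonic.
have L2 : (h2 - h1) * (2 / (n%:R - `|q.1|)) @[n --> \oo] --> (0 : R).
  have L3 : ((n%:R : R) - `|q.1|)^-1 @[n --> \oo] --> (0 : R).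
    apply/cvgrPdist_le => e e0; near=> n; rewrite sub0r normrN.
    have n1 : e^-1 + `|q.1| <= (n%:R : R) by near: n; exact: nbhs_infty_ger.
    have ei : 0 < e^-1 by rewrite invr_gt0.
    have p0 : 0 < (n%:R : R) - `|q.1| by lra.
    rewrite gtr0_norm ?invr_gt0// -[leRHS]invrK lef_pV2 ?posrE ?invr_gt0//; lra.
  rewrite -[X in _ --> X](mulr0 (h2 - h1)); apply: cvgMl_tmp.
  rewrite -[X in _ --> X](mulr0 2); exact: cvgMl_tmp.
apply: squeeze0 L2; near=> n; apply/andP; split; first exact: rint_ge0.
have n1 : 1 + `|q.1| <= (n%:R : R) by near: n; exact: nbhs_infty_ger.
have p0 : 0 < (n%:R : R) - `|q.1| by lra.
apply: (@le_trans _ _ (\int[mu]_r (2 / (n%:R - `|q.1|) * ind h1 h2 r))).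
  apply: rint_le; [by apply: itg_norm; exact: itg_ind (Ib n q)|by apply: itgZ; exact: ind_itg|].
  move=> r; rewrite normrM (ger0_norm (ind_ge0 _ _ _)) mulrC.
  have [->|i0] := eqVneq (ind h1 h2 r) 0; first by rewrite !mulr0.
  have [r1 r2] := ind_pos i0; rewrite ler_wpM2r ?ind_ge0//.
  have [] := @K_bound R (sg * n%:R, r) q (n%:R - `|q.1|) p0 _ (lt_trans h10 r1) q0; last by [].
  apply: (@le_trans _ _ ((sg * n%:R - q.1) ^+ 2)); last by rewrite /rsq /= lerDl sqr_ge0.
  rewrite -[leRHS]real_normK ?num_real// !expr2.
  have : n%:R - `|q.1| <= `|sg * n%:R - q.1|.
    have := ler_normD (sg * n%:R - q.1) q.1; rewrite subrK normrM sg1 mul1r ger0_norm ?ler0n//.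
    by lra.
  by move=> H; rewrite ler_pM// ltW.
by rewrite rintZ; [rewrite rint_ind// mulrC|exact: ind_itg].
Unshelve. all: by end_near. Qed.

Lemma vyW_infty w (h1 h2 : R) (sg : R) : `|sg| = 1 -> 0 < h1 ->
  \int[mu]_r (ind h1 h2 r * vyW w (sg * n%:R, r)) @[n --> \oo] --> (0 : R).
Proof.
move=> sg1 h10; have [C C0 bC] := gamW_bound w.
have L : \sum_(i <- sW w) C * \int[mu]_r `|\int[mtree R i.2]_q ((ind h1 h2 r * bK (sg * n%:R, r) q) * dens i.2 q)|
    @[n --> \oo] --> (0 : R).
  rewrite [X in _ --> X](_ : (0 : R) = \sum_(i <- sW w) C * 0); last by rewrite big1// => i _; rewrite mulr0.
  by apply: cvg_sumr => i; apply: cvgMl_tmp; exact: bT_infty.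
apply/cvgrPdist_le => e e0; move/cvgrPdist_le : L => /(_ _ e0); apply: filterS => n.
rewrite !sub0r !normrN => H; apply: le_trans H; apply: le_trans (ler_norm _).
have [Iv _] := @vy_line R _ (sW w) (gamW w) snd C (mgamW w) bC (sg * n%:R).
have Ib t : itg mu (fun r => ind h1 h2 r * bT t (sg * n%:R, r)) by apply: itg_ind; exact: (@bT_itg R t _).
have Eb t (r : R) : itg (mtree R t) (fun q => bK (sg * n%:R, r) q * dens t q) ->
    \int[mtree R t]_q ((ind h1 h2 r * bK (sg * n%:R, r) q) * dens t q) = ind h1 h2 r * bT t (sg * n%:R, r).
  by move=> I; rewrite /bT -rintZ//; apply: rint_eq => q; rewrite mulrA.
rewrite (eq_bigr (fun i => C * \int[mu]_r `|ind h1 h2 r * bT i.2 (sg * n%:R, r)|)); last first.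
  move=> i _; congr (_ * _); have [I1 _] := @bT_line R i.2 (sg * n%:R).
  apply: rint_ae; [apply: mfnorm| by apply: mfnorm; exact: itg_meas (Ib _)|].
    apply: (@mrint1 _ _ _ _ _ (mtree R i.2) (fun z => ind h1 h2 z.1 * bK (sg * n%:R, z.1) z.2 * dens i.2 z.2)).
    apply: mfM; last by apply: (measurableT_comp (@mdens R i.2)); msr.
    by apply: mfM; [apply: mind; msr|apply: mbK; msr].
  by apply: filterS (fub_ae1 I1) => r Ir; rewrite Eb.
have IS : itg mu (fun r => \sum_(i <- sW w) C * `|ind h1 h2 r * bT i.2 (sg * n%:R, r)|).
  by apply: itg_sum => i; apply: itgZ; exact: itg_norm.
apply: (@le_trans _ _ (\int[mu]_r \sum_(i <- sW w) C * `|ind h1 h2 r * bT i.2 (sg * n%:R, r)|)).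
  apply: rint_bound => //; first exact: itg_ind.
  move=> r; rewrite /vyW /vy mulr_sumr (le_trans (ler_norm_sum _ _ _))//; apply: ler_sum => i _.
  by rewrite mulrCA normrM ler_wpM2r.
rewrite rint_sum; last by move=> i; apply: itgZ; exact: itg_norm.
by rewrite le_eqVlt; apply/orP; left; apply/eqP; apply: eq_bigr => i _; rewrite rintZ//; exact: itg_norm.
Qed.

Lemma gW_lim w (h : R) : gW w (n%:R, h) @[n --> \oo] --> HT (fun v t => aW v (t, h)) w /\
  (w != [::] -> gW w (- n%:R, h) @[n --> \oo] --> (0 : R)).
Proof. exact: (IT_lim w (aW_ok h)). Qed.

(** [gW] solves the transport equation horizontally by definition; vertically this is flatness. The
    defect of the vertical equation is independent of x, since Stokes' formula turns its variation
    into the integral of the curvature, and it vanishes as x tends to minus infinity. The induction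
    on the word supplies the vertical equation for the shorter prefixes, which Stokes' formula
    multiplies with the forms of the suffixes. *)
Lemma gW_y w (x h1 h2 : R) : 0 < h1 -> h1 <= h2 ->
  gW w (x, h2) - gW w (x, h1) = \int[mu]_r (ind h1 h2 r * vyW w (x, r)).
Proof.
elim/word_ind: w x h1 h2 => w IH x h1 h2 h10 h12; have [->|w0] := eqVneq w [::].
  rewrite /gW !IT0 subrr -(rint0 mu); apply: rint_eq => t.
  by rewrite vyE big_geq ?mulr0.
have [C C0 bC] := gamW_bound w.
have ST (x1 : R) k T : x1 <= x -> (k < size w)%N ->
  [/\ itg mu2 (fun p => indR x1 x h1 h2 p * (vyW (take k w) p * aT T p - vxW (take k w) p * bT T p)),
      itg (mtree R T) (fun q => indR x1 x h1 h2 q * (gW (take k w) q * dens T q)) &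
   bdT (gW (take k w)) T x1 x h1 h2 =
   \int[mu2]_p (indR x1 x h1 h2 p * (vyW (take k w) p * aT T p - vxW (take k w) p * bT T p))
   - 2 * pi * \int[mtree R T]_q (indR x1 x h1 h2 q * (gW (take k w) q * dens T q))].
  move=> x1x kw; have [Cg Cg0 bg] := gW_bound (take k w); have [Cm Cm0 bm] := gamW_bound (take k w).
  apply: (@stokes_tree R (gW (take k w)) Cg _ (sW (take k w)) (gamW (take k w)) snd Cm) => //.
  - exact: mgW.
  - exact: mgamW.
  - by move=> h a b _; exact: gW_x.
  - by move=> a b c; apply: IH; exact: size_take_lt.
have DT (x1 : R) k T : x1 <= x -> (k < size w)%N ->
   itg mu2 (fun p => indR x1 x h1 h2 p * (gW (take k w) p * dT T p)) /\
   \int[mtree R T]_q (indR x1 x h1 h2 q * (gW (take k w) q * dens T q)) =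
   \int[mu2]_p (indR x1 x h1 h2 p * (gW (take k w) p * dT T p)).
  move=> x1x kw; have [_ I _] := ST x1 k T x1x kw; case: T I => [b|l r] I; last by [].
  split; first by apply: itg_eq (itg0 _) => p; rewrite /= !mulr0.
  rewrite [RHS](rint_eq _ (g := fun=> 0)) ?rint0; last by move=> p; rewrite /= !mulr0.
  rewrite -(rint0 (mtree R (leaf b))); apply: rint_ae; [exact: itg_meas I|exact: measurable_cst|].
  exists [set~ ept R b]; split.
  - by apply: measurableC; exact: measurable_pt1.
  - by rewrite /= diracE (_ : ept R b \in _ = false)//; apply/negbTE/negP => /set_mem/=.
  - move=> q /= nq qb; apply: nq; rewrite qb /indR /ept /= {2}/ind.
    by rewrite (_ : (h1 < 0)%R = false) ?mulr0 ?mul0r//; apply/negbTE; rewrite -leNgt ltW.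
pose Dx (x : R) := gW w (x, h2) - gW w (x, h1) - \int[mu]_r (ind h1 h2 r * vyW w (x, r)).
have cst (x1 : R) : x1 <= x -> Dx x = Dx x1.
  move=> x1x.
  have lx (h : R) : gW w (x, h) - gW w (x1, h) =
      \sum_(i <- sW w) cfW w i * \int[mu]_t (ind x1 x t * (gW (take i.1 w) (t, h) * aT i.2 (t, h))).
    rewrite gW_x// (rint_eq _ (g := fun t : rT => \sum_(i <- sW w) cfW w i * (ind x1 x t * (gW (take i.1 w) (t, h) * aT i.2 (t, h))))).
      have I i : itg mu (fun t => ind x1 x t * (gW (take i.1 w) (t, h) * aT i.2 (t, h))).
        have [Cg Cg0 bg] := gW_bound (take i.1 w); apply: itg_ind; apply: (@itg_mulb _ _ _ _ _ _ Cg) => //.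
          exact: mslice2 (mgW _).
        exact: (@aT_itg R i.2 h).
      rewrite rint_sum; last by move=> i; apply: itgZ; exact: I.
      by apply: eq_bigr => i _; rewrite rintZ//; exact: I.
    by move=> t; rewrite /vxW /vx mulr_sumr; apply: eq_bigr => i _; rewrite /gamW; ring.
  have ly (a : R) : \int[mu]_r (ind h1 h2 r * vyW w (a, r)) =
      \sum_(i <- sW w) cfW w i * \int[mu]_r (ind h1 h2 r * (gW (take i.1 w) (a, r) * bT i.2 (a, r))).
    rewrite (rint_eq _ (g := fun t : rT => \sum_(i <- sW w) cfW w i * (ind h1 h2 t * (gW (take i.1 w) (a, t) * bT i.2 (a, t))))).
      have I i : itg mu (fun t => ind h1 h2 t * (gW (take i.1 w) (a, t) * bT i.2 (a, t))).
        have [Cg Cg0 bg] := gW_bound (take i.1 w); apply: itg_ind; apply: (@itg_mulb _ _ _ _ _ _ Cg) => //.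
          exact: mslice1 (mgW _).
        exact: (@bT_itg R i.2 a).
      rewrite rint_sum; last by move=> i; apply: itgZ; exact: I.
      by apply: eq_bigr => i _; rewrite rintZ//; exact: I.
    by move=> t; rewrite /vyW /vy mulr_sumr; apply: eq_bigr => i _; rewrite /gamW; ring.
  have tot : Dx x - Dx x1 = \sum_(i <- sW w) cfW w i * bdT (gW (take i.1 w)) i.2 x1 x h1 h2.
    have ar (a b c e a' b' : R) : (a - b - c) - (a' - b' - e) = (a - a') - (b - b') - c + e by ring.
    have ar2 (k a b c e : R) : k * a - k * b - k * c + k * e = k * (a - b - c + e) by ring.
    by rewrite /Dx ar !lx !ly -!sumrB -big_split /=; apply: eq_bigr => i _; rewrite /bdT ar2.
  apply/eqP; rewrite -subr_eq0 tot sum_sW.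
  pose F k T p : R := indR x1 x h1 h2 p * (vyW (take k w) p * aT T p - vxW (take k w) p * bT T p)
     - 2 * pi * (indR x1 x h1 h2 p * (gW (take k w) p * dT T p)).
  have IF k T : (k < size w)%N -> itg mu2 (F k T).
    by move=> kw; have [I1 _ _] := ST x1 k T x1x kw; apply: itgB => //; apply: itgZ; exact: (DT x1 k T x1x kw).1.
  have IFs k : itg mu2 (fun p => if (k < size w)%N then \sum_(T <- brk (drop k w)) cfW w (k, T) * F k T p else 0).
    by case: (boolP (k < size w)%N) => kw; [apply: itg_sum => T; apply: itgZ; exact: IF|exact: itg0].
  rewrite (_ : \sum_(0 <= k < size w) _ = \sum_(0 <= k < size w) \int[mu2]_p
     (if (k < size w)%N then \sum_(T <- brk (drop k w)) cfW w (k, T) * F k T p else 0)); last first.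
    rewrite !big_nat; apply: eq_bigr => k /andP[_ kw]; rewrite kw rint_sum; last by move=> T; apply: itgZ; exact: IF.
    apply: eq_bigr => T _; rewrite rintZ; last exact: IF.
    have [I1 _ ->] := ST x1 k T x1x kw; have [I2 ->] := DT x1 k T x1x kw.
    by rewrite /F rintB//; [rewrite rintZ|exact: itgZ].
  rewrite -rint_sum//; apply/eqP; rewrite -[RHS](rint0 mu2); apply: rint_ae; [by apply: itg_meas; exact: itg_sum|exact: measurable_cst|].
  have AE : {ae mu2, forall p, \sum_(k <- index_iota 0 (size w)) gW (take k w) p * \sum_(T <- brk (drop k w)) kap ^+ (size (drop k w)).-1 * dT T p =
     \sum_(k <- index_iota 0 (size w)) gW (take k w) p * \sum_(1 <= j < size (drop k w)) kap * (up p * (aW (take j (drop k w)) p * bW (drop j (drop k w)) p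
        - bW (take j (drop k w)) p * aW (drop j (drop k w)) p))}.
    by apply: ae_sum_eq => k; apply: filterS (dW_ae (drop k w)) => p ->.
  apply: filterS AE => p Hp.
  have [i0|i0] := eqVneq (indR x1 x h1 h2 p) 0.
    by rewrite big1// => k _; case: ifP => // _; rewrite big1// => T _; rewrite /F i0 !mul0r mulr0 subr0 mulr0.
  have up1 : up p = 1.
    have : ind h1 h2 p.2 != 0 by apply: contra i0 => /eqP e; rewrite /indR e mulr0.
    by move=> /ind_pos[a _]; rewrite /up (lt_trans h10 a).
  rewrite (_ : \sum_(0 <= k < size w) _ = indR x1 x h1 h2 p * (
     \sum_(0 <= k < size w) (vyW (take k w) p * aW (drop k w) p - vxW (take k w) p * bW (drop k w) p)
     - 2 * pi * \sum_(k <- index_iota 0 (size w)) gW (take k w) p * \sum_(T <- brk (drop k w)) kap ^+ (size (drop k w)).-1 * dT T p)); last first.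
    rewrite mulr_sumr -sumrB mulr_sumr !big_nat; apply: eq_bigr => k /andP[_ kw]; rewrite kw.
    rewrite /aW /bW !mulr_sumr -!sumrB mulr_sumr; apply: eq_bigr => T _.
    have ar3 (z i a b c e f g y : R) : z * (i * (a * b - c * e) - f * (i * (g * y))) =
      i * (a * (z * b) - c * (z * e) - f * (g * (z * y))) by ring.
    by rewrite /F /cfW /= size_drop ar3.
  rewrite Hp (_ : _ - _ = 0) ?mulr0//.
  (* [j] and [k] are two cut positions. The terms of dg /\ omega come indexed by k and then j < k,
     those of g d omega by j and then the length of the middle piece; [sum_triangle] matches
     them. *)
  pose Fjk j k : R := gW (take j w) p * (bW (drop j (take k w)) p * aW (drop k w) p
     - aW (drop j (take k w)) p * bW (drop k w) p).
  have E1 : \sum_(0 <= k < size w) (vyW (take k w) p * aW (drop k w) p - vxW (take k w) p * bW (drop k w) p) =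
     \sum_(0 <= k < size w) \sum_(0 <= j < k) Fjk j k.
    rewrite !big_nat; apply: eq_bigr => k /andP[_ kw].
    rewrite vyE vxE size_take kw !mulr_suml -sumrB !big_nat; apply: eq_bigr => j /andP[_ jk].
    by rewrite /Fjk take_takel ?(ltnW jk)//; ring.
  rewrite E1 -sum_triangle mulr_sumr -sumrB big1// => j _.
  rewrite size_drop mulr_sumr mulr_sumr -sumrB big1// => i _.
  rewrite /Fjk take_drop drop_drop up1.
  have kE : 2 * pi * kap = - 1 :> R by have := kapE; rewrite mulNr => h; rewrite -[LHS]opprK h.
  have ar4 (k q G a b a' b' : R) : q * k = - 1 ->
     G * (b * a' - a * b') - q * (G * (k * (1 * (a * b' - b * a')))) = 0.
    by move=> qk; rewrite (_ : q * _ = (q * k) * (G * (a * b' - b * a'))); [rewrite qk; ring|ring].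
  exact: ar4.
apply/eqP; rewrite -subr_eq0 -/(Dx x); apply/eqP.
have L : Dx (- n%:R) @[n --> \oo] --> (0 : R).
  rewrite (_ : (0 : R) = 0 - 0 - 0); last by rewrite !subr0.
  apply: cvgB; first by apply: cvgB; exact: (gW_lim w _).2.
  rewrite (_ : (fun n : nat => \int[mu]_r (ind h1 h2 r * vyW w (- n%:R, r))) =
     (fun n : nat => \int[mu]_r (ind h1 h2 r * vyW w (-1 * n%:R, r)))).
    by apply: vyW_infty => //; rewrite normrN1.
  by apply/funext => n; rewrite mulN1r.
have L2 : Dx (- n%:R) @[n --> \oo] --> Dx x.
  apply: cvg_near_cst; near=> n; apply/esym/cst.
  have : - x <= (n%:R : R) by near: n; exact: nbhs_infty_ger.
  by lra.
by rewrite -(cvg_lim (@Rhausdorff R) L2) (cvg_lim (@Rhausdorff R) L).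
Unshelve. all: by end_near. Qed.

(** The rectangle between the two lines is closed at infinity, where its vertical sides contribute
    nothing. *)
Lemma HT_const w (h1 h2 : R) : 0 < h1 -> h1 <= h2 ->
  HT (fun v t => aW v (t, h1)) w = HT (fun v t => aW v (t, h2)) w.
Proof.
move=> h10 h12.
have L : gW w (n%:R, h2) - gW w (n%:R, h1) @[n --> \oo] -->
    HT (fun v t => aW v (t, h2)) w - HT (fun v t => aW v (t, h1)) w.
  by apply: cvgB; exact: (gW_lim w _).1.
have L2 : gW w (n%:R, h2) - gW w (n%:R, h1) @[n --> \oo] --> (0 : R).
  have E n := @gW_y w n%:R h1 h2 h10 h12; rewrite (funext E).
  rewrite (_ : (fun n : nat => \int[mu]_r (ind h1 h2 r * vyW w (n%:R, r))) =
     (fun n : nat => \int[mu]_r (ind h1 h2 r * vyW w (1 * n%:R, r)))).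
    by apply: vyW_infty => //; rewrite normr1.
  by apply/funext => n; rewrite mul1r.
apply/esym/eqP; rewrite -subr_eq0; apply/eqP.
by rewrite -(cvg_lim (@Rhausdorff R) L) (cvg_lim (@Rhausdorff R) L2).
Qed.

End Transport.

(** * Powers of noncommutative series, word by word *)

Section ConvolutionPowers.
Variable R : realType.
Implicit Types (Z : seq bool -> R) (w : seq bool).

(** The coefficient of [w] in the m-th power of a series without constant term: each factor takes a
    nonempty suffix, so the value of [Z] at the empty word never enters. *)
Fixpoint Zm Z (m : nat) w : R :=
  match m with
  | 0 => (w == [::])%:R
  | m'.+1 => \sum_(0 <= k < size w) Zm Z m' (take k w) * Z (drop k w)
  end.

Lemma Zm_gt Z m w : (size w < m)%N -> Zm Z m w = 0.
Proof.
elim: m w => // m IH w; rewrite ltnS => wm /=; rewrite big_nat big1// => k /andP[_ kw].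
by rewrite IH ?mul0r// size_take kw (leq_trans kw).
Qed.

(** Multiplying each letter by q multiplies a word by q to the power of its length; this trades the
    normalisation natural for the holonomy for that of the weights. *)
Lemma Zm_scale Z Y (q : R) m w : (forall v, (0 < size v)%N -> q * Z v = q ^+ size v * Y v) ->
  Zm Z m w * q ^+ m = q ^+ size w * Zm Y m w.
Proof.
move=> H; elim: m w => [|m IH] w /=.
  by rewrite expr0 mulr1; case: w => [|b w]; rewrite /= ?expr0 ?mul1r ?mulr0.
rewrite mulr_suml mulr_sumr !big_nat; apply: eq_bigr => k /andP[_ kw].
have E : q ^+ size w = q ^+ k * q ^+ size (drop k w) by rewrite -exprD size_drop subnKC// ltnW.
have IHk := IH (take k w); rewrite size_take kw in IHk.
have Hk : q * Z (drop k w) = q ^+ size (drop k w) * Y (drop k w) by apply: H; rewrite size_drop subn_gt0.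
rewrite (_ : _ * _ * q ^+ m.+1 = (Zm Z m (take k w) * q ^+ m) * (q * Z (drop k w))); last by rewrite exprS; ring.
by rewrite IHk Hk E; ring.
Qed.

(* the coefficient of the word [w] in [e^{F a} e^{G b}], with [a] = [false], [b] = [true] *)
Definition EAB w (F G : R) : R := \sum_(j < (size w).+1)
  (all negb (take j w) && all id (drop j w))%:R * (F ^+ j / j`!%:R) * (G ^+ (size w - j) / (size w - j)`!%:R).

Lemma EAB_scale w q : EAB w q q = q ^+ size w * EAB w 1 1.
Proof.
rewrite /EAB mulr_sumr; apply: eq_bigr => j _.
have -> : q ^+ size w = q ^+ j * q ^+ (size w - j) by rewrite -exprD subnKC// -ltnS.
by rewrite !expr1n; ring.
Qed.

Lemma EAB_rcons_false w F G : EAB (rcons w false) F G =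
  (all negb w)%:R * (F ^+ (size w).+1 / (size w).+1`!%:R).
Proof.
rewrite /EAB size_rcons big_ord_recr /= big1 ?add0r => [|j _].
  rewrite -[X in take X _](size_rcons w false) take_size -[X in drop X _](size_rcons w false) drop_size.
  by rewrite all_rcons /= andbT subnn expr0 fact0 invr1 !mulr1.
have jw : (j <= size w)%N by rewrite -ltnS.
by rewrite drop_rcons// all_rcons /= andbF !mul0r.
Qed.

Lemma EAB_rcons_true w F G : EAB (rcons w true) F G = \sum_(j < (size w).+1)
  (all negb (take j w) && all id (drop j w))%:R * (F ^+ j / j`!%:R) *
  (G ^+ (size w - j).+1 / (size w - j).+1`!%:R).
Proof.
rewrite /EAB size_rcons big_ord_recr /= [X in _ + X](_ : _ = 0) ?addr0; last first.
  by rewrite -[X in take X _](size_rcons w true) take_size all_rcons /= !mul0r.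
apply: eq_bigr => j _; have jw : (j <= size w)%N by rewrite -ltnS.
by rewrite subSn// drop_rcons// all_rcons /= -cats1 takel_cat.
Qed.

Lemma cvg_pow (f : nat -> R) (l : R) m : f n @[n --> \oo] --> l -> f n ^+ m @[n --> \oo] --> l ^+ m.
Proof.
move=> fl; elim: m => [|m IH].
  by rewrite expr0 (_ : (fun n => _) = fun=> 1); [exact: cvg_cst|apply/funext => n; rewrite expr0].
rewrite exprS (_ : (fun n => f n ^+ m.+1) = fun n => f n * f n ^+ m); first exact: cvgM.
by apply/funext => n; rewrite exprS.
Qed.

Lemma EAB_cvg w (F G : nat -> R) (a b : R) : F n @[n --> \oo] --> a -> G n @[n --> \oo] --> b ->
  EAB w (F n) (G n) @[n --> \oo] --> EAB w a b.
Proof.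
move=> Fa Gb; apply: cvg_sumr => j; apply: cvgM.
  by apply: cvgM; [exact: cvg_cst|apply: cvgM; [exact: cvg_pow|exact: cvg_cst]].
by apply: cvgM; [exact: cvg_pow|exact: cvg_cst].
Qed.

End ConvolutionPowers.

(** * Two connections on the line whose holonomy is explicit *)

Section LineEvaluation.
Variable R : realType.
Local Notation mu := (@lebesgue_measure R).
Local Notation rT := (measurableTypeR R).

Definition prim (k : rT -> R) (x : rT) : R := \int[mu]_t (lft x t * k t).

Lemma mprim k : itg mu k -> measurable_fun setT (prim k).
Proof.
move=> Ik; apply: (@mrint1 _ _ _ _ _ mu (fun z : rT * rT => lft z.1 z.2 * k z.2)).
by apply: mfM; [apply: mlft; msr|exact: (measurableT_comp (itg_meas Ik))].
Qed.

Lemma prim_bound k x : itg mu k -> `|prim k x| <= \int[mu]_t `|k t|.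
Proof.
move=> Ik; apply: rint_bound; [exact: itg_lft|exact: itg_norm|].
by move=> t; rewrite normrM -[leRHS]mul1r ler_wpM2r// norm_bool_le1.
Qed.

Lemma prim_pow_itg k m : itg mu k -> itg mu (fun t => prim k t ^+ m * k t).
Proof.
move=> Ik; apply: (@itg_mulb _ _ _ _ _ _ ((\int[mu]_t `|k t|) ^+ m)) => //.
  by apply: mfX; exact: mprim.
by move=> t; rewrite normrX lerXn2r ?nnegrE ?rint_ge0//; exact: prim_bound.
Qed.

(** The chain rule for powers of a primitive, by induction through [prim_mul], as k is only
    integrable. *)
Lemma prim_pow k m x : itg mu k ->
  \int[mu]_t (lft x t * (prim k t ^+ m * k t)) = prim k x ^+ m.+1 / m.+1%:R.
Proof.
move=> Ik; elim: m x => [|m IH] x.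
  by rewrite expr1 divr1; apply: rint_eq => t; rewrite expr0 mul1r.
have P := prim_mul x Ik (prim_pow_itg m Ik).
rewrite IH [X in _ = X](rint_eq _ (g := fun r : rT => (m.+2%:R / m.+1%:R) * (lft x r * (prim k r ^+ m.+1 * k r)))) in P; last first.
  move=> r /=; rewrite IH -/(prim k r) (_ : m.+2%:R = m.+1%:R + 1 :> R); last by rewrite natr1.
  have m0 : m.+1%:R != 0 :> R by rewrite pnatr_eq0.
  by rewrite exprS; field.
rewrite rintZ in P; last by apply: itg_lft; exact: prim_pow_itg.
have m0 : m.+1%:R != 0 :> R by rewrite pnatr_eq0.
have m1 : m.+2%:R != 0 :> R by rewrite pnatr_eq0.
have -> : \int[mu]_t (lft x t * (prim k t ^+ m.+1 * k t)) =
  (m.+1%:R / m.+2%:R) * (m.+2%:R / m.+1%:R * \int[mu]_t (lft x t * (prim k t ^+ m.+1 * k t))).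
  by rewrite mulrA mulrA divfK// divff// mul1r.
rewrite -P -/(prim k x) [in RHS]exprS; move: (m.+1%:R : R) (m.+2%:R : R) m0 m1 => A B A0 B0.
by field; rewrite A0 B0.
Qed.

Lemma prim_lim k : itg mu k -> prim k n%:R @[n --> \oo] --> \int[mu]_t k t.
Proof. by move=> Ik; exact: (rint_lft_lim Ik).1. Qed.

(** All values of the connection are multiples of one series, so they commute and the path-ordered
    exponential is an ordinary exponential. *)
Lemma IT_scal (Z : seq bool -> R) k w x n : itg mu k -> (size w < n)%N ->
  IT (fun v t => Z v * k t) w x = \sum_(m < n) Zm Z m w * (prim k x ^+ m / m`!%:R).
Proof.
move=> Ik; elim/word_ind: w x n => w IH x [//|n] wn.
rewrite big_ord_recl; have [w0|w0] := eqVneq w [::].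
  rewrite w0 IT0 /= expr0 fact0 divr1 mulr1 big1 ?addr0// => m _.
  by rewrite /= big_geq ?mul0r.
rewrite /= (negbTE w0) mul0r add0r ITE//.
under [RHS]eq_bigr => m _ do rewrite mulr_suml.
rewrite exchange_big /= !big_nat; apply: eq_bigr => k0 /andP[_ kw].
rewrite (rint_eq _ (g := fun t : rT => \sum_(m < n) (Zm Z m (take k0 w) * Z (drop k0 w) / m`!%:R) *
   (lft x t * (prim k t ^+ m * k t)))); last first.
  move=> t; rewrite (IH _ (size_take_lt kw) t n); last by rewrite size_take kw (leq_trans kw).
  by rewrite mulr_suml mulr_sumr; apply: eq_bigr => m _; ring.
rewrite rint_sum; last by move=> m; apply: itgZ; apply: itg_lft; exact: prim_pow_itg.
apply: eq_bigr => m _; rewrite rintZ; last by apply: itg_lft; exact: prim_pow_itg.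
rewrite prim_pow// factS natrM /bump leq0n add1n add0n.
have m0 : m.+1%:R != 0 :> R by rewrite pnatr_eq0.
have f0 : m`!%:R != 0 :> R by rewrite pnatr_eq0 -lt0n fact_gt0.
by move: (m.+1%:R : R) (m`!%:R : R) m0 f0 => A B A0 B0; field; rewrite A0 B0.
Qed.

Lemma HT_scal N (Z : seq bool -> R) k w n : itg mu k -> line_ok N (fun v t => Z v * k t) -> (size w < n)%N ->
  HT (fun v t => Z v * k t) w = \sum_(m < n) Zm Z m w * ((\int[mu]_t k t) ^+ m / m`!%:R).
Proof.
move=> Ik ok wn; have L := (IT_lim w ok).1.
have L2 : IT (fun v t => Z v * k t) w i%:R @[i --> \oo] --> \sum_(m < n) Zm Z m w * ((\int[mu]_t k t) ^+ m / m`!%:R).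
  rewrite (funext (fun i : nat => IT_scal Z i%:R Ik wn)).
  apply: cvg_sumr => m; apply: cvgM; first exact: cvg_cst.
  by apply: cvgM; [apply: cvg_pow; exact: prim_lim|exact: cvg_cst].
by rewrite -(cvg_lim (@Rhausdorff R) L) (cvg_lim (@Rhausdorff R) L2).
Qed.

Definition cutal (f g : rT -> R) (v : seq bool) (t : rT) : R :=
  if v == [:: false] then f t else if v == [:: true] then g t else 0.

Lemma IT_rcons (al : seq bool -> rT -> R) w b x :
  (forall v t, (1 < size v)%N -> al v t = 0) ->
  IT al (rcons w b) x = \int[mu]_t (lft x t * (IT al w t * al [:: b] t)).
Proof.
move=> H; rewrite ITE; last by case: w.
rewrite size_rcons big_nat_recr//= big_nat big1 ?add0r => [|k /andP[_ kw]].
  by apply: rint_eq => t; rewrite -cats1 takel_cat// take_size drop_size_cat.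
rewrite -[RHS](rint0 mu); apply: rint_eq => t; rewrite H ?mulr0//.
by rewrite size_drop size_rcons subSn ?(ltnW kw)// ltnS subn_gt0.
Qed.

(** The first letter acts only up to c and the second only beyond it, so the transport factors as
    e^(F a) e^(G b). In the proof [Gf] says that the primitive of g is still zero where f lives, and
    [Fg] that the primitive of f is complete where g lives. *)
Lemma IT_cut (f g : rT -> R) (c : R) w x : itg mu f -> itg mu g ->
  (forall t, c < t -> f t = 0) -> (forall t, t <= c -> g t = 0) ->
  IT (cutal f g) w x = EAB w (prim f x) (prim g x).
Proof.
move=> If Ig f0 g0.
have small v t : (1 < size v)%N -> cutal f g v t = 0 by case: v => [|b [|b' v]]// _; rewrite /cutal !eqseq_cons !andbF.
have Gf t : prim g t * f t = 0.
  have [tc|ct] := leP t c; last by rewrite f0// mulr0.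
  rewrite /prim (rint_eq _ (g := fun=> 0)) ?rint0 ?mul0r// => s; rewrite /lft.
  by case: leP => st; rewrite ?mul0r// g0 ?mulr0// (le_trans st).
have Fg t : lft x t * g t * prim f t = lft x t * g t * prim f x.
  have [tc|ct] := leP t c; first by rewrite g0// mulr0 !mul0r.
  rewrite /lft; case: (leP t x) => tx; last by rewrite !mul0r.
  congr (_ * _); rewrite /prim; apply: rint_eq => s; have [cs|sc] := ltP c s; first by rewrite f0 ?mulr0.
  by rewrite /lft (le_trans sc (ltW ct)) (le_trans (le_trans sc (ltW ct)) tx).
elim/last_ind: w x Fg => [|w b IH] x Fg.
  by rewrite IT0 /EAB big_ord_recl big_ord0 /= !expr0 fact0 !divr1 !mulr1 addr0.
have Fgt (t : R) : IT (cutal f g) w t = EAB w (prim f t) (prim g t).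
  apply: IH => s; have [tc|ct] := leP s c; first by rewrite g0// mulr0 !mul0r.
  rewrite /lft; case: (leP s t) => tx; last by rewrite !mul0r.
  congr (_ * _); rewrite /prim; apply: rint_eq => s'; have [cs|sc] := ltP c s'; first by rewrite f0 ?mulr0.
  by rewrite /lft (le_trans sc (ltW ct)) (le_trans (le_trans sc (ltW ct)) tx).
rewrite IT_rcons//; case: b; last first.
  rewrite EAB_rcons_false factS natrM.
  rewrite (rint_eq _ (g := fun t : rT => ((all negb w)%:R / (size w)`!%:R) * (lft x t * (prim f t ^+ size w * f t)))); last first.
    move=> t; rewrite Fgt /cutal /= /EAB big_ord_recr /= take_size drop_size /= andbT subnn expr0 fact0 divr1 mulr1.
    rewrite mulrDl mulr_suml big1 ?add0r; first by ring.
    move=> j _.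
    have : (0 < size w - j)%N by rewrite subn_gt0.
    case: (size w - j)%N => // s _; rewrite exprS.
    set A := (X in X * _ * _ = _); set P := prim g t ^+ s.
    by rewrite (_ : A * (prim g t * P / s.+1`!%:R) * f t = A * (P / s.+1`!%:R) * (prim g t * f t)); [rewrite Gf mulr0|ring].
  rewrite rintZ; last by apply: itg_lft; exact: prim_pow_itg.
  rewrite prim_pow//.
  have m0 : (size w).+1%:R != 0 :> R by rewrite pnatr_eq0.
  have f1 : (size w)`!%:R != 0 :> R by rewrite pnatr_eq0 -lt0n fact_gt0.
  by move: ((size w).+1%:R : R) ((size w)`!%:R : R) m0 f1 => A B A0 B0; field; rewrite A0 B0.
rewrite EAB_rcons_true.
rewrite (rint_eq _ (g := fun t : rT => \sum_(j < (size w).+1) ((all negb (take j w) && all id (drop j w))%:R *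
    (prim f x ^+ j / j`!%:R) / (size w - j)`!%:R) * (lft x t * (prim g t ^+ (size w - j) * g t)))); last first.
  move=> t; rewrite Fgt /cutal /= /EAB mulr_suml mulr_sumr; apply: eq_bigr => j _.
  have pw m : lft x t * g t * prim f t ^+ m = lft x t * g t * prim f x ^+ m.
    elim: m => [|m IHm]; first by rewrite !expr0.
    by rewrite !exprSr !mulrA IHm mulrAC Fg mulrAC.
  set b := _%:R; set fj := j`!%:R; set fs := (_ - _)`!%:R; set P := prim g t ^+ _.
  rewrite (_ : lft x t * (b * (prim f t ^+ j / fj) * (P / fs) * g t) = (lft x t * g t * prim f t ^+ j) * (b / fj * (P / fs))); last by ring.
  by rewrite pw; ring.
rewrite rint_sum; last by move=> j; apply: itgZ; apply: itg_lft; exact: prim_pow_itg.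
apply: eq_bigr => j _; rewrite rintZ; last by apply: itg_lft; exact: prim_pow_itg.
rewrite prim_pow// [in RHS]factS natrM.
set s := (size w - j)%N; set b := _%:R.
have m0 : s.+1%:R != 0 :> R by rewrite pnatr_eq0.
have f1 : s`!%:R != 0 :> R by rewrite pnatr_eq0 -lt0n fact_gt0.
have f2 : j`!%:R != 0 :> R by rewrite pnatr_eq0 -lt0n fact_gt0.
by move: (s.+1%:R : R) (s`!%:R : R) (j`!%:R : R) m0 f1 f2 => A B C A0 B0 C0; field; rewrite A0 B0 C0.
Qed.

Lemma HT_cut N (f g : rT -> R) (c : R) w : line_ok N (cutal f g) -> itg mu f -> itg mu g ->
  (forall t, c < t -> f t = 0) -> (forall t, t <= c -> g t = 0) ->
  HT (cutal f g) w = EAB w (\int[mu]_t f t) (\int[mu]_t g t).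
Proof.
move=> ok If Ig f0 g0; have L := (IT_lim w ok).1.
have L2 : IT (cutal f g) w i%:R @[i --> \oo] --> EAB w (\int[mu]_t f t) (\int[mu]_t g t).
  rewrite (funext (fun i : nat => IT_cut w i%:R If Ig f0 g0)).
  by apply: EAB_cvg; exact: prim_lim.
by rewrite -(cvg_lim (@Rhausdorff R) L) (cvg_lim (@Rhausdorff R) L2).
Qed.

End LineEvaluation.

(** * The holonomy at infinite and at zero height *)

Section HolonomyLimits.
Variable R : realType.
Local Notation mu := (@lebesgue_measure R).
Local Notation rT := (measurableTypeR R).
Local Notation pt := (pt R).
Local Notation kap := (kap R).
Local Notation q2 := (- (2 * pi) : R).

Definition ZW (w : seq bool) : R := \sum_(T <- brk w) kap ^+ (size w).-1 * mass R T.

Lemma rint_cau (s c : R) : 0 < s -> \int[mu]_t cau s c t = pi.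
Proof.
move=> s0; rewrite -(rint_cauchy c (lt0r_neq0 s0)); apply: rint_eq => t.
by rewrite /cau gtr0_norm.
Qed.

Lemma aK_leaf (x h : R) b : aK (x, h) (ept R b) = - 2 * cau h b%:R x.
Proof. by rewrite aKE /ept /cau /= !add0r sqrrN; ring. Qed.

Lemma rint_aK_leaf (h : R) b : 0 < h -> \int[mu]_x aK (x, h) (ept R b) = q2.
Proof.
move=> h0; rewrite (rint_eq _ (g := fun x : rT => - 2 * cau h b%:R x)); last by move=> x; exact: aK_leaf.
by rewrite rintZ; [rewrite rint_cau// mulNr|exact: (cau_itg h b%:R).1].
Qed.

Lemma aT_leaf b p : aT (leaf b) p = aK p (ept R b).
Proof.
rewrite /aT /= /Rintegral integral_dirac//=; last first.
  apply/measurable_EFinP; apply: mfM; first by apply: maK; msr.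
  exact: (@mdens R (leaf b)).
by rewrite indicT /= mul1r lexx mulr1.
Qed.

Lemma aW1 b p : aW [:: b] p = aK p (ept R b).
Proof. by rewrite /aW brk1 big_seq1 /= expr0 mul1r aT_leaf. Qed.

(** From far above, a source at q looks like one at 0: by [K_diff] the difference is of order |q|/h
    times a Cauchy kernel of width h. The threshold on h gives |p|^2 / 4 <= |p - q|^2 for p on the
    line. *)
Lemma aK_far_diff (q : pt) : 0 <= q.2 ->
  \int[mu]_x `|aK (x, n.+1%:R) q - aK (x, n.+1%:R) (ept R false)| @[n --> \oo] --> (0 : R).
Proof.
move=> q0; set o := ept R false; set D := rsq q o; have D0 : 0 <= D := rsq_ge0 _ _.
have L : (4 * Num.sqrt D * pi) * (n.+1%:R : R)^-1 @[n --> \oo] --> (0 : R).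
  rewrite -[X in _ --> X](mulr0 (4 * Num.sqrt D * pi)); apply: cvgMl_tmp; exact: cvg_harmonic.
apply: squeeze0 L; near=> n; apply/andP; split; first exact: rint_ge0.
set h : R := n.+1%:R; have h0 : 0 < h by rewrite ltr0n.
have hD : 4 * D + 1 <= h.
  have n1 : 4 * D <= (n%:R : R) by near: n; exact: nbhs_infty_ger.
  by rewrite /h -(natr1 n) lerD2r.
have hD2 : 4 * D < h ^+ 2 by rewrite expr2; nra.
have Ic := (cau_itg h 0).1.
apply: (@le_trans _ _ (\int[mu]_x ((4 * Num.sqrt D / h) * cau h 0 x))); last first.
  by rewrite rintZ// rint_cau// le_eqVlt; apply/orP; left; apply/eqP; ring.
apply: rint_le; [by apply/itg_norm/itgB; exact: (aK_itg _ _).1|exact: itgZ|].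
move=> x; have pq (r : pt) : rsq r o <= D -> ((x, h) : pt) != r.
  move=> rD; apply/eqP => e; move: rD; rewrite -e /rsq /o /ept /= !subr0 => rD.
  by have := sqr_ge0 (x : R); lra.
have po : ((x, h) : pt) != o by apply: pq; rewrite /rsq !subrr expr0n addr0.
have pqq : ((x, h) : pt) != q by apply: pq.
have KD := @K_diff R (x, h) q o h0 q0 (lexx _) pqq po.
have c0 : 0 <= 4 * Num.sqrt D / h * cau h 0 x.
  rewrite /cau mulr_ge0 ?divr_ge0 ?mulr_ge0 ?sqrtr_ge0 ?addr_ge0 ?sqr_ge0 ?(ltW h0)//.
rewrite -(@ler_pXn2r _ 2) ?nnegrE// real_normK ?num_real//.
apply: (@le_trans _ _ (4 * D / (rsq (x, h) q * rsq (x, h) o))).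
  by apply: le_trans KD; rewrite lerDl sqr_ge0.
have r0 : 0 < rsq (x, h) o := rsq_gt0 po.
have rq : rsq (x, h) o / 4 <= rsq (x, h) q.
  have e1 : 0 <= ((x : R) - 2 * q.1) ^+ 2 := sqr_ge0 _.
  have e2 : 0 <= (h - 2 * q.2) ^+ 2 := sqr_ge0 _.
  move: hD2; rewrite /D /rsq /o /ept /= !subr0.
  by have := sqr_ge0 (x : R); nra.
have rq0 : 0 < rsq (x, h) q by rewrite (lt_le_trans _ rq)// divr_gt0.
have E : (4 * Num.sqrt D / h * cau h 0 x) ^+ 2 = 16 * D / (rsq (x, h) o * rsq (x, h) o).
  have ro : rsq (x, h) o = x ^+ 2 + h ^+ 2 by rewrite /rsq /o /ept /= !subr0.
  rewrite /cau subr0 -ro !exprMn sqr_sqrtr// exprVn.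
  have hn : h != 0 by rewrite gt_eqF.
  have rn : rsq (x, h) o != 0 by rewrite gt_eqF.
  have gen (a b r : R) : a != 0 -> r != 0 ->
      4 ^+ 2 * b / a ^+ 2 * (a ^+ 2 * r^-1 ^+ 2) = 16 * b / (r * r).
    by move=> a0 rr0; field; rewrite a0 rr0.
  exact: gen.
rewrite E (_ : 16 * D / _ = 4 * D / (rsq (x, h) o / 4 * rsq (x, h) o)); last first.
  have gen (b r : R) : r != 0 -> 16 * b / (r * r) = 4 * b / (r / 4 * r) by move=> rr0; field; rewrite ?rr0.
  by apply: gen; rewrite gt_eqF.
apply: ler_wpM2l; first by rewrite mulr_ge0.
by rewrite lef_pV2 ?posrE ?mulr_gt0// ?divr_gt0// ler_wpM2r// ltW.
Unshelve. all: by end_near. Qed.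

(** The line passes below the source at height y, and the two Cauchy kernels, of widths y - h and y
    + h, nearly cancel. *)
Lemma aK_low (q : pt) : 0 < q.2 ->
  \int[mu]_x `|aK (x, n.+1%:R^-1) q| @[n --> \oo] --> (0 : R).
Proof.
move=> q0; set y : R := q.2.
have L : (3 * pi / y) * (n.+1%:R : R)^-1 @[n --> \oo] --> (0 : R).
  rewrite -[X in _ --> X](mulr0 (3 * pi / y)); apply: cvgMl_tmp; exact: cvg_harmonic.
apply: squeeze0 L; near=> n; apply/andP; split; first exact: rint_ge0.
have hy : (n.+1%:R : R)^-1 < y / 2.
  by near: n; apply: (near_infty_natSinv_lt (PosNum (divr_gt0 q0 (ltr0n R 2)))).
move: hy; set h : R := n.+1%:R^-1 => hy; have h0 : 0 < h by rewrite invr_gt0 ltr0n.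
have s1 : 0 < y - h by lra.
have s2 : 0 < y + h by lra.
have I1 := (cau_itg (y - h) q.1).1; have I2 := (cau_itg (y + h) q.1).1.
apply: (@le_trans _ _ (\int[mu]_x ((h / (y - h)) * cau (y - h) q.1 x + (h / (y + h)) * cau (y + h) q.1 x))); last first.
  rewrite (rintD (itgZ _ I1) (itgZ _ I2)) (rintZ _ I1) (rintZ _ I2) !rint_cau// -mulrDl.
  rewrite [leRHS](_ : _ = (3 * h / y) * pi); last by rewrite -/h; ring.
  rewrite ler_wpM2r ?pi_ge0// -subr_ge0.
  have -> : 3 * h / y - (h / (y - h) + h / (y + h)) = h * ((3 * (y - h) * (y + h) - 2 * y * y) / (y * (y - h) * (y + h))).
    by field; rewrite !gt_eqF.
  rewrite mulr_ge0 ?(ltW h0)// divr_ge0 ?mulr_ge0 ?(ltW q0) ?(ltW s1) ?(ltW s2)//.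
  have : 0 < y by []. nra.
apply: rint_le; [exact/itg_norm/(aK_itg _ _).1|by apply: itgD; exact: itgZ|].
move=> x; rewrite aKE -/y /cau.
set D1 := (x - q.1) ^+ 2 + (y - h) ^+ 2; set D2 := (x - q.1) ^+ 2 + (y + h) ^+ 2.
have d1 : 0 < D1 by rewrite ltr_wpDl ?sqr_ge0// exprn_gt0.
have d2 : 0 < D2 by rewrite ltr_wpDl ?sqr_ge0// exprn_gt0.
have -> : h / (y - h) * ((y - h) / D1) + h / (y + h) * ((y + h) / D2) = h * (D1 + D2) / (D1 * D2).
  by field; rewrite !gt_eqF.
have -> : (y - h) / D1 - (y + h) / D2 = ((y - h) * D2 - (y + h) * D1) / (D1 * D2).
  by field; rewrite !gt_eqF.
rewrite normrM (gtr0_norm (_ : 0 < (D1 * D2)^-1)); last by rewrite invr_gt0 mulr_gt0.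
apply: ler_wpM2r; first by rewrite invr_ge0 mulr_ge0 ?ltW.
rewrite ler_norml /D1 /D2; set X := (x - q.1) ^+ 2; have X0 : 0 <= X := sqr_ge0 _.
by apply/andP; split; rewrite -subr_ge0; nra.
Unshelve. all: by end_near. Qed.

Lemma aT_high t : \int[mu]_x `|aT t (x, n.+1%:R) - mass R t * aK (x, n.+1%:R) (ept R false)|
  @[n --> \oo] --> (0 : R).
Proof.
pose kn (n : nat) (x : rT) (q : pt) : R := aK (x, n.+1%:R) q - aK (x, n.+1%:R) (ept R false).
have mk n : measurable_fun setT (fun z : rT * pt => kn n z.1 z.2).
  by apply: mfD; [apply: maK; msr|apply: mfN; apply: maK; msr].
have Hk n q : itg mu (kn n ^~ q) /\ \int[mu]_x `|kn n x q| <= 2 * pi + 2 * pi.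
  have [I1 L1] := aK_itg n.+1%:R q; have [I2 L2] := aK_itg n.+1%:R (ept R false).
  split; first exact: itgB.
  apply: (@le_trans _ _ (\int[mu]_x (`|aK (x, n.+1%:R) q| + `|aK (x, n.+1%:R) (ept R false)|))).
    apply: rint_le; [exact/itg_norm/itgB|by apply: itgD; exact: itg_norm|by move=> x; exact: ler_normB].
  by rewrite rintD; [exact: lerD|exact: itg_norm|exact: itg_norm].
have K := @kern_lim R t kn (2 * pi + 2 * pi) (addr_ge0 (twopi_ge0 R) (twopi_ge0 R)) mk Hk.
have E n : \int[mu]_x `|aT t (x, n.+1%:R) - mass R t * aK (x, n.+1%:R) (ept R false)| =
    \int[mu]_x `|\int[mtree R t]_q (kn n x q * dens t q)|.
  have [I1 _] := aT_line t (n.+1%:R : R).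
  have [I2 _] := line_itg t (addr_ge0 (twopi_ge0 R) (twopi_ge0 R)) (mk n) (Hk n).
  apply: rint_ae.
  - apply: mfnorm; apply: mfD; first exact: itg_meas (@aT_itg R t _).
    by apply: mfN; apply: mfM; [exact: measurable_cst|exact: itg_meas (aK_itg _ _).1].
  - by apply: mfnorm; exact: itg_meas (fub_itg1 I2).
  - apply: filterS (fub_ae1 I1) => x Ix; congr `|_|.
    rewrite (rint_eq _ (g := fun q => aK (x, n.+1%:R) q * dens t q - aK (x, n.+1%:R) (ept R false) * dens t q)); last first.
      by move=> q; rewrite /kn mulrBl.
    rewrite rintB//; last by apply: itgZ; exact: dens_itg.
    by rewrite rintZ; [rewrite [in RHS]mulrC|exact: dens_itg].
rewrite (funext E); apply: K; apply: nearW => q d0; exact: aK_far_diff (dens_supp d0).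
Qed.

Lemma aT_low l r : \int[mu]_x `|aT (node l r) (x, n.+1%:R^-1)| @[n --> \oo] --> (0 : R).
Proof.
apply: (@kern_lim R (node l r) (fun n x q => aK (x, n.+1%:R^-1) q) (2 * pi) (twopi_ge0 R)).
- by move=> n; apply: maK; msr.
- by move=> n q; exact: aK_itg.
- have H : {ae sprod mu mu, forall q : pt, dens (node l r) q != 0 ->
      \int[mu]_x `|aK (x, n.+1%:R^-1) q| @[n --> \oo] --> (0 : R)}.
    apply: filterS (ae_line2 0) => q q0 d0; have q1 : 0 < q.2 by rewrite lt_def q0 (dens_supp d0).
    exact: (aK_low q1).
  exact: H.
Qed.

(** By [HT_const] the height may tend to infinity, where the form of every tree becomes its mass
    times the form of the boundary point 0. The factor -2 pi is the integral of that form over a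
    line. *)
Lemma HT_high w n : (size w < n)%N ->
  HT (fun v t => aW v (t, 1 : R)) w = \sum_(m < n) Zm ZW m w * (q2 ^+ m / m`!%:R).
Proof.
move=> wn.
pose al (i : nat) v (t : rT) : R := aW v (t, i.+1%:R).
pose k (i : nat) (t : rT) : R := aK (t, i.+1%:R) (ept R false).
pose be (i : nat) v (t : rT) : R := ZW v * k i t.
pose N v : R := NW R v + `|ZW v| * (2 * pi).
have N0 v : 0 <= NW R v.
  apply: sumr_ge0 => T _; rewrite mulr_ge0// mulr_ge0 ?twopi_ge0//; exact: ndens_ge0.
have oka i : line_ok N (al i).
  move=> v; have [I L] := aW_ok (i.+1%:R : R) v; split => //.
  by rewrite (le_trans L)// lerDl mulr_ge0 ?twopi_ge0.
have Ik i : itg mu (k i) := (aK_itg _ _).1.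
have okb i : line_ok N (be i).
  move=> v; split; first exact: itgZ.
  rewrite (rint_eq _ (g := fun t : rT => `|ZW v| * `|k i t|)); last by move=> t; rewrite normrM.
  rewrite rintZ; last exact: itg_norm.
  rewrite (le_trans (ler_wpM2l (normr_ge0 _) (aK_itg _ _).2))// lerDr; exact: N0.
have cv v : (0 < size v)%N -> \int[mu]_t `|al n v t - be n v t| @[n --> \oo] --> (0 : R).
  move=> _; have L : \sum_(T <- brk v) `|kap ^+ (size v).-1| *
      \int[mu]_x `|aT T (x, n.+1%:R) - mass R T * aK (x, n.+1%:R) (ept R false)| @[n --> \oo] --> (0 : R).
    rewrite [X in _ --> X](_ : (0 : R) = \sum_(T <- brk v) `|kap ^+ (size v).-1| * 0); last by rewrite big1// => T _; rewrite mulr0.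
    by apply: cvg_sumr => T; apply: cvgMl_tmp; exact: aT_high.
  apply: squeeze0 L; apply: nearW => i; apply/andP; split; first exact: rint_ge0.
  have IT0 T : itg mu (fun x => aT T (x, i.+1%:R) - mass R T * aK (x, i.+1%:R) (ept R false)).
    by apply: itgB; [exact: (@aT_itg R T _)|apply: itgZ; exact: Ik].
  under [leRHS]eq_bigr => T _ do rewrite -(rintZ _ (itg_norm (IT0 T))).
  rewrite -rint_sum; last by move=> T; apply: itgZ; exact/itg_norm.
  apply: rint_le.
  - by apply: itg_norm; apply: itgB; [exact: (oka i v).1|exact: (okb i v).1].
  - by apply: itg_sum => T; apply: itgZ; exact: itg_norm.
  - move=> t; rewrite /al /be /aW /ZW mulr_suml -sumrB (le_trans (ler_norm_sum _ _ _))//.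
    by apply: ler_sum => T _; rewrite -mulrA -mulrBr normrM.
have S := HT_stab w oka okb cv.
have E i : HT (al i) w - HT (be i) w = HT (fun v t => aW v (t, 1 : R)) w - \sum_(m < n) Zm ZW m w * (q2 ^+ m / m`!%:R).
  have ki : \int[mu]_t k i t = q2 by apply: rint_aK_leaf; rewrite ltr0n.
  have EB := @HT_scal R N ZW (k i) w n (Ik i) (okb i) wn; rewrite ki in EB.
  rewrite [HT (be i) w]EB.
  have EA : HT (fun v t => aW v (t, 1 : R)) w = HT (al i) w.
    exact: (@HT_const R w 1 i.+1%:R ltr01 (ler1n R i.+1)).
  by rewrite EA.
rewrite (funext E) in S; apply/eqP; rewrite -subr_eq0; apply/eqP.
rewrite -[RHS](cvg_lim (@Rhausdorff R) S); apply/esym; apply: cvg_lim => //; exact: cvg_cst.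
Qed.

(** The hypothesis says that t is at distance at least 1/2 from the boundary point b, half the
    distance from 0 to 1; then X + 1 <= 5 X for the square X of that distance. *)
Lemma cau_cut (h : R) b (t : R) : 0 < h -> 4^-1 <= (t - b%:R) ^+ 2 -> cau h b%:R t <= 5 * h * cau 1 b%:R t.
Proof.
move=> h0; rewrite /cau expr1n; set X := (t - b%:R) ^+ 2 => X4.
have X0 : 0 < X by rewrite (lt_le_trans _ X4)// invr_gt0.
have a0 : 0 < X + h ^+ 2 by rewrite addr_gt0// exprn_gt0.
have b0 : 0 < X + 1 by rewrite addr_gt0.
rewrite -mulrA [5 * _]mulrC -mulrA ler_wpM2l ?(ltW h0)// mul1r.
rewrite [leRHS]mulrC ler_pdivlMr// [leLHS]mulrC ler_pdivrMr//.
have := sqr_ge0 h; have : 1 <= 4 * X by rewrite mulrC -ler_pdivrMr// mul1r. nra.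
Qed.

(** As the height tends to 0 the forms of composite trees vanish in L1, and those of the two leaves
    concentrate at 0 and 1, each with mass -2 pi. Cutting the latter at the midpoint changes them by
    O(h) in L1 and makes [HT_cut] applicable. *)
Lemma HT_low w : HT (fun v t => aW v (t, 1 : R)) w = EAB w q2 q2.
Proof.
pose hn (i : nat) : R := i.+1%:R^-1.
have h0 i : 0 < hn i by rewrite invr_gt0 ltr0n.
pose al (i : nat) v (t : rT) : R := aW v (t, hn i).
pose c : R := 2^-1.
pose f i (t : rT) : R := lft c t * aK (t, hn i) (ept R false).
pose g i (t : rT) : R := (1 - lft c t) * aK (t, hn i) (ept R true).
pose be (i : nat) := cutal (f i) (g i).
have IK i b : itg mu (fun t => aK (t, hn i) (ept R b)) := (aK_itg _ _).1.
have If i : itg mu (f i) by exact: itg_lft.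
have n1 (t : R) : `|1 - lft c t| <= 1 by rewrite /lft; case: (t <= c); rewrite ?subrr ?subr0 ?normr0 ?normr1.
have Ig i : itg mu (g i).
  by apply: (@itg_mulb _ _ _ _ _ _ 1) => //; apply: mfD; [exact: measurable_cst|apply: mfN; apply: mlft; msr].
pose N v : R := NW R v + 2 * pi.
have N0 v : 0 <= NW R v.
  apply: sumr_ge0 => T _; rewrite mulr_ge0// mulr_ge0 ?twopi_ge0//; exact: ndens_ge0.
have oka i : line_ok N (al i).
  move=> v; have [I L] := aW_ok (hn i) v; split => //.
  by rewrite (le_trans L)// lerDl twopi_ge0.
have okb i : line_ok N (be i).
  have bn b (k : rT -> R) (m : rT -> R) : itg mu k -> (forall t, k t = m t * aK (t, hn i) (ept R b)) -> (forall t, `|m t| <= 1) ->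
      \int[mu]_t `|k t| <= 2 * pi.
    move=> Ik kE m1; apply: le_trans (aK_itg (hn i) (ept R b)).2; apply: rint_le; [exact: itg_norm|exact/itg_norm/IK|].
    by move=> t; rewrite kE normrM -[leRHS]mul1r ler_wpM2r.
  move=> v; rewrite /be /cutal; case: eqP => _.
    split => //; rewrite (le_trans (bn false _ (lft c) (If i) (fun=> erefl) (fun=> norm_bool_le1 _ _)))//.
    by rewrite lerDr; exact: N0.
  case: eqP => _.
    split => //; rewrite (le_trans (bn true _ (fun t => 1 - lft c t) (Ig i) (fun=> erefl) n1))//.
    by rewrite lerDr; exact: N0.
  split; first exact: itg0.
  by rewrite normr0 rint0; exact: (addr_ge0 (N0 v) (twopi_ge0 R)).
have cvl b (k : nat -> rT -> R) : (forall i, itg mu (k i)) ->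
    (forall i t, `|aK (t, hn i) (ept R b) - k i t| <= 10 * hn i * cau 1 b%:R t) ->
    \int[mu]_t `|aK (t, hn n) (ept R b) - k n t| @[n --> \oo] --> (0 : R).
  move=> Ik kb; have L : (10 * pi) * (n.+1%:R : R)^-1 @[n --> \oo] --> (0 : R).
    rewrite -[X in _ --> X](mulr0 (10 * pi)); apply: cvgMl_tmp; exact: cvg_harmonic.
  apply: squeeze0 L; apply: nearW => i; apply/andP; split; first exact: rint_ge0.
  have Ic := (cau_itg (1 : R) b%:R).1.
  apply: (@le_trans _ _ (\int[mu]_t (10 * hn i * cau 1 b%:R t))).
    by apply: rint_le => //; [by apply/itg_norm/itgB|exact: itgZ].
  by rewrite rintZ// rint_cau// le_eqVlt; apply/orP; left; apply/eqP; rewrite /hn; ring.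
have cpos (b : bool) (t : R) : 0 <= cau 1 b%:R t by rewrite /cau divr_ge0// addr_ge0// sqr_ge0.
have cposh i (b : bool) (t : R) : 0 <= cau (hn i) b%:R t by rewrite /cau divr_ge0 ?(ltW (h0 i))// addr_ge0// sqr_ge0.
have cut (b : bool) (i : nat) (t : R) (m : R) : m = 0 \/ m = 1 -> (m = 0 -> 4^-1 <= (t - b%:R) ^+ 2) ->
    `|aK (t, hn i) (ept R b) - m * aK (t, hn i) (ept R b)| <= 10 * hn i * cau 1 b%:R t.
  case=> ->; last by move=> _; rewrite mul1r subrr normr0; exact: (mulr_ge0 (mulr_ge0 (ler0n R 10) (ltW (h0 i))) (cpos b t)).
  move=> /(_ erefl) t4; rewrite mul0r subr0 aK_leaf normrM (ger0_norm (cposh i b t)) normrN ger0_norm//.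
  by have := cau_cut (h0 i) t4; rewrite (_ : 10 * hn i * cau 1 b%:R t = 2 * (5 * hn i * cau 1 b%:R t)); [move=> H; rewrite ler_wpM2l|ring].
have cvf : \int[mu]_t `|aK (t, hn n) (ept R false) - f n t| @[n --> \oo] --> (0 : R).
  apply: cvl => // i t; apply: (cut false); rewrite /lft; case: (leP t c) => tc; [by right|by left|by move/eqP; rewrite oner_eq0|].
  by move=> _; rewrite subr0 expr2; move: tc; rewrite /c; nra.
have cvg_ : \int[mu]_t `|aK (t, hn n) (ept R true) - g n t| @[n --> \oo] --> (0 : R).
  apply: cvl => // i t; apply: (cut true); rewrite /lft; case: (leP t c) => tc; rewrite ?subrr ?subr0.
  - by left.
  - by right.
  - by move=> _; rewrite (_ : true%:R = 1 :> R)// expr2; move: tc; rewrite /c; nra.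
  - by move/eqP; rewrite oner_eq0.
have cv v : (0 < size v)%N -> \int[mu]_t `|al n v t - be n v t| @[n --> \oo] --> (0 : R).
  case: v => [//|b [|b' v]] _.
    case: b.
      rewrite (_ : (fun n => _) = fun n => \int[mu]_t `|aK (t, hn n) (ept R true) - g n t|)//.
      by apply/funext => i; apply: rint_eq => t; rewrite /al aW1.
    rewrite (_ : (fun n => _) = fun n => \int[mu]_t `|aK (t, hn n) (ept R false) - f n t|)//.
    by apply/funext => i; apply: rint_eq => t; rewrite /al aW1.
  set u := [:: b, b' & v].
  have L : \sum_(T <- brk u) `|kap ^+ (size u).-1| * \int[mu]_x `|aT T (x, hn n)| @[n --> \oo] --> (0 : R).
    have E (n : nat) := @sum_brk R (fun T => `|kap ^+ (size u).-1| * \int[mu]_x `|aT T (x, hn n)|) u isT.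
    rewrite (funext E) [X in _ --> X](_ : (0 : R) = \sum_(1 <= k < size u) \sum_(l <- brk (take k u)) \sum_(r <- brk (drop k u)) `|kap ^+ (size u).-1| * 0); last first.
      by rewrite big1// => i _; rewrite big1// => l _; rewrite big1// => r _; rewrite mulr0.
    apply: cvg_sumr => k; apply: cvg_sumr => l; apply: cvg_sumr => r.
    by apply: cvgMl_tmp; exact: aT_low.
  apply: squeeze0 L; apply: nearW => i; apply/andP; split; first exact: rint_ge0.
  have IT0 T : itg mu (fun x => aT T (x, hn i)) by exact: (@aT_itg R T _).
  under [leRHS]eq_bigr => T _ do rewrite -(rintZ _ (itg_norm (IT0 T))).
  rewrite -rint_sum; last by move=> T; apply: itgZ; exact/itg_norm.
  apply: rint_le.
  - by apply: itg_norm; apply: itgB; [exact: (oka i u).1|exact: (okb i u).1].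
  - by apply: itg_sum => T; apply: itgZ; exact: itg_norm.
  - move=> t; have b0 : be i u t = 0 by rewrite /be /cutal !eqseq_cons !andbF.
    rewrite b0 subr0 /al /aW (le_trans (ler_norm_sum _ _ _))//.
    by apply: ler_sum => T _; rewrite normrM.
have S := HT_stab w oka okb cv.
have lim b (k : nat -> rT -> R) : (forall i, itg mu (k i)) ->
   \int[mu]_t `|aK (t, hn n) (ept R b) - k n t| @[n --> \oo] --> (0 : R) -> \int[mu]_t k n t @[n --> \oo] --> q2.
  move=> Ik ck; apply/cvgrPdist_le => e e0; move/cvgrPdist_le : ck => /(_ _ e0); apply: filterS => i.
  rewrite sub0r normrN => H; apply: le_trans H; apply: le_trans (ler_norm _).
  by rewrite -(@rint_aK_leaf (hn i) b (h0 i)) -rintB//; apply: rint_norm; exact: itgB.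
have E i : HT (al i) w - HT (be i) w = HT (fun v t => aW v (t, 1 : R)) w - EAB w (\int[mu]_t f i t) (\int[mu]_t g i t).
  rewrite (@HT_cut R N (f i) (g i) c w (okb i) (If i) (Ig i)).
  - have h1 : hn i <= 1 by rewrite /hn invf_le1 ?ltr0n// ler1n.
    have EA : HT (al i) w = HT (fun v t => aW v (t, 1 : R)) w by exact: (@HT_const R w (hn i) 1 (h0 i) h1).
    by rewrite EA.
  - by move=> t ct; rewrite /f /lft leNgt ct mul0r.
  - by move=> t ct; rewrite /g /lft ct subrr mul0r.
rewrite (funext E) in S.
have L : EAB w (\int[mu]_t f n t) (\int[mu]_t g n t) @[n --> \oo] --> EAB w q2 q2.
  by apply: EAB_cvg; [exact: (lim false)|exact: (lim true)].
have L2 : HT (fun v t => aW v (t, 1 : R)) w - EAB w (\int[mu]_t f n t) (\int[mu]_t g n t) @[n --> \oo] -->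
    HT (fun v t => aW v (t, 1 : R)) w - EAB w q2 q2 by apply: cvgB; [exact: cvg_cst|].
apply/eqP; rewrite -subr_eq0; apply/eqP.
by rewrite -(cvg_lim (@Rhausdorff R) L2) (cvg_lim (@Rhausdorff R) S).
Qed.

(** A factor (2 pi)^-2 for each inner vertex, the normalisation of [wstd]. *)
Definition Theta (w : seq bool) : R := \sum_(T <- brk w) ((2 * pi) ^+ 2) ^- (size w).-1 * mass R T.

(** The two evaluations of the holonomy are equated; substituting -2 pi times each letter turns -2
    pi [ZW] into [Theta] and normalises e^A e^B. *)
Theorem exp_Theta w n : (size w < n)%N -> \sum_(m < n) Zm Theta m w / m`!%:R = EAB w 1 1.
Proof.
move=> wn; have q0 : q2 != 0 by rewrite oppr_eq0 mulf_neq0// gt_eqF// pi_gt0.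
have ZT v : (0 < size v)%N -> q2 * ZW v = q2 ^+ size v * Theta v.
  move=> v0; rewrite -(prednK v0) exprS -mulrA; congr (_ * _); rewrite /ZW /Theta mulr_sumr.
  apply: eq_bigr => T _; rewrite mulrA; congr (_ * _).
  rewrite -exprVn -exprMn; congr (_ ^+ _); rewrite /kap.
  have p0 : 2 * pi != 0 :> R by rewrite mulf_neq0// gt_eqF// pi_gt0.
  have gen (a : R) : a != 0 -> - a^-1 = - a / a ^+ 2 by move=> a0; field; rewrite ?a0.
  exact: gen.
have := HT_high wn; rewrite HT_low EAB_scale => H.
apply: (mulfI (expf_neq0 (size w) q0)); rewrite H mulr_sumr; apply: eq_bigr => m _.
by rewrite [LHS]mulrA -(Zm_scale m w ZT) -mulrA.
Qed.

End HolonomyLimits.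

(** * Inverting the exponential on a single word *)

Section LogExp.
Variable R : realType.

Definition expp N : {poly R} := \poly_(i < N.+1) (if i == 0%N then 0 else (i`!%:R)^-1).
Definition logp N : {poly R} := \poly_(i < N.+1) (if i == 0%N then 0 else (-1) ^+ i.-1 / i%:R).

(** [expp] truncates e^X - 1 and [logp] truncates log(1 + X). The composite has derivative 1 modulo
    X^N, by (1 + X) log' = 1 - (-X)^N and q' = 1 + q - X^N / N! for q = [expp N]: the truncation
    errors have order N. *)
Lemma logp_expp N i : (i <= N)%N -> (logp N \Po expp N)`_i = (i == 1%N)%:R.
Proof.
case: i => [|j] jN.
  rewrite -horner_coef0 horner_comp horner_coef0 /expp /logp.
  by rewrite coef_poly /= horner_coef0 coef_poly.
have f0 k : k`!%:R != 0 :> R by rewrite pnatr_eq0 -lt0n fact_gt0.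
have j0 : j.+1%:R != 0 :> R by rewrite pnatr_eq0.
have dE : ((logp N \Po expp N)^`())`_j = (j == 0%N)%:R.
  pose q := expp N; pose q1 : {poly R} := \poly_(i < N) (i.+1`!%:R)^-1.
  have qX : q = q1 * 'X.
    apply/polyP => i; rewrite coefMX /q /expp !coef_poly; case: i => [|i] //=.
  have dp : (1 + 'X) * (logp N)^`() = 1 - (- 'X) ^+ N.
    have -> : (logp N)^`() = \sum_(i < N) (- 'X : {poly R}) ^+ i.
      apply/polyP => i; rewrite coef_deriv coef_poly ltnS coef_sum.
      have sg k : ((- 'X : {poly R}) ^+ k)`_i = (-1) ^+ k * (i == k)%:R.
        have -> : (- 'X : {poly R}) ^+ k = (-1) ^+ k *: 'X^k.
          elim: k => [|k IHk]; first by rewrite !expr0 scale1r.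
          by rewrite exprS IHk -scalerAr mulNr -exprS scalerN -scaleNr [in RHS]exprS mulN1r.
        by rewrite coefZ coefXn.
      rewrite (eq_bigr _ (fun (k : 'I_N) _ => sg k)).
      case: (ltnP i N) => iN /=; last first.
        rewrite mul0rn big1// => k _; rewrite (_ : i == k = false) ?mulr0//.
        by apply/negbTE; rewrite neq_ltn (leq_trans (ltn_ord k) iN) orbT.
      rewrite (bigD1 (Ordinal iN))//= eqxx mulr1 big1 ?addr0 => [|k /negbTE ki]; last first.
        by rewrite (_ : i == k = false) ?mulr0//; apply/negbTE; move/negbT: ki; apply: contra => /eqP ik; apply/eqP/val_inj.
      by rewrite -[LHS]mulr_natr divfK ?pnatr_eq0.
    by rewrite -opprB subrX1 -mulNr opprB opprK.
  have dq : q^`() = 1 + q - (N`!%:R)^-1 *: 'X^N.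
    apply/polyP => i; rewrite coef_deriv !(coefD, coefN) coef1 coefZ coefXn /q !coef_poly !ltnS.
    case: (ltngtP i N) => iN /=.
    - rewrite mulr0 subr0; case: i iN => [|i] iN /=; first by rewrite invr1 addr0.
      rewrite add0r -[LHS]mulr_natr factS natrM invfM mulrAC mulVf ?mul1r ?pnatr_eq0//.
    - rewrite mul0rn mulr0 subr0 addr0; case: i iN => // i; by [].
    - rewrite iN mul0rn mulr1; case: (N) => [|n] /=; by rewrite ?invr1 ?addr0 ?add0r subrr.
  rewrite deriv_comp -/q dq mulrBr.
  have -> : ((logp N)^`() \Po q) * (1 + q) = 1 - (- q) ^+ N.
    have := congr1 (comp_poly q) dp.
    rewrite rmorphM rmorphD rmorph1 /= comp_polyX rmorphB rmorph1 rmorphXn rmorphN /= comp_polyX => <-.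
    by rewrite mulrC.
  rewrite !coefB -scalerAr coefZ coefMXn jN mulr0 subr0 qX -mulNr exprMn_comm; last exact: mulrC.
  by rewrite coefMXn jN subr0 coef1.
move: dE; rewrite coef_deriv => dE.
apply: (mulIf j0); rewrite [LHS]mulr_natr dE eqSS; case: eqP => [->|_]; first by rewrite mulr1.
by rewrite mul0r.
Qed.

Variable v : seq bool.
Local Notation N := (size v).

Definition slice (i j : nat) := drop i (take j v).
(** Rows and columns are the positions between letters of [v]. Concatenation of adjacent factors
    becomes the matrix product, and a series without constant term becomes strictly triangular. *)
Definition Mx (f : seq bool -> R) : 'M[R]_(N.+1) :=
  \matrix_(i, j) if (i <= j)%N then f (slice i j) else 0.

Lemma size_slice i j : (j <= N)%N -> size (slice i j) = (j - i)%N.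
Proof. by move=> jN; rewrite size_drop size_takel. Qed.

Lemma Mx_pow (Z : seq bool -> R) m : Z [::] = 0 -> Mx Z ^+ m = Mx (Zm Z m).
Proof.
move=> Z0; elim: m => [|m IH].
  apply/matrixP => i j; rewrite expr0 !mxE /=; have jN : (j <= N)%N by rewrite -ltnS.
  case: (leqP i j) => ij; last by rewrite (_ : i == j = false)//; apply/negbTE; rewrite -val_eqE /= gtn_eqF.
  by rewrite -size_eq0 size_slice// subn_eq0 -val_eqE /= eqn_leq ij.
apply/matrixP => i j; rewrite exprSr IH -mulmxE !mxE.
have jN : (j <= N)%N by rewrite -ltnS.
pose F (k : nat) : R := (if (i <= k)%N then Zm Z m (slice i k) else 0) * (if (k <= j)%N then Z (slice k j) else 0).
rewrite (eq_bigr (fun k : 'I_N.+1 => F k)); last by move=> k _; rewrite !mxE.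
rewrite -(big_mkord xpredT F).
case: (leqP i j) => ij; last first.
  rewrite big1// => k _; rewrite /F; case: leqP => ik; rewrite ?mul0r//.
  by rewrite leqNgt (leq_trans ij ik) mulr0.
rewrite (@big_cat_nat _ _ _ i)//=; last by rewrite ltnW.
rewrite [X in X + _]big_nat [X in X + _]big1 ?add0r => [|k /andP[_ ki]]; last by rewrite /F leqNgt ki mul0r.
rewrite (@big_cat_nat _ _ _ j)//=; last by rewrite ltnW.
rewrite [X in _ + X]big_nat [X in _ + X]big1 ?addr0 => [|k /andP[jk _]]; last first.
  rewrite /F; case: (leqP k j) => kj; last by rewrite mulr0.
  have -> : k = j by apply/eqP; rewrite eqn_leq kj jk.
  by rewrite (_ : slice j j = [::]) ?Z0 ?mulr0//; apply: size0nil; rewrite size_slice// subnn.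
rewrite -{1}(add0n (i : nat)) big_addn size_slice// !big_nat; apply: eq_bigr => k /andP[_ kij].
have kj : (k + i <= j)%N by rewrite addnC -leq_subRL// ltnW.
rewrite /F leq_addl kj /slice drop_drop take_drop take_takel//.
Qed.

Lemma Mx_nilp (Z : seq bool -> R) : Z [::] = 0 -> Mx Z ^+ N.+1 = 0.
Proof.
move=> Z0; rewrite Mx_pow//; apply/matrixP => i j; rewrite !mxE; case: leqP => // ij.
have jN : (j <= N)%N by rewrite -ltnS.
by rewrite Zm_gt// size_slice// ltnS (leq_trans (leq_subr _ _)).
Qed.

Lemma horner_mx_poly n (A : 'M[R]_(N.+1)) (E : nat -> R) :
  horner_mx A (\poly_(i < n) E i) = \sum_(i < n) E i *: A ^+ i.
Proof.
rewrite poly_def raddf_sum /=; apply: eq_bigr => i _.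
by rewrite linearZ /= rmorphXn /= horner_mx_X.
Qed.

(* log(exp Th) = Th, evaluated in the nilpotent matrices indexed by the positions of [v] *)
Lemma log_word (Th X : seq bool -> R) : (0 < N)%N -> Th [::] = 0 -> X [::] = 0 ->
  (forall w, (0 < size w)%N -> (size w <= N)%N -> \sum_(m < N.+1) Zm Th m w / m`!%:R = X w) ->
  \sum_(m < N.+1) (if m == 0%N :> nat then 0 else (-1) ^+ m.-1 / m%:R) * Zm X m v = Th v.
Proof.
move=> N0 T0 X0 H; pose A := Mx Th; pose B := Mx X.
have EB : horner_mx A (expp N) = B.
  rewrite /expp horner_mx_poly; apply/matrixP => i j.
  rewrite summxE /B /Mx mxE; have jN : (j <= N)%N by rewrite -ltnS.
  under eq_bigr => m _ do rewrite Mx_pow// !mxE.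
  case: (leqP i j) => ij; last by rewrite big1// => m _; rewrite mulr0.
  case: (posnP (j - i)%N) => [s0|s0].
    have e0 : slice i j = [::] by apply: size0nil; rewrite size_slice.
    rewrite e0 X0 big1// => -[[|m] hm] _ /=; rewrite ?mul0r// big_geq ?mulr0//.
  rewrite -H ?size_slice ?(leq_trans (leq_subr _ _))//; apply: eq_bigr => m _.
  have sn : (slice i j == [::]) = false by rewrite -size_eq0 size_slice// eqn0Ngt s0.
  by case: m => [[|m] hm] /=; [rewrite sn !mul0r|rewrite mulrC].
have E1 : horner_mx A (logp N \Po expp N) = horner_mx B (logp N).
  rewrite /logp horner_mx_poly poly_def [X in horner_mx A X]raddf_sum /= raddf_sum /=.
  apply: eq_bigr => i _; rewrite linearZ /= linearZ /= rmorphXn /= comp_polyX rmorphXn /=.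
  by rewrite -EB.
have E2 : horner_mx A (logp N \Po expp N) = A.
  rewrite -(poly_take_drop N.+1 (logp N \Po expp N)).
  have -> : take_poly N.+1 (logp N \Po expp N) = 'X.
    apply/polyP => i; rewrite coef_take_poly coefX ltnS; case: (leqP i N) => iN; first exact: logp_expp.
    by rewrite gtn_eqF// (leq_ltn_trans N0).
  by rewrite rmorphD rmorphM rmorphXn /= horner_mx_X Mx_nilp// mulr0 addr0.
have := congr1 (fun M : 'M[R]_(N.+1) => M ord0 ord_max) (esym E1).
rewrite E2 /logp horner_mx_poly summxE [RHS]mxE /= => E.
have sl : slice 0 N = v by rewrite /slice drop0 take_size.
rewrite sl in E; rewrite -E; apply: eq_bigr => m _.
by rewrite mxE Mx_pow// mxE /= sl.
Qed.

End LogExp.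

(** * Sums over words of a given length *)

Section Words.
Fixpoint wds (n : nat) : seq (seq bool) :=
  if n is n'.+1 then map (cons false) (wds n') ++ map (cons true) (wds n') else [:: [::]].

Lemma size_wds n w : w \in wds n -> size w = n.
Proof.
elim: n w => [|n IH] w /=; first by rewrite inE => /eqP ->.
by rewrite mem_cat => /orP[] /mapP[u /IH <- ->].
Qed.

Lemma sum_wds_cat (V : nmodType) k l (F : seq bool -> V) :
  \sum_(w <- wds (k + l)) F w = \sum_(u <- wds k) \sum_(v <- wds l) F (u ++ v).
Proof.
elim: k F => [|k IH] F; first by rewrite big_seq1.
by rewrite /= !big_cat !big_map /= !IH.
Qed.

Variable R : realType.
Variable V : lmodType R.

Lemma sum_all_const (b : bool) (p : pred bool) j (F : seq bool -> V) : p b -> ~~ p (~~ b) ->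
  \sum_(u <- wds j) (all p u)%:R *: F u = F (nseq j b).
Proof.
move=> pb npb; elim: j F => [|j IH] F; first by rewrite big_seq1 scale1r.
rewrite /= big_cat !big_map /=; case: b pb npb IH => /= pb npb IH.
  rewrite big1 ?add0r => [|u _]; last by rewrite (negbTE npb) scale0r.
  by under eq_bigr => u _ do rewrite pb; rewrite (IH (fun u => F (true :: u))).
rewrite [X in _ + X]big1 ?addr0 => [|u _]; last by rewrite (negbTE npb) scale0r.
by under eq_bigr => u _ do rewrite pb; rewrite (IH (fun u => F (false :: u))).
Qed.

Lemma sum_EAB s (nu : seq bool -> V) : \sum_(w <- wds s) EAB w 1 1 *: nu w =
  \sum_(0 <= j < s.+1) (j`!%:R * (s - j)`!%:R)^-1 *: nu (nseq j false ++ nseq (s - j) true).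
Proof.
rewrite big_seq (eq_bigr (fun w => \sum_(j < s.+1) ((all negb (take j w) && all id (drop j w))%:R *
   (j`!%:R * (s - j)`!%:R)^-1) *: nu w)); last first.
  move=> w ws; rewrite -scaler_suml; congr (_ *: _); rewrite /EAB (size_wds ws); apply: eq_bigr => j _.
  by rewrite !expr1n !mul1r invfM mulrA.
rewrite -big_seq exchange_big /= big_mkord; apply: eq_bigr => j _.
have js : (j <= s)%N by rewrite -ltnS.
rewrite -{1}(subnKC js) sum_wds_cat.
rewrite -(@sum_all_const false negb j (fun u => (j`!%:R * (s - j)`!%:R)^-1 *: nu (u ++ nseq (s - j) true)))//.
rewrite !big_seq; apply: eq_bigr => u uj.
rewrite -(@sum_all_const true id (s - j) (fun v => (j`!%:R * (s - j)`!%:R)^-1 *: nu (u ++ v)))//.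
rewrite scaler_sumr; apply: eq_bigr => v _.
rewrite take_size_cat ?(size_wds uj)// drop_size_cat ?(size_wds uj)//.
by case: (all negb u); rewrite /= ?scale1r ?scale0r ?mul0r ?scale0r// scalerA.
Qed.

End Words.

(** * Splitting off the last value of a finite function *)

Section FfunSplit.

Definition ffrcons (T : Type) m (f : {ffun 'I_m -> T}) (x : T) : {ffun 'I_m.+1 -> T} :=
  [ffun i : 'I_m.+1 => if (insub (i : nat) : option 'I_m) is Some j then f j else x].

Lemma ffrcons_widen T m (f : {ffun 'I_m -> T}) x i : ffrcons f x (widen_ord (leqnSn m) i) = f i.
Proof. by rewrite ffunE /= valK. Qed.

Lemma ffrcons_max T m (f : {ffun 'I_m -> T}) x : ffrcons f x ord_max = x.
Proof. by rewrite ffunE /= insubF// ltnn. Qed.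

Lemma sum_ffunS (V : nmodType) (T : finType) m (F : {ffun 'I_m.+1 -> T} -> V) :
  \sum_f F f = \sum_(f : {ffun 'I_m -> T}) \sum_(x : T) F (ffrcons f x).
Proof.
rewrite pair_big /= (reindex (fun p : {ffun 'I_m -> T} * T => ffrcons p.1 p.2))//=.
apply: onW_bij; exists (fun g : {ffun 'I_m.+1 -> T} => ([ffun i : 'I_m => g (widen_ord (leqnSn m) i)], g ord_max)).
  move=> [f x] /=; rewrite ffrcons_max; congr (_, _); apply/ffunP => i.
  by rewrite ffunE ffrcons_widen.
move=> g /=; apply/ffunP => i; rewrite ffunE /=.
case: insubP => [j _ ji|]; first by rewrite ffunE; congr (g _); apply: val_inj.
rewrite -leqNgt => mi; congr (g _); apply: val_inj => /=; apply/eqP.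
by rewrite eqn_leq mi -ltnS ltn_ord.
Qed.

Lemma sum_ffun0 (V : nmodType) (T : finType) (F : {ffun 'I_0 -> T} -> V) f0 : \sum_f F f = F f0.
Proof.
rewrite (bigD1 f0)//= big1 ?addr0// => f /eqP[]; by apply/ffunP => -[].
Qed.

Lemma forall_ordS m (p : pred 'I_m.+1) :
  [forall i, p i] = [forall i : 'I_m, p (widen_ord (leqnSn m) i)] && p ord_max.
Proof.
apply/forallP/andP => [H|[/forallP H1 H2] i]; first by split => //; apply/forallP.
have [im|im] := ltnP i m.
  by have := H1 (Ordinal im); congr p; apply: val_inj.
by rewrite (_ : i = ord_max)//; apply: val_inj; apply/eqP; rewrite eqn_leq im -ltnS ltn_ord.
Qed.

End FfunSplit.

(** * Dynkin's sum over exponents as a sum over words *)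

Section DynkinSum.
Variables (R : realType) (V : lmodType R).

(** The coefficients of e^A e^B - 1; the m-th power of this series runs over m nonempty blocks A^r
    B^s, as Dynkin's formula does. *)
Definition Xw (w : seq bool) : R := if w is [::] then 0 else EAB w 1 1.

(** A last block A^a B^b is described by the position k where it starts in a word of length M and by
    its number j of letters A. *)
Lemma sum_simplex B M (F : nat -> nat -> V) : (M <= B)%N ->
  \sum_(a < B.+1) \sum_(b < B.+1) (if (0 < a + b)%N && (a + b <= M)%N then F a b else 0) =
  \sum_(0 <= k < M) \sum_(0 <= j < (M - k).+1) F j (M - k - j)%N.
Proof.
move=> MB.
transitivity (\sum_(a < B.+1) \sum_(b < B.+1) \sum_(0 <= k < M) (if (a + b == M - k)%N then F a b else 0)).
  apply: eq_bigr => a _; apply: eq_bigr => b _.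
  case: ifP => [/andP[p0 pM]|np].
    have lt : (M - (a + b) < M)%N by rewrite ltn_subrL p0 (leq_trans p0).
    rewrite big_mkord (bigD1 (Ordinal lt))//= subKn// eqxx big1 ?addr0// => k kn; case: eqP => // e.
    by move/eqP: kn => []; apply: val_inj => /=; rewrite e subKn// ltnW.
  rewrite big_nat big1// => k /andP[_ kM]; case: eqP => // e.
  by move: np; rewrite e subn_gt0 kM leq_subr.
under eq_bigr => a _ do rewrite exchange_big /=.
rewrite exchange_big /= !big_nat; apply: eq_bigr => k /andP[_ kM].
set s := (M - k)%N; have sB : (s.+1 <= B.+1)%N by rewrite ltnS (leq_trans (leq_subr _ _)).
rewrite -(big_mkord xpredT (fun a => \sum_(b < B.+1) (if (a + b == s)%N then F a b else 0))).
rewrite (@big_cat_nat _ _ _ s.+1)//= [X in _ + X]big_nat [X in _ + X]big1 ?addr0; last first.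
  move=> a /andP[sa _]; rewrite big1// => b _; case: eqP => // e.
  by move: sa; rewrite -e ltnNge leq_addr.
rewrite !big_nat; apply: eq_bigr => a /andP[_ as_].
have bB : (s - a < B.+1)%N by rewrite ltnS (leq_trans (leq_subr _ _))// -ltnS.
rewrite (bigD1 (Ordinal bB))//= subnKC// eqxx big1 ?addr0// => b bn; case: eqP => // e.
by move/eqP: bn => []; apply: val_inj => /=; rewrite -e addKn.
Qed.

(** Induction on m splits off the last block. The bound B on the exponents stays fixed while M
    decreases; it cuts nothing off because the exponents add up to M. *)
Lemma dynkin_sum B m M (nu : seq bool -> V) : (M <= B)%N ->
  \sum_(r : {ffun 'I_m -> 'I_B.+1}) \sum_(s : {ffun 'I_m -> 'I_B.+1})
    (if [forall i, (0 < r i + s i)%N] && (\sum_(i < m) (r i + s i) == M)%N then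
      (\prod_(i < m) ((r i)`!%:R * (s i)`!%:R))^-1 *:
       nu (flatten [seq nseq (r i) false ++ nseq (s i) true | i <- enum 'I_m])
     else 0) = \sum_(w <- wds M) Zm Xw m w *: nu w.
Proof.
elim: m M nu => [|m IH] M nu MB.
  rewrite (sum_ffun0 _ [ffun=> ord0]) (sum_ffun0 _ [ffun=> ord0]) !big_ord0 invr1 scale1r.
  rewrite (_ : enum 'I_0 = [::]) /=; last by apply: size0nil; rewrite size_enum_ord.
  rewrite (_ : [forall i : 'I_0, _]) /=; last by apply/forallP => -[].
  case: M MB => [|M] _; first by rewrite /= big_seq1 scale1r.
  by rewrite big_seq big1// => w /size_wds; case: w => // b w _; rewrite scale0r.
rewrite sum_ffunS.
under eq_bigr => r _ do under eq_bigr => a _ do rewrite sum_ffunS.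
transitivity (\sum_(a < B.+1) \sum_(b < B.+1) (if (0 < a + b)%N && (a + b <= M)%N then
    (a`!%:R * b`!%:R)^-1 *: \sum_(w <- wds (M - (a + b))) Zm Xw m w *: nu (w ++ nseq a false ++ nseq b true) else 0)).
  rewrite exchange_big /=; apply: eq_bigr => a _.
  under eq_bigr => r _ do rewrite exchange_big /=.
  rewrite exchange_big /=; apply: eq_bigr => b _.
  case: ifP => [/andP[p0 pM]|np].
    rewrite -IH; last by rewrite (leq_trans (leq_subr _ _)).
    rewrite scaler_sumr; apply: eq_bigr => r _; rewrite scaler_sumr; apply: eq_bigr => s _.
    rewrite forall_ordS !big_ord_recr /= !ffrcons_max p0 andbT.
    rewrite (eq_forallb (P2 := fun i => (0 < r i + s i)%N)); last by move=> i; rewrite !ffrcons_widen.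
    under eq_bigr => i _ do rewrite !ffrcons_widen.
    have PE : \prod_(i < m) ((ffrcons r a (widen_ord (leqnSn m) i))`!%:R * (ffrcons s b (widen_ord (leqnSn m) i))`!%:R) =
       \prod_(i < m) ((r i)`!%:R * (s i)`!%:R) :> R by apply: eq_bigr => i _; rewrite !ffrcons_widen.
    rewrite PE.
    rewrite -(eqn_add2r (a + b) (\sum_(i < m) (r i + s i))) subnK//.
    case: ifP => _; last by rewrite scaler0.
    rewrite invfM scalerA mulrC; congr (_ *: nu _).
    rewrite enum_ordSr map_rcons flatten_rcons -map_comp /= !ffrcons_max; congr (flatten _ ++ _).
    by apply: eq_map => i /=; rewrite !ffrcons_widen.
  rewrite big1// => r _; rewrite big1// => s _.
  rewrite forall_ordS !big_ord_recr /= !ffrcons_max; case: ifP => // /andP[/andP[_ p0] /eqP e].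
  by move: np; rewrite p0 -e leq_addl.
rewrite (@sum_simplex B M (fun a b => (a`!%:R * b`!%:R)^-1 *:
  \sum_(w <- wds (M - (a + b))) Zm Xw m w *: nu (w ++ nseq a false ++ nseq b true)))//.
transitivity (\sum_(0 <= k < M) \sum_(u <- wds k) \sum_(w <- wds (M - k)) (Zm Xw m u * Xw w) *: nu (u ++ w)).
  rewrite !big_nat; apply: eq_bigr => k /andP[_ kM].
  transitivity (\sum_(u <- wds k) Zm Xw m u *: \sum_(0 <= j < (M - k).+1) (j`!%:R * (M - k - j)`!%:R)^-1 *:
      nu (u ++ nseq j false ++ nseq (M - k - j) true)).
    under [RHS]eq_bigr => u _ do rewrite scaler_sumr.
    rewrite exchange_big /= !big_nat; apply: eq_bigr => j /andP[_ jk].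
    have jk' : (j <= M - k)%N by rewrite -ltnS.
    rewrite (subnKC jk') (subKn (ltnW kM)) scaler_sumr; apply: eq_bigr => u _.
    by rewrite !scalerA mulrC.
  apply: eq_bigr => u _; rewrite -(sum_EAB (M - k) (fun w => nu (u ++ w))) scaler_sumr.
  rewrite !big_seq; apply: eq_bigr => w /size_wds sw; rewrite scalerA.
  by case: w sw => [|b w]// /esym/eqP; rewrite subn_eq0 leqNgt kM.
rewrite [RHS]big_seq (eq_bigr (fun w => \sum_(0 <= k < M) (Zm Xw m (take k w) * Xw (drop k w)) *: nu w)); last first.
  by move=> w /size_wds sw; rewrite /= sw scaler_suml.
rewrite -big_seq exchange_big /= !big_nat; apply: eq_bigr => k /andP[_ kM].
rewrite -[in RHS](subnKC (ltnW kM)) sum_wds_cat !big_seq; apply: eq_bigr => u /size_wds su.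
by apply: eq_bigr => w _; rewrite take_size_cat// drop_size_cat.
Qed.

End DynkinSum.

(** * Plane trees by their number of leaves *)

Section TreeWords.

Fixpoint word (T : tree) : seq bool :=
  match T with leaf b => [:: b] | node l r => word l ++ word r end.

Fixpoint leaves (T : tree) : nat :=
  match T with leaf _ => 1 | node l r => (leaves l + leaves r)%N end.

Lemma leaves_word T : leaves T = size (word T).
Proof. by elim: T => //= l -> r ->; rewrite size_cat. Qed.

Lemma leaves_gt0 T : (0 < leaves T)%N.
Proof. by elim: T => //= l hl r _; rewrite addn_gt0 hl. Qed.

Fixpoint TRn (n N : nat) : seq tree :=
  match n with
  | 0 => [::]
  | n'.+1 => if N == 1%N then [:: leaf false; leaf true] else
     flatten [seq [seq node l r | l <- TRn n' k, r <- TRn n' (N - k)] | k <- index_iota 1 N]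
  end.

Definition TR N := TRn N N.

Lemma TRn_stable n m N : (N <= n)%N -> (N <= m)%N -> TRn n N = TRn m N.
Proof.
elim: n m N => [|n IH] [|m] N //.
- by rewrite leqn0 => /eqP ->.
- by move=> _; rewrite leqn0 => /eqP ->.
move=> Nn Nm /=; case: eqP => // _; congr (flatten _); apply/eq_in_map => k.
rewrite mem_index_iota => /andP[k0 kN].
have kn : (k <= n)%N by rewrite -ltnS (leq_trans kN).
have km : (k <= m)%N by rewrite -ltnS (leq_trans kN).
have sk : (N - k < N)%N by rewrite ltn_subrL k0 (leq_trans _ kN).
have sn : (N - k <= n)%N by rewrite -ltnS (leq_trans sk).
have sm : (N - k <= m)%N by rewrite -ltnS (leq_trans sk).
by rewrite (IH m k)// (IH m (N - k)%N).
Qed.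

Lemma sum_TR1 (V : Type) (idx : V) (op : Monoid.com_law idx) (phi : tree -> V) :
  \big[op/idx]_(T <- TR 1) phi T = op (phi (leaf false)) (phi (leaf true)).
Proof. by rewrite /TR /= big_cons big_seq1. Qed.

Lemma sum_TR (V : Type) (idx : V) (op : Monoid.com_law idx) (phi : tree -> V) N : (1 < N)%N ->
  \big[op/idx]_(T <- TR N) phi T = \big[op/idx]_(1 <= k < N) \big[op/idx]_(l <- TR k)
    \big[op/idx]_(r <- TR (N - k)) phi (node l r).
Proof.
case: N => // N N1; rewrite {1}/TR [TRn _ _]/= gtn_eqF// big_flatten big_map.
rewrite [LHS]big_seq [RHS]big_seq; apply: eq_bigr => k; rewrite mem_index_iota => /andP[k0 kN].
have sk : (N.+1 - k <= N)%N by rewrite -ltnS ltn_subrL k0.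
rewrite big_allpairs_dep (@TRn_stable N k k)//.
by apply: eq_bigr => l _; rewrite (@TRn_stable N (N.+1 - k)%N (N.+1 - k)%N).
Qed.

(** Every bracketing of [w] spells [w]; phrased through sums, this can be rewritten under a
    summation sign. *)
Lemma sum_brk_word (V : nmodType) (F : tree -> seq bool -> V) w :
  \sum_(T <- brk w) F T (word T) = \sum_(T <- brk w) F T w.
Proof.
elim/word_ind: w F => w IH F; case: (ltnP 1 (size w)) => w1; last first.
  by case: w w1 IH => [|b [|]]// _ _; rewrite /brk /= ?big_nil// !big_seq1.
rewrite !sum_brk// !big_nat; apply: eq_bigr => k /andP[k0 kw].
have st : (size (take k w) < size w)%N by rewrite size_take kw.
have sd : (size (drop k w) < size w)%N by rewrite size_drop ltn_subrL k0 (leq_trans _ kw).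
rewrite exchange_big /=.
under eq_bigr => r _ do rewrite (IH _ st (fun l u => F (node l r) (u ++ word r))).
rewrite exchange_big /=; apply: eq_bigr => l _.
by rewrite (IH _ sd (fun r u => F (node l r) (take k w ++ u))) cat_take_drop.
Qed.

Lemma nat_lt_ind (P : nat -> Prop) : (forall n, (forall m, (m < n)%N -> P m) -> P n) -> forall n, P n.
Proof.
move=> H n; have [m le_m] := ubnP n; elim: m n le_m => // m IH n le_m.
by apply: H => k kn; apply: IH; rewrite (leq_trans kn).
Qed.

Lemma sum_TR_leaves (V : nmodType) (F : tree -> nat -> V) N : (0 < N)%N ->
  \sum_(T <- TR N) F T (leaves T) = \sum_(T <- TR N) F T N.
Proof.
elim/nat_lt_ind: N F => N IH F N0; case: (ltngtP N 1) => N1; first by case: N N0 N1 {IH}.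
  rewrite !sum_TR// !big_nat; apply: eq_bigr => k /andP[k0 kN].
  have sk : (N - k < N)%N by rewrite ltn_subrL k0.
  rewrite exchange_big /=.
  under eq_bigr => r _ do rewrite (IH _ kN (fun l u => F (node l r) (u + leaves r)%N))//.
  rewrite exchange_big /=; apply: eq_bigr => l _.
  by rewrite (IH _ sk (fun r u => F (node l r) (k + u)%N)) ?subn_gt0// subnKC// ltnW.
by rewrite N1 !sum_TR1.
Qed.

Lemma sum_wds_brk (V : nmodType) (phi : tree -> V) N : (0 < N)%N ->
  \sum_(w <- wds N) \sum_(T <- brk w) phi T = \sum_(T <- TR N) phi T.
Proof.
elim/nat_lt_ind: N phi => N IH phi N0; case: (ltngtP N 1) => N1; first by case: N N0 N1 {IH}.
  rewrite sum_TR// big_seq (eq_bigr (fun w => \sum_(1 <= k < N) \sum_(l <- brk (take k w))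
    \sum_(r <- brk (drop k w)) phi (node l r))); last by move=> w /size_wds sw; rewrite sum_brk ?sw.
  rewrite -big_seq exchange_big /= !big_nat; apply: eq_bigr => k /andP[k0 kN].
  have sk : (N - k < N)%N by rewrite ltn_subrL k0.
  rewrite -{1}(subnKC (ltnW kN)) sum_wds_cat -(IH _ kN)// !big_seq; apply: eq_bigr => u /size_wds su.
  under eq_bigr => v _ do rewrite take_size_cat// drop_size_cat//.
  rewrite exchange_big /=; apply: eq_bigr => l _; rewrite -(IH _ sk) ?subn_gt0//.
by rewrite N1 sum_TR1 /brk /= !big_cons !big_nil !addr0.
Qed.

End TreeWords.

(** * Expanding bracketed trees into words *)

Section LieExpansion.

(** The linear extension of [nu] evaluated on the expansion of the Lie monomial T, in which a node
    with subtrees l and r stands for lr - rl. *)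
Fixpoint exS (V : zmodType) (T : tree) (nu : seq bool -> V) : V :=
  match T with
  | leaf b => nu [:: b]
  | node l r => exS r (fun v => exS l (fun u => nu (u ++ v)))
              - exS l (fun u => exS r (fun v => nu (v ++ u)))
  end.

Lemma exS_ext (V : zmodType) T (nu nu' : seq bool -> V) :
  (forall u, (0 < size u)%N -> nu u = nu' u) -> exS T nu = exS T nu'.
Proof.
elim: T nu nu' => [b|l IHl r IHr] nu nu' H /=; first exact: H.
by congr (_ - _); [apply: IHr => v v0; apply: IHl => u u0|apply: IHl => u u0; apply: IHr => v v0];
  apply: H; rewrite size_cat addn_gt0 ?u0 ?v0.
Qed.

Lemma exS_morph (V W : zmodType) (phi : V -> W) T (nu : seq bool -> V) :
  (forall u v, phi (u - v) = phi u - phi v) -> exS T (fun u => phi (nu u)) = phi (exS T nu).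
Proof.
move=> H; elim: T nu => [b|l IHl r IHr] nu //=.
rewrite H -IHr -IHl; congr (_ - _); apply: exS_ext => u _; [exact: IHl|exact: IHr].
Qed.

Lemma exS_sum (V : zmodType) (I : Type) (s : seq I) T (F : I -> seq bool -> V) :
  exS T (fun u => \sum_(i <- s) F i u) = \sum_(i <- s) exS T (F i).
Proof.
elim: T F => [b|l IHl r IHr] F //=; rewrite sumrB -IHr -IHl.
by congr (_ - _); apply: exS_ext => u _; [rewrite -IHl|rewrite -IHr].
Qed.

Variable R : realType.

Lemma exS_Z (V : lmodType R) (a : R) T (nu : seq bool -> V) : exS T (fun u => a *: nu u) = a *: exS T nu.
Proof. by apply: (exS_morph (phi := fun v => a *: v)) => u v; rewrite scalerBr. Qed.

(* [plug C T] puts [T] into the hole of the one-hole context [C], listed from the hole outwards *)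
Fixpoint plug (C : seq (bool * tree)) (T : tree) : tree :=
  if C is (b, s) :: C' then plug C' (if b then node s T else node T s) else T.

Lemma plug_cat C D T : plug (C ++ D) T = plug D (plug C T).
Proof. by elim: C T => //= -[b s] C IH T. Qed.

(** Quantifying over contexts covers an exchange at any depth, and makes the property pass to the
    restriction to either subtree. *)
Definition flip_anti (f : tree -> R) :=
  forall C l r, f (plug C (node l r)) = - f (plug C (node r l)).

Lemma flip_anti_l f r : flip_anti f -> flip_anti (fun l => f (node l r)).
Proof.
move=> H C a b; have E T : node (plug C T) r = plug (C ++ [:: (false, r)]) T by rewrite plug_cat.
by rewrite !E.
Qed.

Lemma flip_anti_r f l : flip_anti f -> flip_anti (fun r => f (node l r)).
Proof.
move=> H C a b; have E T : node l (plug C T) = plug (C ++ [:: (true, l)]) T by rewrite plug_cat.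
by rewrite !E.
Qed.

Lemma sum_TR_swap (V : nmodType) N (F : tree -> tree -> V) :
  \sum_(1 <= k < N) \sum_(l <- TR k) \sum_(r <- TR (N - k)) F l r =
  \sum_(1 <= k < N) \sum_(l <- TR k) \sum_(r <- TR (N - k)) F r l.
Proof.
rewrite big_nat_rev /= !big_nat; apply: eq_bigr => k /andP[k0 kN].
rewrite exchange_big /= add1n subSS; congr (\sum_(i <- TR _) _); first by rewrite subKn// ltnW.
Qed.

(** The two terms lr and -rl of a node become equal after exchanging its subtrees, by antisymmetry
    of f. Each of the N - 1 nodes thus contributes a factor 2, and the expansion of T may be
    replaced by its plain word. *)
Lemma exS_flip (V : lmodType R) N f (nu : seq bool -> V) : flip_anti f -> (0 < N)%N ->
  \sum_(T <- TR N) f T *: exS T nu = 2 ^+ N.-1 *: \sum_(T <- TR N) f T *: nu (word T).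
Proof.
elim/nat_lt_ind: N f nu => N IH f nu fa N0; case: (ltngtP N 1) => N1; first by case: N N0 N1 {IH}.
  have E1 : \sum_(T <- TR N) f T *: exS T nu = 2 *: \sum_(1 <= k < N) \sum_(l <- TR k) \sum_(r <- TR (N - k))
      f (node l r) *: exS r (fun v => exS l (fun u => nu (u ++ v))).
    rewrite sum_TR//=.
    under eq_bigr => k _ do under eq_bigr => l _ do under eq_bigr => r _ do rewrite scalerBr.
    under eq_bigr => k _ do under eq_bigr => l _ do rewrite sumrB.
    under eq_bigr => k _ do rewrite sumrB.
    rewrite sumrB [X in _ - X](@sum_TR_swap _ N (fun l r => f (node l r) *: exS l (fun u => exS r (fun v => nu (v ++ u))))).
    rewrite -[X in _ = X]/(_) scaler_nat mulr2n; congr (_ + _); rewrite -sumrN; apply: eq_bigr => k _.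
    rewrite -sumrN; apply: eq_bigr => l _; rewrite -sumrN; apply: eq_bigr => r _.
    by rewrite (fa [::] r l) scaleNr opprK.
  rewrite E1 sum_TR//.
  have -> : 2 ^+ N.-1 = 2 * 2 ^+ N.-2 :> R by rewrite -exprS; congr (_ ^+ _); case: (N) N1 => [|[|]].
  rewrite -scalerA; congr (_ *: _); rewrite scaler_sumr !big_nat; apply: eq_bigr => k /andP[k0 kN].
  have sk : (N - k < N)%N by rewrite ltn_subrL k0.
  have sk0 : (0 < N - k)%N by rewrite subn_gt0.
  have E2 : \sum_(l <- TR k) \sum_(r <- TR (N - k)) f (node l r) *: exS r (fun v => exS l (fun u => nu (u ++ v))) =
     \sum_(r <- TR (N - k)) 2 ^+ k.-1 *: \sum_(l <- TR k) f (node l r) *: exS r (fun v => nu (word l ++ v)).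
    rewrite exchange_big /=; apply: eq_bigr => r _.
    transitivity (exS r (fun v => \sum_(l <- TR k) f (node l r) *: exS l (fun u => nu (u ++ v)))).
      by rewrite exS_sum; apply: eq_bigr => l _; rewrite exS_Z.
    rewrite [X in _ = _ *: X](eq_bigr (fun l => exS r (fun v => f (node l r) *: nu (word l ++ v)))); last by move=> l _; rewrite exS_Z.
    rewrite -exS_sum -exS_Z; apply: exS_ext => v _.
    by rewrite (IH _ kN (fun l => f (node l r)) (fun u => nu (u ++ v)) (flip_anti_l r fa) k0).
  rewrite E2.
  have -> : 2 ^+ N.-2 = 2 ^+ k.-1 * 2 ^+ (N - k).-1 :> R.
    by rewrite -exprD; congr (_ ^+ _); lia.
  rewrite -scaler_sumr -scalerA; congr (_ *: _); rewrite [LHS]exchange_big /= scaler_sumr; apply: eq_bigr => l _.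
  by rewrite (IH _ sk (fun r => f (node l r)) (fun v => nu (word l ++ v)) (flip_anti_r l fa) sk0).
by rewrite N1 !sum_TR1 expr0 scale1r.
Qed.

End LieExpansion.

(** * Antisymmetry of the tree weights *)

Section MassFlip.
Variable R : realType.
Local Notation mu := (@lebesgue_measure R).
Local Notation mu2 := (sprod mu mu).

(** A relation that climbs up a context: densities opposite almost everywhere have opposite
    one-forms almost everywhere, hence opposite densities after one more grafting. *)
Definition opp_dens (T T' : tree) : Prop :=
  [/\ mtree R T = mu2, mtree R T' = mu2 & {ae mu2, forall p, dens T p = - dens T' p :> R}].

Lemma opp_dens_ab T T' : opp_dens T T' ->
  {ae mu2, forall p, aT T p = - aT T' p /\ bT T p = - bT T' p :> R}.
Proof.
move=> [mT mT' H]; have mN f (k : pt R -> R) : measurable_fun setT k -> itg (mtree R T') (fun q => k q * dens T' q) ->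
    f = \int[mtree R T]_q (k q * dens T q) -> f = - \int[mtree R T']_q (k q * dens T' q).
  move=> mk I ->; rewrite -mulN1r -rintZ// mT' mT; apply: rint_ae.
  - by apply: mfM => //; exact: (@mdens R T).
  - by apply: mfM; [exact: measurable_cst|apply: mfM => //; exact: (@mdens R T')].
  - by apply: filterS H => q ->; ring.
apply: filterS (filterI (@aK_dens_ae R T') (@bK_dens_ae R T')) => p [Ia Ib]; split.
  by apply: mN => //; apply: maK; msr.
by apply: mN => //; apply: mbK; msr.
Qed.

Lemma opp_dens_node T T' s : opp_dens T T' ->
  opp_dens (node T s) (node T' s) /\ opp_dens (node s T) (node s T').
Proof.
move=> H; have AB := opp_dens_ab H; split; split=> //.
  apply: filterS (filterI AB (filterI (@dens_nodeE R T s) (@dens_nodeE R T' s))) => p [[a b] [-> ->]].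
  by rewrite a b; ring.
apply: filterS (filterI AB (filterI (@dens_nodeE R s T) (@dens_nodeE R s T'))) => p [[a b] [-> ->]].
by rewrite a b; ring.
Qed.

Lemma opp_dens_plug C l r : opp_dens (plug C (node l r)) (plug C (node r l)).
Proof.
have : opp_dens (node l r) (node r l).
  split=> //; apply: filterS (filterI (@dens_nodeE R l r) (@dens_nodeE R r l)) => p [-> ->].
  by ring.
elim: C (node l r) (node r l) => //= -[b s] C IH T T' H; apply: IH.
by have [h1 h2] := opp_dens_node s H; case: b.
Qed.

Lemma mass_flip : flip_anti (mass R).
Proof.
move=> C l r; have [m1 m2 H] := opp_dens_plug C l r.
rewrite /mass -mulN1r -rintZ; last exact: dens_itg.
rewrite m1 m2; apply: rint_ae; [exact: (@mdens R _)|by apply: mfM; [exact: measurable_cst|exact: (@mdens R _)]|].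
by apply: filterS H => p ->; ring.
Qed.

(** The weight of a tree as normalised in [wstd], apart from the factorial. *)
Definition th (T : tree) : R := ((2 * pi) ^+ 2) ^- (leaves T).-1 * mass R T.

Lemma th_flip : flip_anti th.
Proof.
move=> C l r; rewrite /th mass_flip mulrN; congr (- (_ ^- _.-1 * _)).
have : leaves (node l r) = leaves (node r l) by rewrite /= addnC.
elim: C (node l r) (node r l) => //= -[b s] C IH T T' H; apply: IH.
by case: b; rewrite /= H.
Qed.

Lemma sum_th w : \sum_(T <- brk w) th T = Theta R w.
Proof.
have := sum_brk_word (fun T u => ((2 * pi) ^+ 2) ^- (size u).-1 * mass R T) w.
by rewrite /Theta => <-; apply: eq_bigr => T _; rewrite /th leaves_word.
Qed.

(** The logarithm series inverts [exp_Theta]: the left-hand side is the coefficient of [v] in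
    log(e^A e^B). *)
Lemma log_EAB v : (0 < size v)%N ->
  \sum_(m < (size v).+1) (if m == 0%N :> nat then 0 else (-1) ^+ m.-1 / m%:R) * Zm (@Xw R) m v =
  \sum_(T <- brk v) th T.
Proof.
move=> v0; rewrite sum_th; apply: log_word => //; first by rewrite /Theta /brk /= big_nil.
by move=> w w0 wv; rewrite exp_Theta//; case: w w0 {wv}.
Qed.

End MassFlip.

(** * The Campbell-Baker-Hausdorff series as a sum over trees *)

Section CBH.
Variables (R : realType) (d : nat) (c : 'I_d -> 'I_d -> 'I_d -> R).
Hypothesis anti : lie_antisym c.
Hypothesis jac : lie_jacobi c.
Local Notation lie := (lie R d).
Local Notation bracket := (bracket c).

Lemma lscaleE (a : R) (u : lie) : lscale (mpolyC (nv d) a) u = a *: u.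
Proof. by apply/ffunP => k; rewrite !ffunE mul_mpolyC. Qed.

Lemma bracketBr (u v w : lie) : bracket u (v - w) = bracket u v - bracket u w.
Proof.
apply/ffunP => k; rewrite !ffunE -sumrB; apply: eq_bigr => i _; rewrite -sumrB; apply: eq_bigr => j _.
by rewrite !ffunE !mulrBr.
Qed.

Lemma bracketZr (a : R) (u v : lie) : bracket u (a *: v) = a *: bracket u v.
Proof.
apply/ffunP => k; rewrite !ffunE scaler_sumr; apply: eq_bigr => i _; rewrite scaler_sumr; apply: eq_bigr => j _.
by rewrite !ffunE -!scalerAr.
Qed.

Lemma bracketC (u v : lie) : bracket u v = - bracket v u.
Proof.
apply/ffunP => k; rewrite !ffunE exchange_big /= -sumrN; apply: eq_bigr => i _.
rewrite -sumrN; apply: eq_bigr => j _; rewrite (anti k j i) mpolyCN mulNr; congr (- (_ * _)).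
exact: mulrC.
Qed.

(** The identity in the form ad [x, y] = ad x ad y - ad y ad x, which is how the expansion of a tree
    acts on a nested bracket. *)
Lemma bracket_jacobi (x y z : lie) :
  bracket (bracket x y) z = bracket x (bracket y z) - bracket y (bracket x z).
Proof.
(* The three double brackets are brought to one common order of summation, so that the Jacobi
   identity applies to their coefficients. *)
pose nf (F : 'I_d -> 'I_d -> 'I_d -> 'I_d -> R) : P R d :=
  \sum_(i < d) \sum_(j < d) \sum_(l < d) \sum_(k < d) mpolyC (nv d) (F i j l k) * (x i * y j * z l).
apply/ffunP => m.
have L : bracket (bracket x y) z m = nf (fun i j l k => c k i j * c m k l).
  rewrite ffunE /nf; transitivity (\sum_(k < d) \sum_(l < d) \sum_(i < d) \sum_(j < d)
      mpolyC (nv d) (c k i j * c m k l) * (x i * y j * z l)).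
    apply: eq_bigr => k _; apply: eq_bigr => l _; rewrite ffunE mulr_suml mulr_sumr; apply: eq_bigr => i _.
    rewrite mulr_suml mulr_sumr; apply: eq_bigr => j _; rewrite mpolyCM.
    by rewrite !mulrA; congr (_ * _ * _ * _); exact: mulrC.
  rewrite exchange_big /=; under eq_bigr => l _ do rewrite exchange_big /=.
  under eq_bigr => l _ do under eq_bigr => i _ do rewrite exchange_big /=.
  by rewrite exchange_big /=; apply: eq_bigr => i _; rewrite exchange_big.
have R1 : bracket x (bracket y z) m = nf (fun i j l k => c m i k * c k j l).
  rewrite ffunE /nf; apply: eq_bigr => i _; transitivity (\sum_(k < d) \sum_(j < d) \sum_(l < d)
      mpolyC (nv d) (c m i k * c k j l) * (x i * y j * z l)).
    apply: eq_bigr => k _; rewrite ffunE !mulr_sumr; apply: eq_bigr => j _; rewrite !mulr_sumr; apply: eq_bigr => l _.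
    by rewrite mpolyCM !mulrA; congr (_ * _ * _); rewrite -!mulrA; congr (_ * _); exact: mulrC.
  by rewrite exchange_big /=; apply: eq_bigr => j _; rewrite exchange_big.
have R2 : bracket y (bracket x z) m = nf (fun i j l k => c m j k * c k i l).
  rewrite ffunE /nf; transitivity (\sum_(j < d) \sum_(k < d) \sum_(i < d) \sum_(l < d)
      mpolyC (nv d) (c m j k * c k i l) * (x i * y j * z l)).
    apply: eq_bigr => j _; apply: eq_bigr => k _; rewrite ffunE !mulr_sumr; apply: eq_bigr => i _.
    rewrite !mulr_sumr; apply: eq_bigr => l _.
    rewrite mpolyCM !mulrA; congr (_ * _); rewrite -!mulrA; congr (_ * _).
    by rewrite mulrCA [y j * _]mulrC.
  under eq_bigr => j _ do rewrite exchange_big /=.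
  rewrite exchange_big /=; apply: eq_bigr => i _; apply: eq_bigr => j _.
  by rewrite exchange_big.
rewrite L; transitivity (bracket x (bracket y z) m - bracket y (bracket x z) m); last by rewrite !ffunE.
rewrite R1 R2 /nf -sumrB; apply: eq_bigr => i _; rewrite -sumrB; apply: eq_bigr => j _.
rewrite -sumrB; apply: eq_bigr => l _; rewrite -!mulr_suml -mulrBl; congr (_ * _).
rewrite -!raddf_sum -raddfB; congr (mpolyC _ _).
apply/eqP; rewrite -subr_eq0 -!sumrB -[X in _ == X](jac i j l m); apply/eqP; apply: eq_bigr => k _.
by rewrite (anti m k i) (anti k l i) (anti m k j); ring.
Qed.

Definition ev (b : bool) : lie := if b then tB R d else sA R d.

Fixpoint lieT (T : tree) : lie :=
  match T with leaf b => ev b | node l r => bracket (lieT l) (lieT r) end.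

Definition nst (w : seq bool) : lie := nest c (map ev w).

Lemma nst_cons b w : (0 < size w)%N -> nst (b :: w) = bracket (ev b) (nst w).
Proof. by case: w. Qed.

(** Prefixing a nonempty word acts on nested brackets by successive adjoint maps, so the expansion
    of T acts as the adjoint map of its bracket. *)
Lemma exS_nst_cat T w : (0 < size w)%N -> exS T (fun u => nst (u ++ w)) = bracket (lieT T) (nst w).
Proof.
elim: T w => [b|l IHl r IHr] w w0 /=; first exact: nst_cons.
have s0 (v : seq bool) : (0 < size (v ++ w))%N by rewrite size_cat addn_gt0 w0 orbT.
rewrite bracket_jacobi; congr (_ - _).
  rewrite -(IHr w w0) -(exS_morph (phi := bracket (lieT l))); last exact: bracketBr.
  by apply: exS_ext => v _; rewrite -IHl//; apply: exS_ext => u _; rewrite catA.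
rewrite -(IHl w w0) -(exS_morph (phi := bracket (lieT r))); last exact: bracketBr.
by apply: exS_ext => v _; rewrite -IHr//; apply: exS_ext => u _; rewrite catA.
Qed.

(* Specht-Wever *)
Lemma exS_nst T : exS T nst = (leaves T)%:R *: lieT T.
Proof.
elim: T => [b|l IHl r IHr] /=; first by rewrite scale1r.
rewrite (@exS_ext _ r _ (fun v => bracket (lieT l) (nst v))); last by move=> v v0; rewrite exS_nst_cat.
rewrite (@exS_ext _ l _ (fun v => bracket (lieT r) (nst v))); last by move=> v v0; rewrite exS_nst_cat.
rewrite (exS_morph (phi := bracket (lieT l))); last exact: bracketBr.
rewrite (exS_morph (phi := bracket (lieT r))); last exact: bracketBr.
rewrite IHl IHr !bracketZr (bracketC (lieT r)) scalerN opprK -scalerDl natrD addrC.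
by [].
Qed.

(** Dynkin's formula applies 1/N times the nested bracket to the degree N part of log(e^A e^B),
    whose coefficients are sums of tree weights. [exS_flip] replaces the word of each tree by its
    expansion at the price of 2^(N-1), and the factor N from [exS_nst] cancels 1/N. *)
Theorem cbh_trees N : (0 < N)%N ->
  cbh_deg c N = \sum_(T <- TR N) (th R T / 2 ^+ N.-1) *: lieT T.
Proof.
move=> N0; have Nn : N%:R != 0 :> R by rewrite pnatr_eq0 -lt0n.
transitivity (N%:R^-1 *: \sum_(1 <= m < N.+1) ((-1) ^+ m.-1 / m%:R) *: \sum_(w <- wds N) Zm (@Xw R) m w *: nst w).
  rewrite /cbh_deg scaler_sumr; apply: eq_bigr => m _.
  rewrite -(@dynkin_sum R _ N m N nst (leqnn N)) !scaler_sumr; apply: eq_bigr => r _.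
  rewrite !scaler_sumr; apply: eq_bigr => s _; case: ifP => _; last by rewrite !scaler0.
  rewrite lscaleE !scalerA; congr (_ *: _); first by rewrite invfM mulrCA mulrA.
  rewrite /nst map_flatten -map_comp; congr (nest c (flatten _)); apply: eq_map => i /=.
  by rewrite map_cat !map_nseq.
transitivity (N%:R^-1 *: \sum_(w <- wds N) (\sum_(T <- brk w) th R T) *: nst w).
  congr (_ *: _); under eq_bigr => m _ do rewrite scaler_sumr.
  rewrite exchange_big /= !big_seq; apply: eq_bigr => w /size_wds sw.
  rewrite -log_EAB ?sw// big_ord_recl /= mul0r add0r scaler_suml -(big_mkord xpredT
    (fun i : nat => (((-1) ^+ i / i.+1%:R) * Zm (@Xw R) i.+1 w) *: nst w)) big_add1 /=.
  by apply: eq_bigr => m _; rewrite scalerA.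
have -> : \sum_(w <- wds N) (\sum_(T <- brk w) th R T) *: nst w = \sum_(T <- TR N) th R T *: nst (word T).
  rewrite -sum_wds_brk//; apply: eq_bigr => w _.
  by rewrite scaler_suml -(sum_brk_word (fun T u => th R T *: nst u)).
have F := exS_flip nst (th_flip R) N0.
have two : 2 ^+ N.-1 != 0 :> R by rewrite expf_neq0// pnatr_eq0.
have -> : \sum_(T <- TR N) th R T *: nst (word T) = (2 ^+ N.-1)^-1 *: \sum_(T <- TR N) th R T *: exS T nst.
  by rewrite F scalerA mulVf// scale1r.
under eq_bigr => T _ do rewrite exS_nst scalerA.
rewrite (@sum_TR_leaves _ (fun T n => (th R T * n%:R) *: lieT T))// !scaler_sumr.
by apply: eq_bigr => T _; rewrite !scalerA; congr (_ *: _); field; rewrite two.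
Qed.

End CBH.

(** * Loop-free graphs *)

Section Acyclic.
Variables (n : nat) (Gam : graph n).
Hypothesis nl : ~~ loop_graph Gam.

(** The number of vertices reachable from k, itself included: a height function that strictly
    decreases along the edges of a loop-free graph. *)
Definition rk (k : 'I_n) : nat := #|[pred l | connect (aedge Gam) k l]|.

Lemma rk_lt k l : aedge Gam k l -> (rk l < rk k)%N.
Proof.
move=> kl; apply: proper_card; apply/properP; split.
  apply/fintype.subsetP => m; rewrite !inE; exact: connect_trans (connect1 kl).
exists k; rewrite !inE ?connect0//; apply/negP => lk.
by move: nl; rewrite negb_exists => /forallP/(_ k); rewrite negb_exists => /forallP/(_ l); rewrite kl lk.
Qed.

Lemma rk_le k : (rk k <= n)%N.
Proof. by rewrite -[leqRHS](card_ord n); exact: max_card. Qed.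

End Acyclic.

Section Vertices.
Variables (R : realType) (n : nat).

Lemma vA_inj : injective (@vA n). Proof. exact: lshift_inj. Qed.

Lemma vertexP (v : 'I_(n + 2)) : [\/ v = vX n, v = vY n | exists k, v = vA k].
Proof.
case: (split_ordP v) => [k ->|j ->]; first by apply: Or33; exists k.
case: j => [[|[|]]]// hj; [apply: Or31|apply: Or32]; congr rshift; exact: val_inj.
Qed.

Lemma vpos_vA (z : nat -> R) (k : 'I_n) : vpos z (vA k) = apos z k.
Proof. by rewrite /vpos /vA -[lshift 2 k]/(unsplit (inl k)) unsplitK. Qed.

Lemma vpos_vX (z : nat -> R) : vpos z (vX n) = (0, 0).
Proof. by rewrite /vpos /vX -[rshift n _]/(unsplit (inr (0 : 'I_2))) unsplitK. Qed.

Lemma vpos_vY (z : nat -> R) : vpos z (vY n) = (1, 0).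
Proof. by rewrite /vpos /vY -[rshift n _]/(unsplit (inr (1 : 'I_2))) unsplitK. Qed.

Lemma vA_neqX k : vA k != vX n. Proof. by rewrite eq_lrshift. Qed.
Lemma vA_neqY k : vA k != vY n. Proof. by rewrite eq_lrshift. Qed.

End Vertices.

(** * The Jacobian determinant of a loop-free graph *)

Lemma det_sylvester (F : fieldType) m p (U : 'M[F]_(m, p)) (V : 'M[F]_(p, m)) :
  \det (1%:M + U *m V) = \det (1%:M + V *m U).
Proof.
have E1 : block_mx 1%:M (- U) V 1%:M = block_mx 1%:M 0 V 1%:M *m block_mx 1%:M (- U) 0 (1%:M + V *m U).
  by rewrite mulmx_block !mul1mx !mulmx1 !mulmx0 !mul0mx !addr0 mulmxN addrC addrK.
have E2 : block_mx 1%:M (- U) V 1%:M = block_mx (1%:M + U *m V) (- U) 0 1%:M *m block_mx 1%:M 0 V 1%:M.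
  by rewrite mulmx_block !mul1mx !mulmx1 !mulmx0 ?mul0mx !add0r mulNmx addrK.
have := congr1 determinant E1; rewrite {1}E2 !det_mulmx !det_ublock !det_lblock !det1 !mul1r !mulr1.
by [].
Qed.

Lemma det_mx2 (F : comNzRingType) (A : 'M[F]_2) : \det A = A 0 0 * A 1 1 - A 0 1 * A 1 0.
Proof.
rewrite (expand_det_row _ 0) !big_ord_recl big_ord0 addr0 /cofactor !det_mx11 !mxE /=.
rewrite addn0 expr0 mul1r (_ : (-1) ^+ (0 + bump 0 0) = -1) ?expr1// mulN1r mulrN.
by congr (A _ _ * A _ _ - A _ _ * A _ _); apply: val_inj.
Qed.

Section JacobianDet.
Local Open Scope set_scope.
Variables (R : realType) (n : nat) (Gam : graph n) (z : nat -> R).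
Hypothesis GG : Gam \in G n.
Hypothesis nl : ~~ loop_graph Gam.
Local Notation E := #|{: edge n}|.

Definition JG (k : 'I_n) : R :=
  JK (apos z k : pt R) (vpos z (Gam (k, 0)) : pt R) (vpos z (Gam (k, 1)) : pt R).

Lemma dphi_coord_own (k : 'I_n) (i j : 'I_2) : dphi_coord Gam z (k, i) (k, j) =
  if j == 0 then aK (apos z k : pt R) (vpos z (Gam (k, i)) : pt R)
  else bK (apos z k : pt R) (vpos z (Gam (k, i)) : pt R).
Proof.
rewrite /dphi_coord /= eqxx; have := GG; rewrite inE => /forallP/(_ (k, i))/= /negbTE ->.
rewrite vpos_vA /utan; case: (apos z k) => p1 p2; case: (vpos z _) => q1 q2.
rewrite /dphi /darg /subp /conjp /aK /bK /rsq /rsqN; case: eqP => _ /=.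
  by congr (_ / _ - _ / _); ring.
rewrite -[X in _ = _ + X]opprK -[X in _ = _ - X]mulNr.
by congr (_ / _ - _ / _); ring.
Qed.

Lemma dphi_coord_far (e cj : edge n) : e.1 != cj.1 -> Gam e != vA cj.1 -> dphi_coord Gam z e cj = 0.
Proof.
move=> h1 h2; rewrite /dphi_coord (negbTE h2) (inj_eq (@vA_inj n)) (negbTE h1).
by rewrite /dphi /darg /subp /conjp /= !(subr0, oppr0, mulr0) !mul0r subr0.
Qed.

(** The Jacobian with the rows of vertices outside S replaced by those of the identity; enlarging S
    one vertex at a time exploits triangularity without reordering rows. *)
Definition MS (S : {set 'I_n}) : 'M[R]_E :=
  \matrix_(r, s) if (enum_val r).1 \in S then jac Gam z r s else (r == s)%:R.

(** An edge depends only on the positions of its two ends, so the rows of k vanish in the columns of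
    S. *)
Lemma MS_step k (S : {set 'I_n}) : k \notin S -> (forall l, aedge Gam k l -> l \notin S) ->
  MS (k |: S) = MS [set k] *m MS S.
Proof.
move=> kS ch; apply/matrixP => r s; rewrite !mxE finset.in_setU1.
have [ek|ek] := eqVneq (enum_val r).1 k; last first.
  rewrite (bigD1 r)//= !mxE finset.in_set1 (negbTE ek) eqxx mul1r big1 ?addr0// => t tr.
  by rewrite !mxE finset.in_set1 (negbTE ek) eq_sym (negbTE tr) mul0r.
rewrite (bigD1 s)//= !mxE finset.in_set1 ek eqxx big1 ?addr0 => [|t ts].
  case: ifP => sS; last by rewrite eqxx mulr1.
  rewrite (_ : dphi_coord _ _ _ _ = 0) ?mul0r//; apply: dphi_coord_far.
    by rewrite ek; apply: contra kS => /eqP ->.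
  apply/negP => /eqP H; have : aedge Gam k (enum_val s).1.
    by apply/existsP; exists (enum_val r).2; rewrite -ek -surjective_pairing H.
  by move=> /ch; rewrite sS.
rewrite !mxE finset.in_set1 ek eqxx; case: ifP => sS; last by rewrite (negbTE ts) mulr0.
rewrite (_ : dphi_coord _ _ _ _ = 0) ?mul0r//; apply: dphi_coord_far.
  by rewrite ek; apply: contra kS => /eqP ->.
apply/negP => /eqP H; have : aedge Gam k (enum_val t).1.
  by apply/existsP; exists (enum_val r).2; rewrite -ek -surjective_pairing H.
by move=> /ch; rewrite sS.
Qed.

Lemma det_MS1 k : \det (MS [set k]) = JG k.
Proof.
pose U : 'M[R]_(E, 2) := \matrix_(r, i) (enum_val r == (k, i))%:R.
pose V : 'M[R]_(2, E) := \matrix_(i, s) (dphi_coord Gam z (k, i) (enum_val s) - (enum_val s == (k, i))%:R).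
have EU : MS [set k] = 1%:M + U *m V.
  apply/matrixP => r s; rewrite !mxE finset.in_set1.
  have [ek|ek] := eqVneq (enum_val r).1 k; last first.
    rewrite big1 ?addr0// => i _; rewrite !mxE (_ : enum_val r == _ = false) ?mul0r//.
    by apply/negbTE; apply: contra ek => /eqP ->.
  have er : enum_val r = (k, (enum_val r).2) by rewrite -ek -surjective_pairing.
  rewrite (bigD1 (enum_val r).2)//= !mxE -er eqxx mul1r big1 ?addr0 => [|i ni].
    by rewrite (inj_eq enum_val_inj) eq_sym addrC subrK.
  rewrite !mxE er xpair_eqE eqxx /= eq_sym (negbTE ni) mul0r //.
have EV : 1%:M + V *m U = \matrix_(i, j) dphi_coord Gam z (k, i) (k, j).
  apply/matrixP => i j; rewrite !mxE (bigD1 (enum_rank (k, j)))//= !mxE enum_rankK eqxx mulr1 big1 ?addr0.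
    by rewrite xpair_eqE eqxx /= eq_sym addrC subrK.
  move=> t tn; rewrite !mxE (_ : (enum_val t == (k, j)) = false) ?mulr0//.
  by apply/negbTE; apply: contra tn => /eqP <-; rewrite enum_valK.
(* Only two rows differ from the identity, so the determinant reduces to size 2. *)
rewrite EU det_sylvester EV det_mx2 !mxE !dphi_coord_own /=.
by rewrite /JG /JK.
Qed.

(** A vertex of least rank in S has no successor in S, so [MS_step] splits it off; what remains is
    again closed under predecessors, because the removed vertex cannot precede another element of
    S. *)
Lemma det_MS (S : {set 'I_n}) : (forall k l, aedge Gam k l -> l \in S -> k \in S) ->
  \det (MS S) = \prod_(k in S) JG k.
Proof.
move: {2}#|S| (erefl #|S|) => m; elim: m S => [|m IH] S Sm up.
  move/eqP: Sm; rewrite cards_eq0 => /eqP ->; rewrite big_set0 (_ : MS finset.set0 = 1%:M) ?det1//.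
  by apply/matrixP => r s; rewrite !mxE inE.
have [k0 k0S] : exists k, k \in S by apply/set0Pn; rewrite -cards_eq0 Sm.
pose k := [arg min_(i < k0 in S) rk Gam i]; have [kS kmin] : k \in S /\ forall l, l \in S -> (rk Gam k <= rk Gam l)%N.
  by rewrite /k; case: arg_minnP.
pose S' := S :\ k; have SE : S = k |: S' by rewrite finset.setD1K.
have kS' : k \notin S' by rewrite !inE eqxx.
rewrite SE MS_step//; last first.
  move=> l kl; rewrite !inE negb_and orbC; apply/orP; left; apply/negP => lS.
  by have := kmin l lS; rewrite leqNgt (rk_lt nl kl).
rewrite det_mulmx det_MS1 IH.
- by rewrite [RHS]big_setU1.
- by apply/eqP; rewrite -eqSS -Sm SE cardsU1 kS'.
- move=> a b ab; rewrite !inE => /andP[_ bS]; rewrite (up _ _ ab bS) andbT.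
  by apply/negP => /eqP ak; have := kmin b bS; rewrite -ak leqNgt (rk_lt nl ab).
Qed.

Lemma det_jac : \det (jac Gam z) = \prod_k JG k.
Proof.
have := @det_MS finset.setT (fun _ _ _ _ => finset.in_setT _).
rewrite (_ : MS finset.setT = jac Gam z); last by apply/matrixP => r s; rewrite !mxE inE.
by move=> ->; apply: eq_bigl => k; rewrite inE.
Qed.

End JacobianDet.

HB.instance Definition _ := gen_eqMixin tree.

Lemma sum_count (V : nmodType) (T : eqType) (s : seq T) (x : T) (F : T -> V) :
  \sum_(y <- s) (if y == x then F y else 0) = F x *+ count_mem x s.
Proof.
elim: s => [|y s IH]; first by rewrite big_nil mulr0n.
rewrite big_cons IH /=; case: eqP => [->|_]; first by rewrite mulrS.
by rewrite !add0r.
Qed.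

Lemma count_sum (T : eqType) (s : seq T) (p : pred T) : count p s = (\sum_(y <- s) p y)%N.
Proof. by elim: s => [|y s IH]; rewrite ?big_nil// big_cons /= IH. Qed.

(** * Lists of plane trees with a given number of inner vertices *)

Section TreeLists.

Definition nds (T : tree) : nat := (leaves T).-1.

Lemma nds_node l r : nds (node l r) = (nds l + nds r).+1.
Proof. by rewrite /nds /=; have := leaves_gt0 l; have := leaves_gt0 r; lia. Qed.

(** Multiplicity one: summing over the enumeration counts every tree exactly once, which the
    bijection with graphs relies on. *)
Lemma count_TR T N : count_mem T (TR N) = (leaves T == N).
Proof.
elim: T N => [b|l IHl r IHr] N; rewrite count_sum.
  case: N => [|[|N]]; first by rewrite /TR /= big_nil.
    have e b' : (leaf b' == leaf b) = (b' == b) by apply/eqP/eqP => [[]|->].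
    by rewrite sum_TR1 /= !e; case: b {e}.
  rewrite sum_TR// big1// => k _; rewrite big1// => l _; rewrite big1// => r _.
  by rewrite /= (_ : (node l r == leaf b) = false)//; apply/eqP.
have lg := leaves_gt0 l; have rg := leaves_gt0 r.
case: (leqP N 1) => N1.
  rewrite (_ : _ == N = false); last by rewrite /=; apply/negbTE; lia.
  case: N N1 => [|[|]]// _; first by rewrite /TR /= big_nil.
  have e b : (leaf b == node l r) = false by apply/eqP.
  by rewrite sum_TR1 /= !e.
rewrite sum_TR//.
transitivity (\sum_(1 <= k < N) (leaves l == k) * (leaves r == N - k))%N.
  apply: eq_bigr => k _; rewrite -IHl -IHr !count_sum big_distrl /=; apply: eq_bigr => a _.
  rewrite big_distrr /=; apply: eq_bigr => b _.
  rewrite mulnb; congr nat_of_bool; apply/eqP/andP => [[-> ->]|[/eqP -> /eqP ->]//]; by rewrite !eqxx.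
rewrite /=; case: (boolP (leaves l + leaves r == N)%N) => [/eqP <-|ne].
  rewrite (big_cat_nat lg) /=; last by lia.
  rewrite big_nat big1 ?add0n => [|k /andP[_ kl]]; last by rewrite gtn_eqF.
  rewrite big_ltn; last by lia.
  rewrite eqxx addKn eqxx big_nat big1// => k /andP[kl _]; by rewrite ltn_eqF.
rewrite big_nat big1// => k /andP[k1 kN]; case: eqP => [e|//]; case: eqP => [e'|//].
by case/eqP: ne; rewrite e e' subnKC// ltnW.
Qed.

(** Lists of m trees, none a bare leaf, with n inner vertices in total. They index both the m-th
    term of the exponential and the forests with m roots. *)
Fixpoint FLm (m n : nat) : seq (seq tree) :=
  match m with
  | 0 => if n == 0%N then [:: [::]] else [::]
  | m'.+1 => flatten [seq [seq rcons L T | L <- FLm m' (n - k), T <- TR k.+1] | k <- index_iota 1 n.+1]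
  end.

Lemma sum_FLmS (V : Type) (idx : V) (op : Monoid.com_law idx) m n (h : seq tree -> V) :
  \big[op/idx]_(L <- FLm m.+1 n) h L = \big[op/idx]_(1 <= k < n.+1)
    \big[op/idx]_(L <- FLm m (n - k)) \big[op/idx]_(T <- TR k.+1) h (rcons L T).
Proof.
by rewrite /= big_flatten big_map; apply: eq_bigr => k _; rewrite big_allpairs_dep.
Qed.

Lemma count_FLm L m n : count_mem L (FLm m n) =
  [&& size L == m, all (fun T => (0 < nds T)%N) L & sumn (map nds L) == n].
Proof.
elim: m L n => [|m IH] L n.
  case: L => [|T L]; rewrite /= ?andbF; first by case: n.
  by case: n.
rewrite count_sum sum_FLmS; case/lastP: L => [|L T].
  rewrite /= big1// => k _; rewrite big1// => L _; rewrite big1// => T _.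
  by rewrite (_ : _ == _ = false)//; case: L.
transitivity (\sum_(1 <= k < n.+1) (nds T == k) * [&& size L == m, all (fun T => (0 < nds T)%N) L & sumn (map nds L) == (n - k)%N])%N.
  apply: eq_bigr => k _; rewrite -IH.
  have -> : (nds T == k) = (leaves T == k.+1) by rewrite /nds; have := leaves_gt0 T; case: (leaves T).
  rewrite -count_TR !count_sum mulnC big_distrl /=; apply: eq_bigr => L' _.
  rewrite big_distrr /=; apply: eq_bigr => T' _; by rewrite mulnb eqseq_rcons.
rewrite size_rcons all_rcons eqSS map_rcons sumn_rcons.
case: (boolP ((0 < nds T) && (nds T < n.+1))%N) => [/andP[p0 pn]|np].
  rewrite (big_cat_nat p0 (ltnW pn)) /=.
  rewrite big_nat big1 ?add0n => [|k /andP[_ kl]]; last by rewrite gtn_eqF.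
  rewrite big_ltn// eqxx mul1n big_nat big1 ?addn0 => [|k /andP[kl _]]; last by rewrite ltn_eqF.
  rewrite p0 /=; congr (nat_of_bool [&& _, _ & _]); rewrite -[in RHS](subnK (_ : nds T <= n)%N)//.
  by rewrite eqn_add2r.
rewrite big_nat big1 => [|k /andP[k1 kn]]; last first.
  by case: eqP => // e; move: np; rewrite e k1 kn.
apply/esym/eqP; rewrite eqb0; apply: contra np => /and3P[_ /andP[-> _] /eqP <-].
by rewrite ltnS leq_addl.
Qed.

Definition FL n := flatten [seq FLm m n | m <- iota 0 n.+1].

Lemma size_le_sumn L : all (fun T => (0 < nds T)%N) L -> (size L <= sumn (map nds L))%N.
Proof. by elim: L => //= T L IH /andP[T0 /IH]; lia. Qed.

Lemma sum_FL (V : Type) (idx : V) (op : Monoid.com_law idx) n (h : seq tree -> V) :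
  \big[op/idx]_(L <- FL n) h L = \big[op/idx]_(0 <= m < n.+1) \big[op/idx]_(L <- FLm m n) h L.
Proof. by rewrite /FL big_flatten big_map /index_iota subn0. Qed.

Lemma count_FL L n : count_mem L (FL n) =
  all (fun T => (0 < nds T)%N) L && (sumn (map nds L) == n).
Proof.
rewrite count_sum sum_FL; under eq_bigr => m _ do rewrite -count_sum count_FLm.
case: (boolP (all _ L && _)) => [/andP[a /eqP e]|na].
  have sl : (size L <= n)%N by rewrite -e; exact: size_le_sumn.
  rewrite big_mkord (bigD1 (Ordinal (sl : (size L < n.+1)%N)))//= eqxx big1// => i ni.
  by rewrite andbT; case: eqP => // e'; case/eqP: ni; apply: val_inj.
by rewrite big1// => m _; rewrite andbF.
Qed.

End TreeLists.

(** * Forests of labelled trees and the graphs they encode *)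

Inductive ltree (n : nat) := LL of bool | LN of 'I_n & ltree n & ltree n.
Arguments LL {n}.
HB.instance Definition _ n := gen_eqMixin (ltree n).

Section Forests.
Variable n : nat.
Local Notation ltree := (ltree n).
Implicit Types (t : ltree) (F : seq ltree) (Gam : graph n).

Fixpoint labels t : seq 'I_n :=
  match t with LL _ => [::] | LN k l r => k :: labels l ++ labels r end.
Fixpoint shape t : tree :=
  match t with LL b => leaf b | LN _ l r => node (shape l) (shape r) end.
Definition lroot t : 'I_(n + 2) :=
  match t with LL b => if b then vY n else vX n | LN k _ _ => vA k end.
(** The targets prescribed by t, in the order of [eds t], so that [agree] is an equality of
    lists. *)
Fixpoint tg t : seq 'I_(n + 2) :=
  match t with LL _ => [::] | LN _ l r => lroot l :: lroot r :: tg l ++ tg r end.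
Definition edsl (s : seq 'I_n) : seq (edge n) := [seq (k, i) | k <- s, i <- [:: 0 : 'I_2; 1 : 'I_2]].

Lemma edsl_cons k s : edsl (k :: s) = (k, 0) :: (k, 1) :: edsl s.
Proof. by []. Qed.

Arguments edsl : simpl never.

Lemma edsl_cat s1 s2 : edsl (s1 ++ s2) = edsl s1 ++ edsl s2.
Proof. by rewrite /edsl allpairs_cat. Qed.

Definition eds t := edsl (labels t).
Lemma eds_LN k l r : eds (LN k l r) = (k, 0) :: (k, 1) :: eds l ++ eds r.
Proof. by rewrite /eds [labels _]/= edsl_cons edsl_cat. Qed.

Definition agree Gam t : bool := map Gam (eds t) == tg t.

Lemma size_tg t : size (tg t) = size (eds t).
Proof.
by elim: t => // k l IHl r IHr; rewrite eds_LN /= !size_cat IHl IHr.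
Qed.

Lemma agreeE Gam k l r : agree Gam (LN k l r) =
  [&& Gam (k, 0) == lroot l, Gam (k, 1) == lroot r, agree Gam l & agree Gam r].
Proof.
rewrite /agree eds_LN /= map_cat !eqseq_cons eqseq_cat//.
by rewrite size_map size_tg.
Qed.

Lemma size_labels t : size (labels t) = nds (shape t).
Proof. by elim: t => //= k l IHl r IHr; rewrite nds_node size_cat IHl IHr. Qed.

(** The tree seen from v. The leaf returned when the fuel runs out is a dummy; in a loop-free graph
    a fuel above the height of v is not exhausted. *)
Fixpoint unf Gam (f : nat) (v : 'I_(n + 2)) : ltree :=
  match f with
  | 0 => LL true
  | f'.+1 => match fintype.split v with
    | inr j => LL (j != 0)
    | inl k => LN k (unf Gam f' (Gam (k, 0))) (unf Gam f' (Gam (k, 1)))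
    end
  end.

Lemma split_vA (k : 'I_n) : @fintype.split n 2 (vA k) = inl k.
Proof. by rewrite /vA -[lshift 2 k]/(unsplit (inl k)) unsplitK. Qed.
Lemma split_vX : @fintype.split n 2 (vX n) = inr 0.
Proof. by rewrite /vX -[rshift n _]/(unsplit (inr (0 : 'I_2))) unsplitK. Qed.
Lemma split_vY : @fintype.split n 2 (vY n) = inr 1.
Proof. by rewrite /vY -[rshift n _]/(unsplit (inr (1 : 'I_2))) unsplitK. Qed.

Lemma lroot_unf Gam f v : (0 < f)%N -> lroot (unf Gam f v) = v.
Proof.
case: f => // f _ /=; case: (vertexP v) => [->|->|[k ->]]; rewrite ?split_vX ?split_vY ?split_vA //=.
Qed.

Definition hgt Gam (v : 'I_(n + 2)) : nat := if fintype.split v is inl k then rk Gam k else 0.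

Lemma hgt_child Gam k i : ~~ loop_graph Gam -> (hgt Gam (Gam (k, i)) < rk Gam k)%N.
Proof.
move=> nl; rewrite /hgt; case: (vertexP (Gam (k, i))) => [e|e|[l e]]; rewrite e ?split_vX ?split_vY ?split_vA.
- by apply/card_gt0P; exists k; rewrite inE connect0.
- by apply/card_gt0P; exists k; rewrite inE connect0.
- by apply: rk_lt => //; apply/existsP; exists i; rewrite e.
Qed.

Lemma agree_unf Gam f v : ~~ loop_graph Gam -> (hgt Gam v < f)%N -> agree Gam (unf Gam f v).
Proof.
move=> nl; elim: f v => // f IH v vf /=.
case: (vertexP v) => [e|e|[k e]]; rewrite e ?split_vX ?split_vY ?split_vA // agreeE.
have kf : (rk Gam k <= f)%N by move: vf; rewrite e /hgt split_vA.
have cf i : (hgt Gam (Gam (k, i)) < f)%N := leq_trans (hgt_child k i nl) kf.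
have f0 : (0 < f)%N := leq_ltn_trans (leq0n _) (cf 0).
by rewrite !lroot_unf// !eqxx !IH.
Qed.

Lemma unf_agree Gam f t : agree Gam t -> (size (labels t) < f)%N -> unf Gam f (lroot t) = t.
Proof.
elim: t f => [b|k l IHl r IHr] [|f]//; first by case: b; rewrite /= ?split_vX ?split_vY.
rewrite agreeE => /and4P[/eqP e0 /eqP e1 al ar] /=; rewrite size_cat => sf.
by rewrite split_vA e0 e1 IHl ?IHr//; lia.
Qed.

Definition labsF F := flatten (map labels F).
Definition isnode t := if t is LN _ _ _ then true else false.
Definition good F := all isnode F && perm_eq (labsF F) (enum 'I_n).
Definition agreeF Gam F := all (agree Gam) F.

(** Each occurrence of x in t is either its root or the target of one edge of t. *)
Lemma count_agree Gam t x : agree Gam t ->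
  ((lroot t == vA x) + count (fun e => Gam e == vA x) (eds t) = count_mem x (labels t))%N.
Proof.
elim: t => [b _|k l IHl r IHr].
  by rewrite /= /eds /=; case: b; rewrite ?(eq_sym _ (vA x)) ?(negbTE (vA_neqX _)) ?(negbTE (vA_neqY _)).
rewrite agreeE => /and4P[/eqP e0 /eqP e1 al ar]; rewrite eds_LN /= !count_cat.
rewrite -(IHl al) -(IHr ar) e0 e1 (inj_eq (@vA_inj n)); congr addn.
by rewrite [RHS]addnACA [LHS]addnA.
Qed.

Lemma count_agreeF Gam F x : agreeF Gam F ->
  (count_mem (vA x) (map lroot F) + count (fun e => Gam e == vA x) (edsl (labsF F)) = count_mem x (labsF F))%N.
Proof.
elim: F => //= t F IH /andP[at_ aF]; rewrite /labsF /= edsl_cat !count_cat -(count_agree x at_) -(IH aF) /eds /labsF.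
by rewrite addnACA.
Qed.

Lemma count_edsl k i s : count_mem (k, i) (edsl s) = count_mem k s.
Proof.
elim: s => // k' s IH; rewrite edsl_cons -cat1s -[_ :: edsl s]cat1s !count_cat IH /= !xpair_eqE.
by case: (k' == k) => //=; case: i {IH} => [[|[|]]].
Qed.

Lemma count_edsl_tgt Gam x s :
  count (fun e => Gam e == vA x) (edsl s) = (\sum_(e | Gam e == vA x) count_mem e.1 s)%N.
Proof.
rewrite count_sum; transitivity (\sum_(e' <- edsl s) \sum_(e | Gam e == vA x) (e' == e))%N.
  apply: eq_bigr => e' _; case: (boolP (Gam e' == vA x)) => h.
    rewrite (bigD1 e')//= eqxx big1// => e /andP[_ ne]; by rewrite eq_sym (negbTE ne).
  by rewrite big1// => e he; case: eqP => // ee; move: h; rewrite ee he.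
rewrite exchange_big /=; apply: eq_bigr => -[k i] _; rewrite -(count_edsl k i) count_sum.
by apply: eq_bigr => e' _.
Qed.

Definition indeg Gam x : nat := #|[pred e | Gam e == vA x]|.
Definition forest Gam := ~~ loop_graph Gam && [forall x, (indeg Gam x <= 1)%N].
Definition roots Gam : seq 'I_n := [seq x <- enum 'I_n | indeg Gam x == 0%N].

(** For a good F, the only graph that agrees with F; the default of [nth] is then never reached. *)
Definition dec F : graph n := [ffun e => nth (vX n) (flatten (map tg F)) (index e (edsl (labsF F)))].

Lemma agreeFE Gam F : agreeF Gam F = (map Gam (edsl (labsF F)) == flatten (map tg F)).
Proof.
elim: F => //= t F ->; rewrite /labsF /= edsl_cat map_cat eqseq_cat ?size_map ?size_tg//.
Qed.

Lemma good_edsl F : good F -> uniq (edsl (labsF F)) /\ forall e, e \in edsl (labsF F).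
Proof.
move=> /andP[_ pe]; split.
  apply: allpairs_uniq => //; first by rewrite (perm_uniq pe) enum_uniq.
  by move=> [a b] [a' b'] _ _ [-> ->].
move=> [k i]; apply/allpairsP; exists (k, i); split => //=.
  by rewrite (perm_mem pe) mem_enum.
by case: i => [[|[|]]]// hi; rewrite !inE -!val_eqE /= ?orbT.
Qed.

Lemma agree_decE F Gam : good F -> agreeF Gam F = (Gam == dec F).
Proof.
move=> gF; have [u m] := good_edsl gF; rewrite agreeFE; apply/eqP/eqP => [H|->].
  apply/ffunP => e; rewrite ffunE -H (nth_map e) ?index_mem// nth_index//.
apply: (@eq_from_nth _ (vX n)).
  rewrite size_map; elim: (F) => //= t F' IH; rewrite /labsF /= edsl_cat !size_cat size_tg IH//.
move=> i; rewrite size_map => hi.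
have [e0 _] : exists e0 : edge n, true by case: (edsl (labsF F)) hi => // e0; exists e0.
by rewrite (nth_map e0)// ffunE index_uniq.
Qed.

Lemma sub_agree Gam t k : agree Gam t -> k \in labels t -> exists l r,
  agree Gam (LN k l r) /\ (size (labels (LN k l r)) <= size (labels t))%N.
Proof.
elim: t => //= k' l IHl r IHr; rewrite agreeE => /and4P[e0 e1 al ar]; rewrite inE mem_cat size_cat => /or3P[/eqP ->|kl|kr].
- by exists l, r; rewrite agreeE e0 e1 al ar /= size_cat.
- by have [a [b [h1 h2]]] := IHl al kl; exists a, b; split => //; move: h2 => /=; lia.
- by have [a [b [h1 h2]]] := IHr ar kr; exists a, b; split => //; move: h2 => /=; lia.
Qed.

(** Counting targets shows that a vertex is either a root of F or has in-degree 1, never both.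
    Cycles are excluded because the size [sz] of the unfolded subtree decreases along edges. *)
Lemma agree_forest Gam F : good F -> agreeF Gam F ->
  forest Gam /\ perm_eq (map lroot F) (map (@vA n) (roots Gam)).
Proof.
move=> gF aF; have /andP[nF pe] := gF.
have cnt x : (count_mem (vA x) (map lroot F) + indeg Gam x = 1)%N.
  have c1 y : count_mem y (labsF F) = 1%N by rewrite (seq.permP pe) count_uniq_mem ?enum_uniq// mem_enum.
  have := count_agreeF x aF; rewrite count_edsl_tgt c1 (eq_bigr (fun=> 1%N)); last by move=> e _; rewrite c1.
  by rewrite sum1_card.
have sub k : exists l r, agree Gam (LN k l r) /\ (size (labels (LN k l r)) < n.+1)%N.
  have : k \in labsF F by rewrite (perm_mem pe) mem_enum.
  move=> /flattenP[s /mapP[t tF ->] kt].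
  have [l [r [h1 h2]]] := sub_agree (allP aF t tF) kt; exists l, r; split => //.
  rewrite ltnS (leq_trans h2)// -[leqRHS](size_enum_ord n) -(perm_size pe) /labsF size_flatten.
  elim: (F) tF => //= t' F' IH; rewrite inE => /predU1P[->|/IH h]; first by rewrite leq_addr.
  by rewrite (leq_trans h)// leq_addl.
pose sz k := size (labels (unf Gam n.+1 (vA k))).
have szE k l r : agree Gam (LN k l r) -> (size (labels (LN k l r)) < n.+1)%N -> sz k = size (labels (LN k l r)).
  by move=> a s; rewrite /sz (unf_agree a s).
have dcr k k' : aedge Gam k k' -> (sz k' < sz k)%N.
  move=> /existsP[i /eqP e]; have [l [r [a s]]] := sub k; rewrite (szE _ _ _ a s).
  move: a s; rewrite agreeE => /and4P[/eqP e0 /eqP e1 al ar] /=; rewrite size_cat => s.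
  have [c [ec ac sc]] : exists c, [/\ lroot c = vA k', agree Gam c & (size (labels c) <= size (labels l) + size (labels r))%N].
    case: i e => [[|[|]]]// hi e.
      by exists l; rewrite -e0 -e; split => //; [congr (Gam (_, _)); exact: val_inj|rewrite leq_addr].
    by exists r; rewrite -e1 -e; split => //; [congr (Gam (_, _)); exact: val_inj|rewrite leq_addl].
  rewrite /sz -ec (unf_agree ac) ?ltnS//.
  by rewrite (leq_trans sc)// ltnW// -ltnS.
split.
  apply/andP; split.
    apply/negP => /existsP[k /existsP[l /andP[kl lk]]].
    have : (sz k <= sz l)%N.
      case/connectP: lk => p; elim: p l {kl} => [|m p IH] l /=; first by move=> _ ->.
      by move=> /andP[lm pp] e; rewrite (leq_trans (IH m pp e))// ltnW// dcr.
    by rewrite leqNgt dcr.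
  by apply/forallP => x; rewrite -(cnt x) leq_addl.
apply/allP => v; rewrite mem_cat => vv /=.
have [x ->] : exists x, v = vA x.
  case/orP: vv => /mapP[t tF ->]; last by exists t.
  by have := allP nF t tF; case: t tF => // k l r _ _; exists k.
rewrite (count_map (@vA n)) (eq_count (a2 := pred1 x)); last by move=> y; rewrite /= (inj_eq (@vA_inj n)).
rewrite count_uniq_mem; last by rewrite filter_uniq// enum_uniq.
rewrite mem_filter mem_enum andbT; apply/eqP; have := cnt x; case: (indeg Gam x) => [|[|]] /=; lia.
Qed.

(** Unfolding from the roots meets every vertex exactly once: by induction on n minus the rank, a
    vertex is a root or inherits its count from its only predecessor, whose rank is larger. *)
Lemma forest_good Gam s : forest Gam -> s \in permutations (roots Gam) ->
  let F := map (fun k => unf Gam n.+1 (vA k)) s in good F /\ agreeF Gam F.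
Proof.
move=> /andP[nl /forallP ind]; rewrite mem_permutations => ps F.
have aF : agreeF Gam F.
  by apply/allP => t /mapP[k _ ->]; apply: agree_unf => //; rewrite /hgt split_vA ltnS; exact: rk_le.
split => //; apply/andP; split; first by apply/allP => t /mapP[k _ ->] /=; rewrite split_vA.
have rE : map lroot F = map (@vA n) s by rewrite -map_comp; apply: eq_map => k /=; rewrite split_vA.
have cs x : count_mem (vA x) (map lroot F) = (indeg Gam x == 0%N).
  rewrite rE count_map (eq_count (a2 := pred1 x)); last by move=> y; rewrite /= (inj_eq (@vA_inj n)).
  rewrite (seq.permP ps) count_uniq_mem; last by rewrite filter_uniq// enum_uniq.
  by rewrite mem_filter mem_enum andbT.
have one x : count_mem x (labsF F) = 1%N.
  move: {2}(n - rk Gam x)%N (leqnn (n - rk Gam x)) => m; elim: m x => [|m IH] x hx;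
    rewrite -(count_agreeF x aF) cs count_edsl_tgt.
    have r0 : indeg Gam x = 0%N.
      apply: eq_card0 => -[k i] /=; apply/negbTE/negP; rewrite inE => /eqP e.
      have : (rk Gam x < rk Gam k)%N by apply: rk_lt => //; apply/existsP; exists i; rewrite e.
      by move=> /= h; have := rk_le Gam k; move: h; lia.
    rewrite r0 /= big1// => e he; have := r0; rewrite /indeg => /eqP.
    by rewrite -leqn0 leqNgt => /negP[]; apply/card_gt0P; exists e.
  case: (posnP (indeg Gam x)) => [r0|r1].
    rewrite /= big1// => e he; have := r0; rewrite /indeg => /eqP.
    by rewrite -leqn0 leqNgt => /negP[]; apply/card_gt0P; exists e.
  have i1 : indeg Gam x = 1%N by apply/eqP; rewrite eqn_leq (ind x).
  rewrite ?i1 /= add0n (eq_bigr (fun=> 1%N)); first by rewrite sum1_card.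
  move=> [k i] /eqP e; apply: IH.
  have : (rk Gam x < rk Gam k)%N by apply: rk_lt => //; apply/existsP; exists i; rewrite e.
  by move=> /= h; have := rk_le Gam k; move: hx h; lia.
apply/allP => x _ /=; rewrite one count_uniq_mem ?enum_uniq// mem_enum.
by [].
Qed.

(** Labels a plane tree in prefix order, inversely to [shape] and [labels]; [LL true] is a dummy for
    a list that is too short. *)
Fixpoint fillT (T : tree) (s : seq 'I_n) : ltree :=
  match T with
  | leaf b => LL b
  | node l r => if s is k :: s' then LN k (fillT l (take (nds l) s')) (fillT r (drop (nds l) s')) else LL true
  end.

Fixpoint fillF (L : seq tree) (s : seq 'I_n) : seq ltree :=
  if L is T :: L' then fillT T (take (nds T) s) :: fillF L' (drop (nds T) s) else [::].

Lemma fillTK T s : size s = nds T -> shape (fillT T s) = T /\ labels (fillT T s) = s.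
Proof.
elim: T s => [b|l IHl r IHr] s; first by move/size0nil ->.
rewrite nds_node; case: s => //= k s [es].
have [h1 h2] : shape (fillT l (take (nds l) s)) = l /\ labels (fillT l (take (nds l) s)) = take (nds l) s.
  by apply: IHl; rewrite size_takel// es leq_addr.
have [h3 h4] : shape (fillT r (drop (nds l) s)) = r /\ labels (fillT r (drop (nds l) s)) = drop (nds l) s.
  by apply: IHr; rewrite size_drop es addKn.
by rewrite h1 h2 h3 h4 cat_take_drop.
Qed.

Lemma fillT_shape t : fillT (shape t) (labels t) = t.
Proof.
by elim: t => //= k l IHl r IHr; rewrite -size_labels take_size_cat// drop_size_cat// IHl IHr.
Qed.

Lemma fillFK L s : size s = sumn (map nds L) -> map shape (fillF L s) = L /\ labsF (fillF L s) = s.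
Proof.
elim: L s => [|T L IH] s /=; first by move/size0nil ->.
move=> es; have [h1 h2] : shape (fillT T (take (nds T) s)) = T /\ labels (fillT T (take (nds T) s)) = take (nds T) s.
  by apply: fillTK; rewrite size_takel// es leq_addr.
have [h3 h4] := IH (drop (nds T) s) ltac:(by rewrite size_drop es addKn).
by rewrite h1 h3 /labsF /= h2 -/(labsF _) h4 cat_take_drop.
Qed.

Lemma fillF_shape F : fillF (map shape F) (labsF F) = F.
Proof.
elim: F => //= t F IH; rewrite /labsF /= -size_labels take_size_cat// drop_size_cat// fillT_shape.
by rewrite IH.
Qed.

Lemma isnode_shape F : all (fun T => (0 < nds T)%N) (map shape F) = all isnode F.
Proof. by rewrite all_map; apply: eq_all => -[b|k l r] //=; rewrite nds_node. Qed.

Definition perms := permutations (enum 'I_n).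

Lemma FL_props L : L \in FL n -> all (fun T => (0 < nds T)%N) L /\ sumn (map nds L) = n.
Proof.
rewrite -has_pred1 has_count count_FL; case: (boolP (_ && _)) => // /andP[-> /eqP ->] //.
Qed.

Lemma perms_props s : s \in perms -> perm_eq s (enum 'I_n) /\ size s = n.
Proof. by rewrite mem_permutations => ps; split => //; rewrite (perm_size ps) size_enum_ord. Qed.

Lemma fillF_good L s : L \in FL n -> s \in perms ->
  [/\ good (fillF L s), map shape (fillF L s) = L & labsF (fillF L s) = s].
Proof.
move=> /FL_props[aL sL] /perms_props[ps ss].
have [h1 h2] := @fillFK L s ltac:(by rewrite ss sL).
by split => //; rewrite /good -isnode_shape h1 h2 aL ps.
Qed.

(** A good forest determines its list of shapes and its permutation of labels. The bijection is
    written with indicators so that it can be inserted under other sums. *)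
Lemma sum_fill_eq (R : pzRingType) (F : seq ltree) :
  \sum_(L <- FL n) \sum_(s <- perms) (fillF L s == F)%:R = (good F)%:R :> R.
Proof.
have [gF|ngF] := boolP (good F); last first.
  rewrite big_seq big1// => L LF; rewrite big_seq big1// => s sp; case: eqP => // e.
  by have [] := fillF_good LF sp; rewrite e (negbTE ngF).
have /andP[nF pe] := gF.
transitivity (\sum_(L <- FL n) (if L == map shape F then (1 : R) else 0)).
  rewrite !big_seq; apply: eq_bigr => L LF; case: eqP => [->|nL].
    transitivity (\sum_(s <- perms) (if s == labsF F then (1 : R) else 0)).
      rewrite !big_seq; apply: eq_bigr => s sp; case: (eqVneq s (labsF F)) => [->|ns]; first by rewrite fillF_shape eqxx.
      case: (fillF _ s =P F) => // e; case/eqP: ns; rewrite -e; have [] := @fillF_good (map shape F) s _ sp => //.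
      rewrite -has_pred1 has_count count_FL isnode_shape nF -map_comp.
      rewrite (eq_map (g := size \o labels)); last by move=> t /=; rewrite size_labels.
      by rewrite map_comp -size_flatten (perm_size pe) size_enum_ord eqxx.
    rewrite (sum_count _ _ (fun=> 1)) count_uniq_mem ?permutations_uniq// mem_permutations.
    by rewrite pe.
  rewrite big_seq big1// => s sp; case: eqP => // e; case: nL; rewrite -e.
  by have [] := fillF_good LF sp.
rewrite (sum_count _ _ (fun=> 1)) count_FL isnode_shape nF -map_comp.
rewrite (eq_map (g := size \o labels)); last by move=> t /=; rewrite size_labels.
by rewrite map_comp -size_flatten (perm_size pe) size_enum_ord eqxx.
Qed.

(* A forest together with an ordering of its roots is the same as a list of labelled plane trees. *)
Theorem sum_forests (R : realType) (h : graph n -> R) : \sum_(Gam | forest Gam) h Gam =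
  \sum_(L <- FL n) \sum_(s <- perms) (size L)`!%:R^-1 * h (dec (fillF L s)).
Proof.
pose U Gam := map (fun k => unf Gam n.+1 (vA k)).
(* The good forests encoding a given graph are its unfoldings from the orderings of its roots, which
   explains the factorial that is divided out. *)
have key Gam (F : seq ltree) : forest Gam -> good F ->
    (agreeF Gam F)%:R = \sum_(r <- permutations (roots Gam)) (F == U Gam r)%:R :> R.
  move=> fG gF; have ur : uniq (roots Gam) by rewrite filter_uniq// enum_uniq.
  have [aF|nF] := boolP (agreeF Gam F); last first.
    rewrite big_seq big1// => r rp; case: eqP => // e.
    by have [_] := forest_good fG rp; rewrite -/(U Gam r) -e (negbTE nF).
  have [_ pr] := agree_forest gF aF; have /andP[nF pe] := gF.
  pose rt t : seq 'I_n := if t is LN k _ _ then [:: k] else [::].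
  pose r0 := flatten (map rt F).
  have er0 : map (@vA n) r0 = map lroot F.
    by rewrite /r0; elim: (F) nF => //= -[b|k l r] F' IH //= /IH ->.
  have pr0 : perm_eq r0 (roots Gam) by apply: (perm_map_inj (@vA_inj n)); rewrite er0.
  have FU : F = U Gam r0.
    rewrite /U (map_comp (unf Gam n.+1) (@vA n)) er0 -map_comp -[LHS]map_id; apply/eq_in_map => t tF.
    change (t = unf Gam n.+1 (lroot t)).
    rewrite (unf_agree (allP aF t tF))// ltnS -[leqRHS](size_enum_ord n) -(perm_size pe) /labsF size_flatten.
    elim: (F) tF => //= t' F' IH; rewrite inE => /predU1P[->|/IH hh]; first by rewrite leq_addr.
    by rewrite (leq_trans hh)// leq_addl.
  have Ui : injective (U Gam).
    move=> a b /(congr1 (map lroot)); rewrite /U -!map_comp.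
    rewrite !(eq_map (f := lroot \o _) (g := @vA n)); [exact: (inj_map (@vA_inj n))|by move=> k /=; rewrite split_vA..].
  transitivity (\sum_(r <- permutations (roots Gam)) (if r == r0 then (1 : R) else 0)).
    rewrite (sum_count _ _ (fun=> 1)) count_uniq_mem ?permutations_uniq// mem_permutations pr0 //.
  apply: eq_bigr => r _; rewrite FU (inj_eq Ui) eq_sym; by case: eqP.
transitivity (\sum_(Gam | forest Gam) \sum_(L <- FL n) \sum_(s <- perms)
   (size L)`!%:R^-1 * ((agreeF Gam (fillF L s))%:R * h Gam)).
  apply: eq_bigr => Gam fG; have ur : uniq (roots Gam) by rewrite filter_uniq// enum_uniq.
  have m0 : (size (roots Gam))`!%:R != 0 :> R by rewrite pnatr_eq0 -lt0n fact_gt0.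
  transitivity (\sum_(r <- permutations (roots Gam)) (size (roots Gam))`!%:R^-1 * h Gam).
    rewrite big_const_seq count_predT iter_addr_0 size_permutations// -[RHS]mulr_natl mulrA divff// mul1r.
    by [].
  transitivity (\sum_(r <- permutations (roots Gam)) \sum_(L <- FL n) \sum_(s <- perms)
      (size (roots Gam))`!%:R^-1 * h Gam * (fillF L s == U Gam r)%:R).
    rewrite !big_seq; apply: eq_bigr => r rp; have [gU _] := forest_good fG rp.
    under eq_bigr => L _ do rewrite -mulr_sumr.
    by rewrite -mulr_sumr sum_fill_eq gU mulr1.
  rewrite exchange_big /= !big_seq; apply: eq_bigr => L LF.
  rewrite exchange_big /= !big_seq; apply: eq_bigr => s sp.
  have [gs hs _] := fillF_good LF sp.
  rewrite (key _ _ fG gs) mulr_suml mulr_sumr !big_seq; apply: eq_bigr => r rp; case: eqP => [e|_]; last by rewrite !(mulr0, mul0r).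
  rewrite mulr1 mul1r; congr (_`!%:R^-1 * _); rewrite -hs size_map e size_map.
  by move: rp; rewrite mem_permutations => /perm_size ->.
rewrite exchange_big /= !big_seq; apply: eq_bigr => L LF.
rewrite exchange_big /= !big_seq; apply: eq_bigr => s sp.
have [gs hs _] := fillF_good LF sp.
have ad : agreeF (dec (fillF L s)) (fillF L s) by rewrite agree_decE.
rewrite (bigD1 (dec (fillF L s)))/=; last by case: (agree_forest gs ad).
rewrite ad mul1r big1 ?addr0// => Gam /andP[_ ne].
by rewrite (agree_decE _ gs) (negbTE ne) mul0r mulr0.
Qed.

End Forests.

(** The extended integral is then infinite and [fine] maps it to 0. Scalars can therefore be pulled
    out of a real integral unconditionally, as [rintZm] does. *)
Lemma rint_nitg d (X : measurableType d) (R : realType) (m : {measure set X -> \bar R}) (f : X -> R) :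
  measurable_fun setT f -> ~ itg m f -> \int[m]_x f x = 0.
Proof.
move=> mf nI; rewrite /Rintegral integralE.
have mp : measurable_fun setT ((EFin \o f)^\+)%E by apply: measurable_funepos; exact/measurable_EFinP.
have mn : measurable_fun setT ((EFin \o f)^\-)%E by apply: measurable_funeneg; exact/measurable_EFinP.
have A0 : (0 <= \int[m]_x ((EFin \o f)^\+ x))%E by apply: integral_ge0.
have B0 : (0 <= \int[m]_x ((EFin \o f)^\- x))%E by apply: integral_ge0.
have abs : (\int[m]_x `|(f x)%:E| = \int[m]_x ((EFin \o f)^\+ x) + \int[m]_x ((EFin \o f)^\- x))%E.
  by rewrite -ge0_integralD//; apply: eq_integral => x _; rewrite -/((EFin \o f) x) -[LHS]/((abse \o (EFin \o f)) x) fune_abse.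
move: A0 B0 abs; set A := (\int[m]_x _)%E; set B := (\int[m]_x ((EFin \o f)^\- x))%E => A0 B0 abs.
case: A A0 abs => [a||]//; case: B B0 => [b||]// _ _ abs.
exfalso; apply: nI; apply/integrableP; split; first exact/measurable_EFinP.
by rewrite [X in (X < _)%E]abs -EFinD ltry.
Qed.

Lemma rintZm d (X : measurableType d) (R : realType) (m : {measure set X -> \bar R}) (c : R) (f : X -> R) :
  measurable_fun setT f -> \int[m]_x (c * f x) = c * \int[m]_x f x.
Proof.
move=> mf; have [If|nI] := pselect (itg m f); first exact: rintZ.
have [->|c0] := eqVneq c 0.
  by rewrite mul0r (rint_eq _ (g := fun=> 0)) ?rint0// => x; rewrite mul0r.
rewrite (rint_nitg mf nI) mulr0; apply: rint_nitg; first by apply: mfM => //; exact: measurable_cst.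
by move=> I; apply: nI; apply: itg_eq (itgZ c^-1 I) => x; rewrite mulKf.
Qed.

(** * Iterated integrals over coordinates: reordering and generic points *)

Section IteratedCoordinates.
Variable R : realType.
Local Notation mu := (@lebesgue_measure R).
Local Notation mu2 := (sprod mu mu).
Local Notation rT := (measurableTypeR R).
Local Notation pt := (pt R).

Definition upd (z : nat -> R) (j : nat) (t : R) : nat -> R := fun i => if i == j then t else z i.

Lemma updC z i j s t : i != j -> upd (upd z i s) j t = upd (upd z j t) i s.
Proof.
move=> ij; apply/funext => k; rewrite /upd; case: (eqVneq k j) => [->|//].
by rewrite eq_sym (negbTE ij).
Qed.

Definition mcoord d (T : measurableType d) (z : T -> nat -> R) :=
  forall j, measurable_fun setT (fun x => z x j : R).

Lemma mcoord_upd d (T : measurableType d) (z : T -> nat -> R) j : mcoord z ->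
  mcoord (fun x : T * rT => upd (z x.1) j x.2).
Proof.
move=> mz i; rewrite /upd; case: (i == j); first exact: measurable_snd.
exact: (measurableT_comp (mz i) measurable_fst).
Qed.

(** Measurability of a function of infinitely many coordinates, tested on all measurable
    parametrisations; this form is stable under integrating out one coordinate. *)
Definition meas (F : (nat -> R) -> R) := forall d (T : measurableType d) (z : T -> nat -> R),
  mcoord z -> measurable_fun setT (fun x => F (z x)).
Definition measG (F : (nat -> R) -> \bar R) := forall d (T : measurableType d) (z : T -> nat -> R),
  mcoord z -> measurable_fun setT (fun x => F (z x)).

(** The head of the list is the outermost variable. Real integrals, as in [iterint], do not commute
    without convergence; the companion [itG], used on nonnegative functions, does by Tonelli. *)
Fixpoint itR (s : seq nat) (F : (nat -> R) -> R) (z : nat -> R) : R :=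
  if s is j :: s' then \int[mu]_t itR s' F (upd z j t) else F z.
Fixpoint itG (s : seq nat) (F : (nat -> R) -> \bar R) (z : nat -> R) : \bar R :=
  if s is j :: s' then (\int[mu]_t itG s' F (upd z j t))%E else F z.

Lemma itR_cat s1 s2 F z : itR (s1 ++ s2) F z = itR s1 (itR s2 F) z.
Proof. by elim: s1 z => //= j s1 IH z; apply: rint_eq => t; rewrite IH. Qed.

Lemma itG_cat s1 s2 F z : itG (s1 ++ s2) F z = itG s1 (itG s2 F) z.
Proof. by elim: s1 z => //= j s1 IH z; apply: eq_integral => t _; rewrite IH. Qed.

Lemma itG_ge0 s F z : (forall z, 0 <= F z)%E -> (0 <= itG s F z)%E.
Proof. by move=> F0; elim: s z => //= j s IH z; apply: integral_ge0. Qed.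

Lemma meas_itR s F : meas F -> meas (itR s F).
Proof.
move=> mF; elim: s => //= j s IH d T z mz.
apply: (@mrint1 _ _ _ _ _ mu (fun x : T * rT => itR s F (upd (z x.1) j x.2))).
by apply: IH; exact: mcoord_upd.
Qed.

Lemma meas_itG s F : (forall z, 0 <= F z)%E -> measG F -> measG (itG s F).
Proof.
move=> F0 mF; elim: s => //= j s IH d T z mz.
apply: (@measurable_fun_fubini_tonelli_F _ _ T rT R mu (fun x : T * rT => itG s F (upd (z x.1) j x.2))).
  by apply: IH; exact: mcoord_upd.
by move=> x; exact: itG_ge0.
Qed.

Lemma mcoord_upd1 z j : mcoord (fun t : rT => upd z j t).
Proof.
move=> i; rewrite /upd; case: (i == j); [exact: measurable_id|exact: measurable_cst].
Qed.

Lemma itG_le s F F' z : (forall z, 0 <= F z)%E -> measG F -> measG F' ->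
  (forall z, F z <= F' z)%E -> (itG s F z <= itG s F' z)%E.
Proof.
move=> F0 mF mF' FF'; have F0' z' : (0 <= F' z')%E := le_trans (F0 z') (FF' z').
elim: s z => //= j s IH z; apply: ge0_le_integral => //.
- by move=> t _; exact: itG_ge0.
- exact: (meas_itG s F0 mF (mcoord_upd1 z j)).
- exact: (meas_itG s F0' mF' (mcoord_upd1 z j)).
Qed.

Lemma itG_swap i j s F z : i != j -> (forall z, 0 <= F z)%E -> measG F ->
  itG (i :: j :: s) F z = itG (j :: i :: s) F z.
Proof.
move=> ij F0 mF /=.
have m : measurable_fun setT (fun x : rT * rT => itG s F (upd (upd z i x.1) j x.2)).
  apply: (meas_itG s F0 mF); apply: (@mcoord_upd _ rT (fun t => upd z i t)); exact: mcoord_upd1.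
rewrite (@fubini_tonelli _ _ rT rT R mu mu (fun x : rT * rT => itG s F (upd (upd z i x.1) j x.2)) m); last first.
  by move=> x; exact: itG_ge0.
by apply: eq_integral => t _; apply: eq_integral => u _; rewrite updC.
Qed.

Lemma itG_bubble i s1 s2 F z : i \notin s1 -> (forall z, 0 <= F z)%E -> measG F ->
  itG (i :: s1 ++ s2) F z = itG (s1 ++ i :: s2) F z.
Proof.
move=> is1 F0 mF; elim: s1 z is1 => // j s1 IH z; rewrite inE negb_or => /andP[ij is1].
rewrite cat_cons itG_swap// [LHS]/= [RHS]/=; apply: eq_integral => t _.
by rewrite -(IH (upd z j t) is1).
Qed.

Lemma itG_perm s s' F z : (forall z, 0 <= F z)%E -> measG F -> uniq s -> perm_eq s s' ->
  itG s F z = itG s' F z.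
Proof.
move=> F0 mF; elim: s s' z => [|i s IH] s' z; first by move=> _; rewrite perm_sym => /perm_nilP ->.
move=> /andP[is_ us] ps; have is' : i \in s' by rewrite -(perm_mem ps) mem_head.
case/splitPr: is' ps => s1 s2 ps.
have ps2 : perm_eq s (s1 ++ s2) by move: ps; rewrite perm_sym -cat1s perm_catCA /= perm_cons perm_sym.
have i1 : i \notin s1 by move: is_; rewrite (perm_mem ps2) mem_cat negb_or => /andP[].
rewrite -itG_bubble//=; apply: eq_integral => t _; exact: IH.
Qed.

Definition pos_part (F : (nat -> R) -> R) z : R := Num.max (F z) 0.
Definition neg_part (F : (nat -> R) -> R) z : R := Num.max (- F z) 0.

Lemma meas_pos F : meas F -> measG (fun z => (pos_part F z)%:E) /\ measG (fun z => (neg_part F z)%:E).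
Proof.
move=> mF; split => d T z mz; apply/measurable_EFinP.
  by apply: measurable_maxr; [exact: mF|exact: measurable_cst].
by apply: measurable_maxr; [apply: mfN; exact: mF|exact: measurable_cst].
Qed.

(** Finiteness of the iterated integral of |F| forces almost every inner one to be finite, so
    positive and negative parts can be separated level by level. *)
Lemma itR_parts s F z : meas F -> (itG s (fun z => `|F z|%:E) z < +oo)%E ->
  [/\ (itG s (fun z => (pos_part F z)%:E) z < +oo)%E, (itG s (fun z => (neg_part F z)%:E) z < +oo)%E &
  (itR s F z)%:E = (itG s (fun z => (pos_part F z)%:E) z - itG s (fun z => (neg_part F z)%:E) z)%E].
Proof.
move=> mF; have [mp mn] := meas_pos mF.
have ma : measG (fun z => `|F z|%:E).
  by move=> d T y my; apply/measurable_EFinP; apply: mfnorm; exact: mF.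
have p0 y : (0 <= (pos_part F y)%:E)%E by rewrite lee_fin le_max lexx orbT.
have n0 y : (0 <= (neg_part F y)%:E)%E by rewrite lee_fin le_max lexx orbT.
have a0 y : (0 <= `|F y|%:E)%E by rewrite lee_fin.
have pa y : ((pos_part F y)%:E <= `|F y|%:E)%E by rewrite lee_fin ge_max ler_norm normr_ge0.
have na y : ((neg_part F y)%:E <= `|F y|%:E)%E by rewrite lee_fin ge_max -normrN ler_norm normr_ge0.
have le1 s' y : (itG s' (fun z => (pos_part F z)%:E) y <= itG s' (fun z => `|F z|%:E) y)%E by exact: itG_le.
have le2 s' y : (itG s' (fun z => (neg_part F z)%:E) y <= itG s' (fun z => `|F z|%:E) y)%E by exact: itG_le.
move=> fin; split; [exact: le_lt_trans (le1 s z) fin|exact: le_lt_trans (le2 s z) fin|].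
elim: s z fin => [|j s IH] z /=.
  move=> _; rewrite /pos_part /neg_part -EFinB; congr EFin.
  by case: (leP 0 (F z)) => h; case: (leP 0 (- F z)) => h'; rewrite ?subr0 ?sub0r ?opprK//; lra.
set A := fun t : rT => itG s (fun z => `|F z|%:E) (upd z j t).
set Pp := fun t : rT => itG s (fun z => (pos_part F z)%:E) (upd z j t).
set Nn := fun t : rT => itG s (fun z => (neg_part F z)%:E) (upd z j t).
move=> fin; have mA : measurable_fun setT A := meas_itG s a0 ma (mcoord_upd1 z j).
have mP : measurable_fun setT Pp := meas_itG s p0 mp (mcoord_upd1 z j).
have mN : measurable_fun setT Nn := meas_itG s n0 mn (mcoord_upd1 z j).
have A0 t : (0 <= A t)%E by exact: itG_ge0.
have P0 t : (0 <= Pp t)%E by exact: itG_ge0.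
have N0 t : (0 <= Nn t)%E by exact: itG_ge0.
have IA : mu.-integrable setT A.
  apply/integrableP; split => //; rewrite (eq_integral A)// => t _; by rewrite gee0_abs.
have dom (Q : rT -> \bar R) : measurable_fun setT Q -> (forall t, 0 <= Q t)%E -> (forall t, Q t <= A t)%E ->
    mu.-integrable setT Q.
  move=> mQ Q0 QA; apply: (le_integrable _ mQ _ IA) => //.
  by move=> t _; rewrite gee0_abs// gee0_abs.
have IP := dom Pp mP P0 (fun t => le1 s _); have IN := dom Nn mN N0 (fun t => le2 s _).
have E : (\int[mu]_t (itR s F (upd z j t))%:E = \int[mu]_t (Pp t - Nn t))%E.
  apply: ae_eq_integral => //.
  - apply/measurable_EFinP; exact: (meas_itR s mF (mcoord_upd1 z j)).
  - exact: emeasurable_funB.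
  - apply: filterS (integrable_ae measurableT IA) => t /(_ I) At _; apply: IH.
    by rewrite -ge0_fin_numE// A0.
rewrite -integralB//= -E /Rintegral fineK//.
by rewrite E integralB// fin_numB !integrable_fin_num.
Qed.

Lemma itR_perm s s' F z : meas F -> uniq s -> perm_eq s s' ->
  (itG s (fun z => `|F z|%:E) z < +oo)%E -> itR s F z = itR s' F z.
Proof.
move=> mF us ps fin; have [mp mn] := meas_pos mF.
have ma : measG (fun z => `|F z|%:E).
  by move=> d T y my; apply/measurable_EFinP; apply: mfnorm; exact: mF.
have fin' : (itG s' (fun z => `|F z|%:E) z < +oo)%E.
  by rewrite -(itG_perm _ _ _ us ps)// => y; rewrite lee_fin.
have [_ _ E1] := itR_parts mF fin; have [_ _ E2] := itR_parts mF fin'.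
have : (itR s F z)%:E = (itR s' F z)%:E.
  rewrite E1 E2; congr (_ - _)%E; apply: itG_perm => // y; by rewrite lee_fin le_max lexx orbT.
by move=> [].
Qed.

Lemma ae_notin (l : seq R) : {ae mu, forall t : rT, (t : R) \notin l}.
Proof.
elim: l => [|c l IH]; first exact: nearW.
by apply: filterS (filterI (ae_neq c) IH) => t [h1 h2]; rewrite inE negb_or h1.
Qed.

(** Each variable of integration may avoid the finitely many values held by the coordinates in S.
    This disposes of the coinciding points excluded in [inHn]. *)
Lemma itR_generic (S : seq nat) s F F' z : meas F -> meas F' -> uniq s -> {subset s <= S} ->
  (forall z', (forall i, i \notin s -> z' i = z i) ->
     (forall i j, i \in s -> j \in S -> i != j -> z' i != z' j) -> F z' = F' z') ->
  itR s F z = itR s F' z.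
Proof.
move=> mF mF'; elim: s z => [|j s IH] z us sS H /=; first by apply: H.
have /andP[js us'] := us.
apply: rint_ae; [exact: (meas_itR s mF (mcoord_upd1 z j))|exact: (meas_itR s mF' (mcoord_upd1 z j))|].
apply: filterS (ae_notin [seq z i | i <- S]) => t tn.
apply: IH => //; first by move=> i is_; apply: sS; rewrite inE is_ orbT.
move=> z' z'z dist.
have zj : z' j = t by rewrite z'z// /upd eqxx.
apply: H => [i|i k].
  rewrite inE negb_or => /andP[ij is_]; rewrite z'z// /upd (negbTE ij) //.
rewrite inE => /predU1P[->|is_] kS ik; last exact: dist.
have [ks|ks] := boolP (k \in s); first by rewrite eq_sym; apply: dist; rewrite ?sS ?inE ?eqxx// eq_sym.
have kj : (k == j) = false by rewrite eq_sym; exact: negbTE.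
rewrite zj z'z// /upd kj; apply: contra tn => /eqP ->.
by apply/mapP; exists k.
Qed.

Lemma itR_upd s F j t z : j \notin s -> itR s (fun z => F (upd z j t)) z = itR s F (upd z j t).
Proof.
elim: s z => //= i s IH z; rewrite inE negb_or => /andP[ji js]; apply: rint_eq => u.
by rewrite IH// updC// eq_sym.
Qed.

Lemma iterint_itR m F : iterint m F = itR (rev (iota 0 m)) F (fun=> 0).
Proof.
elim: m F => [//|m IH] F; rewrite [LHS]/= -[in RHS](addn1 m) iotaD rev_cat /= add0n.
apply: rint_eq => t; rewrite IH -(@itR_upd _ F m t)//.
by rewrite mem_rev mem_iota add0n ltnn.
Qed.

Lemma itR_Z s (c F : (nat -> R) -> R) z : meas F -> (forall z j t, j \in s -> c (upd z j t) = c z) ->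
  itR s (fun z => c z * F z) z = c z * itR s F z.
Proof.
move=> mF; elim: s z => //= j s IH z cs.
rewrite -rintZm; last exact: (meas_itR s mF (mcoord_upd1 z j)).
apply: rint_eq => t; rewrite IH; first by rewrite cs// mem_head.
by move=> y i u is_; rewrite cs// inE is_ orbT.
Qed.

Lemma itR_ext s F F' z : F =1 F' -> itR s F z = itR s F' z.
Proof. by move=> /funext ->. Qed.

End IteratedCoordinates.

(** * Integrating out the vertices of a tree *)

Section TreeWeights.
Variables (R : realType) (n : nat).
Local Notation mu := (@lebesgue_measure R).
Local Notation mu2 := (sprod mu mu).
Local Notation rT := (measurableTypeR R).
Local Notation pt := (pt R).
Local Notation ltree := (ltree n).
Implicit Types (t : ltree) (z : nat -> R).

(** The coordinates of the vertices in [l], in order; for the prefix labels of a tree the root comes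
    first and is thus the outermost variable. *)
Definition cds (l : seq 'I_n) : seq nat := flatten [seq [:: (k * 2)%N; (k * 2).+1] | k : 'I_n <- l].

Lemma cds_cat l1 l2 : cds (l1 ++ l2) = cds l1 ++ cds l2.
Proof. by rewrite /cds map_cat flatten_cat. Qed.

Lemma cds_cons k l : cds (k :: l) = (k * 2)%N :: (k * 2).+1 :: cds l. Proof. by []. Qed.

Lemma mem_cds j l : (j \in cds l) = has (fun k : 'I_n => (k : nat) == j %/ 2)%N l.
Proof.
elim: l => // k l IH; rewrite cds_cons !inE IH orbA; congr (_ || _).
by apply/idP/idP; lia.
Qed.

Lemma cdsP j l : reflect (exists2 k : 'I_n, k \in l & (k : nat) = (j %/ 2)%N) (j \in cds l).
Proof.
by rewrite mem_cds; apply: (iffP hasP) => -[k kl]; [move/eqP|move=> e]; exists k => //; apply/eqP.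
Qed.

Lemma cds_notin (k : 'I_n) l j : k \notin l -> (j %/ 2)%N = k -> j \notin cds l.
Proof.
move=> kl jk; apply/negP => /cdsP[k' k'l e]; case/negP: kl.
by rewrite (_ : k = k')//; apply: val_inj; rewrite /= e.
Qed.

Lemma uniq_cds l : uniq l -> uniq (cds l).
Proof.
elim: l => // k l IH /= /andP[kl ul]; rewrite -/(cds l) IH// andbT inE negb_or.
rewrite !(@cds_notin k)//; [|by lia|by lia].
by rewrite andbT; apply/andP; split => //; lia.
Qed.

Lemma perm_cds : perm_eq (rev (iota 0 (n * 2))) (cds (enum 'I_n)).
Proof.
apply: uniq_perm; [by rewrite rev_uniq iota_uniq|by rewrite uniq_cds// enum_uniq|].
move=> j; rewrite mem_rev mem_iota add0n /=; apply/idP/cdsP => [jn|[k _ e]].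
  have jk : (j %/ 2 < n)%N by lia.
  by exists (Ordinal jk); rewrite ?mem_enum.
by have := ltn_ord k; lia.
Qed.

Definition posT z t : pt := match t with LL b => ept R b | LN k _ _ => apos z k end.

Fixpoint WT z t : R := match t with
  | LL _ => 1
  | LN k l r => up (apos z k : pt) * JK (apos z k : pt) (posT z l) (posT z r) * (WT z l * WT z r)
  end.

Lemma apos_upd z j x (k : 'I_n) : (j %/ 2)%N != k -> apos (upd z j x) k = apos z k.
Proof.
move=> jk; rewrite /apos /upd (_ : (k * 2)%N == j = false); last by apply/negbTE; lia.
by rewrite (_ : (k * 2).+1 == j = false)//; apply/negbTE; lia.
Qed.

Lemma cds_neq j (k : 'I_n) l : k \in l -> j \notin cds l -> (j %/ 2)%N != k.
Proof. by move=> kl; apply: contra => /eqP jk; apply/cdsP; exists k. Qed.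

Lemma posT_upd z j x t : j \notin cds (labels t) -> posT (upd z j x) t = posT z t.
Proof.
case: t => // k l r jn; rewrite /posT apos_upd//; apply: cds_neq jn; exact: mem_head.
Qed.

Lemma notin_labels j (k : 'I_n) l r : j \notin cds (labels (LN k l r)) ->
  [/\ (j %/ 2)%N != k, j \notin cds (labels l) & j \notin cds (labels r)].
Proof.
move=> jn; split.
- by apply: cds_neq jn; exact: mem_head.
- by move: jn; rewrite /= cds_cons cds_cat !inE !negb_or mem_cat negb_or => /and4P[].
- by move: jn; rewrite /= cds_cons cds_cat !inE !negb_or mem_cat negb_or => /and4P[].
Qed.

Lemma WT_upd z j x t : j \notin cds (labels t) -> WT (upd z j x) t = WT z t.
Proof.
elim: t => // k l IHl r IHr /notin_labels[jk jl jr] /=.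
by rewrite IHl// IHr// !posT_upd// apos_upd.
Qed.

Lemma mapos d (T : measurableType d) (z : T -> nat -> R) k : mcoord z ->
  measurable_fun setT (fun x => apos (z x) k : pt).
Proof. by move=> mz; apply: mpair; exact: mz. Qed.

Lemma mposT d (T : measurableType d) (z : T -> nat -> R) t : mcoord z ->
  measurable_fun setT (fun x => posT (z x) t).
Proof. by case: t => [b|k l r] mz; [exact: measurable_cst|exact: mapos]. Qed.

Lemma meas_WT t : meas (WT ^~ t).
Proof.
elim: t => [b|k l IHl r IHr] d T z mz /=; first exact: measurable_cst.
apply: mfM; last by apply: mfM; [exact: IHl|exact: IHr].
apply: mfM; first by apply: (measurableT_comp (@measurable_up R)); exact: mapos.
by apply: mJK; [exact: mapos|exact: mposT|exact: mposT].
Qed.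

Definition measP (Psi : (nat -> R) -> pt -> R) := forall d (T : measurableType d) (z : T -> nat -> R) (q : T -> pt),
  mcoord z -> measurable_fun setT q -> measurable_fun setT (fun x => Psi (z x) (q x)).

Lemma itR_reach s F F' z : (forall z', (forall i, i \notin s -> z' i = z i) -> F z' = F' z') ->
  itR s F z = itR s F' z.
Proof.
elim: s z => [|j s IH] z H /=; first by apply: H.
apply: rint_eq => x; apply: IH => z' Hz'; apply: H => i; rewrite inE negb_or => /andP[ij is_].
by rewrite Hz'// /upd (negbTE ij).
Qed.

Lemma cds_own (k : 'I_n) l : k \notin l -> (k * 2)%N \notin cds l /\ (k * 2).+1 \notin cds l.
Proof. by move=> kl; split; apply: (@cds_notin k) => //; lia. Qed.

(** [Psi] is the part of the integrand that sees the tree only through its root; in the recursion it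
    absorbs the Jacobian of the parent. For almost every root position the right subtree and then
    the left one are integrated out, which leaves the density. *)
Lemma itR_eval_tree t (Psi : (nat -> R) -> pt -> R) z0 : uniq (labels t) -> measP Psi ->
  (forall z q j x, j \in cds (labels t) -> Psi (upd z j x) q = Psi z q) ->
  itg (mtree R (shape t)) (fun q => Psi z0 q * dens (shape t) q) ->
  itR (cds (labels t)) (fun z => Psi z (posT z t) * WT z t) z0 =
  \int[mtree R (shape t)]_q (Psi z0 q * dens (shape t) q).
Proof.
have ar1 (P u J a b : R) : P * (u * J * (a * b)) = P * (u * a) * J * b by ring.
have ar2 (P u a I : R) : P * (u * a) * I = P * (u * I) * a by ring.
have ar3 (u J a b : R) : u * J * (a * b) = (u * a) * (J * b) by ring.
have ar4 (P u a I : R) : P * (u * I) * a = P * (u * a * I) by ring.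
elim: t Psi z0 => [b|k l IHl r IHr] Psi z0 ut mPsi indP Ipsi.
  rewrite /= /Rintegral integral_dirac//=; last first.
    apply/measurable_EFinP; exact: itg_meas Ipsi.
  by rewrite indicT /= mul1r lexx mulr1.
set L := shape l; set Rr := shape r.
move: ut => /=; rewrite cat_uniq mem_cat negb_or => /andP[/andP[kl kr] /and3P[ul hlr ur]].
have lr_disj j : j \in cds (labels r) -> j \notin cds (labels l).
  move=> /cdsP[a ar e]; apply: (@cds_notin a) => //; apply: contra hlr => al.
  by apply/hasP; exists a.
have inl j : j \in cds (labels l) -> j \in cds (labels (LN k l r)).
  by move=> jl; rewrite /= cds_cons cds_cat !inE mem_cat jl !orbT.
have inr_ j : j \in cds (labels r) -> j \in cds (labels (LN k l r)).
  by move=> jl; rewrite /= cds_cons cds_cat !inE mem_cat jl !orbT.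
pose F z := Psi z (apos z k) * (up (apos z k : pt) * JK (apos z k : pt) (posT z l) (posT z r) * (WT z l * WT z r)).
have mF : meas F.
  move=> d T z mz; apply: mfM; first by apply: mPsi => //; exact: mapos.
  exact: (meas_WT (LN k l r) mz).
pose zz (p : pt) := upd (upd z0 (k * 2)%N p.1) (k * 2).+1 p.2.
have azz p : apos (zz p) k = p.
  by rewrite /apos /zz /upd !eqxx (_ : (k * 2)%N == (k * 2).+1 = false)//; [case: p|apply/negbTE; lia].
have Pzz p q : Psi (zz p) q = Psi z0 q.
  by rewrite /zz !indP//= /= cds_cons !inE eqxx ?orbT.
have mzz : mcoord zz.
  move=> j; rewrite /zz /upd; case: (j == (k * 2).+1); first exact: measurable_snd.
  by case: (j == (k * 2)%N); [exact: measurable_fst|exact: measurable_cst].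
pose G (p : pt) : R := itR (cds (labels l) ++ cds (labels r)) F (zz p).
have mG : measurable_fun setT G := meas_itR _ mF mzz.
have DI := dens_node_itg (@mdens R L) (@mdens R Rr) (@dens_itg R L) (@dens_itg R Rr).
have key : {ae mu2, forall p, Psi z0 p * dens (node L Rr) p = G p}.
  apply: filterS (filterI (fub_ae1 DI) (filterI (@aK_dens_ae R Rr) (@bK_dens_ae R Rr))) => p [Ip [Ia Ib]].
  have IJ q1 : itg (mtree R Rr) (fun q => JK p q1 q * dens Rr q).
    apply: itg_eq (itgB (itgZ (aK p q1) Ib) (itgZ (bK p q1) Ia)) => q.
    by rewrite /JK; ring.
  (* What remains for the left subtree once the right one is integrated out. *)
  pose Psil z (q1 : pt) := Psi z (apos z k) * (up (apos z k : pt) * \int[mtree R Rr]_q (JK (apos z k : pt) q1 q * dens Rr q)).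
  have E1 : G p = itR (cds (labels l)) (fun z => Psil z (posT z l) * WT z l) (zz p).
    rewrite /G itR_cat; apply: itR_reach => z' Hz'.
    have az' : apos z' k = p.
      by have [c1 c2] := cds_own kl; rewrite -[RHS](azz p) /apos !Hz'.
    pose Psir z (q : pt) := (Psi z (apos z k) * (up (apos z k : pt) * WT z l)) * JK (apos z k : pt) (posT z l) q.
    rewrite (@itR_ext _ _ F (fun z => Psir z (posT z r) * WT z r)); last by move=> z; exact: ar1.
    rewrite (IHr Psir z' ur).
    - rewrite (rint_eq _ (g := fun q => (Psi z' p * (up p * WT z' l)) * (JK p (posT z' l) q * dens Rr q))); last first.
        by move=> q; rewrite /Psir az'; exact/esym/mulrA.
      by rewrite (rintZ _ (IJ _)) /Psil az'; exact: ar2.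
    - move=> d T z q mz mq; apply: mfM; last by apply: mJK => //; [exact: mapos|exact: mposT].
      apply: mfM; first by apply: mPsi => //; exact: mapos.
      apply: mfM; last exact: meas_WT.
      by apply: (measurableT_comp (@measurable_up R)); exact: mapos.
    - move=> z q j x jr; have jl := lr_disj j jr.
      have jk : (j %/ 2)%N != k.
        by apply/negP => /eqP jk; case/cdsP: jr => a ar e; case/negP: kr; rewrite (_ : k = a)//; apply: val_inj; rewrite /= e.
      by rewrite /Psir indP ?inr_// WT_upd// posT_upd// apos_upd.
    - apply: itg_eq (itgZ (Psi z' p * (up p * WT z' l)) (IJ (posT z' l))) => q.
      by rewrite /Psir az'; (exact: mulrA || exact/esym/mulrA).
  have E2 : itR (cds (labels l)) (fun z => Psil z (posT z l) * WT z l) (zz p) =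
      \int[mtree R L]_q (Psil (zz p) q * dens L q).
    have inner q1 : \int[mtree R Rr]_q2 (up p * JK p q1 q2 * (dens L q1 * dens Rr q2)) =
        up p * (\int[mtree R Rr]_q (JK p q1 q * dens Rr q)) * dens L q1.
      rewrite (rint_eq _ (g := fun q => (up p * dens L q1) * (JK p q1 q * dens Rr q))); last by move=> q; exact: ar3.
      by rewrite (rintZ _ (IJ _)) mulrAC.
    apply: IHl => //.
    - move=> d T z q mz mq; apply: mfM; first by apply: mPsi => //; exact: mapos.
      apply: mfM; first by apply: (measurableT_comp (@measurable_up R)); exact: mapos.
      apply: (@mrint1 _ _ _ _ _ (mtree R Rr) (fun x : T * pt => JK (apos (z x.1) k : pt) (q x.1) x.2 * dens Rr x.2)).
      apply: mfM; last by apply: (measurableT_comp (@mdens R Rr)); msr.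
      apply: mJK; [exact: (measurableT_comp (mapos k mz) measurable_fst)|exact: (measurableT_comp mq measurable_fst)|msr].
    - move=> z q j x jl.
      have jk : (j %/ 2)%N != k.
        by apply/negP => /eqP jk; case/cdsP: jl => a ar e; case/negP: kl; rewrite (_ : k = a)//; apply: val_inj; rewrite /= e.
      by rewrite /Psil indP ?inl// apos_upd.
    - apply: itg_eq (itgZ (Psi z0 p) (fub_itg1 Ip)) => q1 /=.
      by rewrite inner /Psil azz Pzz; (exact: mulrA || exact/esym/mulrA).
  rewrite E1 E2 /Psil azz.
  rewrite [RHS](rint_eq _ (g := fun q1 => Psi z0 p * \int[mtree R Rr]_q2 (up p * JK p q1 q2 * (dens L q1 * dens Rr q2)))); last first.
    move=> q1 /=; rewrite (rint_eq _ (f := fun q2 => up p * JK p q1 q2 * _) (g := fun q => (up p * dens L q1) * (JK p q1 q * dens Rr q))); last by move=> q; exact: ar3.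
    by rewrite (rintZ _ (IJ _)) Pzz; exact: ar4.
  rewrite rintZ; last exact: (fub_itg1 Ip).
  by rewrite /= (fub1 Ip).
have IG : itg mu2 G := itg_ae Ipsi mG key.
transitivity (\int[mu]_x \int[mu]_y G (x, y)).
  by rewrite -[flatten _]/(cds (labels l ++ labels r)) cds_cat.
rewrite -(fub1 IG) /=; apply: rint_ae; [exact: mG|exact: itg_meas Ipsi|].
by apply: filterS key => p ->.
Qed.

Lemma itR_eval_forest (F : seq ltree) z0 : uniq (labsF F) ->
  itR (cds (labsF F)) (fun z => \prod_(t <- F) WT z t) z0 = \prod_(t <- F) mass R (shape t).
Proof.
elim: F z0 => [|t F IH] z0; first by move=> _; rewrite /= !big_nil.
rewrite /labsF /= -/(labsF F) cat_uniq => /and3P[ut hd uF]; rewrite cds_cat itR_cat.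
have mp : meas (fun z => \prod_(t <- F) WT z t).
  by move=> d T z mz; apply: mfprod => t'; exact: (meas_WT t' mz).
rewrite (@itR_ext _ _ _ (fun z => (\prod_(t <- F) mass R (shape t)) * WT z t)); last first.
  move=> z; rewrite (@itR_ext _ _ _ (fun z => WT z t * \prod_(t <- F) WT z t)); last by move=> z'; rewrite big_cons.
  rewrite itR_Z//; first by rewrite IH// mulrC.
  move=> z' j x /cdsP[a aF e]; apply: WT_upd; apply: (@cds_notin a) => //.
  by apply: contra hd => at_; apply/hasP; exists a.
have It := itgZ (\prod_(t <- F) mass R (shape t)) (@dens_itg R (shape t)).
rewrite (@itR_eval_tree t (fun _ _ => \prod_(t <- F) mass R (shape t)))//.
by rewrite rintZ; [rewrite big_cons mulrC|exact: dens_itg].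
Qed.

End TreeWeights.

(** * Absolute convergence and the weight integral of a forest *)

Section GraphWeights.
Variables (R : realType) (n : nat) (Gam : graph n).
Hypothesis nl : ~~ loop_graph Gam.
Local Notation mu := (@lebesgue_measure R).
Local Notation mu2 := (sprod mu mu).
Local Notation rT := (measurableTypeR R).
Local Notation pt := (pt R).

Definition fG (z : nat -> R) (k : 'I_n) : R := up (apos z k : pt) * JG Gam z k.

Lemma mvpos d (T : measurableType d) (z : T -> nat -> R) v : mcoord z ->
  measurable_fun setT (fun x => vpos (n := n) (z x) v : pt).
Proof.
move=> mz; case: (vertexP v) => [->|->|[k ->]].
- by under eq_fun do rewrite vpos_vX; exact: measurable_cst.
- by under eq_fun do rewrite vpos_vY; exact: measurable_cst.
- by under eq_fun do rewrite vpos_vA; exact: mapos.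
Qed.

Lemma meas_JG k : meas (fun z : nat -> R => JG Gam z k).
Proof. by move=> d T z mz; apply: mJK; [exact: mapos|exact: mvpos|exact: mvpos]. Qed.

Lemma meas_fG k : meas (fG ^~ k).
Proof.
move=> d T z mz; apply: mfM; last exact: meas_JG.
by apply: (measurableT_comp (@measurable_up R)); exact: mapos.
Qed.

Lemma vpos_upd (z : nat -> R) j x v : (forall k, v = vA k -> (j %/ 2)%N != k) ->
  vpos (n := n) (upd z j x) v = vpos z v.
Proof.
case: (vertexP v) => [->|->|[k ->]] H; rewrite ?vpos_vX ?vpos_vY ?vpos_vA//.
by rewrite apos_upd//; exact: H.
Qed.

(** Sorted by rank, so the aerial targets of a vertex precede it. *)
Definition topo (l : seq 'I_n) := forall s1 k s2, l = s1 ++ k :: s2 ->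
  (forall a, (rk Gam a < rk Gam k)%N -> a \in s1) /\ (forall a, a \in s1 -> (rk Gam a <= rk Gam k)%N).

Lemma topo_rcons l k : topo (rcons l k) -> topo l.
Proof.
by move=> H s1 a s2 e; apply: (H s1 a (rcons s2 k)); rewrite e rcons_cat.
Qed.

(** The last vertex has maximal rank, so no other factor depends on its position, and its own factor
    integrates to at most [CJ] wherever its targets are. Loop-freeness is the only property of the
    graph that enters. *)
Lemma fG_bound l (c : R) z0 : topo l -> uniq l -> 0 <= c ->
  (itG (cds l) (fun z => (c * \prod_(k <- l) `|fG z k|)%:E) z0 <= (c * CJ R ^+ size l)%:E)%E.
Proof.
have CJ0 : 0 <= CJ R by rewrite mulr_ge0// sqr_ge0.
elim/last_ind: l c z0 => [|l k IH] c z0 tl ul c0; first by rewrite /= big_nil expr0.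
have [ch par] := tl l k [::] ltac:(by rewrite cats1).
move: ul; rewrite rcons_uniq => /andP[kl ul].
rewrite -cats1 cds_cat itG_cat cats1 size_rcons exprS mulrA.
have mpr (s : seq 'I_n) (c' : R) : measG (fun z => (c' * \prod_(k <- s) `|fG z k|)%:E).
  move=> d T z mz; apply/measurable_EFinP; apply: mfM; first exact: measurable_cst.
  by apply: mfprod => a; apply: mfnorm; exact: meas_fG.
have ge0 (s : seq 'I_n) (c' : R) z : 0 <= c' -> (0 <= (c' * \prod_(k <- s) `|fG z k|)%:E)%E.
  by move=> c'0; rewrite lee_fin mulr_ge0// prodr_ge0.
apply: le_trans (IH (c * CJ R) z0 (topo_rcons tl) ul (mulr_ge0 c0 CJ0)).
apply: itG_le.
- by move=> z; apply: itG_ge0 => z'; exact: ge0.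
- by apply: meas_itG => [z'|]; [exact: ge0|exact: mpr].
- exact: mpr.
move=> z; rewrite cds_cons /=.
set Pl := \prod_(a <- l) `|fG z a|.
have noloop i : Gam (k, i) != vA k.
  apply/negP => /eqP e; have : aedge Gam k k by apply/existsP; exists i; rewrite e.
  by move/(rk_lt nl); rewrite ltnn.
pose q (i : 'I_2) : pt := vpos z (Gam (k, i)).
have fE (x y : R) : c * \prod_(a <- rcons l k) `|fG (upd (upd z (k * 2)%N x) (k * 2).+1 y) a| =
    (c * Pl) * `|up ((x, y) : pt) * JK ((x, y) : pt) (q 0) (q 1)|.
  have ak : apos (upd (upd z (k * 2)%N x) (k * 2).+1 y) k = (x, y).
    by rewrite /apos /upd !eqxx (_ : (k * 2)%N == (k * 2).+1 = false)//; apply/negbTE; lia.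
  have vk i : vpos (upd (upd z (k * 2)%N x) (k * 2).+1 y) (Gam (k, i)) = q i.
    rewrite !vpos_upd// => a e; apply/negP => /eqP ea; case/eqP: (noloop i); rewrite e; congr vA;
      apply: val_inj; rewrite /= -ea; lia.
  rewrite -cats1 big_cat big_seq1 /= [LHS]mulrA; congr (c * _ * _); last by rewrite /fG /JG ak !vk.
  apply: eq_big_seq => a al.
  have ka : a != k by apply: contra kl => /eqP <-.
  have vka i : Gam (a, i) != vA k.
    apply/negP => /eqP e; have : aedge Gam a k by apply/existsP; exists i; rewrite e.
    by move/(rk_lt nl); rewrite ltnNge par.
  have d1 : ((k * 2) %/ 2)%N = k by rewrite mulnK.
  have d2 : ((k * 2).+1 %/ 2)%N = k by rewrite -addn1 divnMDl// divn_small// addn0.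
  have hb j i b : (j %/ 2)%N = k -> Gam (a, i) = vA b -> (j %/ 2)%N != b.
    by move=> -> e; apply/negP => /eqP/val_inj eb; move: (vka i); rewrite e eb eqxx.
  have va i : vpos (upd (upd z (k * 2)%N x) (k * 2).+1 y) (Gam (a, i)) = vpos z (Gam (a, i)).
    by rewrite !vpos_upd// => b; exact: hb.
  have aa : apos (upd (upd z (k * 2)%N x) (k * 2).+1 y) a = apos z a.
    by rewrite !apos_upd ?d1 ?d2//; apply: contra ka => /eqP/val_inj ->.
  by rewrite /fG /JG !va aa.
have [P0|P0] := eqVneq Pl 0.
  rewrite P0 mulr0 (eq_integral (fun=> 0%E)) ?integral0// => x _.
  by rewrite (eq_integral (fun=> 0%E)) ?integral0// => y _; rewrite fE P0 mulr0 mul0r.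
(* The bound [CJ] requires targets in the closed half plane; an aerial target below it would make
   its own factor, and with it the product [Pl], vanish. *)
have q0 i : 0 <= (q i).2.
  rewrite /q; case: (vertexP (Gam (k, i))) => [->|->|[a e]]; rewrite ?vpos_vX ?vpos_vY//=.
  rewrite e vpos_vA; have al : a \in l by apply: ch; apply: rk_lt => //; apply/existsP; exists i; rewrite e.
  rewrite leNgt; apply/negP => neg; case/eqP: P0; rewrite /Pl (big_rem a al) /= /fG /up.
  by rewrite (_ : (0 < (apos z a).2)%R = false) ?mul0r ?normr0 ?mul0r//; apply/negbTE; rewrite -leNgt ltW.
have [IJ LJ] := JK_itg (q0 0) (q0 1).
have IC := itgZ (c * Pl) (itg_norm IJ).
have E : (\int[mu]_x \int[mu]_y ((c * Pl) * `|up ((x, y) : pt) * JK ((x, y) : pt) (q 0) (q 1)|)%:E =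
    (\int[mu2]_p ((c * Pl) * `|up p * JK p (q 0) (q 1)|))%:E)%E.
  rewrite (rintE IC) /sprod (@fubini_tonelli1 _ _ rT rT R mu mu (fun p : pt => ((c * Pl) * `|up p * JK p (q 0) (q 1)|)%:E))//.
    by apply/measurable_EFinP; exact: itg_meas IC.
  by move=> p; rewrite lee_fin mulr_ge0// mulr_ge0// prodr_ge0.
rewrite (eq_integral (fun x : rT => (\int[mu]_y ((c * Pl) * `|up ((x, y) : pt) * JK ((x, y) : pt) (q 0) (q 1)|)%:E)%E)); last first.
  by move=> x _; apply: eq_integral => y _; rewrite fE.
rewrite E lee_fin rintZ; last exact: itg_norm.
by rewrite [leRHS]mulrAC ler_wpM2l// mulr_ge0// prodr_ge0.
Qed.

Lemma exists_topo : exists2 l : seq 'I_n, perm_eq l (enum 'I_n) & topo l.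
Proof.
pose le (a b : 'I_n) := (rk Gam a <= rk Gam b)%N.
exists (sort le (enum 'I_n)); first by rewrite perm_sort.
have tle : total le by move=> a b; exact: leq_total.
have trl : transitive le by move=> a b c; exact: leq_trans.
have so := sort_sorted tle (enum 'I_n).
move=> s1 k s2 e; rewrite e in so; split => a.
  move=> ak; have : a \in s1 ++ k :: s2 by rewrite -e mem_sort mem_enum.
  rewrite mem_cat => /orP[//|]; move: so; rewrite (sorted_pairwise trl) pairwise_cat /= => /and3P[_ _ /andP[sk _]].
  rewrite inE => /predU1P[ek|a2]; first by move: ak; rewrite ek ltnn.
  by have := allP sk a a2; rewrite /le leqNgt ak.
move=> a1; move: so; rewrite (sorted_pairwise trl) pairwise_cat => /and3P[/allrelP + _ _]; apply => //; exact: mem_head.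
Qed.

(** Coinciding points are dropped as nongeneric, absolute convergence allows the coordinates to be
    regrouped along the trees, and each tree then yields its mass. *)
Lemma itR_graph (F : seq (ltree n)) : good F -> agreeF Gam F ->
  iterint (n * 2) (integrand (R := R) Gam) = \prod_(t <- F) mass R (shape t).
Proof.
move=> gF aF; have /andP[_ pe] := gF.
pose Fp z := \prod_k fG z k.
have mFp : meas Fp by move=> d T z mz; apply: mfprod => k; exact: meas_fG.
have GG : Gam \in G n.
  rewrite inE; apply/forallP => -[k i]; apply/negP => /eqP e.
  have : aedge Gam k k by apply/existsP; exists i; rewrite e.
  by move/(rk_lt nl); rewrite ltnn.
have ID (z : nat -> R) : integrand Gam z = (inHn n z)%:R * \prod_k JG Gam z k.
  by rewrite /integrand (det_jac _ GG nl); case: (inHn n z); rewrite ?mul1r ?mul0r.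
have mI : meas (integrand (R := R) Gam).
  move=> d T z mz; rewrite (_ : (fun x => _) = fun x => (inHn n (z x))%:R * \prod_k JG Gam (z x) k); last first.
    by apply/funext => x; rewrite ID.
  apply: mfM; last by apply: mfprod => k; exact: meas_JG.
  rewrite (_ : (fun x => _) = fun x => (\prod_(m < n) (0 < (apos (z x) m).2)%R%:R) *
     \prod_(m < n) \prod_(l < n) ((m != l) ==> (apos (z x) m != apos (z x) l))%:R); last first.
    have pb (J : finType) (b : J -> bool) : ([forall j, b j])%:R = \prod_j (b j)%:R :> R.
      have [/forallP h|/forallPn[j nj]] := boolP [forall j, b j]; first by rewrite big1// => j _; rewrite h.
      by rewrite (bigD1 j)//= (negbTE nj) mul0r.
    apply/funext => x; rewrite /inHn -mulnb natrM !pb; congr (_ * _); apply: eq_bigr => m _.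
    by rewrite pb.
  apply: mfM; first by apply: mfprod => m; apply: mfb; apply: mblt; [exact: measurable_cst|exact: mz].
  apply: mfprod => m; apply: mfprod => l; case: (m != l) => /=; last exact: measurable_cst.
  rewrite (_ : (fun x => _) = fun x => (~~ ((z x (m * 2)%N == z x (l * 2)%N) && (z x (m * 2).+1 == z x (l * 2).+1)))%:R)//.
  by apply: mfb; apply: mbneg; apply: mband; apply: mbeq; exact: mz.
rewrite iterint_itR.
have gen : itR (rev (iota 0 (n * 2))) (integrand Gam) (fun=> 0 : R) = itR (rev (iota 0 (n * 2))) Fp (fun=> 0).
  apply: (@itR_generic R (rev (iota 0 (n * 2)))) => //; first by rewrite rev_uniq iota_uniq.
  move=> z _ dist; rewrite ID /Fp.
  have [/forallP h|/forallPn[k nk]] := boolP [forall m : 'I_n, 0 < (apos z m).2].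
    rewrite /inHn (_ : [forall m : 'I_n, 0 < (apos z m).2]) ?andTb; last exact/forallP.
    rewrite (_ : [forall m : 'I_n, _]).
      by rewrite mul1r; apply: eq_bigr => k _; rewrite /fG /up h mul1r.
    apply/forallP => m; apply/forallP => l; apply/implyP => ml; apply/negP => /eqP [e _].
    have := dist (m * 2)%N (l * 2)%N; rewrite e eqxx => H; suff : false by [].
    have mn := ltn_ord m; have ln := ltn_ord l.
    apply: H; rewrite ?mem_rev ?mem_iota; [lia|lia|].
    by apply: contra ml => /eqP e2; apply/eqP/val_inj; rewrite /=; lia.
  rewrite /inHn (_ : [forall m : 'I_n, 0 < (apos z m).2] = false) /=; last first.
    by apply/negbTE/forallPn; exists k.
  by rewrite mul0r (bigD1 k)//= /fG /up (negbTE nk) !mul0r.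
rewrite gen; have [l pl tl] := exists_topo.
have ul : uniq l by rewrite (perm_uniq pl) enum_uniq.
have pcds (a b : seq 'I_n) : perm_eq a b -> perm_eq (cds a) (cds b).
  by move=> pab; apply: perm_flatten; exact: perm_map.
have pFl : perm_eq (cds l) (cds (labsF F)).
  by apply: pcds; rewrite (perm_trans pl)// perm_sym.
have mabs : measG (fun z => `|Fp z|%:E).
  by move=> d T z mz; apply/measurable_EFinP; apply: mfnorm; exact: mFp.
have fin : (itG (cds l) (fun z => `|Fp z|%:E) (fun=> 0%R) < +oo)%E.
  apply: le_lt_trans (ltry (1 * CJ R ^+ size l)); have := fG_bound (fun=> 0) tl ul (ler01 : 0 <= 1 :> R).
  apply: le_trans; rewrite le_eqVlt; apply/orP; left; apply/eqP; congr (itG _ _ _); apply/funext => z.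
  by rewrite mul1r /Fp normr_prod (perm_big _ pl) big_enum.
have ui : uniq (rev (iota 0 (n * 2))) by rewrite rev_uniq iota_uniq.
have pil : perm_eq (rev (iota 0 (n * 2))) (cds l).
  by rewrite (perm_trans (perm_cds n))//; apply: pcds; rewrite perm_sym.
have fin2 : (itG (rev (iota 0 (n * 2))) (fun z => `|Fp z|%:E) (fun=> 0%R) < +oo)%E.
  by rewrite (itG_perm _ _ mabs ui pil)// => z; rewrite lee_fin.
rewrite (itR_perm mFp ui (perm_trans pil pFl) fin2).
rewrite -(itR_eval_forest (F := F) (fun=> 0)); last by rewrite (perm_uniq pe) enum_uniq.
apply: itR_ext => z.
have WE t : agree Gam t -> WT z t = \prod_(k <- labels t) fG z k.
  have pE t' : vpos z (lroot t') = posT z t' by case: t' => [[]|k l' r']; rewrite /= ?vpos_vX ?vpos_vY ?vpos_vA.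
  elim: t => [b _|k a IHa b IHb]; first by rewrite big_nil.
  rewrite agreeE => /and4P[/eqP e0 /eqP e1 aa ab] /=; rewrite big_cons big_cat /= -IHa// -IHb//.
  by rewrite {1}/fG /JG e0 e1 !pE.
have -> : Fp z = \prod_(k <- labsF F) fG z k by rewrite (perm_big _ pe) big_enum.
rewrite /labsF big_flatten big_map /=.
by rewrite !big_seq; apply: eq_bigr => t tF; rewrite WE//; exact: (allP aF).
Qed.

End GraphWeights.

(** * Symmetry of mixed derivatives, and the derivatives of [alphabar] *)

Section Schwarz.
Variables (R : realType) (d : nat).
Local Notation Rd := (Rd R d).
Implicit Types (f : 'rV[R]_d -> R) (x y z : 'rV[R]_d).

Definition line f y (u : 'rV[R]_d) : R -> R := fun s => f (s *: u + y).

Lemma is_derive_line f y (u : 'rV[R]_d) (s : R) :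
  derivable (f : Rd -> R^o) (s *: u + y) u ->
  is_derive (s : R^o) (1 : R^o) (line f y u : R^o -> R^o) ('D_u (f : Rd -> R^o) (s *: u + y)).
Proof.
have E : (fun h : R => h^-1 *: (((line f y u : R^o -> R^o) \o shift (s : R^o)) (h *: (1 : R^o)) - line f y u s)) =
    (fun h : R => h^-1 *: (((f : Rd -> R^o) \o shift (s *: u + y)) (h *: u) - f (s *: u + y))).
  by apply/funext => h; rewrite /line /= [h *: (1 : R^o)]mulr1 scalerDl -addrA.
move=> df; apply: DeriveDef; first by rewrite /derivable E.
by rewrite /derive E.
Qed.

Lemma mvt_line f y (u : 'rV[R]_d) (h : R) : 0 < h -> (forall z, derivable (f : Rd -> R^o) z u) ->
  exists2 s : R, 0 < s < h & f (h *: u + y) - f y = 'D_u (f : Rd -> R^o) (s *: u + y) * h.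
Proof.
move=> h0 df; have id s := is_derive_line (df (s *: u + y)).
have [|s] := @MVT R (line f y u) (fun s => 'D_u (f : Rd -> R^o) (s *: u + y)) 0 h h0 (fun s _ => id s).
  by apply: derivable_within_continuous => s _; exact: (@ex_derive _ _ _ _ _ _ _ (id s)).
by rewrite in_itv /= => s0; rewrite /line scale0r add0r subr0 => e; exists s.
Qed.

Lemma derive_translate f (w z u : 'rV[R]_d) : derivable (f : Rd -> R^o) (w + z) u ->
  derivable ((fun y => f (w + y)) : Rd -> R^o) z u /\
  'D_u ((fun y => f (w + y)) : Rd -> R^o) z = 'D_u (f : Rd -> R^o) (w + z).
Proof.
have E : (fun h : R => h^-1 *: ((((fun y => f (w + y)) : Rd -> R^o) \o shift z) (h *: u) - f (w + z))) =
    (fun h : R => h^-1 *: (((f : Rd -> R^o) \o shift (w + z)) (h *: u) - f (w + z))).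
  by apply/funext => h; rewrite /= addrCA.
by move=> df; split; [rewrite /derivable E|rewrite /derive E].
Qed.

(** Two mean value theorems on a second difference: along u for the increment of f by hv, then along
    v for the derivative of f in direction u. *)
Lemma mvt_square f x (u v : 'rV[R]_d) (h : R) : 0 < h ->
  (forall z, derivable (f : Rd -> R^o) z u) ->
  (forall z, derivable ('D_u (f : Rd -> R^o) : Rd -> R^o) z v) ->
  exists s t : R, [/\ 0 < s < h, 0 < t < h &
    f (h *: v + (h *: u + x)) - f (h *: u + x) - (f (h *: v + x) - f x) =
    'D_v ('D_u (f : Rd -> R^o) : Rd -> R^o) (t *: v + (s *: u + x)) * h * h].
Proof.
move=> h0 df ddf.
pose f1 : Rd -> R^o := fun y => f (h *: v + y).
have d1 z : derivable f1 z u by case: (derive_translate (df (h *: v + z))).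
have [|s s0 e] := @mvt_line (f1 - (f : Rd -> R^o)) x u h h0.
  by move=> z; apply: derivableB; [exact: d1|exact: df].
have [t t0 e'] := @mvt_line ('D_u (f : Rd -> R^o)) (s *: u + x) v h h0 ddf.
exists s, t; split => //; rewrite -e' -[LHS]/((f1 - (f : Rd -> R^o)) (h *: u + x) - (f1 - (f : Rd -> R^o)) x) e.
rewrite deriveB; [|exact: d1|exact: df].
by have [_ ->] := derive_translate (df (h *: v + (s *: u + x))).
Qed.

(** Both candidates represent the same second difference divided by h^2, at points that tend to x
    with h. *)
Lemma eq_of_squares f x (u v : 'rV[R]_d) (a b : Rd -> R^o) :
  (forall h : R, 0 < h -> exists s t : R, [/\ 0 < s < h, 0 < t < h &
    f (h *: v + (h *: u + x)) - f (h *: u + x) - (f (h *: v + x) - f x) =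
    a (t *: v + (s *: u + x)) * h * h]) ->
  (forall h : R, 0 < h -> exists s t : R, [/\ 0 < s < h, 0 < t < h &
    f (h *: u + (h *: v + x)) - f (h *: v + x) - (f (h *: u + x) - f x) =
    b (t *: u + (s *: v + x)) * h * h]) ->
  {for x, continuous a} -> {for x, continuous b} -> a x = b x.
Proof.
move=> sqa sqb ca cb.
apply/eqP; rewrite -subr_eq0 -normr_le0; apply/ler_addgt0Pr => e e0; rewrite add0r.
have e2 : 0 < e / 2 by rewrite divr_gt0.
move/cvgrPdist_lt: ca => /(_ _ e2) /nbhs_ballP[r1 /= r10 H1].
move/cvgrPdist_lt: cb => /(_ _ e2) /nbhs_ballP[r2 /= r20 H2].
pose r := Num.min r1 r2; have r0 : 0 < r by rewrite lt_min r10 r20.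
pose K : R := `|u : Rd| + `|v : Rd| + 1.
have K0 : 0 < K by rewrite ltr_wpDl// addr_ge0.
pose h := r / K; have h0 : 0 < h by rewrite divr_gt0.
have close (u' v' : 'rV[R]_d) (s t : R) : `|u' : Rd| + `|v' : Rd| = `|u : Rd| + `|v : Rd| ->
    0 < s < h -> 0 < t < h -> `|(x : Rd) - (t *: v' + (s *: u' + x))| < r.
  move=> E /andP[s0 sh] /andP[t0 th]; rewrite addrA opprD addrCA subrr addr0 normrN.
  apply: le_lt_trans (ler_normD _ _) _; rewrite !normrZ !gtr0_norm//.
  apply: (@le_lt_trans _ _ (h * (`|u : Rd| + `|v : Rd|))).
    by rewrite -E mulrDr addrC lerD// ler_wpM2r// ltW.
  by rewrite -[ltRHS](divfK (lt0r_neq0 K0)) -/h ltr_pM2l// ltrDl.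
have [s [t [s0 t0 e1]]] := sqa h h0; have [s' [t' [s0' t0' e1']]] := sqb h h0.
have ab : a (t *: v + (s *: u + x)) = b (t' *: u + (s' *: v + x)).
  apply: (mulIf (lt0r_neq0 h0)); apply: (mulIf (lt0r_neq0 h0)); rewrite -e1 -e1' [h *: u + (_ + _)]addrCA.
  have ar (A B C D : R) : A - B - (C - D) = A - C - (B - D) by ring.
  exact: ar.
have n1 : `|a x - a (t *: v + (s *: u + x))| < e / 2.
  apply: H1; rewrite -ball_normE /=; have := close u v s t erefl s0 t0.
  by move/lt_le_trans; apply; rewrite ge_min lexx.
have n2 : `|b x - b (t' *: u + (s' *: v + x))| < e / 2.
  apply: H2; rewrite -ball_normE /=; have := close v u s' t' (addrC _ _) s0' t0'.
  by move/lt_le_trans; apply; rewrite ge_min lexx orbT.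
have -> : a x - b x = (a x - a (t *: v + (s *: u + x))) - (b x - b (t' *: u + (s' *: v + x))).
  by rewrite ab opprB addrA subrK.
apply: le_trans (ler_normB _ _) _; rewrite ltW// (splitr e); exact: ltrD.
Qed.

Lemma derive_comm f x (u v : 'rV[R]_d) :
  (forall z, derivable (f : Rd -> R^o) z u) -> (forall z, derivable (f : Rd -> R^o) z v) ->
  (forall z, derivable ('D_u (f : Rd -> R^o) : Rd -> R^o) z v) ->
  (forall z, derivable ('D_v (f : Rd -> R^o) : Rd -> R^o) z u) ->
  {for x, continuous ('D_v ('D_u (f : Rd -> R^o) : Rd -> R^o) : Rd -> R^o)} ->
  {for x, continuous ('D_u ('D_v (f : Rd -> R^o) : Rd -> R^o) : Rd -> R^o)} ->
  'D_v ('D_u (f : Rd -> R^o) : Rd -> R^o) x = 'D_u ('D_v (f : Rd -> R^o) : Rd -> R^o) x.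
Proof.
move=> du dv duv dvu.
exact: (eq_of_squares (fun h h0 => mvt_square x h0 du duv) (fun h h0 => mvt_square x h0 dv dvu)).
Qed.

Lemma iterpartial_cat s t f : iterpartial (s ++ t) f = iterpartial s (iterpartial t f).
Proof. exact: foldr_cat. Qed.

Lemma smooth_iterpartial s f : smooth f -> smooth (iterpartial s f).
Proof. by move=> sf t x; rewrite -iterpartial_cat; exact: sf. Qed.

Lemma partial_comm i j f : smooth f -> partial i (partial j f) = partial j (partial i f).
Proof.
move=> sf; apply/funext => x; rewrite /partial.
have D s k z : derivable (iterpartial s f : Rd -> R^o) z (delta_mx 0 k) by apply: diff_derivable; exact: sf.
apply: (@derive_comm f x (delta_mx 0 j) (delta_mx 0 i)); [exact: (D [::])|exact: (D [::])|
  exact: (D [:: j])|exact: (D [:: i])| |].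
- by apply: differentiable_continuous; exact: (sf [:: i; j]).
- by apply: differentiable_continuous; exact: (sf [:: j; i]).
Qed.

(** Reconciles [hat], which differentiates in the order of the coordinate indices, with graphs,
    which differentiate in the order of their edges. *)
Lemma iterpartial_perm s s' f : smooth f -> perm_eq s s' -> iterpartial s f = iterpartial s' f.
Proof.
move=> sf; have one (i : 'I_d) (t : seq 'I_d) (h : 'rV[R]_d -> R) : smooth h -> partial i (iterpartial t h) = iterpartial t (partial i h).
  move=> sh; elim: t => // j t IH.
  change (partial i (partial j (iterpartial t h)) = partial j (iterpartial t (partial i h))).
  by rewrite partial_comm ?IH//; exact: smooth_iterpartial.
apply: (catCA_perm_subst (F := fun s => iterpartial s f)) => s1 s2 s3; rewrite !iterpartial_cat.
have := smooth_iterpartial s3 sf; move: (iterpartial s3 f) => h sh.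
elim: s1 => // i s1 IH.
change (partial i (iterpartial s1 (iterpartial s2 h)) = iterpartial s2 (partial i (iterpartial s1 h))).
by rewrite IH one//; exact: smooth_iterpartial.
Qed.

Lemma partial_affine f i (k : R) : (forall h y, f (h *: delta_mx 0 i + y) = f y + h * k) ->
  partial i f = fun=> k.
Proof.
move=> H; apply/funext => x; rewrite /partial /derive; apply: cvg_lim; first exact: Rhausdorff.
apply: cvg_near_cst; near=> h; have h0 : h != 0 by near: h; exact: nbhs_dnbhs_neq.
by rewrite /= H addrAC subrr add0r [_ *: _]mulrA mulVf// mul1r.
Unshelve. all: by end_near. Qed.

Variable c : 'I_d -> 'I_d -> 'I_d -> R.

Lemma partial_alphabar a i j : partial a (alphabar c i j) = fun=> 2^-1 * c a i j.
Proof.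
apply: partial_affine => h y; rewrite /alphabar [h * _]mulrCA -mulrDr; congr (_ * _).
under eq_bigr => k _ do rewrite !mxE eqxx /= mulrDr; rewrite big_split /= addrC; congr (_ + _).
rewrite (bigD1 a)//= eqxx mulr1 big1 ?addr0 => [|k /negbTE ka]; first by rewrite mulrC.
by rewrite ka !mulr0.
Qed.

Lemma partial_cst (a : 'I_d) (k : R) : partial a (fun _ : 'rV[R]_d => k) = fun=> 0.
Proof. by apply: partial_affine => h y; rewrite mulr0 addr0. Qed.

(* The derivatives of [alphabar] as formal polynomials: a list of coefficients and monomials. *)
Definition dalpha (s : seq 'I_d) (i j : 'I_d) : seq (R * seq 'I_d) :=
  match s with
  | [::] => [seq (2^-1 * c a i j, [:: a]) | a <- enum 'I_d]
  | [:: a] => [:: (2^-1 * c a i j, [::])]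
  | _ => [::]
  end.

Lemma iterpartial_alphabar s i j x : iterpartial s (alphabar c i j) x =
  \sum_(m <- dalpha s i j) m.1 * \prod_(k <- m.2) x ord0 k.
Proof.
case: s => [|a [|b s]] /=.
- rewrite big_map /alphabar mulr_sumr big_enum /=; apply: eq_bigr => k _.
  by rewrite big_seq1 mulrA.
- by rewrite partial_alphabar big_seq1 big_nil mulr1.
change (partial a (partial b (iterpartial s (alphabar c i j))) x = \sum_(m <- [::]) m.1 * \prod_(k <- m.2) x ord0 k).
have [k ->] : exists k, partial b (iterpartial s (alphabar c i j)) = fun=> k.
  elim: s b => [|b' s IH] b; first by exists (2^-1 * c b i j); exact: partial_alphabar.
  change (exists k, partial b (partial b' (iterpartial s (alphabar c i j))) = fun=> k).
  by have [k ->] := IH b'; exists 0; exact: partial_cst.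
by rewrite partial_cst big_nil.
Qed.

End Schwarz.

(** * From polynomial symbols to bidifferential operators *)

Section Hat.
Variables (R : realType) (d : nat) (f g : 'rV[R]_d -> R) (x : 'rV[R]_d).
Hypotheses (sf : smooth f) (sg : smooth g).
Local Notation P := (P R d).
Local Notation hat p := (hat p f g x).

Definition hatm (mo : 'X_{1..nv d}) : R :=
  (\prod_(k < d) x ord0 k ^+ (mo (xidx k)))
  * iterpartial (flatten [seq nseq (mo (sidx i)) i | i <- enum 'I_d]) f x
  * iterpartial (flatten [seq nseq (mo (tidx i)) i | i <- enum 'I_d]) g x.

Lemma hatE (p : P) k : (msize p <= k)%N -> hat p = \sum_(m : bmultinom (nv d) k) p@_m * hatm m.
Proof.
move=> le; set I : subFinType _ := bmultinom (nv d) k.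
rewrite /Defs.hat (eq_bigr (fun m => p@_m * hatm m)); last by move=> m _; rewrite /hatm !mulrA.
rewrite (ssrcomplements.big_mksub I) ?msupp_uniq//=; last by move=> m /msize_mdeg_lt /leq_trans; apply.
by rewrite big_rmcond //= => j /memN_msupp_eq0 ->; rewrite mul0r.
Qed.

Lemma hatD (p q : P) : hat (p + q) = hat p + hat q.
Proof.
pose k := maxn (msize p) (msize q).
rewrite !(@hatE _ k) ?leq_maxl ?leq_maxr ?msizeD_le// -big_split /=.
by apply: eq_bigr => m _; rewrite mcoeffD mulrDl.
Qed.

Lemma hatZ (a : R) (p : P) : hat (a *: p) = a * hat p.
Proof.
rewrite !(@hatE _ (msize p)) ?msizeZ_le// mulr_sumr.
by apply: eq_bigr => m _; rewrite mcoeffZ -mulrA.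
Qed.

Lemma hat0 : hat (0 : P) = 0. Proof. by rewrite -(scale0r (0 : P)) hatZ mul0r. Qed.

Lemma hat_sum (I : Type) (s : seq I) (Q : pred I) (F : I -> P) :
  hat (\sum_(i <- s | Q i) F i) = \sum_(i <- s | Q i) hat (F i).
Proof. exact: (big_morph (fun p : P => hat p) hatD hat0). Qed.

Definition xprod (u : seq 'I_d) : P := \prod_(k <- u) var R (xidx k).
Definition sprodv (s : seq 'I_d) : P := \prod_(a <- s) var R (sidx a).
Definition tprodv (t : seq 'I_d) : P := \prod_(a <- t) var R (tidx a).

Lemma sidx_eq (i j : 'I_d) : (sidx i == sidx j) = (i == j).
Proof. by rewrite /sidx !(inj_eq (@lshift_inj _ _)). Qed.
Lemma tidx_eq (i j : 'I_d) : (tidx i == tidx j) = (i == j).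
Proof. by rewrite /tidx (inj_eq (@lshift_inj _ _)) (inj_eq (@rshift_inj _ _)). Qed.
Lemma xidx_eq (i j : 'I_d) : (xidx i == xidx j) = (i == j).
Proof. by rewrite /xidx (inj_eq (@rshift_inj _ _)). Qed.
Lemma stidx (i j : 'I_d) : ((sidx i == tidx j) = false) * ((tidx i == sidx j) = false).
Proof. by rewrite /sidx /tidx !(inj_eq (@lshift_inj _ _)) eq_lrshift eq_rlshift. Qed.
Lemma sxidx (i j : 'I_d) : ((sidx i == xidx j) = false) * ((xidx i == sidx j) = false).
Proof. by rewrite /sidx /xidx eq_lrshift eq_rlshift. Qed.
Lemma txidx (i j : 'I_d) : ((tidx i == xidx j) = false) * ((xidx i == tidx j) = false).
Proof. by rewrite /tidx /xidx eq_lrshift eq_rlshift. Qed.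

Lemma prod_pow_count (u : seq 'I_d) : \prod_(k < d) x ord0 k ^+ count_mem k u = \prod_(k <- u) x ord0 k.
Proof.
elim: u => [|a u IH]; first by rewrite big_nil big1.
rewrite big_cons -IH /= (eq_bigr (fun k => x ord0 k ^+ (a == k) * x ord0 k ^+ count_mem k u)); last first.
  by move=> k _; rewrite exprD.
rewrite big_split /=; congr (_ * _); rewrite (bigD1 a)//= eqxx expr1 big1 ?mulr1// => k ka.
by rewrite eq_sym (negbTE ka) expr0.
Qed.

Lemma perm_nseq_count (s : seq 'I_d) : perm_eq (flatten [seq nseq (count_mem i s) i | i <- enum 'I_d]) s.
Proof.
apply/allP => j _ /=; rewrite count_flatten -map_comp sumnE big_map big_enum /=.
rewrite (bigD1 j)//= count_nseq /= eqxx mul1n big1 ?addn0// => i ij.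
by rewrite count_nseq /= (negbTE ij).
Qed.

Lemma hat_monomial u s t : hat (xprod u * sprodv s * tprodv t) =
  \prod_(k <- u) x ord0 k * iterpartial s f x * iterpartial t g x.
Proof.
rewrite /xprod /sprodv /tprodv /var !mprodXE -!mpolyXD /Defs.hat msuppX big_seq1 mcoeffX eqxx mul1r.
have cnt (idx idx' : 'I_d -> 'I_(nv d)) (l : seq 'I_d) i : (forall a b, (idx a == idx' b) = (a == b)) ->
    (\sum_(a <- l) mnm1 (idx a) (idx' i) = count_mem i l)%N.
  by move=> E; rewrite count_sum; apply: eq_bigr => a _; rewrite mnm1E E.
have cnt0 (idx idx' : 'I_d -> 'I_(nv d)) (l : seq 'I_d) i : (forall a b, (idx a == idx' b) = false) ->
    (\sum_(a <- l) mnm1 (idx a) (idx' i) = 0)%N.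
  by move=> E; rewrite big1// => a _; rewrite mnm1E E.
congr (_ * _ * _).
- rewrite -prod_pow_count; apply: eq_bigr => k _; congr (_ ^+ _).
  rewrite !mnmDE !mnm_sumE (cnt _ _ _ _ xidx_eq) !cnt0 ?addn0// => a b; by rewrite ?(sxidx, txidx).
- rewrite -(iterpartial_perm sf (perm_nseq_count s)); congr (iterpartial (flatten _) f x).
  apply: eq_map => i; congr nseq.
  rewrite !mnmDE !mnm_sumE (cnt _ _ _ _ sidx_eq) !cnt0 ?addn0 ?add0n// => a b; by rewrite ?(sxidx, stidx).
- rewrite -(iterpartial_perm sg (perm_nseq_count t)); congr (iterpartial (flatten _) g x).
  apply: eq_map => i; congr nseq.
  rewrite !mnmDE !mnm_sumE (cnt _ _ _ _ tidx_eq) !cnt0 ?addn0 ?add0n// => a b; by rewrite ?(txidx, stidx).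
Qed.

Definition xq (J : seq (R * seq 'I_d)) : P := \sum_(m <- J) m.1 *: xprod m.2.

(** Factors in X alone pass through [hat] as their values at x. The monomial [u] accumulates those
    already expanded, which makes the induction go through. *)
Lemma hat_prod (K : Type) (l : seq K) (J : K -> seq (R * seq 'I_d)) u s t :
  hat (\prod_(k <- l) xq (J k) * (xprod u * sprodv s * tprodv t)) =
  \prod_(k <- l) (\sum_(m <- J k) m.1 * \prod_(k <- m.2) x ord0 k) *
  (\prod_(k <- u) x ord0 k * iterpartial s f x * iterpartial t g x).
Proof.
elim: l u => [|k l IH] u; first by rewrite !big_nil !mul1r hat_monomial.
rewrite !big_cons {1}/xq !mulr_suml hat_sum; apply: eq_bigr => m _.
have -> : m.1 *: xprod m.2 * \prod_(j <- l) xq (J j) * (xprod u * sprodv s * tprodv t) =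
    m.1 *: (\prod_(j <- l) xq (J j) * (xprod (m.2 ++ u) * sprodv s * tprodv t)).
  have -> : xprod (m.2 ++ u) = xprod m.2 * xprod u by rewrite /xprod big_cat.
  have ar (X Q U S T : P) : X * Q * (U * S * T) = Q * (X * U * S * T) by ring.
  by rewrite -!scalerAl; congr (_ *: _); exact: ar.
rewrite hatZ IH big_cat /=.
move: (\prod_(j <- l) _) (\prod_(k <- m.2) _) (\prod_(k <- u) _) (iterpartial s f x) (iterpartial t g x) (m.1).
by move=> a1 a2 a3 a4 a5 a6; ring.
Qed.

End Hat.

(** * Symbols of graphs *)

Section GraphSymbol.
Variables (R : realType) (d : nat) (c : 'I_d -> 'I_d -> 'I_d -> R).
Variables (n : nat).
Local Notation P := (P R d).
Local Notation ltree := (ltree n).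
Implicit Types (Gam : graph n) (I : {ffun edge n -> 'I_d}) (t : ltree).

Definition vfac Gam I (k : 'I_n) : P := xq (dalpha c (into Gam I (vA k)) (I (k, 0)) (I (k, 1))).

(** The polynomial whose operator is [Bop]: with f and g removed, the sum over edge labellings can
    be evaluated by algebra alone. *)
Definition symbol Gam : P := \sum_(I : {ffun edge n -> 'I_d})
  \prod_(k < n) vfac Gam I k * (sprodv R (into Gam I (vX n)) * tprodv R (into Gam I (vY n))).

Lemma Bop_hat Gam (f g : 'rV[R]_d -> R) x : smooth f -> smooth g ->
  Bop c Gam f g x = hat (symbol Gam) f g x.
Proof.
move=> sf sg; transitivity (\sum_(I : {ffun edge n -> 'I_d}) hat (\prod_(k < n) vfac Gam I k *
  (sprodv R (into Gam I (vX n)) * tprodv R (into Gam I (vY n)))) f g x); last by rewrite /symbol hat_sum.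
rewrite /Bop; apply: eq_bigr => I _.
have := hat_prod x sf sg (index_enum 'I_n) (fun k => dalpha c (into Gam I (vA k)) (I (k, 0)) (I (k, 1)))
  [::] (into Gam I (vX n)) (into Gam I (vY n)).
rewrite /xprod !big_nil !mul1r => ->; rewrite mulrA; congr (_ * _ * _).
by apply: eq_bigr => k _; rewrite iterpartial_alphabar.
Qed.

Lemma size_into Gam I k : size (into Gam I (vA k)) = indeg Gam k.
Proof.
rewrite size_map size_filter -sum1_count /indeg -sum1_card big_enum_cond.
by apply: eq_bigl => e; rewrite !inE.
Qed.

Lemma symbol0 Gam k : (1 < indeg Gam k)%N -> symbol Gam = 0.
Proof.
move=> k1; rewrite /symbol big1// => I _; rewrite (bigD1 k)//= {1}/vfac.
by move: k1; rewrite -(size_into Gam I); case: (into Gam I (vA k)) => [|a [|b s]]//= _; rewrite /xq big_nil !mul0r.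
Qed.

Definition efac Gam I (e : edge n) : P :=
  if Gam e == vX n then var R (sidx (I e)) else if Gam e == vY n then var R (tidx (I e)) else 1.

Lemma vX_neqY : vX n != vY n.
Proof. by rewrite /vX /vY (inj_eq (@rshift_inj _ _)). Qed.

Lemma prod_efac Gam I : sprodv R (into Gam I (vX n)) * tprodv R (into Gam I (vY n)) = \prod_e efac Gam I e.
Proof.
have E v (h : 'I_d -> P) : \prod_(a <- into Gam I v) h a = \prod_e (if Gam e == v then h (I e) else 1).
  by rewrite /into big_map big_filter big_enum_cond big_mkcond; apply: eq_bigr => e _; rewrite inE.
rewrite /sprodv /tprodv !E [RHS](eq_bigr (fun e => (if Gam e == vX n then var R (sidx (I e)) else 1) *
  (if Gam e == vY n then var R (tidx (I e)) else 1))) ?big_split//.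
move=> e _; rewrite /efac; case: eqP => [->|_]; last by rewrite mul1r.
by rewrite (negbTE vX_neqY) mulr1.
Qed.

(** The contribution of everything below an edge labelled a. That edge differentiates [alphabar] at
    its target and leaves a structure constant over 2. *)
Fixpoint tfac (I : edge n -> 'I_d) t (a : 'I_d) : P :=
  match t with
  | LL b => if b then var R (tidx a) else var R (sidx a)
  | LN k l r => (2^-1 * c a (I (k, 0)) (I (k, 1))) *: (tfac I l (I (k, 0)) * tfac I r (I (k, 1)))
  end.

Lemma into1 Gam I e k : (indeg Gam k <= 1)%N -> Gam e = vA k -> into Gam I (vA k) = [:: I e].
Proof.
move=> i1 ek; have : I e \in into Gam I (vA k) by apply: map_f; rewrite mem_filter ek eqxx mem_enum.
have := i1; rewrite -(size_into Gam I); move: ek; rewrite /into.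
have : e \in [seq e <- enum (edge n) | Gam e == Gam e] by rewrite mem_filter eqxx mem_enum.
move=> _ ek; have : e \in [seq e <- enum (edge n) | Gam e == vA k] by rewrite mem_filter ek eqxx mem_enum.
by case: [seq e <- _ | _] => [|e' [|]]//=; rewrite inE => /eqP ->.
Qed.

Lemma child_fac Gam I t e : (forall k, (indeg Gam k <= 1)%N) -> agree Gam t -> Gam e = lroot t ->
  efac Gam I e * (\prod_(k <- labels t) vfac Gam I k * \prod_(e <- eds t) efac Gam I e) = tfac I t (I e).
Proof.
move=> i1; elim: t e => [b|k l IHl r IHr] e.
  move=> _ /= h; rewrite /eds /edsl /= !big_nil !mulr1 /efac h.
  by case: b {h}; rewrite ?eqxx//= [vY n == vX n]eq_sym (negbTE vX_neqY).
rewrite agreeE => /and4P[/eqP e0 /eqP e1 al ar] ek; rewrite eds_LN /= !big_cons !big_cat /=.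
rewrite -(IHl _ al e0) -(IHr _ ar e1) {1}/efac ek (negbTE (vA_neqX k)) (negbTE (vA_neqY k)) mul1r.
rewrite {1}/vfac (into1 I (i1 k) ek) /= /xq big_seq1 /xprod big_nil -!scalerAl mul1r; congr (_ *: _).
move: (\prod_(j <- labels l) _) (\prod_(j <- labels r) _) (\prod_(j <- eds l) _) (\prod_(j <- eds r) _).
by move: (efac Gam I (k, 0)) (efac Gam I (k, 1)) => a1 a2 a3 a4 a5 a6; ring.
Qed.

(** Nothing differentiates [alphabar] at a root, so a factor linear in X survives there. *)
Lemma root_fac Gam I k l r : (forall k, (indeg Gam k <= 1)%N) -> indeg Gam k = 0%N -> agree Gam (LN k l r) ->
  \prod_(j <- labels (LN k l r)) vfac Gam I j * \prod_(e <- eds (LN k l r)) efac Gam I e =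
  \sum_a var R (xidx a) * tfac I (LN k l r) a.
Proof.
move=> i1 k0; rewrite agreeE => /and4P[/eqP e0 /eqP e1 al ar]; rewrite eds_LN /= !big_cons !big_cat /=.
rewrite -(child_fac I i1 al e0) -(child_fac I i1 ar e1) {1}/vfac.
have -> : into Gam I (vA k) = [::] by apply: size0nil; rewrite size_into.
rewrite /= /xq big_map big_enum /= !mulr_suml; apply: eq_bigr => a _.
rewrite /xprod big_seq1 -!scalerAl -!scalerAr; congr (_ *: _).
move: (\prod_(j <- labels l) _) (\prod_(j <- labels r) _) (\prod_(j <- eds l) _) (\prod_(j <- eds r) _).
by move: (efac Gam I (k, 0)) (efac Gam I (k, 1)) => a1 a2 a3 a4 a5 a6; rewrite -!mulrA; congr (_ * _); ring.
Qed.

Lemma symbol_summand Gam F I : good F -> agreeF Gam F ->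
  \prod_(k < n) vfac Gam I k * (sprodv R (into Gam I (vX n)) * tprodv R (into Gam I (vY n))) =
  \prod_(t <- F) \sum_a var R (xidx a) * tfac I t a.
Proof.
move=> gF aF; have [/andP[_ /forallP i1] pr] := agree_forest gF aF; have /andP[nF pe] := gF.
have [ue me] := good_edsl gF.
have pe2 : perm_eq (edsl (labsF F)) (enum (edge n)).
  by apply: uniq_perm; rewrite ?enum_uniq// => e; rewrite mem_enum me.
have -> : \prod_(k < n) vfac Gam I k = \prod_(k <- labsF F) vfac Gam I k by rewrite (perm_big _ pe) big_enum.
have -> : sprodv R (into Gam I (vX n)) * tprodv R (into Gam I (vY n)) = \prod_(e <- edsl (labsF F)) efac Gam I e.
  by rewrite prod_efac (perm_big _ pe2) big_enum.
have rt k : vA k \in map (@lroot n) F -> indeg Gam k = 0%N.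
  by rewrite (perm_mem pr) (mem_map (@vA_inj n)) mem_filter => /andP[/eqP].
elim: F nF aF rt {gF pr pe pe2 ue me} => [|t F IH]; first by move=> _ _ _; rewrite !big_nil mulr1.
move=> /= /andP[nt nF] /andP[at_ aF] rt.
rewrite big_cons -IH//; last by move=> k kF; apply: rt; rewrite inE kF orbT.
rewrite /labsF /= edsl_cat !big_cat /= mulrACA; congr (_ * _).
case: t nt at_ rt => // k l r _ at_ rt; apply: root_fac => //; apply: rt; exact: mem_head.
Qed.

Definition updI I (e : edge n) (a : 'I_d) : {ffun edge n -> 'I_d} := [ffun e' => if e' == e then a else I e'].

(** Sums over the labels of the edges in [s] one at a time, so that the sum can follow the recursion
    of a tree; labels of other edges are kept from I. *)
Fixpoint esum (s : seq (edge n)) (Phi : {ffun edge n -> 'I_d} -> P) I : P :=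
  if s is e :: s' then \sum_a esum s' Phi (updI I e a) else Phi I.

Lemma esumE s Phi I : uniq s ->
  esum s Phi I = \sum_(I' : {ffun edge n -> 'I_d} | [forall e, (e \notin s) ==> (I' e == I e)]) Phi I'.
Proof.
elim: s I => [|e s IH] I /=.
  move=> _; rewrite (big_pred1 I)// => I'; apply/forallP/eqP => [h|-> e]; last by rewrite eqxx.
  by apply/ffunP => e; apply/eqP; exact: h.
move=> /andP[es us]; rewrite (partition_big (fun I' : {ffun edge n -> 'I_d} => I' e) predT)//=.
apply: eq_bigr => a _; rewrite IH//; apply: eq_bigl => I'.
apply/forallP/andP => [h|[/forallP h /eqP ea] e'].
  split; last by have := h e; rewrite es ffunE eqxx.
  apply/forallP => e'; apply/implyP; rewrite inE negb_or => /andP[ne ns].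
  by have := h e'; rewrite ns ffunE (negbTE ne).
apply/implyP => ns; rewrite ffunE; case: (eqVneq e' e) => [->|ne]; first by rewrite ea.
by have := h e'; rewrite inE negb_or ne ns.
Qed.

Lemma esum_cat s1 s2 Phi I : esum (s1 ++ s2) Phi I = esum s1 (esum s2 Phi) I.
Proof. by elim: s1 I => //= e s1 IH I; apply: eq_bigr => a _; rewrite IH. Qed.

Lemma esum_reach s Phi Psi I :
  (forall I', (forall e, e \notin s -> I' e = I e) -> Phi I' = Psi I') -> esum s Phi I = esum s Psi I.
Proof.
elim: s I => [|e s IH] I H /=; first exact: H.
apply: eq_bigr => a _; apply: IH => I' h; apply: H => e'; rewrite inE negb_or => /andP[ne ns].
by rewrite h// ffunE (negbTE ne).
Qed.

Lemma esumMl s (q : P) Phi I : esum s (fun I => q * Phi I) I = q * esum s Phi I.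
Proof. by elim: s I => //= e s IH I; rewrite mulr_sumr; apply: eq_bigr => a _. Qed.

Lemma esumMr s (q : P) Phi I : esum s (fun I => Phi I * q) I = esum s Phi I * q.
Proof. by elim: s I => //= e s IH I; rewrite mulr_suml; apply: eq_bigr => a _. Qed.

Lemma tfac_local (I I' : {ffun edge n -> 'I_d}) t a : {in eds t, I =1 I'} -> tfac I t a = tfac I' t a.
Proof.
elim: t a => [//|k l IHl r IHr] a; rewrite eds_LN => H /=.
rewrite !H ?inE ?eqxx ?orbT// IHl ?IHr// => e he; apply: H; by rewrite !inE mem_cat he !orbT.
Qed.

Lemma mem_eds (k : 'I_n) i l : ((k, i) \in edsl l) = (k \in l).
Proof. by rewrite -!has_pred1 !has_count count_edsl. Qed.

(** Each inner vertex supplies 1/2 from [alphabar] and one bracket from the structure constants. *)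
Definition tval t : lie R d := (2 ^- nds (shape t)) *: lieT c (shape t).

Lemma esum_tree t a I : uniq (labels t) -> esum (eds t) (fun I => tfac I t a) I = tval t a.
Proof.
elim: t a I => [b|k l IHl r IHr] a I.
  by move=> _; rewrite /eds /edsl /= /tval /= ffunE expr0 invr1 scale1r; case: b; rewrite /ev ffunE.
rewrite eds_LN /= cat_uniq mem_cat negb_or => /andP[/andP[kl kr] /and3P[ul hlr ur]].
have -> : tval (LN k l r) a = \sum_i \sum_j (2^-1 * c a i j) *: (tval l i * tval r j).
  rewrite /tval ffunE /= ffunE scaler_sumr; apply: eq_bigr => i _; rewrite scaler_sumr; apply: eq_bigr => j _.
  rewrite mul_mpolyC !ffunE -!scalerAl -!scalerAr !scalerA; congr (_ *: _).
  rewrite nds_node exprS exprD !invfM; ring.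
apply: eq_bigr => i _; apply: eq_bigr => j _; rewrite esum_cat.
have nI (e : edge n) (s : seq 'I_n) : e.1 \notin s -> e \notin edsl s by case: e => k' i'; rewrite mem_eds.
rewrite -[RHS]mul_mpolyC -(IHl i (updI (updI I (k, 0) i) (k, 1) j))// -esumMr -esumMl; apply: esum_reach => I1 h1.
rewrite -(IHr j I1)// -esumMl -esumMl; apply: esum_reach => I2 h2.
have v1 i' : I2 (k, i') = updI (updI I (k, 0) i) (k, 1) j (k, i').
  by rewrite h2 ?h1//; apply: nI.
rewrite !v1 !ffunE /= !xpair_eqE !eqxx /= mul_mpolyC; congr (_ *: (_ * _)).
apply: tfac_local => -[k' i']; rewrite mem_eds => k'l; rewrite h2// nI//.
by apply: contra hlr => k'r; apply/hasP; exists k'.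
Qed.

Lemma symbol_forest Gam F : good F -> agreeF Gam F -> symbol Gam = \prod_(t <- F) pairX (tval t).
Proof.
move=> gF aF; rewrite /symbol (eq_bigr (fun I : {ffun edge n -> 'I_d} => \prod_(t <- F) \sum_a var R (xidx a) * tfac I t a)); last first.
  by move=> I _; exact: symbol_summand.
have [ue me] := good_edsl gF; have /andP[_ pe] := gF.
(* If there is no edge labelling at all, that is d = 0 and n > 0, both sides vanish. *)
case: (pickP (fun _ : {ffun edge n -> 'I_d} => true)) => [I0 _|none]; last first.
  rewrite big_pred0; last by move=> I; have := none I.
  case: F gF aF ue me pe => [|t F] gF aF ue me pe.
    have e0 (e : edge n) : False by have := me e; rewrite /labsF.
    by have := none (ffun0 (eq_card0 (fun e => False_ind _ (e0 e)))).
  rewrite big_cons /pairX big1 ?mul0r// => k _.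
  by have := none [ffun=> k].
transitivity (esum (edsl (labsF F)) (fun I => \prod_(t <- F) \sum_a var R (xidx a) * tfac I t a) I0).
  rewrite esumE//; apply: eq_bigl => I; apply/esym/forallP => e; by rewrite me.
have uF : uniq (labsF F) by rewrite (perm_uniq pe) enum_uniq.
elim: F uF I0 {gF aF ue me pe} => [|t F IH] uF I0; first by rewrite /= !big_nil.
move: uF; rewrite /labsF /= -/(labsF F) cat_uniq => /and3P[ut hd uF].
rewrite edsl_cat esum_cat big_cons -(IH uF I0).
have -> : pairX (tval t) = esum (edsl (labels t)) (fun I => \sum_a var R (xidx a) * tfac I t a) I0.
  rewrite /pairX; have ex (J : Type) (l : seq J) s (Ph : J -> {ffun edge n -> 'I_d} -> P) I :
      esum s (fun I => \sum_(j <- l) Ph j I) I = \sum_(j <- l) esum s (Ph j) I.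
    by elim: s I => //= e s IHs I; rewrite exchange_big /=; apply: eq_bigr => a _.
  by rewrite ex; apply: eq_bigr => a _; rewrite esumMl -(esum_tree a I0 ut) mulrC.
rewrite -esumMr; apply: esum_reach => I1 h1; rewrite (IH uF I0) -(IH uF I1) -esumMl.
apply: esum_reach => I2 h2; rewrite big_cons; congr (_ * _); apply: eq_bigr => a _; congr (_ * _).
apply: tfac_local => -[k i]; rewrite mem_eds => kt; rewrite h2// mem_eds.
by apply: contra hd => kF; apply/hasP; exists k.
Qed.

End GraphSymbol.

(** * Weights of forests and the orientation sign *)

Section Weights.
Variable R : realType.

Lemma wstd_forest n (Gam : graph n) F : good F -> agreeF Gam F ->
  wstd R Gam = n`!%:R^-1 * \prod_(t <- F) th R (shape t).
Proof.
move=> gF aF; have [/andP[nl _] _] := agree_forest gF aF; have /andP[_ pe] := gF.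
have sn : (\sum_(t <- F) (leaves (shape t)).-1 = n)%N.
  rewrite -[RHS](size_enum_ord n) -(perm_size pe) /labsF size_flatten /seq.shape -map_comp sumnE big_map.
  by apply: eq_bigr => t _; rewrite /= size_labels.
rewrite /wstd (itR_graph _ nl gF aF) invfM -mulrA; congr (_ * _).
by rewrite /th big_split /=; congr (_ * _); rewrite prodfV prodrXr sn exprM.
Qed.

(** Needs no separate integration: the word AB has a single bracketing, so its weight is the
    coefficient of AB in log(e^A e^B), which is 1 - 1/2. *)
Lemma th_AB : th R (node (leaf false) (leaf true)) = 2^-1.
Proof.
have := @log_EAB R [:: false; true] erefl; rewrite /brk /= big_seq1 => <-.
have X0 : Xw R [::] = 0 by [].
have X1 b : Xw R [:: b] = 1.
  by case: b; rewrite /Xw /EAB /= !big_ord_recr big_ord0 /= ?fact0 ?factS ?fact0; field.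
have X2 : Xw R [:: false; true] = 1.
  by rewrite /Xw /EAB /= !big_ord_recr big_ord0 /= ?factS ?fact0; field.
have Z0 : Zm (Xw R) 1 [::] = 0 by rewrite /= big_geq.
have Z1 b : Zm (Xw R) 1 [:: b] = 1.
  rewrite -[LHS]/(\sum_(0 <= k < 1) Zm (Xw R) 0 (take k [:: b]) * Xw R (drop k [:: b])).
  by rewrite big_nat1 take0 drop0 X1 mulr1.
have Z1' : Zm (Xw R) 1 [:: false; true] = 1.
  rewrite -[LHS]/(\sum_(0 <= k < 2) Zm (Xw R) 0 (take k [:: false; true]) * Xw R (drop k [:: false; true])).
  rewrite big_ltn// big_nat1 take0 drop0 X2 mulr1.
  by have -> : Zm (Xw R) 0 (take 1 [:: false; true]) = 0 by []; rewrite mul0r addr0.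
have Z2 : Zm (Xw R) 2 [:: false; true] = 1.
  rewrite -[LHS]/(\sum_(0 <= k < 2) Zm (Xw R) 1 (take k [:: false; true]) * Xw R (drop k [:: false; true])).
  by rewrite big_ltn// big_nat1 [take 0 _]/= [take 1 _]/= [drop 1 _]/= Z0 Z1 X1 mul0r add0r mul1r.
rewrite -(big_mkord xpredT (fun m => (if m == 0%N then 0 else (-1) ^+ m.-1 / m%:R) * Zm (Xw R) m [:: false; true])).
by rewrite 2?big_ltn// big_nat1 Z1' Z2 /= mul0r add0r expr0 expr1; field.
Qed.

(** The standard orientation already gives the basic graph the weight 1/2, by [th_AB]. *)
Lemma orient_sign1 : orient_sign R = 1.
Proof.
rewrite /orient_sign (@wstd_forest 1 basic_graph [:: LN ord0 (LL false) (LL true)]).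
- by rewrite big_seq1 /= th_AB invr1 mul1r eqxx.
- rewrite /good /= /labsF /=; apply: uniq_perm; rewrite ?enum_uniq// => k.
  by rewrite mem_enum inE ord1 eqxx.
- by rewrite /agreeF /= agreeE /= !ffunE /= ?eqxx.
Qed.

End Weights.

(** * Comparison with the exponential of the tree series *)

Section TreeSeries.
Variables (R : realType) (d : nat) (c : 'I_d -> 'I_d -> 'I_d -> R).
Hypothesis anti : lie_antisym c.
Hypothesis jac : lie_jacobi c.
Local Notation lie := (lie R d).
Local Notation P := (P R d).

Lemma pairXZ (a : R) (u : lie) : pairX (a *: u) = a *: pairX u.
Proof. by rewrite /pairX scaler_sumr; apply: eq_bigr => k _; rewrite ffunE -scalerAl. Qed.

Lemma pairX_sum (I : Type) (s : seq I) (F : I -> lie) : pairX (\sum_(i <- s) F i) = \sum_(i <- s) pairX (F i).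
Proof.
apply: (big_morph (@pairX R d)) => [u v|]; rewrite /pairX.
  by rewrite -big_split; apply: eq_bigr => k _; rewrite ffunE mulrDl.
by rewrite big1// => k _; rewrite ffunE mul0r.
Qed.

Definition etree (T : tree) : P := (th R T / 2 ^+ nds T) *: pairX (lieT c T).

(** The linear terms are subtracted at k = 0 only, and a tree with k + 1 leaves has k inner
    vertices. *)
Lemma Ecoef_trees k : (0 < k)%N -> Ecoef c k = \sum_(T <- TR k.+1) etree T.
Proof.
move=> k0; rewrite /Ecoef gtn_eqF// subr0 (cbh_trees anti jac)// pairX_sum.
under eq_bigr => T _ do rewrite pairXZ.
by rewrite -(@sum_TR_leaves _ (fun T n => (th R T / 2 ^+ n.-1) *: pairX (lieT c T)) k.+1).
Qed.

(** A part of the composition is the number of inner vertices of the corresponding tree, so the m-th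
    power of the exponent runs over lists of m trees. The bound N on the parts stays fixed in the
    induction. *)
Lemma sum_compositions N m n : (n <= N)%N ->
  \sum_(k : {ffun 'I_m -> 'I_N.+1})
    (if [forall i, (0 < k i)%N] && (\sum_(i < m) k i == n)%N then \prod_(i < m) Ecoef c (k i) else 0) =
  \sum_(L <- FLm m n) \prod_(T <- L) etree T.
Proof.
elim: m n => [|m IH] n nN.
  rewrite (eq_bigr (fun=> if n == 0%N then 1 else 0)); last first.
    move=> k _; rewrite !big_ord0 (_ : [forall i, _] = true) /= 1?eq_sym//.
    by apply/forallP => -[].
  rewrite sumr_const card_ffun !card_ord expn0 mulr1n /=.
  by case: (n == 0%N); rewrite ?big_seq1 ?big_nil.
have fa (f : {ffun 'I_m -> 'I_N.+1}) x :
    [forall i, (0 < ffrcons f x i)%N] = [forall i, (0 < f i)%N] && (0 < x)%N.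
  apply/forallP/andP => [h|[/forallP h x0] i].
    split; last by have := h ord_max; rewrite ffrcons_max.
    by apply/forallP => i; have := h (widen_ord (leqnSn m) i); rewrite ffrcons_widen.
  by rewrite ffunE; case: insubP => [j _ _|_].
pose H (k : nat) : P := \sum_(L <- FLm m (n - k)) \sum_(T <- TR k.+1) \prod_(T <- rcons L T) etree T.
rewrite sum_FLmS sum_ffunS exchange_big /=.
transitivity (\sum_(x < N.+1) (if (0 < x)%N && (x <= n)%N then H x else 0)).
  apply: eq_bigr => x _.
  have -> : \sum_(f : {ffun 'I_m -> 'I_N.+1}) (if [forall i, (0 < ffrcons f x i)%N] &&
        (\sum_(i < m.+1) ffrcons f x i == n)%N then \prod_(i < m.+1) Ecoef c (ffrcons f x i) else 0) =
      \sum_(f : {ffun 'I_m -> 'I_N.+1}) (if ([forall i, (0 < f i)%N] && (0 < x)%N) &&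
        (\sum_(i < m) f i + x == n)%N then \prod_(i < m) Ecoef c (f i) * Ecoef c x else 0).
    apply: eq_bigr => f _; rewrite fa !big_ord_recr /= ffrcons_max.
    rewrite (eq_bigr (fun i => nat_of_ord (f i))); last by move=> i _; rewrite ffrcons_widen.
    by rewrite (eq_bigr (fun i => Ecoef c (f i)))// => i _; rewrite ffrcons_widen.
  case: (boolP ((0 < x)%N && (x <= n)%N)) => [/andP[x0 xn]|nx]; last first.
    rewrite big1// => f _; case: (boolP (_ && _)) => // /andP[/andP[_ x0] /eqP e].
    by move: nx; rewrite x0 -e leq_addl.
  transitivity ((\sum_(L <- FLm m (n - x)) \prod_(T <- L) etree T) * \sum_(T <- TR x.+1) etree T).
    rewrite -IH; last by rewrite (leq_trans (leq_subr _ _)).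
    rewrite -Ecoef_trees// mulr_suml; apply: eq_bigr => f _; rewrite x0 andbT.
    rewrite -{1}(subnK xn) eqn_add2r; case: ifP => // _; by rewrite mul0r.
  rewrite /H mulr_suml; apply: eq_bigr => L _; rewrite mulr_sumr; apply: eq_bigr => T _.
  by rewrite -cats1 big_cat big_seq1.
rewrite -(big_mkord xpredT (fun x => if (0 < x)%N && (x <= n)%N then H x else 0)) big_ltn//= add0r.
rewrite (@big_cat_nat _ _ _ n.+1)//= [X in _ + X]big_nat [X in _ + X]big1 ?addr0; last first.
  by move=> k /andP[nk _]; rewrite [(k <= n)%N]leqNgt nk andbF.
by rewrite !big_nat; apply: eq_bigr => k /andP[k0]; rewrite ltnS => kn; rewrite k0 kn.
Qed.

End TreeSeries.

Theorem theorem5p0p1 (R : realType) (d : nat) (c : 'I_d -> 'I_d -> 'I_d -> R) :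
  lie_antisym c -> lie_jacobi c ->
  forall f g : 'rV[R]_d -> R, smooth f -> smooth g ->
  forall (n : nat) (x : 'rV[R]_d),
    star_K_nonloop_coef c n f g x = star_cbh_coef c n f g x.
Proof.
move=> anti jac f g sf sg n x; rewrite /star_K_nonloop_coef /star_cbh_coef.
transitivity (\sum_(Gam : graph n | forest Gam) wstd R Gam * hat (symbol c Gam) f g x).
  rewrite (bigID (fun Gam : graph n => [forall k, (indeg Gam k <= 1)%N])) /=.
  rewrite [X in _ + X]big1 ?addr0 => [|Gam /andP[_ /forallPn[k]]]; last first.
    by rewrite -ltnNge => k1; rewrite Bop_hat// (symbol0 c k1) hat0 mulr0.
  apply: eq_big => [Gam|Gam _]; last by rewrite /wK orient_sign1 expr1n mul1r Bop_hat.
  rewrite /forest; case: (boolP (loop_graph Gam)) => nl; rewrite ?andbF//= andbT.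
  rewrite (_ : Gam \in G n)// inE; apply/forallP => -[k i]; apply/negP => /eqP e.
  have : aedge Gam k k by apply/existsP; exists i; rewrite e.
  by move/(rk_lt nl); rewrite ltnn.
rewrite sum_forests.
(* The n! labellings of a list of shapes all contribute equally and cancel the 1/n! in the weight;
   the factor 1/(size L)! that remains is the one of the exponential. *)
transitivity (\sum_(L <- FL n) (size L)`!%:R^-1 * hat (\prod_(T <- L) etree c T) f g x).
  rewrite !big_seq; apply: eq_bigr => L LF.
  transitivity (\sum_(s <- perms n) (size L)`!%:R^-1 * (n`!%:R^-1 * hat (\prod_(T <- L) etree c T) f g x)).
    rewrite [LHS]big_seq [RHS]big_seq; apply: eq_bigr => s sp; congr (_ * _).
    have [gs hs _] := fillF_good LF sp.
    have ad : agreeF (dec (fillF L s)) (fillF L s) by rewrite agree_decE.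
    rewrite (wstd_forest R gs ad) (symbol_forest c gs ad) -mulrA; congr (_ * _).
    have -> : \prod_(T <- L) etree c T = \prod_(t <- fillF L s) etree c (shape t) by rewrite -[in LHS]hs big_map.
    rewrite -hatZ -scaler_prod; congr (hat _ f g x); apply: eq_bigr => t _.
    by rewrite /tval pairXZ scalerA.
  rewrite big_const_seq count_predT iter_addr_0 size_permutations ?enum_uniq// size_enum_ord.
  have n0 : n`!%:R != 0 :> R by rewrite pnatr_eq0 -lt0n fact_gt0.
  by rewrite -[LHS]mulr_natl mulrCA; congr (_ * _); rewrite mulrA divff// mul1r.
rewrite sum_FL /Dcoef hat_sum big_mkord; apply: eq_bigr => m _.
rewrite hatZ (sum_compositions anti jac)// hat_sum mulr_sumr !big_seq; apply: eq_bigr => L.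
by rewrite -has_pred1 has_count count_FLm; case: (eqVneq (size L) m) => // ->.
Qed.
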